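(* Let $\kappa\ge3$ be an integer, $\lambda>0$, and let $v$ be the unique solution of $$\lambda=\frac{a_\kappa+\kappa\, r_v f(r_v)\Psi(r_v)\,b_\kappa}{\kappa\, r_v f(r_v)\,b_\kappa}.$$ If $K=\mathsf{Reg}(\kappa)$, then $\Phi^K_\lambda(C)=\mathsf L(C)^3\mathsf A(C)^\lambda$ has a unique maximizer $C$ among the compact convex subsets of $K$, and the boundary of $C$ is constituted of $\kappa$ arcs of hyperbolas, where the $i$-th one lies inside the triangle $m_im_{i+1}w_{i+1}$ and is the image of $\mathcal H_v$ by the affine map that sends $(A,B,C)$ onto $(m_i,m_{i+1},w_{i+1})$ (indices modulo $\kappa$), where $A=(0,0)$, $B=(2,0)$, $C=(1,1)$ are the vertices of the unit triangle.
   Context: $\mathsf{Reg}(\kappa)$ is the (filled) regular $\kappa$-gon of area 1 with vertices $w_j=\rho_\kappa\exp(2i\pi j/\kappa)$, $0\le j\le\kappa-1$, where $\rho_\kappa=\big(\frac{2}{\kappa\sin(2\pi/\kappa)}\big)^{1/2}$ and $\mathbb R^2$ is identified with $\mathbb C$; $m_i$ is the midpoint of $[w_i,w_{i+1}]$ (indices mod $\kappa$). The area of the polygon with vertices $m_0,\dots,m_{\kappa-1}$ is $a_\kappa=\cos(\pi/\kappa)^2$, and each triangle $m_im_{i+1}w_{i+1}$ has area $b_\kappa=(1-a_\kappa)/\kappa=\sin(\pi/\kappa)^2/\kappa$. $\Psi(r)=\frac{\sinh(2r)}{2r}-1$ (with $\Psi(0)=0$) is a continuous increasing bijection of $[0,+\infty)$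 onto itself, $r_v:=\Psi^{-1}(v)$, and $f(h)=\cosh(h)/\sinh(h)^3$ for $h>0$. For $v>0$, $\mathcal H_v=\{(X(t),Y(t)):t\in[0,1]\}$ with $X(t)=1+\frac{\sinh(r_v(1-2t))}{\sinh(r_v)}$, $Y(t)=\frac{2\cosh(r_v)}{\sinh(r_v)^2}\sinh(r_v(1-t))\sinh(r_vt)$. For a compact convex set, $\mathsf A$ is its area and $\mathsf L(C)=\int_{\partial C}\kappa_C(s)^{1/3}ds$ its affine perimeter, where $\kappa_C(s)\ge0$ is the curvature of $\partial C$ (existing almost everywhere) and $s$ is Euclidean arc length. *)

(* Defs.v *)
From HB Require Import structures.
From mathcomp Require Import all_boot all_order all_algebra.
From mathcomp Require Import all_classical all_reals all_analysis.

Set Implicit Arguments.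
Unset Strict Implicit.
Unset Printing Implicit Defensive.

Import Order.TTheory GRing.Theory Num.Theory.
Import numFieldNormedType.Exports.

Local Open Scope classical_set_scope.
Local Open Scope ring_scope.

(* R^o rather than R: it is R^o * R^o that is a normed R-module. Its library
   norm is the sup norm, hence the separate Euclidean norm below. *)
Notation plane R := (R^o * R^o)%type.

Definition enorm {R : realType} (p : plane R) : R :=
  Num.sqrt (p.1 ^+ 2 + p.2 ^+ 2).

Definition boundary {R : realType} (C : set (plane R)) : set (plane R) :=
  closure C `\` interior C.

Definition convex_hull {R : realType} (A : set (plane R)) : set (plane R) :=
  smallest (@convex_set R (plane R)) A.

Definition area {R : realType} (C : set (plane R)) : \bar R :=
  ((@lebesgue_measure R) \x (@lebesgue_measure R))%E C.

Definition polygonal_length {R : realType} (gamma : R -> plane R)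
    (a b : R) (s : seq R) : R :=
  let F := gamma \o nth b (a :: s) in
  \sum_(0 <= n < size s) enorm (F n.+1 - F n).

Definition curve_length {R : realType} (gamma : R -> plane R)
    (a b : R) : \bar R :=
  ereal_sup [set (polygonal_length gamma a b s)%:E | s in itv_partition a b].

(* gamma, restricted to [0, l], runs exactly once around the boundary of C, at
   unit speed. *)
Definition arc_length_param {R : realType} (C : set (plane R))
    (l : R) (gamma : R -> plane R) : Prop :=
  [/\ 0 < l,
      {within `[0, l], continuous gamma},
      {in `[0, l[ &, injective gamma} /\ gamma l = gamma 0,
      gamma @` `[0, l] = boundary C &
      forall t, t \in `[0, l] -> curve_length gamma 0 t = t%:E].

(* The right derivative: for the boundary of a convex set it exists at every
   parameter in [0, l), corners included, and is a unit vector; the two-sided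
   derivative may fail to exist on a dense set. *)
Definition tangent {R : realType} (gamma : R -> plane R) (s : R) : plane R :=
  lim ((fun h : R => h^-1 *: (gamma (s + h) - gamma s)) @ 0^'+).

(* |dT/ds|; for the boundary of a convex set the unit tangent T has bounded
   variation, so that dT/ds exists for almost every s. *)
Definition curvature {R : realType} (gamma : R -> plane R) (s : R) : R :=
  enorm (derive1 (tangent gamma) s).

(* The value does not depend on which arc-length parametrization is picked.
   Compact convex sets with empty interior (points, segments, the empty set)
   have none, and affine perimeter 0. *)
Definition affine_perimeter {R : realType} (C : set (plane R)) : \bar R :=
  let p : R * (R -> plane R) :=
    xget (0, cst 0) [set p | arc_length_param C p.1 p.2] in
  (\int[@lebesgue_measure R]_(s in `[0%R, p.1])
     ((curvature p.2 s) `^ (3%:R^-1))%:E)%E.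

Definition Phi {R : realType} (lambda : R) (C : set (plane R)) : \bar R :=
  (affine_perimeter C ^+ 3 * area C `^ lambda)%E.

Definition maximizer {R : realType} (lambda : R) (K C : set (plane R)) : Prop :=
  let competitor (D : set (plane R)) :=
    [/\ compact D, @convex_set R (plane R) D & D `<=` K] in
  competitor C /\
  forall D, competitor D -> (Phi lambda D <= Phi lambda C)%E.

(* Indices are in nat, not mod k: the formula is k-periodic in j, and so is
   [midpoint]. *)
Definition vertex (R : realType) (k : nat) (j : nat) : plane R :=
  let rho := Num.sqrt (2 / (k%:R * sin (2 * pi / k%:R))) in
  (rho * cos (2 * pi * j%:R / k%:R), rho * sin (2 * pi * j%:R / k%:R)).

Definition midpoint (R : realType) (k : nat) (i : nat) : plane R :=
  (2^-1 : R) *: (vertex R k i + vertex R k i.+1).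

Definition Reg (R : realType) (k : nat) : set (plane R) :=
  convex_hull [set vertex R k j | j in [set j | (j < k)%N]].

Arguments Reg R k : clear implicits.

Definition area_inner (R : realType) (k : nat) : R := cos (pi / k%:R) ^+ 2.

Definition area_corner (R : realType) (k : nat) : R :=
  (1 - area_inner R k) / k%:R.

Definition sinh {R : realType} (x : R) : R := (expR x - expR (- x)) / 2.

Definition cosh {R : realType} (x : R) : R := (expR x + expR (- x)) / 2.

Definition Psi {R : realType} (r : R) : R :=
  if r == 0 then 0 else sinh (2 * r) / (2 * r) - 1.

(* The inverse of Psi as a self-map of [0, +oo). *)
Definition Psi_inv {R : realType} (v : R) : R :=
  xget 0 [set r | 0 <= r /\ Psi r = v].

Definition fhyp {R : realType} (h : R) : R := cosh h / sinh h ^+ 3.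

Definition Hcurve {R : realType} (v t : R) : plane R :=
  let r := Psi_inv v in
  (1 + sinh (r * (1 - 2 * t)) / sinh r,
   2 * cosh r / sinh r ^+ 2 * sinh (r * (1 - t)) * sinh (r * t)).

Definition Hset {R : realType} (v : R) : set (plane R) :=
  [set Hcurve v t | t in `[0, 1]].

Definition affine_map {R : realType} (f : plane R -> plane R) : Prop :=
  linear (fun p => f p - f 0).

Definition hyperbola {R : realType} (H : set (plane R)) : Prop :=
  exists f : plane R -> plane R, [/\ affine_map f, bijective f &
    H = f @` [set p | p.1 ^+ 2 - p.2 ^+ 2 = 1]].

Definition hyperbola_arc {R : realType} (S : set (plane R)) : Prop :=
  (exists g : R -> plane R, [/\ {within `[0, 1], continuous g},
     {in `[0, 1] &, injective g} & S = g @` `[0, 1]]) /\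
  exists2 H, hyperbola H & S `<=` H.

(* Main.v *)
Require Import Defs.
From HB Require Import structures.
From mathcomp Require Import all_boot all_order all_algebra.
From mathcomp Require Import all_classical all_reals all_analysis.
From mathcomp Require Import measurable_realfun.
From mathcomp Require Import zify ring lra.

Set Implicit Arguments.
Unset Strict Implicit.
Unset Printing Implicit Defensive.

Import Order.TTheory GRing.Theory Num.Theory.
Import numFieldNormedType.Exports.

Local Open Scope classical_set_scope.
Local Open Scope ring_scope.

(** Why the theorem holds.

    Let N be the product A * B of the semi-axes of the hyperbolas, and let
    C0 be the convex body bounded by the k arcs.  Write H for its support
    function, as a function of the normal angle psi, and q(psi) for the rate
    at which the hyperbolic parameter w of the arcs moves against arc length
    at the point with normal psi; the curvature of C0 there is N q^3, and
    N q = ze cos phi - H, where phi is the offset of psi from the centre of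
    its sector and ze is the distance from the origin to the centre of the
    hyperbola.

    Upper bound.  Run along the boundary of a competitor C at unit speed,
    counterclockwise, with outer normal angle psi(s).  For the curvature kap
    the inequality of the means gives
      3 N^(2/3) kap^(1/3) <= kap / q(psi)^2 + 2 N q(psi)    [cube_root_bound],
    with equality when kap = N q^3.  The first term on the right is N times
    the derivative of the global hyperbolic parameter u(psi(s)), so it
    integrates to 2 r k N, whatever C is [uu_growth, uu_period].  In the
    second term, 2 N q = 2 (ze cos phi - H).  The function ze cos phi
    integrates the potential V_j(p) = ze det(n_j, p) + const * j, with n_j the
    centre of the current sector; at a change of sector V can only jump
    upwards, exactly because C lies in the half planes of the polygon
    [Vj_mono].  As for H, let c(s) be the point of C0 that corresponds to the
    boundary point (x, y) of C when the abscissae are matched affinely and the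
    graphs of the upper and of the lower boundaries are matched; then
    H(psi) >= c . n(psi), and the integral of c . n(psi) is exactly
    rho |C| + |C0| / rho, where rho is the ratio of the widths [turn_Spot].
    This is E. Schmidt's transport proof of the isoperimetric inequality, in
    its form for a mixed area.  Altogether [affine_length_bound, length_bound]
      L(C) / L(C0) <= 1 + lambda / 3 * (2 - rho t - 1 / rho),   t = |C| / |C0|,
    the coefficient being what it is by the equation that defines v, which
    says lambda = |C0| / (k r N) [area_lambda].  Since ln z <= z - 1, this
    gives L(C)^3 |C|^lambda <= L(C0)^3 |C0|^lambda [gain_bound], with equality
    only if rho = t = 1.

    All of this has to be done for a boundary that may have corners and
    a curvature that exists only almost everywhere.  Nothing absolutely
    continuous is available; instead, the three potentials are assembled into
    one nondecreasing function with right derivatives bounded below by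
    kap^(1/3), and such a function grows at least by the integral of kap^(1/3)
    [integral_le_increment, a form of Fatou's lemma].  The unit tangent, its
    one-sided derivative and the angle psi are produced from an arc-length
    parametrization by comparing chords and arcs seen from an interior point
    [tangent_exists, tangent_angle, ccw_of_param].

    Equality and uniqueness.  For C0 itself every inequality above is an
    equality; concretely its affine length is computed from the curvature
    N q^3 [refset_length].  Conversely, if C attains the maximum then the
    inequality H(psi) >= c . n(psi) is an equality along the whole boundary
    [no_slack]; so C and C0 have common slopes over matched abscissae, hence
    are translates of each other [translate_of_normals], and since C0 touches
    all sides of the polygon the translation is trivial [refbody_fixed].

    The equation for v has a single solution because its right-hand side is
    increasing in r, from 0 to infinity [lambda_equation]. *)

(** * Right derivatives and Dini monotonicity *)

(** Linear arithmetic from the named hypotheses only; in a long context this is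
    much faster than a search among all of them. *)
Tactic Notation "flra" ne_hyp_list(hs) := clear - hs; lra.

Section Analysis.
Context {R : realType}.
Implicit Types (f g F W : R -> R) (a b s t x d e : R).

(** The right derivative, as a first-order expansion: the angle of a convex
    curve has no more than this at a corner, and an expansion composes well
    with the monotonicity criterion below. *)
Definition rder f s d := forall e : R, 0 < e -> exists2 del : R, 0 < del &
  forall h : R, 0 < h -> h < del -> `|f (s + h) - f s - d * h| <= e * h.

Definition rcont f s := forall e : R, 0 < e -> exists2 del : R, 0 < del &
  forall h : R, 0 < h -> h < del -> `|f (s + h) - f s| <= e.

Lemma min3_gt0 (x y z : R) : 0 < x -> 0 < y -> 0 < z ->
  exists2 m, 0 < m & [/\ m <= x, m <= y & m <= z].
Proof.
move=> x0 y0 z0; exists (Num.min x (Num.min y z)).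
  by rewrite !lt_min x0 y0 z0.
by split; rewrite ?ge_min ?lexx ?orbT //.
Qed.

Lemma rderD f g s d1 d2 : rder f s d1 -> rder g s d2 ->
  rder (fun t => f t + g t) s (d1 + d2).
Proof.
move=> hf hg e e0; have e20 : 0 < e / 2 by lra.
have [u u0 hu] := hf _ e20; have [v v0 hv] := hg _ e20.
have [m m0 [mu mv _]] := min3_gt0 u0 v0 v0; exists m => // h h0 hm.
have {}hu := hu h h0 (lt_le_trans hm mu); have {}hv := hv h h0 (lt_le_trans hm mv).
rewrite !ler_norml in hu hv *; lra.
Qed.

Lemma rderZ f s d c : rder f s d -> rder (fun t => c * f t) s (c * d).
Proof.
move=> hf e e0.
have c0 : 0 < `|c| + 1 by have := normr_ge0 c; lra.
have ec0 : 0 < e / (`|c| + 1) by rewrite divr_gt0.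
have [u u0 hu] := hf _ ec0; exists u => // h h0 hm.
have {}hu := hu h h0 hm.
have -> : c * f (s + h) - c * f s - c * d * h = c * (f (s + h) - f s - d * h) by ring.
rewrite normrM.
have h1 : `|c| * `|f (s + h) - f s - d * h| <= (`|c| + 1) * (e / (`|c| + 1) * h).
  by apply: ler_pM => //; lra.
have -> : e * h = (`|c| + 1) * (e / (`|c| + 1) * h) by field; apply: lt0r_neq0.
exact: h1.
Qed.

Lemma rderN f s d : rder f s d -> rder (fun t => - f t) s (- d).
Proof.
move=> hf e e0; have [u u0 hu] := hf _ e0; exists u => // h h0 hm.
have := hu h h0 hm; rewrite !ler_norml; lra.
Qed.

Lemma rderB f g s d1 d2 : rder f s d1 -> rder g s d2 ->
  rder (fun t => f t - g t) s (d1 - d2).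
Proof. by move=> hf /rderN; apply: rderD. Qed.

Lemma rder_cst c s : rder (fun=> c) s 0.
Proof.
move=> e e0; exists 1 => // h h0 _; rewrite subrr mul0r subrr normr0.
by rewrite mulr_ge0 // ltW.
Qed.

Lemma rder_ext f g s d : (exists2 del : R, 0 < del & forall h : R, 0 <= h -> h < del ->
  f (s + h) = g (s + h)) -> rder f s d -> rder g s d.
Proof.
move=> [u u0 hu] hf e e0; have [v v0 hv] := hf _ e0.
have [m m0 [mu mv _]] := min3_gt0 u0 v0 v0; exists m => // h h0 hm.
have E0 : f s = g s by have := hu 0 (lexx 0) u0; rewrite addr0.
rewrite -E0 -hu; [|exact: ltW|exact: lt_le_trans mu].
by apply: hv => //; exact: lt_le_trans mv.
Qed.

Lemma rder_rcont f s d : rder f s d -> rcont f s.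
Proof.
move=> hf e e0; have [u u0 hu] := hf 1 ltr01.
have c0 : 0 < `|d| + 1 by have := normr_ge0 d; lra.
have [m m0 [mu mv _]] := min3_gt0 u0 (divr_gt0 e0 c0) u0; exists m => // h h0 hm.
have {}hu := hu h h0 (lt_le_trans hm mu).
have : h * (`|d| + 1) <= e.
  by rewrite -ler_pdivlMr //; apply: le_trans (ltW hm) mv.
have : `|d * h| = `|d| * h by rewrite normrM (gtr0_norm h0).
have := ler_normD (f (s + h) - f s - d * h) (d * h).
by rewrite subrK; lra.
Qed.
Lemma rder_uniq f s d1 d2 : rder f s d1 -> rder f s d2 -> d1 = d2.
Proof.
move=> h1 h2; apply/eqP; rewrite -subr_eq0; apply/negPn/negP => n0.
have e0 : 0 < `|d1 - d2| / 4 by rewrite divr_gt0 ?normr_gt0.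
have [u u0 hu] := h1 _ e0; have [v v0 hv] := h2 _ e0.
have [m m0 [mu mv _]] := min3_gt0 u0 v0 v0.
have m20 : 0 < m / 2 by lra. have m2m : m / 2 < m by lra.
have {}hu := hu _ m20 (lt_le_trans m2m mu); have {}hv := hv _ m20 (lt_le_trans m2m mv).
have : `|(d1 - d2) * (m / 2)| <= (`|d1 - d2| / 4) * (m / 2) + (`|d1 - d2| / 4) * (m / 2).
  rewrite !ler_norml in hu hv *; flra hu hv.
rewrite normrM (gtr0_norm m20).
have : 0 < `|d1 - d2| * (m / 2) by rewrite mulr_gt0 // normr_gt0.
lra.
Qed.

(** The function may jump upwards at any point from the left, so no integral
    of a derivative is available: given e, follow the supremum of the points
    up to which W decreases at a rate of at most e. The first condition moves
    this supremum to the right, the second one lets W pass it. *)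
Lemma dini_nondecreasing W a b :
  (forall s, a <= s < b -> forall e : R, 0 < e -> exists2 del : R, 0 < del &
     forall h : R, 0 < h -> h < del -> W s - e * h <= W (s + h)) ->
  (forall s, a < s <= b -> forall e : R, 0 < e -> exists2 del : R, 0 < del &
     forall t : R, a <= t -> s - del < t -> t < s -> W t <= W s + e) ->
  forall x y, a <= x -> x <= y -> y <= b -> W x <= W y.
Proof.
move=> hr hl x y ax xy yb.
have key e : 0 < e -> W x - e * (y - x) <= W y.
  move=> e0.
  pose E := [set t | x <= t <= y /\ forall u, x <= u <= t -> W x - e * (u - x) <= W u].
  have Ex : E x.
    split=> [|u]; first by rewrite lexx.
    rewrite -eq_le => /eqP <-; lra.
  have supE : has_sup E.
    by split; [exists x|exists y => t [/andP[]]].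
  pose m := sup E.
  have xm : x <= m by apply: ub_le_sup => //; case: supE.
  have my : m <= y by apply: ge_sup; [exists x|move=> t [/andP[]]].
  have lowm u : x <= u < m -> W x - e * (u - x) <= W u.
    move=> /andP[xu um].
    have [t [/andP[xt ty] ht] ut] := sup_gt (proj1 supE) um.
    by apply: ht; rewrite xu ltW.
  have Wm : W x - e * (m - x) <= W m.
    have [xm'|xm'] := ltP x m; last first.
      have -> : m = x by apply/eqP; rewrite eq_le xm' xm.
      lra.
    apply/ler_addgt0Pr => e' e'0.
    have [|del del0 hd] := hl m _ e' e'0.
      by rewrite (le_lt_trans ax xm') (le_trans my yb).
    pose t := Num.max x (m - del / 2).
    have tm : t < m by rewrite gt_max xm'; lra.
    have xt : x <= t by rewrite le_max lexx.
    have dt : m - del < t by rewrite lt_max; apply/orP; right; lra.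
    have := hd t (le_trans ax xt) dt tm.
    have := lowm t; rewrite xt tm => /(_ isT).
    have : e * (t - x) <= e * (m - x) by rewrite ler_pM2l //; lra.
    lra.
  have [my'|my'] := ltP m y; last first.
    by have <- : m = y by apply/eqP; rewrite eq_le my' my.
  have [|del del0 hd] := hr m _ e e0.
    by rewrite (le_trans ax xm) (lt_le_trans my' yb).
  have ym0 : 0 < y - m by lra.
  have [h h0 [hd1 hym _]] := min3_gt0 del0 ym0 ym0.
  have h20 : 0 < h / 2 by lra.
  suff : E (m + h / 2).
    move=> /(ub_le_sup (proj2 supE)); rewrite -/m; lra.
  split=> [|u /andP[xu uh]]; first by apply/andP; split; flra xm hym h20.
  have [um|um] := ltP u m; first by apply: lowm; rewrite xu um.
  have [um'|um'] := leP u m.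
    by have -> : u = m by apply/eqP; rewrite eq_le um um'.
  have d0 : 0 < u - m by lra.
  have d1 : u - m < del by flra hd1 uh d0.
  have := hd _ d0 d1; rewrite [m + _]addrC subrK.
  have : e * (u - x) = e * (m - x) + e * (u - m) by ring.
  flra Wm.
have [xy'|xy'] := ltP x y; last first.
  by have -> : x = y by apply/eqP; rewrite eq_le xy xy'.
apply/ler_addgt0Pr => e e0.
have yx0 : 0 < y - x by lra.
have := key _ (divr_gt0 e0 yx0); rewrite divfK ?gt_eqF //; lra.
Qed.

(** Apply the monotonicity criterion to the function and to its opposite. *)
Lemma rder0_cst f a b :
  (forall s, a <= s < b -> rder f s 0) ->
  (forall s, a < s <= b -> forall e : R, 0 < e -> exists2 del : R, 0 < del &
     forall t : R, a <= t -> s - del < t -> t < s -> `|f t - f s| <= e) ->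
  forall x y, a <= x -> x <= y -> y <= b -> f x = f y.
Proof.
move=> hr hl x y ax xy yb; apply/eqP; rewrite eq_le; apply/andP; split.
- apply: (@dini_nondecreasing f a b) => // s sab e e0.
    have [u u0 hu] := hr s sab e e0; exists u => // h h0 hh.
    by have := hu h h0 hh; rewrite ler_norml; lra.
  have [u u0 hu] := hl s sab e e0; exists u => // t t1 t2 t3.
  by have := hu t t1 t2 t3; rewrite ler_norml; lra.
- rewrite -lerN2; apply: (@dini_nondecreasing (fun t => - f t) a b) => // s sab e e0.
    have [u u0 hu] := hr s sab e e0; exists u => // h h0 hh.
    by have := hu h h0 hh; rewrite ler_norml; lra.
  have [u u0 hu] := hl s sab e e0; exists u => // t t1 t2 t3.
  by have := hu t t1 t2 t3; rewrite ler_norml; lra.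
Qed.

Lemma continuous_epsP f x : {for x, continuous f} <->
  forall e : R, 0 < e -> exists2 del : R, 0 < del & forall y : R, `|y - x| < del -> `|f y - f x| < e.
Proof.
split=> [/cvgrPdist_lt H e e0|H].
  have := H e e0; rewrite near_simpl => /nbhs_ballP[del /= del0 hd].
  exists del => // y yx; rewrite distrC; apply: hd.
  by rewrite /ball /= distrC.
apply/cvgrPdist_lt => e e0; have [del del0 hd] := H e e0.
apply/nbhs_ballP; exists del => //= y; rewrite /ball /= distrC => /hd.
by rewrite distrC.
Qed.

Lemma is_derive_eps F x d : is_derive x 1 F d ->
  forall e : R, 0 < e -> exists2 del : R, 0 < del & forall h : R, `|h| < del ->
    `|F (x + h) - F x - d * h| <= e * `|h|.
Proof.
move=> [dF <-] e e0.
have /cvgrPdist_lt /(_ e e0) := dF.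
move=> /nbhs_ballP[del /= del0 hd].
exists del => // h hdel.
have [->|h0] := eqVneq h 0; first by rewrite addr0 subrr mulr0 subr0 normr0 mulr0.
have := hd h; rewrite /ball /= sub0r normrN => /(_ hdel h0).
rewrite [h *: 1]mulr1 [h + x]addrC => /ltW.
rewrite /GRing.scale /= => H.
have -> : F (x + h) - F x - 'D_1 F x * h =
   - ('D_1 F x - h^-1 * (F (x + h) - F x)) * h by field.
by rewrite normrM normrN ler_wpM2r.
Qed.

Lemma eps_is_derive F x d :
  (forall e : R, 0 < e -> exists2 del : R, 0 < del & forall h : R, `|h| < del ->
    `|F (x + h) - F x - d * h| <= e * `|h|) -> is_derive x 1 F d.
Proof.
move=> H.
have cv : (fun h : R => h^-1 *: ((F \o shift x) (h *: (1:R)) - F x)) @ 0^' --> d.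
  apply/cvgrPdist_le => e e0; have [del del0 hd] := H e e0.
  apply/nbhs_ballP; exists del => //= h; rewrite /ball /= sub0r normrN => hdel h0.
  have := hd h hdel; rewrite [h *: 1]mulr1 [h + x]addrC /GRing.scale /= => K.
  have -> : d - h^-1 * (F (x + h) - F x) = - ((F (x + h) - F x - d * h) / h) by field.
  by rewrite normrN normrM normfV ler_pdivrMr // normr_gt0.
apply: DeriveDef; first by apply/cvg_ex; exists d.
exact: cvg_lim cv.
Qed.

Lemma antiderivative f a b : a < b -> continuous f ->
  exists F, (forall x, a <= x <= b -> is_derive x 1 F (f x)) /\
    (\int[lebesgue_measure]_(x in `[a, b]) (f x)%:E = (F b - F a)%:E)%E.
Proof.
move=> ab cf.
pose F x := (\int[lebesgue_measure]_(t in `[a - 1, x]) f t)%R.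
have dF x : a <= x <= b -> derivable F x 1 /\ F^`()%classic x = f x.
  move=> /andP[ax xb].
  apply: (@continuous_FTC1_closed R f (a - 1) x (b + 1)) => //; try lra.
    apply: continuous_compact_integrable; first exact: segment_compact.
    by apply: continuous_subspaceT.
  exact: cf.
have iF x : a <= x <= b -> is_derive x 1 F (f x).
  by move=> /dF[D <-]; rewrite derive1E; exact: derivableP.
exists F; split=> //.
rewrite EFinB; apply: continuous_FTC2 => //.
- by apply: continuous_subspaceT.
- split.
  + move=> x; rewrite in_itv /= => /andP[ax xb].
    by have [] := dF x; rewrite ?(ltW ax) ?(ltW xb).
  + apply: cvg_at_right_filter.
    have [|D _] := dF a; first by rewrite lexx ltW.
    exact/differentiable_continuous/derivable1_diffP.
  + apply: cvg_at_left_filter.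
    have [|D _] := dF b; first by rewrite lexx ltW.
    exact/differentiable_continuous/derivable1_diffP.
- move=> x; rewrite in_itv /= => /andP[ax xb].
  by apply: (dF x _).2; rewrite (ltW ax) (ltW xb).
Qed.

End Analysis.

(** * The increment of a nondecreasing function bounds the integral of its derivative *)

Section MonotoneFatou.
Context {R : realType}.
Notation mu := (@lebesgue_measure R).

(** The integral of a nonnegative function is a supremum over simple
    functions, hence monotone on all functions; the curvature is integrated
    without knowing that it is measurable. *)
Lemma le_integral_nonneg (D : set R) (f g : R -> \bar R) :
  (forall x, D x -> (0 <= f x)%E) -> (forall x, D x -> (f x <= g x)%E) ->
  (\int[mu]_(x in D) f x <= \int[mu]_(x in D) g x)%E.
Proof.
move=> f0 fg; rewrite [leLHS]integral_mkcond [leRHS]integral_mkcond.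
have f10 x : (0 <= (f \_ D) x)%E by apply: erestrict_ge0.
have fg1 x : ((f \_ D) x <= (g \_ D) x)%E by apply: lee_restrict.
rewrite !ge0_integralTE //; last by move=> x; apply: le_trans (f10 x) (fg1 x).
apply: le_ereal_sup => _ [h hf <-]; exists h => // x.
exact: le_trans (hf x) (fg1 x).
Qed.

(** At the right end of the parameter interval the derivative is not
    controlled; a point has measure zero. *)
Lemma le_integral_but_right (a b : R) (f g : R -> \bar R) :
  (forall x, a <= x <= b -> (0 <= f x)%E) ->
  (forall x, a <= x <= b -> (0 <= g x)%E) ->
  measurable_fun `[a, b] g ->
  (forall x, a <= x < b -> (f x <= g x)%E) ->
  (\int[mu]_(x in `[a, b]) f x <= \int[mu]_(x in `[a, b]) g x)%E.
Proof.
move=> f0 g0 mg fg.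
pose h : R -> \bar R := (cst +oo%E) \_ [set b].
have h0 x : (0 <= h x)%E by apply: erestrict_ge0 => //= y _; exact: leey.
have mh : measurable_fun `[a, b] h.
  apply: measurable_funTS; apply/(measurable_restrictT _ _).1 => //.
have -> : (\int[mu]_(x in `[a, b]) g x = \int[mu]_(x in `[a, b]) (g x + h x))%E.
  rewrite ge0_integralD //=.
  rewrite /h -integral_mkcondr [X in (_ + X)%E](@integral_Sset1 _ _ _ b) ?adde0 //.
apply: le_integral_nonneg => x /=; rewrite in_itv /= => /andP[ax xb].
  by apply: f0; rewrite ax xb.
have [->|xb'] := eqVneq x b.
  rewrite /h patchE mem_set //= addey ?leey //.
  by apply/eqP => E; have := g0 b; rewrite E lexx (le_trans ax xb) => /(_ isT).
apply: (le_trans (fg x _)); first by rewrite ax lt_neqAle xb' xb.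
by rewrite leeDl.
Qed.

Lemma integral_translate (a b c : R) (f : R -> \bar R) :
  measurable_fun [set: R] f -> (forall x, (0 <= f x)%E) ->
  (\int[mu]_(x in `[a, b]) f (x + c)%R = \int[mu]_(x in `[(a + c)%R, (b + c)%R]) f x)%E.
Proof.
move=> mf f0.
pose phi : measurableTypeR R -> measurableTypeR R := fun x => x + c.
have mphi : measurable_fun [set: measurableTypeR R] phi.
  by apply: measurable_funD.
have E : phi @^-1` `[a + c, b + c]%classic = `[a, b]%classic.
  by apply/seteqP; split=> x /=; rewrite !in_itv /= !lerD2r.
rewrite -E -(ge0_integral_pushforward mphi) //; last exact: measurable_funTS.
apply: eq_measure_integral => //= A mA _; apply/esym.
have itvE (x y : R) : phi @^-1` `]x, y]%classic = `](x - c), (y - c)]%classic.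
  by apply/seteqP; split=> z /=; rewrite !in_itv /= ltrBlDr lerBrDr.
apply: (lebesgue_measure_unique) => //= _ [[x y]] _ <- /=.
rewrite /pushforward itvE !lebesgue_measure_itv /= !lte_fin ltrD2r.
by case: ifP => // _; rewrite -!EFinD; congr EFin; ring.
Qed.


(** Fatou's lemma for the difference quotients of W, extended by constants:
    these are measurable because W is monotone, their lower limit dominates
    phi, and their integrals telescope to at most the increment of W. So W may
    have jumps and singular parts. *)
Lemma integral_le_increment (a b : R) (W phi : R -> R) : a < b ->
  {in `[a, b] &, {homo W : x y / x <= y}} ->
  (forall s, a <= s <= b -> 0 <= phi s) ->
  (forall s, a <= s < b -> forall e : R, 0 < e -> exists2 del : R, 0 < del &
     forall h : R, 0 < h -> h < del -> (phi s - e) * h <= W (s + h) - W s) ->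
  (\int[mu]_(s in `[a, b]) (phi s)%:E <= (W b - W a)%:E)%E.
Proof.
move=> ab hW phi0 hphi.
pose cl (s : R) := Num.max a (Num.min b s).
have clE s : cl s \in `[a, b].
  by rewrite in_itv /= le_max lexx ge_max ge_min lexx (ltW ab).
have clh : {homo cl : x y / x <= y}.
  move=> x y xy; rewrite /cl.
  have : Num.min b x <= Num.min b y.
    by rewrite le_min ge_min lexx /= ge_min xy orbT.
  by move=> h; rewrite ge_max le_max lexx /= le_max h orbT.
have clid s : a <= s <= b -> cl s = s.
  by move=> /andP[as_ sb]; rewrite /cl (min_idPr sb) (max_idPr as_).
pose V s := W (cl s) - W a.
have Vh : {homo V : x y / x <= y}.
  by move=> x y /clh xy; rewrite lerB // hW.
have V0 s : 0 <= V s.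
  by rewrite subr_ge0 hW // ?in_itv /= ?lexx ?(ltW ab) // le_max lexx.
have VM s : V s <= W b - W a.
  by rewrite lerB // hW // ?in_itv /= ?lexx ?(ltW ab) // ge_max (ltW ab) ge_min lexx.
have mV : measurable_fun [set: R] V by exact: nondecreasing_measurable.
have mVs c : measurable_fun [set: R] (fun s => V (s + c)).
  by apply: nondecreasing_measurable => // x y xy; apply: Vh; rewrite lerD2r.
set M := W b - W a in VM *.
have M0 : 0 <= M by rewrite (le_trans (V0 a)).
(* the difference quotients of step 1 / (n + 1) *)
pose f (n : nat) (s : R) : \bar R := (n.+1%:R * (V (s + n.+1%:R^-1) - V s))%:E.
have f0 n s : (0 <= f n s)%E.
  by rewrite lee_fin mulr_ge0 // subr_ge0 Vh // lerDl invr_ge0.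
have mf n : measurable_fun [set: R] (f n).
  by apply/measurable_EFinP; apply: measurable_funM => //; apply: measurable_funB.
have fint n : (\int[mu]_(s in `[a, b]) f n s <= M%:E)%E.
  set h : R := n.+1%:R^-1.
  have h0 : 0 < h by rewrite invr_gt0.
  have iVfin : (\int[mu]_(s in `[a, b]) (V s)%:E \is a fin_num)%E.
    rewrite ge0_fin_numE; last by apply: integral_ge0 => x _; rewrite lee_fin.
    apply: (@le_lt_trans _ _ (\int[mu]_(s in `[a, b]) (M)%:E)%E).
      by apply: le_integral_nonneg => x _; rewrite lee_fin.
    by rewrite integral_cst //= lebesgue_measure_itv /= lte_fin ab -EFinD -EFinM ltry.
  have step : (\int[mu]_(s in `[a, b]) (V (s + h))%:E <=
               \int[mu]_(s in `[a, b]) (V s)%:E + (M * h)%:E)%E.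
    rewrite (@integral_translate a b h (EFin \o V)) //; last exact/measurable_EFinP.
    apply: (@le_trans _ _ (\int[mu]_(s in `[a, (b + h)%R]) (V s)%:E)%E).
      apply: ge0_subset_integral => //=.
      - by apply/measurable_EFinP; exact: measurable_funTS.
      - by move=> x _; rewrite lee_fin.
      - by apply: subset_itvr => /=; rewrite ?bnd_simp; lra.
    have -> : `[a, b + h]%classic = `[a, b]%classic `|` `]b, b + h]%classic.
      by rewrite (@itv_bndbnd_setU _ _ _ (BRight b)) //= bnd_simp; lra.
    rewrite ge0_integral_setU //=.
    - apply: leeD => //.
      apply: (@le_trans _ _ (\int[mu]_(s in `]b, (b + h)%R]) (M)%:E)%E).
        by apply: le_integral_nonneg => x _; rewrite lee_fin.
      rewrite integral_cst //= lebesgue_measure_itv /= lte_fin ltrDl h0.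
      by rewrite -EFinD -EFinM lee_fin; have -> : b + h - b = h by ring.
    - by apply/measurable_EFinP; exact: measurable_funTS.
    - by move=> x _; rewrite lee_fin.
    - apply/disj_setPS => x [] /=; rewrite !in_itv /= => /andP[_ xb] /andP[bx _].
      by have := lt_le_trans bx xb; rewrite ltxx.
  have mD : measurable_fun [set: R] (fun s => (V (s + h) - V s)%:E).
    by apply/measurable_EFinP; apply: measurable_funB.
  have fE s : f n s = (n.+1%:R%:E * (V (s + h) - V s)%:E)%E by [].
  under eq_integral do rewrite fE.
  rewrite ge0_integralZl_EFin //; last 2 first.
  - by move=> x _; rewrite lee_fin subr_ge0 Vh // lerDl ltW.
  - exact: (measurable_funTS mD).
  have iD : (\int[mu]_(s in `[a, b]) (V (s + h) - V s)%:E +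
      \int[mu]_(s in `[a, b]) (V s)%:E = \int[mu]_(s in `[a, b]) (V (s + h))%:E)%E.
    rewrite -ge0_integralD //=.
    - by apply: eq_integral => x _; rewrite -EFinD subrK.
    - by move=> x _; rewrite lee_fin subr_ge0 Vh // lerDl ltW.
    - exact: (measurable_funTS mD).
    - by move=> x _; rewrite lee_fin.
    - by apply/measurable_EFinP; exact: measurable_funTS.
  have : (\int[mu]_(s in `[a, b]) (V (s + h) - V s)%:E <= (M * h)%:E)%E.
    by rewrite -(leeD2rE _ _ iVfin) iD addeC.
  move=> H; apply: (le_trans (lee_wpmul2l _ H)); first by rewrite lee_fin.
  by rewrite -EFinM lee_fin /h mulrCA mulfV ?mulr1.
apply: (@le_trans _ _ (\int[mu]_(s in `[a, b]) limn_einf (f^~ s))%E); last first.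
  apply: (@le_trans _ _ (limn_einf (fun n => \int[mu]_(s in `[a, b]) f n s)%E)).
  - apply: fatou => //.
    by move=> n; exact: (measurable_funTS (mf n)).
  - rewrite limn_einf_lim; apply: lime_le; first exact: is_cvg_einfs.
    apply: nearW => n; apply: le_trans (fint n).
    by apply: ereal_inf_lbound; exists n => /=.
apply: le_integral_but_right.
- by move=> x xab; rewrite lee_fin phi0.
- move=> x _; rewrite limn_einf_lim; apply: lime_ge; first exact: is_cvg_einfs.
  by apply: nearW => n; apply: le_ereal_inf_tmp => _ [m _ <-].
- apply: (emeasurable_fun_cvg (fun n x => einfs (f^~ x) n)).
    by apply: measurable_fun_einfs => n; exact: (measurable_funTS (mf n)).
  by move=> x _; rewrite limn_einf_lim; exact: is_cvg_einfs.
- move=> s /andP[as_ sb]; apply/lee_addgt0Pr => e e0.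
  rewrite -leeBlDr // -EFinB.
  have [|del del0 hd] := hphi s _ e e0; first by rewrite as_ sb.
  rewrite limn_einf_lim; apply: lime_ge; first exact: is_cvg_einfs.
  have bs0 : 0 < b - s by lra.
  have m0 : 0 < Num.min del (b - s) by rewrite lt_min del0 bs0.
  near=> n; apply: le_ereal_inf_tmp => _ [m /= nm <-].
  rewrite /f lee_fin.
  set h : R := m.+1%:R^-1.
  have h0 : 0 < h by rewrite invr_gt0.
  have hm : h < Num.min del (b - s).
    apply: (@le_lt_trans _ _ n.+1%:R^-1); last by near: n; exact: near_infty_natSinv_lt (PosNum m0).
    by rewrite lef_pV2 ?posrE // ler_nat.
  rewrite lt_min in hm; case/andP: hm => hm1 hm2.
  have := hd h h0 hm1.
  rewrite /V !clid; [|flra as_ h0 hm2|flra as_ h0 hm2].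
  have -> : W (s + h) - W a - (W s - W a) = W (s + h) - W s by ring.
  move=> K; rewrite -ler_pdivrMl // -/h mulrC //.
Unshelve. all: by end_near. Qed.

End MonotoneFatou.

(** * Closed convex curves seen from an interior point *)

Section Cone.
Context {R : realType}.

Definition dt (x1 y1 x2 y2 : R) := x1 * y2 - y1 * x2.

Definition convexP (D : R -> R -> Prop) := forall u v u' v' t : R, D u v -> D u' v' ->
  0 <= t <= 1 -> D ((1 - t) * u + t * u') ((1 - t) * v + t * v').

(** The position of a boundary curve relative to an interior point placed at
    the origin. The field ar_radial expresses that the curve lies on the
    boundary, without any topology, and ar_surj that it goes all the way
    around. The field ar_length says that arc length is the least length
    compatible with the chords. *)
Record around (D : R -> R -> Prop) (l : R) (a b : R -> R) : Prop := Around {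
  ar_convex : convexP D;
  ar_ball : exists2 d0 : R, 0 < d0 & forall u v : R, `|u| < d0 -> `|v| < d0 -> D u v;
  ar_l : 0 < l;
  ar_D : forall s : R, D (a s) (b s);
  ar_radial : forall s c : R, 1 < c -> ~ D (c * a s) (c * b s);
  ar_lip : forall s t : R, (a s - a t) ^+ 2 + (b s - b t) ^+ 2 <= (s - t) ^+ 2;
  ar_inj : forall s t : R, 0 <= s < l -> 0 <= t < l -> a s = a t -> b s = b t -> s = t;
  ar_closed : a l = a 0 /\ b l = b 0;
  ar_surj : forall u v : R, (u != 0) || (v != 0) -> exists s c : R, [/\ 0 <= s < l, 0 < c,
    a s = c * u & b s = c * v];
  ar_length : forall (s t : R) (m : R -> R), 0 <= s -> s < t -> t <= l ->
    (forall u v : R, s <= u -> u < v -> v <= t ->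
      Num.sqrt ((a v - a u) ^+ 2 + (b v - b u) ^+ 2) <= m v - m u) ->
    t - s <= m t - m s }.

Variables (D : R -> R -> Prop) (l : R) (a b : R -> R).
Hypothesis H : around D l a b.

Lemma lip_a s t : `|a s - a t| <= `|s - t|.
Proof.
rewrite -ler_sqr ?nnegrE // -!normrX !ger0_norm ?sqr_ge0 //.
by apply: le_trans (ar_lip H s t); rewrite lerDl sqr_ge0.
Qed.

Lemma lip_b s t : `|b s - b t| <= `|s - t|.
Proof.
rewrite -ler_sqr ?nnegrE // -!normrX !ger0_norm ?sqr_ge0 //.
by apply: le_trans (ar_lip H s t); rewrite lerDr sqr_ge0.
Qed.

Lemma lip_continuous (f : R -> R) : (forall s t, `|f s - f t| <= `|s - t|) ->
  continuous f.
Proof.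
move=> hf x; apply/continuous_epsP => e e0; exists e => // y yx.
exact: le_lt_trans (hf _ _) yx.
Qed.

Lemma cont_a : continuous a. Proof. exact: lip_continuous lip_a. Qed.
Lemma cont_b : continuous b. Proof. exact: lip_continuous lip_b. Qed.

Lemma cont_dt (x y : R) : continuous (fun t => dt x y (a t) (b t)).
Proof.
move=> t; apply: cvgB; apply: cvgM; try exact: cvg_cst; [exact: cont_b|exact: cont_a].
Qed.

Lemma curve_neq0 s : (a s != 0) || (b s != 0).
Proof.
rewrite -negb_and; apply/negP => /andP[/eqP a0 /eqP b0].
have := @ar_radial _ _ _ _ H s 2; rewrite a0 b0 !mulr0 ltr1n => /(_ isT); apply.
by have [d0 d00] := ar_ball H; apply; rewrite normr0.
Qed.

Lemma curve_sq_gt0 s : 0 < a s ^+ 2 + b s ^+ 2.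
Proof.
rewrite lt0r addr_ge0 ?sqr_ge0 // andbT paddr_eq0 ?sqr_ge0 // !sqrf_eq0.
by rewrite negb_and curve_neq0.
Qed.

(** Otherwise a multiple of the boundary point by a factor above 1 would lie
    on the chord, hence in D, against ar_radial. *)
Lemma cone_chord (s p1 p2 r1 r2 : R) : D p1 p2 -> D r1 r2 ->
  0 < dt p1 p2 r1 r2 -> 0 <= dt p1 p2 (a s) (b s) -> 0 <= dt (a s) (b s) r1 r2 ->
  0 <= dt (a s - p1) (b s - p2) (r1 - a s) (r2 - b s).
Proof.
move=> Dp Dr pr ps sr.
suff K : dt p1 p2 r1 r2 <= dt p1 p2 (a s) (b s) + dt (a s) (b s) r1 r2.
  by move: K; rewrite /dt => K; lra.
rewrite leNgt; apply/negP => K.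
set A := dt (a s) (b s) r1 r2 in sr K; set B := dt p1 p2 (a s) (b s) in ps K.
set P := dt p1 p2 r1 r2 in pr K.
have E1 : P * a s = A * p1 + B * r1 by rewrite /A /B /P /dt; ring.
have E2 : P * b s = A * p2 + B * r2 by rewrite /A /B /P /dt; ring.
have AB0 : 0 < A + B.
  rewrite lt_neqAle addr_ge0 // andbT eq_sym paddr_eq0 //; apply/negP => /andP[/eqP A0 /eqP B0].
  have := curve_neq0 s.
  move: E1 E2; rewrite A0 B0 !mul0r addr0 => /eqP; rewrite mulf_eq0 gt_eqF //= => /eqP ->.
  by move=> /eqP; rewrite mulf_eq0 gt_eqF //= => /eqP ->; rewrite eqxx.
have c1 : 1 < P / (A + B) by rewrite ltr_pdivlMr // mul1r addrC.
apply: (ar_radial H (s := s) c1).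
have t01 : 0 <= B / (A + B) <= 1.
  by rewrite divr_ge0 ?(ltW AB0) //= ler_pdivrMr // mul1r lerDr.
have := ar_convex H Dp Dr t01.
have -> : (1 - B / (A + B)) * p1 + B / (A + B) * r1 = P / (A + B) * a s.
  have -> : P / (A + B) * a s = (P * a s) / (A + B) by ring.
  by rewrite E1; field; rewrite gt_eqF.
have -> // : (1 - B / (A + B)) * p2 + B / (A + B) * r2 = P / (A + B) * b s.
have -> : P / (A + B) * b s = (P * b s) / (A + B) by ring.
by rewrite E2; field; rewrite gt_eqF.
Qed.

(** If two boundary points lie on one ray, the outer one is excluded by
    ar_radial for the inner one. *)
Lemma ray_inj (s t c : R) : 0 <= s < l -> 0 <= t < l -> 0 < c ->
  a s = c * a t -> b s = c * b t -> s = t.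
Proof.
move=> hs ht c0 E1 E2.
have [c1|c1|c1] := ltgtP c 1.
- have c'1 : 1 < c^-1 by rewrite invf_gt1.
  exfalso; apply: (ar_radial H (s := s) c'1).
  by rewrite E1 E2 !mulKf ?gt_eqF //; exact: ar_D H _.
- by exfalso; apply: (ar_radial H (s := t) c1); rewrite -E1 -E2; exact: ar_D H _.
- by apply: (ar_inj H) => //; rewrite ?E1 ?E2 c1 mul1r.
Qed.

Lemma parallel (x y x' y' : R) : (x != 0) || (y != 0) -> dt x y x' y' = 0 ->
  exists c : R, x' = c * x /\ y' = c * y.
Proof.
rewrite /dt => /orP[x0|y0] E.
  exists (x' / x); split; first by field.
  apply: (mulfI x0); have -> : x * (x' / x * y) = y * x' by field.
  lra.
exists (y' / y); split; last by field.
apply: (mulfI y0); have -> : y * (y' / y * x) = x * y' by field.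
lra.
Qed.

Lemma ivt_gt0 (f : R -> R) (p q : R) : continuous f -> p <= q ->
  (forall s : R, p <= s <= q -> f s != 0) -> 0 < f p * f q.
Proof.
move=> cf pq f0.
have fp : f p != 0 by apply: f0; rewrite lexx pq.
have fq : f q != 0 by apply: f0; rewrite lexx pq.
rewrite lt_neqAle eq_sym mulf_neq0 //= leNgt; apply/negP => K.
have [||c] := @IVT _ f p q 0 pq.
- exact: continuous_subspaceT.
- have [fp0|fp0|fp0] := ltgtP (f p) 0; [| |by rewrite fp0 eqxx in fp].
  + have : 0 < f q by nra.
    by rewrite ge_min le_max (ltW fp0) /= => /ltW ->; rewrite orbT.
  + have : f q < 0 by nra.
    by rewrite ge_min le_max (ltW fp0) /= => /ltW ->; rewrite orbT.
- by rewrite in_itv /= => cpq fc; have := f0 c cpq; rewrite fc eqxx.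
Qed.

(** A determinant of two positions vanishes only if they are parallel, which
    is excluded on the arc by ray_inj; so it keeps its sign by the
    intermediate value theorem. *)
Lemma half_turn (p q c0 : R) : 0 <= p -> p < q -> q <= l -> 0 < c0 ->
  a q = - c0 * a p -> b q = - c0 * b p ->
  (forall t : R, p < t < q -> 0 < dt (a p) (b p) (a t) (b t)) ->
  forall s t : R, p <= s -> s < t -> t <= q -> (p < s) || (t < q) ->
  0 < dt (a s) (b s) (a t) (b t).
Proof.
move=> p0 pq ql c00 Eq1 Eq2 hp s t ps st tq pstq.
have [sp|ps'] := leP s p.
  have E : s = p by apply/eqP; rewrite eq_le sp ps.
  by move: pstq st; rewrite E ltxx /= => tq' pt; apply: hp; rewrite pt tq'.
have sq : s < q by exact: lt_le_trans st tq.
have hs : 0 < dt (a p) (b p) (a s) (b s) by apply: hp; rewrite ps' sq.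
have hsq : 0 < dt (a s) (b s) (a q) (b q).
  have -> : dt (a s) (b s) (a q) (b q) = c0 * dt (a p) (b p) (a s) (b s).
    by rewrite /dt Eq1 Eq2; ring.
  by rewrite mulr_gt0.
have : 0 < dt (a s) (b s) (a t) (b t) * dt (a s) (b s) (a q) (b q).
  apply: (ivt_gt0 (f := fun u => dt (a s) (b s) (a u) (b u))) => //.
    exact: cont_dt.
  move=> u /andP[tu uq]; apply/eqP => E.
  have su : s < u by exact: lt_le_trans st tu.
  have [uq'|uq'] := ltP u q; last first.
    have uE : u = q by apply/eqP; rewrite eq_le uq uq'.
    by move: hsq; rewrite -uE E ltxx.
  have [c [Ec1 Ec2]] := parallel (curve_neq0 s) E.
  have [c_gt0|c_le0] := ltP 0 c.
    have Es : u = s by apply: (ray_inj _ _ c_gt0 Ec1 Ec2); apply/andP; split; flra p0 ql ps' su uq'.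
    by move: su; rewrite Es ltxx.
  have := hp u; rewrite (lt_trans ps' su) uq' => /(_ isT).
  have -> : dt (a p) (b p) (a u) (b u) = c * dt (a p) (b p) (a s) (b s).
    by rewrite /dt Ec1 Ec2; ring.
  by rewrite ltNge mulr_le0_ge0 // ltW.
by rewrite pmulr_lgt0.
Qed.

(** The polar angle increases, by at most a half turn. *)
Definition turning (p q : R) := forall s t : R, p <= s -> s < t -> t <= q ->
  (p < s) || (t < q) -> 0 < dt (a s) (b s) (a t) (b t).

(** The ray opposite to the starting point has to be met. *)
Lemma antipode : exists M c0 : R, [/\ 0 < M < l, 0 < c0, a M = - c0 * a 0 & b M = - c0 * b 0].
Proof.
have [|M [c [/andP[M0 Ml] c0 E1 E2]]] := ar_surj H (u := - a 0) (v := - b 0).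
  by rewrite !oppr_eq0; exact: curve_neq0.
exists M, c; split=> //; rewrite ?E1 ?E2; try ring.
rewrite Ml andbT lt_neqAle M0 andbT; apply/eqP => ME.
have n0 := curve_neq0 0; move: E1 E2; rewrite -ME => E1 E2.
have {}E1 : (1 + c) * a 0 = 0 by rewrite mulrDl mul1r {1}E1; ring.
have {}E2 : (1 + c) * b 0 = 0 by rewrite mulrDl mul1r {1}E2; ring.
have c1 : 1 + c != 0 by rewrite gt_eqF //; lra.
by move: E1 E2 n0 => /eqP + /eqP; rewrite !mulf_eq0 (negbTE c1) /= => /eqP -> /eqP ->; rewrite eqxx.
Qed.

(** The determinant with the starting position vanishes only at the two
    antipodal points, so it has a constant sign on each of the two arcs
    between them. Both signs occur, since the two rays orthogonal to the
    starting position are met. *)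
Lemma orientation : exists M e c0 : R, [/\ 0 < M < l, (e == 1) || (e == -1), 0 < c0,
   a M = - c0 * a 0 /\ b M = - c0 * b 0 &
   (forall t : R, 0 < t < M -> 0 < e * dt (a 0) (b 0) (a t) (b t)) /\
   (forall t : R, M < t < l -> 0 < e * dt (a M) (b M) (a t) (b t))].
Proof.
have [M [c0 [/andP[M0 Ml] c00 E1 E2]]] := antipode.
pose g t := dt (a 0) (b 0) (a t) (b t).
have cg : continuous g by exact: cont_dt.
have l0 := ar_l H.
have gn0 t : 0 < t < l -> t != M -> g t != 0.
  move=> /andP[t0 tl] tM; apply/eqP => E.
  have [c [Ec1 Ec2]] := parallel (curve_neq0 0) E.
  have [c_gt0|c_le0] := ltP 0 c.
    have Es : t = 0 by apply: (ray_inj _ _ c_gt0 Ec1 Ec2); apply/andP; split; flra t0 tl.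
    by move: t0; rewrite Es ltxx.
  have [cE|cn0] := eqVneq c 0.
    by have := curve_neq0 t; rewrite Ec1 Ec2 cE !mul0r eqxx.
  have cc : 0 < - c / c0 by rewrite divr_gt0 //; lra.
  have Es : t = M.
    apply: (ray_inj _ _ cc); try (apply/andP; split; lra).
      by rewrite Ec1 E1; field; rewrite gt_eqF.
    by rewrite Ec2 E2; field; rewrite gt_eqF.
  by move: tM; rewrite Es eqxx.
have same1 s t : 0 < s < M -> 0 < t < M -> 0 < g s * g t.
  move=> /andP[s1 s2] /andP[t1 t2].
  wlog st : s t s1 s2 t1 t2 / s <= t.
    by move=> W; have [/W|/ltW/W] := leP s t; [exact|rewrite mulrC; exact].
  apply: ivt_gt0 => // u /andP[su ut]; apply: gn0; first by apply/andP; split; lra.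
  by rewrite lt_eqF //; lra.
have same2 s t : M < s < l -> M < t < l -> 0 < g s * g t.
  move=> /andP[s1 s2] /andP[t1 t2].
  wlog st : s t s1 s2 t1 t2 / s <= t.
    by move=> W; have [/W|/ltW/W] := leP s t; [exact|rewrite mulrC; exact].
  apply: ivt_gt0 => // u /andP[su ut]; apply: gn0; first by apply/andP; split; lra.
  by rewrite gt_eqF //; lra.
have sq := curve_sq_gt0 0.
have [|s1 [c1 [s1l c10 F1 F2]]] := ar_surj H (u := - b 0) (v := a 0).
  by rewrite oppr_eq0 orbC; exact: curve_neq0.
have [|s2 [c2 [s2l c20 F3 F4]]] := ar_surj H (u := b 0) (v := - a 0).
  by rewrite oppr_eq0 orbC; exact: curve_neq0.
have g1 : 0 < g s1.
  have -> : g s1 = c1 * (a 0 ^+ 2 + b 0 ^+ 2) by rewrite /g /dt F1 F2; ring.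
  exact: mulr_gt0.
have g2 : g s2 < 0.
  have -> : g s2 = - (c2 * (a 0 ^+ 2 + b 0 ^+ 2)) by rewrite /g /dt F3 F4; ring.
  by rewrite oppr_lt0 mulr_gt0.
have g0E : g 0 = 0 by rewrite /g /dt; ring.
have gME : g M = 0 by rewrite /g /dt E1 E2; ring.
have place s : 0 <= s < l -> g s != 0 -> (0 < s < M) \/ (M < s < l).
  move=> /andP[s0 sl] gs.
  have [sM|sM|sM] := ltgtP s M.
  - left; rewrite andbT lt_neqAle s0 andbT; apply/eqP => E.
    by rewrite -E g0E eqxx in gs.
  - by right.
  - by rewrite sM gME eqxx in gs.
have gM t : dt (a M) (b M) (a t) (b t) = - c0 * g t by rewrite /g /dt E1 E2; ring.
have Mh : 0 < M / 2 < M by apply/andP; split; flra M0 E2.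
have Mlh : M < (M + l) / 2 < l by apply/andP; split; flra Ml E2.
have neq1 : g s1 != 0 by rewrite gt_eqF.
have neq2 : g s2 != 0 by rewrite lt_eqF.
case: (place s1 s1l neq1) => p1; case: (place s2 s2l neq2) => p2.
- by have := same1 _ _ p1 p2; rewrite nmulr_lgt0 // ltNge (ltW g1).
- exists M, 1, c0; split=> //; rewrite ?M0 ?eqxx //; split=> t ht.
    by rewrite mul1r; have := same1 _ _ p1 ht; rewrite pmulr_rgt0.
  rewrite mul1r gM mulNr oppr_gt0 pmulr_rlt0 //.
  by have := same2 _ _ p2 ht; rewrite nmulr_rgt0.
- exists M, (-1), c0; split=> //; rewrite ?M0 ?eqxx ?orbT //; split=> t ht.
    by rewrite mulN1r oppr_gt0; have := same1 _ _ p2 ht; rewrite nmulr_rgt0.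
  rewrite gM mulrA mulN1r opprK pmulr_rgt0 //.
  by have := same2 _ _ p1 ht; rewrite pmulr_rgt0.
- by have := same2 _ _ p1 p2; rewrite nmulr_lgt0 // ltNge (ltW g1).
Qed.

End Cone.

(** * Existence of the right tangent *)

Section Frame.
Context {R : realType}.

Lemma unit_vector_frame (Q B1 B2 n m : R) : 0 < n -> 0 < m ->
  n ^+ 2 = B1 ^+ 2 + B2 ^+ 2 -> m ^+ 2 = Q ^+ 2 + 1 ->
  ((Q * B1 + - B2) / (n * m)) ^+ 2 + ((Q * B2 + B1) / (n * m)) ^+ 2 = 1.
Proof.
move=> n0 m0 nn mm.
have -> : ((Q * B1 + - B2) / (n * m)) ^+ 2 + ((Q * B2 + B1) / (n * m)) ^+ 2 =
  ((Q ^+ 2 + 1) * (B1 ^+ 2 + B2 ^+ 2)) / (n ^+ 2 * m ^+ 2).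
  field.
  by rewrite !gt_eqF.
rewrite nn mm [X in X / _]mulrC divff // gt_eqF // mulr_gt0 // -?nn -?mm exprn_gt0 //.
Qed.

(** In a frame of norm n, the curve is a graph of Z over X with slope tending
    to Q, and y is the deviation from the line of slope Q. The arc length t -
    s is, up to the factor n, equal to m = sqrt (1 + Q^2) times the increment
    of X, up to y, which is of higher order. So X is differentiable with
    respect to the arc length, and with it all linear combinations g of X and
    Z. *)
Lemma rder_of_chord_arc (X Z : R -> R) (s del Q n m nB : R) :
  0 < n -> n ^+ 2 = nB -> 1 <= m ->
  (forall t : R, s < t -> t < s + del -> 0 < X t - X s /\
   let y := Q * (X t - X s) - (Z t - Z s) in
   [/\ 0 <= y, n * (t - s) <= (X t - X s) * m + y & (X t - X s) * m - y <= n * (t - s)]) ->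
  (forall e : R, 0 < e -> exists2 del' : R, 0 < del' <= del & forall t : R, s < t -> t < s + del' ->
    Q * (X t - X s) - (Z t - Z s) <= e * (X t - X s)) ->
  forall (g : R -> R) (c1 c2 : R),
   (forall t : R, g t - g s = ((Z t - Z s) * c1 + (X t - X s) * c2) / nB) ->
   rder g s ((Q * c1 + c2) / (n * m)).
Proof.
move=> n0 nn m1 arc slim g c1 c2 hg e e0.
have m0 : 0 < m by lra.
have nB0 : 0 < nB by rewrite -nn exprn_gt0.
pose K : R := `|Q * c1 + c2| / (nB * m) + `|c1| / nB.
have K0 : 0 <= K.
  by apply: addr_ge0; apply: divr_ge0 => //; apply/ltW => //; exact: mulr_gt0.
pose e' := Num.min 2^-1 (e / (2 * n * (K + 1))).
have K1 : 0 < K + 1 by lra.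
have e'0 : 0 < e' by rewrite lt_min invr_gt0 ltr0n divr_gt0 // !mulr_gt0.
have e'2 : e' <= 2^-1 by rewrite ge_min lexx.
have e'3 : e' * (2 * n * (K + 1)) <= e.
  by rewrite -ler_pdivlMr ?mulr_gt0 // ge_min lexx orbT.
have [d' /andP[d'0 d'd] hd'] := slim e' e'0.
exists d' => // h h0 hd.
have st : s < s + h by flra h0. have sh' : s + h < s + d' by flra hd.
have shd : s + h < s + del by flra d'd sh'.
have [x0 [y0 k1 k2]] := arc (s + h) st shd.
have yx := hd' (s + h) st sh'.
have := hg (s + h).
set x := X (s + h) - X s in x0 y0 k1 k2 yx *.
set y : R := Q * x - (Z (s + h) - Z s) in y0 k1 k2 yx *.
have -> : Z (s + h) - Z s = Q * x - y by rewrite /y; ring.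
have hE : s + h - s = h by ring.
rewrite hE in k1 k2.
move=> ->; clearbody y x; clear -x0 y0 k1 k2 yx n0 nn m0 m1 nB0 K0 K1 e'0 e'2 e'3 h0 e0.
have xm : x <= x * m by rewrite ler_peMr // ltW.
have yx2 : e' * x <= 2^-1 * x by rewrite ler_pM2r.
have xh : x <= 2 * (n * h) by lra.
have yh : y <= 2 * e' * n * h.
  apply: le_trans yx _; have : e' * x <= e' * (2 * (n * h)) by rewrite ler_pM2l.
  flra xh.
have -> : ((Q * x - y) * c1 + x * c2) / nB - (Q * c1 + c2) / (n * m) * h =
   (Q * c1 + c2) / (nB * m) * (x * m - n * h) - y * c1 / nB.
  rewrite -nn.
  field.
  by rewrite !gt_eqF.
apply: le_trans (ler_normB _ _) _.
have t1 : `|(Q * c1 + c2) / (nB * m) * (x * m - n * h)| <= `|Q * c1 + c2| / (nB * m) * y.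
  rewrite normrM normrM normfV [`|nB * m|]gtr0_norm ?mulr_gt0 //.
  apply: ler_wpM2l; first by apply: divr_ge0 => //; apply/ltW/mulr_gt0.
  by rewrite ler_norml; flra k1 k2.
have t2 : `|y * c1 / nB| <= `|c1| / nB * y.
  by rewrite !normrM normfV (gtr0_norm nB0) (ger0_norm y0) -mulrA mulrC.
apply: le_trans (lerD t1 t2) _; rewrite -mulrDl -/K.
have : K * y <= (K + 1) * y by rewrite ler_wpM2r //; flra t2.
have : (K + 1) * y <= (K + 1) * (2 * e' * n * h) by rewrite ler_pM2l.
have : e' * (2 * n * (K + 1)) * h <= e * h by rewrite ler_pM2r.
flra t2.
Qed.

Lemma frame_coords1 (B1 B2 x y x' y' nB : R) : nB = B1 ^+ 2 + B2 ^+ 2 -> 0 < nB ->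
  x - x' = ((B1 * x + B2 * y - (B1 * x' + B2 * y')) * B1 +
            (dt B1 B2 x y - dt B1 B2 x' y') * - B2) / nB.
Proof.
move=> nBE nB0; apply: (mulIf (lt0r_neq0 nB0)); rewrite divfK ?lt0r_neq0 //.
by rewrite nBE /dt; ring.
Qed.

Lemma frame_coords2 (B1 B2 x y x' y' nB : R) : nB = B1 ^+ 2 + B2 ^+ 2 -> 0 < nB ->
  y - y' = ((B1 * x + B2 * y - (B1 * x' + B2 * y')) * B2 +
            (dt B1 B2 x y - dt B1 B2 x' y') * B1) / nB.
Proof.
move=> nBE nB0; apply: (mulIf (lt0r_neq0 nB0)); rewrite divfK ?lt0r_neq0 //.
by rewrite nBE /dt; ring.
Qed.

End Frame.

Section Tangent.
Context {R : realType}.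
Variables (D : R -> R -> Prop) (l : R) (a b : R -> R).
Hypothesis H : around D l a b.

Lemma norm_prod_le (x y A B : R) : `|x| <= A -> `|y| <= B -> `|x * y| <= A * B.
Proof. by move=> xA yB; rewrite normrM ler_pM. Qed.

(** Apply cone_chord to the point whose difference to the current boundary
    point is the tilted position; that point is small, hence in D. *)
Lemma frame_ge0 (s q eta : R) : 0 <= s -> s < q -> q <= l -> turning a b s q -> 0 < eta ->
  (exists2 d0 : R, 0 < d0 /\ eta * (`|a s| + `|b s|) < d0 &
     forall u v : R, `|u| < d0 -> `|v| < d0 -> D u v) ->
  exists2 del : R, 0 < del & forall t t' : R, s <= t -> t < t' -> t' < s + del ->
    t' < q /\
    0 <= dt (a s - eta * b s) (b s + eta * a s) (a t' - a t) (b t' - b t).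
Proof.
move=> s0 sq ql tu eta0 [d0 [d00 hd0] ball].
pose S := `|a s| + `|b s| + 1.
have S0 : 0 < S by rewrite /S; have := normr_ge0 (a s); have := normr_ge0 (b s); lra.
have as0 := normr_ge0 (a s); have bs0 := normr_ge0 (b s).
pose r0 := d0 - eta * (`|a s| + `|b s|).
have r00 : 0 < r0 by rewrite /r0; lra.
have sq2 := curve_sq_gt0 H s.
pose n2 := a s ^+ 2 + b s ^+ 2.
pose c := eta * n2 / (2 * S + 2 * eta * S).
have den : 0 < 2 * S + 2 * eta * S by rewrite addr_gt0 // !mulr_gt0.
have c0 : 0 < c by rewrite /c divr_gt0 // mulr_gt0.
have qs : 0 < q - s by lra.
have [m m0 [m1 m2 m3]] := min3_gt0 r00 c0 qs.
exists (Num.min m 1) => [|t t' st tt' t'm]; first by rewrite lt_min m0 ltr01.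
have mm : Num.min m 1 <= m by rewrite ge_min lexx.
have mo : Num.min m 1 <= 1 by rewrite ge_min lexx orbT.
split; first by flra m3 t'm mm.
set P1 := a t - a s + eta * b s; set P2 := b t - b s - eta * a s.
have lipa u : s <= u -> u < s + Num.min m 1 -> `|a u - a s| <= u - s.
  by move=> su um; apply: le_trans (lip_a H _ _) _; rewrite ger0_norm ?subr_ge0.
have lipb u : s <= u -> u < s + Num.min m 1 -> `|b u - b s| <= u - s.
  by move=> su um; apply: le_trans (lip_b H _ _) _; rewrite ger0_norm ?subr_ge0.
have ht : t < s + Num.min m 1 by flra tt' t'm.
have st' : s <= t' by flra st tt'.
have DP : D P1 P2.
  have e1 : `|eta * b s| = eta * `|b s| by rewrite normrM gtr0_norm.
  have e2 : `|eta * a s| = eta * `|a s| by rewrite normrM gtr0_norm.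
  have p1 : 0 <= eta * `|b s| by rewrite mulr_ge0 // ltW.
  have p2 : 0 <= eta * `|a s| by rewrite mulr_ge0 // ltW.
  have r0E : r0 = d0 - (eta * `|a s| + eta * `|b s|) by rewrite /r0; ring.
  apply: ball.
    apply: le_lt_trans (ler_normD _ _) _; have := lipa t st ht; flra m1 mm ht e1 p2 r0E.
  apply: le_lt_trans (ler_normB _ _) _; have := lipb t st ht; flra m1 mm ht e2 p1 r0E.
have pos u : s <= u -> u < s + Num.min m 1 -> 0 < dt P1 P2 (a u) (b u).
  move=> su um.
  have au : `|a u| <= S.
    have := lipa u su um; have := ler_normD (a u - a s) (a s); rewrite subrK /S; flra bs0 mo um.
  have bu : `|b u| <= S.
    have := lipb u su um; have := ler_normD (b u - b s) (b s); rewrite subrK /S; flra as0 mo um.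
  have aS : `|a s| <= S by rewrite /S; flra bs0.
  have bS : `|b s| <= S by rewrite /S; flra as0.
  have k1 := norm_prod_le (lipa t st ht) bu.
  have k2 := norm_prod_le (lipb t st ht) au.
  have k3 := norm_prod_le bS (lipb u su um).
  have k4 := norm_prod_le aS (lipa u su um).
  have E : dt P1 P2 (a u) (b u) = eta * n2 + ((a t - a s) * b u - (b t - b s) * a u
      + eta * (b s * (b u - b s)) + eta * (a s * (a u - a s))).
    by rewrite /dt /P1 /P2 /n2; ring.
  have tm : (t - s) * S <= m * S by rewrite ler_pM2r //; flra tt' t'm mm.
  have um' : S * (u - s) <= S * m by rewrite ler_pM2l //; flra mm um.
  have k3' : `|eta * (b s * (b u - b s))| <= eta * (S * m).
    by rewrite normrM gtr0_norm // ler_pM2l //; flra k3 um'.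
  have k4' : `|eta * (a s * (a u - a s))| <= eta * (S * m).
    by rewrite normrM gtr0_norm // ler_pM2l //; flra k4 um'.
  have tot : m * (2 * S + 2 * eta * S) <= eta * n2 by rewrite -ler_pdivlMr.
  have strict : (t - s) * S < m * S by rewrite ltr_pM2r //; flra mm ht.
  rewrite E; rewrite !ler_norml in k1 k2 k3' k4'; flra k1 k2 k3' k4' tot strict.
have := cone_chord H (s := t) DP (ar_D H t') (pos t' st' t'm) (ltW (pos t st ht)).
have -> : a t - P1 = a s - eta * b s by rewrite /P1; ring.
have -> : b t - P2 = b s + eta * a s by rewrite /P2; ring.
apply; apply/ltW/tu => //; flra m3 t'm mm.
Qed.

(** In a tilted frame the abscissa X increases along a short arc, by frame_ge0
    with a smaller and a larger tilt, and Z is a concave function of X, by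
    cone_chord. The slopes of the chords from the starting point increase to
    their supremum Q, and the length of a concave graph is squeezed between
    the bounds that rder_of_chord_arc needs: from above by ar_length, from
    below because a chord is not longer than its arc. *)
Lemma tangent_exists (s q : R) : 0 <= s -> s < q -> q <= l -> turning a b s q ->
  exists T1 T2 : R, [/\ T1 ^+ 2 + T2 ^+ 2 = 1, rder a s T1 & rder b s T2].
Proof.
move=> s0 sq ql tu.
have [d0 d00 ball] := ar_ball H.
have n20 := curve_sq_gt0 H s; set n2 := a s ^+ 2 + b s ^+ 2 in n20.
have sum0 : 0 < `|a s| + `|b s| + 1.
  by have := normr_ge0 (a s); have := normr_ge0 (b s); lra.
(* the tilts eta, 2 eta and 3 eta all leave room in the ball around the origin *)
pose eta : R := d0 / (4 * (`|a s| + `|b s| + 1)).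
have eta0 : 0 < eta by rewrite divr_gt0 // mulr_gt0.
have etaE : eta * (4 * (`|a s| + `|b s| + 1)) = d0.
  by rewrite /eta divfK // gt_eqF // mulr_gt0.
have eta3 : 0 < 3 * eta by rewrite mulr_gt0.
have [|d1 d10 h1] := frame_ge0 s0 sq ql tu eta0.
  exists d0 => //; split=> //.
  have : 0 <= eta * (`|a s| + `|b s|) by apply: mulr_ge0; [exact: ltW|exact: addr_ge0].
  move: etaE; lra.
have [|d3 d30 h3] := frame_ge0 s0 sq ql tu eta3.
  exists d0 => //; split=> //.
  have : 0 <= eta * (`|a s| + `|b s|) by apply: mulr_ge0; [exact: ltW|exact: addr_ge0].
  move: etaE; lra.
have [del del0 [dd1 dd3 _]] := min3_gt0 d10 d30 d30.
(* the frame: the position tilted by 2 eta, between the tilts eta and 3 eta of frame_ge0 *)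
pose B1 := a s - 2 * eta * b s; pose B2 := b s + 2 * eta * a s.
pose X t := dt B1 B2 (a t) (b t); pose Z t := B1 * a t + B2 * b t.
have XD t t' : s <= t -> t < t' -> t' < s + del -> 0 < X t' - X t.
  move=> st tt' t'd.
  have [t'q k1] := h1 t t' st tt' (lt_le_trans t'd (lerD (lexx s) dd1)).
  have [_ k3] := h3 t t' st tt' (lt_le_trans t'd (lerD (lexx s) dd3)).
  have E : X t' - X t = 2^-1 * (dt (a s - eta * b s) (b s + eta * a s) (a t' - a t) (b t' - b t)
     + dt (a s - 3 * eta * b s) (b s + 3 * eta * a s) (a t' - a t) (b t' - b t)).
    by rewrite /X /dt /B1 /B2; field.
  rewrite lt_neqAle; apply/andP; split; last by rewrite E; flra k1 k3.
  apply/eqP => X0; rewrite -X0 in E.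
  have K1 : dt (a s - eta * b s) (b s + eta * a s) (a t' - a t) (b t' - b t) = 0 by flra k1 k3 E.
  have K3 : dt (a s - 3 * eta * b s) (b s + 3 * eta * a s) (a t' - a t) (b t' - b t) = 0 by flra E K1.
  have pos : 0 < dt (a t) (b t) (a t') (b t').
    by apply: tu; rewrite ?t'q ?orbT //; flra t'd t'q.
  have E1 : dt (a s) (b s) (a t' - a t) (b t' - b t) = 0 by move: K1 K3; rewrite /dt; lra.
  have E2 : eta * (a s * (a t' - a t) + b s * (b t' - b t)) = 0.
    by move: K1 K3; rewrite /dt; lra.
  move/eqP: E2; rewrite mulf_eq0 gt_eqF //= => /eqP E2.
  have Ea : n2 * (a t' - a t) = 0.
    have -> : n2 * (a t' - a t) = a s * (a s * (a t' - a t) + b s * (b t' - b t))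
      - b s * dt (a s) (b s) (a t' - a t) (b t' - b t) by rewrite /n2 /dt; ring.
    by rewrite E1 E2 !mulr0 subr0.
  have Eb : n2 * (b t' - b t) = 0.
    have -> : n2 * (b t' - b t) = b s * (a s * (a t' - a t) + b s * (b t' - b t))
      + a s * dt (a s) (b s) (a t' - a t) (b t' - b t) by rewrite /n2 /dt; ring.
    by rewrite E1 E2 !mulr0 addr0.
  move/eqP: Ea; rewrite mulf_eq0 gt_eqF //= subr_eq0 => /eqP Ea.
  move/eqP: Eb; rewrite mulf_eq0 gt_eqF //= subr_eq0 => /eqP Eb.
  by move: pos; rewrite Ea Eb /dt mulrC subrr ltxx.
pose nB := B1 ^+ 2 + B2 ^+ 2.
have nBE : nB = n2 * (1 + (2 * eta) ^+ 2) by rewrite /nB /n2 /B1 /B2; ring.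
have nB0 : 0 < nB by rewrite nBE mulr_gt0 // ltr_wpDr ?sqr_ge0.
pose sl t t' := (Z t' - Z t) / (X t' - X t).
have slE t t' : s <= t -> t < t' -> t' < s + del -> Z t' - Z t = sl t t' * (X t' - X t).
  by move=> st tt' t'd; rewrite /sl divfK // gt_eqF // XD.
have sl_mono t t' t'' : s <= t -> t < t' -> t' < t'' -> t'' < s + del -> sl t' t'' <= sl t t'.
  move=> st tt' t't'' t''d.
  have x1 := XD t t' st tt' (lt_trans t't'' t''d).
  have st' : s <= t' by flra st tt'.
  have x2 := XD t' t'' st' t't'' t''d.
  have t''d1 : t'' < s + d1 by flra dd1 t''d.
  have [t''q _] := h1 t' t'' st' t't'' t''d1.
  have p1 : 0 < dt (a t) (b t) (a t'') (b t'').
    by apply: tu; rewrite ?t''q ?orbT //; flra tt' t't'' t''q.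
  have p2 : 0 < dt (a t) (b t) (a t') (b t').
    by apply: tu => //; [flra t't'' t''q|apply/orP; right; flra t't'' t''q].
  have p3 : 0 < dt (a t') (b t') (a t'') (b t'').
    by apply: tu; rewrite ?t''q ?orbT //; flra t''d1 t''q.
  have := cone_chord H (ar_D H t) (ar_D H t'') p1 (ltW p2) (ltW p3).
  move=> K; rewrite /sl ler_pdivlMr // mulrAC ler_pdivrMr //.
  rewrite -subr_ge0; have -> : (Z t' - Z t) * (X t'' - X t') - (Z t'' - Z t') * (X t' - X t) =
     nB * dt (a t' - a t) (b t' - b t) (a t'' - a t') (b t'' - b t').
    by rewrite /Z /X /nB /dt; ring.
  by rewrite mulr_ge0 // ltW.
pose E := [set y | exists2 t, s < t < s + del & y = sl s t].
have ub : ubound E (((a s - 3 * eta * b s) * B1 + (b s + 3 * eta * a s) * B2) / (eta * n2)).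
  move=> _ [t /andP[st td] ->].
  have x0 := XD s t (lexx s) st td.
  have [_ k3] := h3 s t (lexx s) st (lt_le_trans td (lerD (lexx s) dd3)).
  rewrite /sl ler_pdivrMr // mulrAC ler_pdivlMr ?mulr_gt0 // -subr_ge0.
  have -> : ((a s - 3 * eta * b s) * B1 + (b s + 3 * eta * a s) * B2) * (X t - X s) - (Z t - Z s) * (eta * n2)
    = nB * dt (a s - 3 * eta * b s) (b s + 3 * eta * a s) (a t - a s) (b t - b s).
    by rewrite /X /Z /nB /n2 /B1 /B2 /dt; ring.
  by rewrite mulr_ge0 // ltW.
have supE : has_sup E.
  split; last by eexists; exact: ub.
  by exists (sl s (s + del / 2)), (s + del / 2) => //; apply/andP; split; flra d30 del0.
pose Q := sup E.
have slQ t t' : s <= t -> t < t' -> t' < s + del -> sl t t' <= Q.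
  move=> st tt' t'd.
  have [ts|st'] := leP t s.
    have -> : t = s by apply/eqP; rewrite eq_le ts st.
    apply: ub_le_sup; first by case: supE.
    by exists t' => //; apply/andP; split; flra st tt' t'd.
  pose u := (s + t) / 2.
  have su : s < u by rewrite /u; flra t'd st'. have ut : u < t by rewrite /u; flra st' su.
  have su' := ltW su.
  have k1 := sl_mono s u t (lexx s) su ut (lt_trans tt' t'd).
  have k2 := sl_mono u t t' su' ut tt' t'd.
  apply: le_trans k2 (le_trans k1 _).
  apply: ub_le_sup; first by case: supE.
  by exists u => //; apply/andP; split; flra tt' t'd su ut.
have slim (e : R) : 0 < e -> exists2 del' : R, 0 < del' <= del & forall t : R, s < t -> t < s + del' -> Q - e <= sl s t.
  move=> e0; have [_ [t /andP[st td] ->] ht] := sup_adherent e0 supE.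
  exists (t - s) => [|u su ut]; first by apply/andP; split; flra st td.
  apply/ltW/(lt_le_trans ht).
  have ut' : u < t by flra ut.
  have x1 := XD s u (lexx s) su (lt_trans ut' td).
  have x2 := XD u t (ltW su) ut' td.
  have K := sl_mono s u t (lexx s) su ut' td.
  have e1 := slE s u (lexx s) su (lt_trans ut' td).
  have e2 := slE u t (ltW su) ut' td.
  rewrite {1}/sl ler_pdivrMr; last by apply: XD => //; lra.
  have -> : Z t - Z s = (Z u - Z s) + (Z t - Z u) by ring.
  rewrite e1 e2.
  have : sl u t * (X t - X u) <= sl s u * (X t - X u) by rewrite ler_pM2r.
  have -> : sl s u * (X t - X s) = sl s u * (X u - X s) + sl s u * (X t - X u) by ring.
  flra e2.
pose n : R := Num.sqrt nB; pose m : R := Num.sqrt (Q ^+ 2 + 1).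
have n0 : 0 < n by rewrite sqrtr_gt0.
have nn : n ^+ 2 = nB by rewrite sqr_sqrtr // ltW.
have mm : m ^+ 2 = Q ^+ 2 + 1 by rewrite sqr_sqrtr // addr_ge0 ?sqr_ge0.
have m1 : 1 <= m.
  by rewrite -[leLHS]sqrtr1 ler_sqrt ?ler_wpDl ?sqr_ge0 // addr_ge0 ?sqr_ge0.
have m0 : 0 < m by flra m1.
have Qm : `|Q| <= m by rewrite -sqrtr_sqr ler_sqrt ?lerDl // addr_ge0 ?sqr_ge0.
rewrite ler_norml in Qm; case/andP: Qm => Qm1 Qm2.
have arc t : s < t -> t < s + del ->
   X t - X s > 0 /\
   let y := Q * (X t - X s) - (Z t - Z s) in
   [/\ 0 <= y, n * (t - s) <= (X t - X s) * m + y & (X t - X s) * m - y <= n * (t - s)].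
  move=> st td.
  have x0 := XD s t (lexx s) st td; split=> // y.
  have [_ tq] : True /\ t < q.
    by split=> //; have [] := h1 s t (lexx s) st (lt_le_trans td (lerD (lexx s) dd1)).
  have gen u v : s <= u -> u < v -> v < s + del -> 0 <= Q * (X v - X u) - (Z v - Z u).
    move=> su uv vd; rewrite subr_ge0 (slE u v su uv vd) ler_pM2r ?slQ //.
    exact: XD.
  have y0 : 0 <= y by apply: gen.
  have sqE u v : ((a v - a u) ^+ 2 + (b v - b u) ^+ 2) * nB = (X v - X u) ^+ 2 + (Z v - Z u) ^+ 2.
    by rewrite /nB /X /Z /dt; ring.
  split=> //.
    pose mf u := X u * m / n + (Q * X u - Z u) / n.
    have := @ar_length _ _ _ _ _ H s t mf s0 st (ltW (lt_le_trans tq ql)).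
    have K u v : s <= u -> u < v -> v <= t ->
      Num.sqrt ((a v - a u) ^+ 2 + (b v - b u) ^+ 2) <= mf v - mf u.
      move=> su uv vt.
      have vd : v < s + del by flra td vt.
      have xuv := XD u v su uv vd; have yuv := gen u v su uv vd.
      set x := X v - X u in xuv yuv; set w := Q * x - (Z v - Z u) in yuv.
      have -> : mf v - mf u = (x * m + w) / n by rewrite /mf /w /x; field; rewrite gt_eqF.
      rewrite ler_pdivlMr //.
      have r0 : 0 <= x * m + w by rewrite addr_ge0 // mulr_ge0 ?ltW.
      have -> : x * m + w = Num.sqrt ((x * m + w) ^+ 2) by rewrite sqrtr_sqr ger0_norm.
      rewrite /n -sqrtrM ?addr_ge0 ?sqr_ge0 // sqE ler_sqrt ?sqr_ge0 //.
      have -> : Z v - Z u = Q * x - w by rewrite /w; ring.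
      rewrite -/x; rewrite -subr_ge0.
      have -> : (x * m + w) ^+ 2 - (x ^+ 2 + (Q * x - w) ^+ 2) =
        2 * (x * (w * (m + Q))) + x ^+ 2 * (m ^+ 2 - (Q ^+ 2 + 1)) by ring.
      by rewrite mm subrr mulr0 addr0 !mulr_ge0 ?(ltW xuv) //; flra Qm1.
    move=> /(_ K); have -> : mf t - mf s = ((X t - X s) * m + y) / n.
      by rewrite /mf /y; field; rewrite gt_eqF.
    by rewrite ler_pdivlMr // mulrC.
  have lip := ar_lip H t s.
  set x := X t - X s in x0 y y0 *.
  have [neg|pos] := leP (x * m - y) 0.
    by apply: le_trans neg _; rewrite mulr_ge0 ?ltW //; lra.
  have p2 : 0 <= n * (t - s) by rewrite mulr_ge0 ?ltW //; flra Qm2 st.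
  rewrite -ler_sqr ?nnegrE ?(ltW pos) // exprMn nn.
  apply: (@le_trans _ _ (nB * ((a t - a s) ^+ 2 + (b t - b s) ^+ 2))); last first.
    by rewrite ler_pM2l // ?nB0.
  rewrite [leRHS]mulrC sqE -/x.
  have -> : Z t - Z s = Q * x - y by rewrite /y; ring.
  rewrite -subr_ge0.
  have -> : x ^+ 2 + (Q * x - y) ^+ 2 - (x * m - y) ^+ 2 =
    2 * (x * (y * (m - Q))) - x ^+ 2 * (m ^+ 2 - (Q ^+ 2 + 1)) by ring.
  by rewrite mm subrr mulr0 subr0 !mulr_ge0 ?(ltW x0) //; flra Qm2.
have small (e : R) : 0 < e -> exists2 del' : R, 0 < del' <= del & forall t : R, s < t -> t < s + del' ->
    Q * (X t - X s) - (Z t - Z s) <= e * (X t - X s).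
  move=> e0; have [d' /andP[d'0 d'd] hd'] := slim e e0.
  exists d' => [|t st td]; first by rewrite d'0 d'd.
  have td' : t < s + del by flra d'd td.
  have x0 := XD s t (lexx s) st td'.
  rewrite (slE s t (lexx s) st td') -mulrBl ler_pM2r // lerBlDr addrC -lerBlDr.
  exact: hd'.
have comp := rder_of_chord_arc n0 nn m1 arc small.
clear - comp nn mm n0 m0 nB0.
exists ((Q * B1 + - B2) / (n * m)), ((Q * B2 + B1) / (n * m)); split.
- by apply: unit_vector_frame => //; rewrite nn.
- by apply: comp => t; exact: frame_coords1.
- by apply: comp => t; exact: frame_coords2.
Qed.

End Tangent.

(** * Angles, and the support property of the tangent *)

Section Angles.
Context {R : realType}.
Implicit Types x y d : R.

Lemma sin_gt0_itv d : - pi <= d -> d <= pi -> 0 < sin d -> 0 < d.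
Proof.
move=> d1 d2; rewrite !ltNge; apply: contra => d0.
by rewrite -oppr_ge0 -sinN; apply: sin_ge0_pi; apply/andP; split; lra.
Qed.

Lemma sin_ge0_itv d : - pi < d -> d < pi -> 0 <= sin d -> 0 <= d.
Proof.
move=> d1 d2; rewrite !leNgt; apply: contra => d0.
by rewrite -oppr_gt0 -sinN; apply: sin_gt0_pi; apply/andP; split; lra.
Qed.

Lemma cos_lt_itv d e : - pi <= d -> d <= pi -> 0 < e -> e <= pi -> cos e < cos d -> `|d| < e.
Proof.
move=> d1 d2 e0 epi; rewrite -[cos d]cos_norm => h.
rewrite -ltr_cos ?in_itv //=; last by rewrite (ltW e0).
by rewrite normr_ge0 ler_norml d1 d2.
Qed.

Lemma acos_upper (c s : R) : c ^+ 2 + s ^+ 2 = 1 -> 0 <= s ->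
  [/\ cos (acos c) = c, sin (acos c) = s & 0 <= acos c <= pi].
Proof.
move=> E s0.
have c1 : -1 <= c <= 1.
  rewrite -ler_norml -(@ler_pXn2r _ 2) ?nnegrE // expr1n -normrX ger0_norm ?sqr_ge0 //.
  by rewrite -E lerDl sqr_ge0.
split; first by rewrite acosK ?in_itv.
  by rewrite sin_acos // -E addrAC subrr add0r sqrtr_sqr ger0_norm.
by rewrite acos_ge0 // acos_lepi.
Qed.

Lemma acos_upper_gt0 (c s : R) : c ^+ 2 + s ^+ 2 = 1 -> 0 < s ->
  [/\ cos (acos c) = c, sin (acos c) = s & 0 < acos c < pi].
Proof.
move=> E s0; have [h1 h2 /andP[h3 h4]] := acos_upper E (ltW s0); split=> //.
rewrite !lt_neqAle h3 h4 !andbT; apply/andP; split; apply/eqP => K.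
  by move: h2 s0; rewrite -K sin0 => <-; rewrite ltxx.
by move: h2 s0; rewrite K sinpi => <-; rewrite ltxx.
Qed.

Lemma polar_unit (c s : R) : c ^+ 2 + s ^+ 2 = 1 -> exists t : R, cos t = c /\ sin t = s.
Proof.
move=> E; have [s0|/ltW s0] := leP 0 s.
  by have [h1 h2 _] := acos_upper E s0; exists (acos c).
have E' : c ^+ 2 + (- s) ^+ 2 = 1 by rewrite sqrrN.
have [|h1 h2 _] := acos_upper E'; first by rewrite oppr_ge0.
by exists (- acos c); rewrite cosN sinN h1 h2 opprK.
Qed.

Lemma dt_polar n m x y : dt (n * cos x) (n * sin x) (m * cos y) (m * sin y) = n * m * sin (y - x).
Proof. by rewrite /dt sinB; ring. Qed.

Lemma dot_polar n m x y : (n * cos x) * (m * cos y) + (n * sin x) * (m * sin y) = n * m * cos (y - x).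
Proof. by rewrite cosB; ring. Qed.

Lemma cos2pi_sub x : cos (2 * pi - x) = cos x.
Proof.
by rewrite cosB mulr_natl cos2pi sin2pi mul1r mul0r addr0.
Qed.

Lemma sin2pi_sub x : sin (2 * pi - x) = - sin x.
Proof.
by rewrite sinB mulr_natl cos2pi sin2pi mul1r mul0r add0r.
Qed.

Lemma rder_ge0 (f : R -> R) s d : rder f s d ->
  (exists2 del : R, 0 < del & forall h : R, 0 < h -> h < del -> f s <= f (s + h)) -> 0 <= d.
Proof.
move=> hf [u u0 hu]; rewrite leNgt; apply/negP => d0.
have e0 : 0 < - d / 2 by lra.
have [v v0 hv] := hf _ e0; have [m m0 [mu mv _]] := min3_gt0 u0 v0 v0.
have m2 : 0 < m / 2 by lra.
have m2m : m / 2 < m by lra.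
have := hu _ m2 (lt_le_trans m2m mu); have := hv _ m2 (lt_le_trans m2m mv).
rewrite ler_norml => /andP[_].
have : d * (m / 2) < 0 by rewrite nmulr_rlt0.
lra.
Qed.

Lemma rder_near_gt0 (f : R -> R) s d : rder f s d -> 0 < f s ->
  exists2 del : R, 0 < del & forall h : R, 0 < h -> h < del -> 0 < f (s + h).
Proof.
move=> hf f0; have e0 : 0 < f s / 2 by lra.
have [v v0 hv] := rder_rcont hf e0; exists v => // h h0 hd.
by have := hv h h0 hd; rewrite ler_norml; lra.
Qed.

Lemma rder_dt (a b : R -> R) s T1 T2 x y : rder a s T1 -> rder b s T2 ->
  rder (fun t => dt (a t) (b t) x y) s (dt T1 T2 x y).
Proof.
move=> ha hb; apply: (rder_ext (f := fun t => y * a t - x * b t)).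
  by exists 1 => // h _ _; rewrite /dt; ring.
have -> : dt T1 T2 x y = y * T1 - x * T2 by rewrite /dt; ring.
by apply: rderB; apply: rderZ.
Qed.

End Angles.

Section Support.
Context {R : realType}.
Variables (D : R -> R -> Prop) (l : R) (a b : R -> R).
Hypothesis H : around D l a b.

(** For a point strictly to the right or to the left of the ray through the
    base point, cone_chord compares it with the nearby points of the curve,
    and the inequality passes to the right derivative. A point on the line of
    this ray is pushed slightly to the left. *)
Lemma tangent_support (s q T1 T2 : R) : s < q -> turning a b s q ->
  rder a s T1 -> rder b s T2 -> forall u v : R, D u v -> 0 <= dt T1 T2 (u - a s) (v - b s).
Proof.
move=> sq tu ha hb.
have [d0 d00 ball] := ar_ball H.
have sq2 := curve_sq_gt0 H s.
have pos h : 0 < h -> h < q - s -> 0 < dt (a s) (b s) (a (s + h)) (b (s + h)).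
  by move=> h0 hq; apply: tu; lra.
have right u v : D u v -> 0 < dt u v (a s) (b s) -> 0 <= dt T1 T2 (u - a s) (v - b s).
  move=> Duv uvs.
  apply: (rder_ge0 (rder_dt _ _ ha hb)).
  have [||v0 v00 hv0] := @rder_near_gt0 _ (fun t => dt u v (a t) (b t)) s (- dt T1 T2 u v) => //.
    apply: (rder_ext (f := fun t => - dt (a t) (b t) u v)).
      by exists 1 => // h _ _; rewrite /dt; ring.
    exact/rderN/rder_dt.
  have qs : 0 < q - s by lra.
  have [m m0 [m1 m2 _]] := min3_gt0 v00 qs qs; exists m => // h h0 hm.
  have := cone_chord H Duv (ar_D H (s + h)) (hv0 h h0 (lt_le_trans hm m1)) (ltW uvs).
  move=> /(_ (ltW (pos h h0 (lt_le_trans hm m2)))); rewrite /dt; lra.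
have left u v : D u v -> 0 < dt (a s) (b s) u v -> 0 <= dt T1 T2 (u - a s) (v - b s).
  move=> Duv uvs.
  apply: (rder_ge0 (rder_dt _ _ ha hb)).
  have [//|v0 v00 hv0] := rder_near_gt0 (rder_dt u v ha hb).
  have qs : 0 < q - s by lra.
  have [m m0 [m1 m2 _]] := min3_gt0 v00 qs qs; exists m => // h h0 hm.
  have := cone_chord H (s := s + h) (ar_D H s) Duv uvs (ltW (pos h h0 (lt_le_trans hm m2))).
  move=> /(_ (ltW (hv0 h h0 (lt_le_trans hm m1)))); rewrite /dt; lra.
move=> u v Duv.
have [uvs|uvs|E] := ltgtP 0 (dt (a s) (b s) u v); first exact: left.
  by apply: right => //; move: uvs; rewrite /dt; lra.
(* push the point slightly to the left *)
pose S : R := `|a s| + `|b s| + 1.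
have S0 : 0 < S by rewrite /S; have := normr_ge0 (a s); have := normr_ge0 (b s); lra.
pose c : R := d0 / S / 2.
have c0 : 0 < c by rewrite /c !divr_gt0.
have cS : c * S < d0.
  by rewrite /c mulrAC divfK ?gt_eqF //; lra.
have Dp : D (- (c * b s)) (c * a s).
  have na := normr_ge0 (a s). have nb := normr_ge0 (b s).
  have ca : 0 <= c * `|a s| by rewrite mulr_ge0 // ltW.
  have cb : 0 <= c * `|b s| by rewrite mulr_ge0 // ltW.
  have cE : c * S = c * `|a s| + c * `|b s| + c by rewrite /S; ring.
  by apply: ball; rewrite ?normrN normrM (gtr0_norm c0); flra c0 cS ca cb cE.
set L := fun x y => dt T1 T2 (x - a s) (y - b s).
have key e : 0 < e -> e <= 1 -> 0 <= (1 - e) * L u v + e * L (- (c * b s)) (c * a s).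
  move=> e0 e1.
  have e01 : 0 <= e <= 1 by rewrite (ltW e0).
  have := left _ _ (ar_convex H Duv Dp e01).
  have -> : dt (a s) (b s) ((1 - e) * u + e * - (c * b s)) ((1 - e) * v + e * (c * a s)) =
     (1 - e) * dt (a s) (b s) u v + e * (c * (a s ^+ 2 + b s ^+ 2)) by rewrite /dt; ring.
  rewrite -E mulr0 add0r => /(_ (mulr_gt0 e0 (mulr_gt0 c0 sq2))).
  by rewrite /L /dt; lra.
rewrite -/(L u v) leNgt; apply/negP => Lneg.
set y := L (- (c * b s)) (c * a s) in key.
have yp : 0 < y.
  have := key 1 ltr01 (lexx 1); rewrite subrr mul0r add0r mul1r => y0.
  have := key 2^-1; rewrite invr_gt0 ltr0n => /(_ isT); rewrite invf_le1 ?ler1n // => /(_ isT).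
  lra.
pose e : R := - L u v / (2 * (y - L u v)).
have den : 0 < 2 * (y - L u v) by lra.
have e0 : 0 < e by rewrite /e divr_gt0 //; lra.
have eE : e * (2 * (y - L u v)) = - L u v by rewrite /e divfK // lt0r_neq0.
have e1 : e <= 1 by rewrite /e ler_pdivrMr //; lra.
have := key e e0 e1; lra.
Qed.

(** The ball around the origin contains a small vector in the direction of the
    outer normal. *)
Lemma tangent_transversal (s T1 T2 : R) : T1 ^+ 2 + T2 ^+ 2 = 1 ->
  (forall u v : R, D u v -> 0 <= dt T1 T2 (u - a s) (v - b s)) -> 0 < dt (a s) (b s) T1 T2.
Proof.
move=> T_1 sup.
have [d0 d00 ball] := ar_ball H.
have n1 : `|T1| <= 1.
  rewrite -(@ler_pXn2r _ 2) ?nnegrE // expr1n -normrX ger0_norm ?sqr_ge0 //.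
  by rewrite -T_1 lerDl sqr_ge0.
have n2 : `|T2| <= 1.
  rewrite -(@ler_pXn2r _ 2) ?nnegrE // expr1n -normrX ger0_norm ?sqr_ge0 //.
  by rewrite -T_1 lerDr sqr_ge0.
pose c := d0 / 2. have c0 : 0 < c by rewrite /c; lra.
have Dp : D (c * T2) (- (c * T1)).
  apply: ball; rewrite ?normrN normrM gtr0_norm //.
    have : c * `|T2| <= c * 1 by rewrite ler_pM2l.
    by rewrite /c; lra.
  have : c * `|T1| <= c * 1 by rewrite ler_pM2l.
  by rewrite /c; lra.
have := sup _ _ Dp.
have -> : dt T1 T2 (c * T2 - a s) (- (c * T1) - b s) = dt (a s) (b s) T1 T2 - c * (T1 ^+ 2 + T2 ^+ 2).
  by rewrite /dt; ring.
rewrite T_1; lra.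
Qed.

End Support.

(** * The tangent angle as a nondecreasing function *)

Section Lift.
Context {R : realType}.

Definition cnorm (a b : R -> R) (s : R) : R := Num.sqrt (a s ^+ 2 + b s ^+ 2).

(** Angles are lifted separately over two half turns, on each of which the arc
    cosine is a continuous inverse. *)
Record two_turns (a b : R -> R) (l M : R) : Prop := TwoTurns {
  tt_M0 : 0 < M; tt_Ml : M < l;
  tt_1 : turning a b 0 M; tt_2 : turning a b M l;
  tt_opp : exists2 c0 : R, 0 < c0 & a M = - c0 * a 0 /\ b M = - c0 * b 0 }.

(** Two parameters on a common half turn: only there does the determinant
    control the difference of the angles. *)
Definition piece (l M s t : R) := (0 <= s /\ t <= M) \/ (M <= s /\ t <= l).

Definition tangent_at (D : R -> R -> Prop) (a b : R -> R) (l s T1 T2 : R) :=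
 [/\ T1 ^+ 2 + T2 ^+ 2 = 1,
  forall u v : R, D u v -> 0 <= dt T1 T2 (u - a s) (v - b s) & s < l -> rder a s T1 /\ rder b s T2].

Lemma cnorm_gt0 D l a b s : around D l a b -> 0 < cnorm a b s.
Proof. by move=> H; rewrite sqrtr_gt0; exact: curve_sq_gt0 H s. Qed.

Lemma cnorm_sq D l a b s : around D l a b -> cnorm a b s ^+ 2 = a s ^+ 2 + b s ^+ 2.
Proof. by move=> H; rewrite sqr_sqrtr // ltW // (curve_sq_gt0 H s). Qed.

(** On each half turn the angle is obtained from the arc cosine, applied to
    the direction relative to the start of that half turn. *)
Lemma polar_angle (D : R -> R -> Prop) (l : R) (a b : R -> R) (M : R) : around D l a b -> two_turns a b l M ->
  exists om : R -> R,
  [/\ forall s : R, 0 <= s <= l -> a s = cnorm a b s * cos (om s) /\ b s = cnorm a b s * sin (om s),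
      forall s t : R, piece l M s t -> s < t -> om s < om t <= om s + pi,
      om l = om 0 + 2 * pi &
      forall s : R, 0 <= s <= l -> forall e : R, 0 < e -> exists2 del : R, 0 < del &
        forall t : R, 0 <= t <= l -> `|t - s| < del -> `|om t - om s| < e].
Proof.
move=> H [M0 Ml tu1 tu2 opp].
pose n := cnorm a b.
have n_gt0 s : 0 < n s by exact: cnorm_gt0 H.
have n_sq s : n s ^+ 2 = a s ^+ 2 + b s ^+ 2 by exact: cnorm_sq H.
have n00 := n_gt0 0.
have [|w0 [cw0 sw0]] := @polar_unit R (a 0 / n 0) (b 0 / n 0).
  by rewrite !exprMn !exprVn n_sq -mulrDl divff // gt_eqF // (curve_sq_gt0 H).
pose c s : R := (a 0 * a s + b 0 * b s) / (n 0 * n s).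
pose d s : R := dt (a 0) (b 0) (a s) (b s) / (n 0 * n s).
have nn s : 0 < n 0 * n s by rewrite mulr_gt0.
have cd s : c s ^+ 2 + d s ^+ 2 = 1.
  rewrite /c /d !exprMn exprVn -mulrDl.
  have -> : (a 0 * a s + b 0 * b s) ^+ 2 + dt (a 0) (b 0) (a s) (b s) ^+ 2 =
     n 0 ^+ 2 * n s ^+ 2 by rewrite !n_sq /dt; ring.
  by rewrite exprMn divff // -exprMn gt_eqF // exprn_gt0.
have d1 s : 0 <= s <= M -> 0 <= d s.
  move=> /andP[s0 sM]; apply: divr_ge0; last exact: ltW.
  have [-> | s0'] := eqVneq s 0; first by rewrite /dt mulrC subrr.
  have [-> | sM'] := eqVneq s M.
    by have [c0 c00 [-> ->]] := opp; rewrite /dt; have -> : a 0 * (- c0 * b 0) - b 0 * (- c0 * a 0) = 0 by ring.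
  apply/ltW/tu1 => //; first by rewrite lt_neqAle eq_sym s0'.
  by apply/orP; right; rewrite lt_neqAle sM'.
have d2 s : M <= s <= l -> 0 <= - d s.
  move=> /andP[sM sl]; rewrite -mulNr; apply: divr_ge0; last exact: ltW.
  have [c0 c00 [EM1 EM2]] := opp.
  have E : c0 * - dt (a 0) (b 0) (a s) (b s) = dt (a M) (b M) (a s) (b s).
    by rewrite EM1 EM2 /dt; ring.
  rewrite -(pmulr_rge0 _ c00) E.
  have [-> | sM'] := eqVneq s M; first by rewrite /dt mulrC subrr.
  have [-> | sl'] := eqVneq s l.
    have [-> ->] := ar_closed H.
    by rewrite EM1 EM2 /dt; have -> : - c0 * a 0 * b 0 - - c0 * b 0 * a 0 = 0 by ring.
  apply/ltW/tu2 => //; first by rewrite lt_neqAle eq_sym sM'.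
  by apply/orP; right; rewrite lt_neqAle sl'.
pose al s : R := if s <= M then acos (c s) else 2 * pi - acos (c s).
have al1 s : 0 <= s <= M -> [/\ cos (al s) = c s, sin (al s) = d s & 0 <= al s <= pi].
  by move=> sM; rewrite /al; case/andP: (sM) => _ ->; apply: acos_upper (cd s) (d1 s sM).
have al2 s : M <= s <= l -> [/\ cos (al s) = c s, sin (al s) = d s & pi <= al s <= 2 * pi].
  move=> sM.
  have E' : c s ^+ 2 + (- d s) ^+ 2 = 1 by rewrite sqrrN.
  have [h1 h2 /andP[h3 h4]] := acos_upper E' (d2 s sM).
  have [sM'|sM'] := leP s M; last first.
    rewrite /al leNgt sM' /= cos2pi_sub sin2pi_sub h1 h2 opprK; split=> //.
    by apply/andP; split; flra h3 h4.
  have E : s = M by apply/eqP; rewrite eq_le sM'; case/andP: sM.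
  have M0M : 0 <= M <= M by rewrite ltW ?lexx.
  rewrite E; have [k1 k2 /andP[k3 k4]] := al1 M M0M; split=> //.
  have : c M = -1.
    have [c0 c00 [EM1 EM2]] := opp.
    have : c M <= 0.
      rewrite /c pmulr_lle0 ?invr_gt0 // EM1 EM2.
      have -> : a 0 * (- c0 * a 0) + b 0 * (- c0 * b 0) = - (c0 * (a 0 ^+ 2 + b 0 ^+ 2)) by ring.
      by rewrite oppr_le0 ltW // mulr_gt0 // (curve_sq_gt0 H).
    have dM : d M = 0.
      apply/eqP; rewrite eq_le d1 // andbT -oppr_ge0 d2 //.
      by rewrite lexx ltW.
    have := cd M; rewrite dM expr0n addr0 => /eqP; rewrite sqrf_eq1 => /orP[/eqP ->|/eqP -> //].
    by rewrite ler10.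
  by rewrite /al lexx => ->; rewrite acosN1; have := pi_gt0 R; move=> ?; apply/andP; split; flra k3 k4.
have alcs s : 0 <= s <= l -> cos (al s) = c s /\ sin (al s) = d s.
  move=> /andP[s0 sl]; have [sM|/ltW sM] := leP s M.
    by have [|] := al1 s; rewrite ?s0.
  by have [|] := al2 s; rewrite ?sM.
pose om s := w0 + al s.
have omE s : 0 <= s <= l -> a s = n s * cos (om s) /\ b s = n s * sin (om s).
  move=> hs; have [h1 h2] := alcs s hs.
  rewrite /om cosD sinD h1 h2 cw0 sw0 /c /d /dt.
  have ns := n_gt0 s.
  have n0sq := n_sq 0.
  have e1 : n s * (a 0 / n 0 * ((a 0 * a s + b 0 * b s) / (n 0 * n s)) -
       b 0 / n 0 * ((a 0 * b s - b 0 * a s) / (n 0 * n s))) = (a 0 ^+ 2 + b 0 ^+ 2) * a s / n 0 ^+ 2.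
    field.
    by rewrite !gt_eqF.
  have e2 : n s * (b 0 / n 0 * ((a 0 * a s + b 0 * b s) / (n 0 * n s)) +
       a 0 / n 0 * ((a 0 * b s - b 0 * a s) / (n 0 * n s))) = (a 0 ^+ 2 + b 0 ^+ 2) * b s / n 0 ^+ 2.
    field.
    by rewrite !gt_eqF.
  have cancel y : (a 0 ^+ 2 + b 0 ^+ 2) * y / n 0 ^+ 2 = y.
    by rewrite -n0sq [_ * y]mulrC mulfK // gt_eqF // exprn_gt0.
  by rewrite e1 e2 !cancel.
have dif s t : 0 <= s <= l -> 0 <= t <= l -> (s <= M /\ t <= M) \/ (M <= s /\ M <= t) ->
    - pi <= al t - al s <= pi.
  move=> /andP[s0 sl] /andP[t0 tl] [[sM tM]|[sM tM]].
    have [|_ _ /andP[h1 h2]] := al1 s; first by rewrite s0.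
    have [|_ _ /andP[h3 h4]] := al1 t; first by rewrite t0.
    by apply/andP; split; flra h1 h2 h3 h4.
  have [|_ _ /andP[h1 h2]] := al2 s; first by rewrite sM.
  have [|_ _ /andP[h3 h4]] := al2 t; first by rewrite tM.
  by apply/andP; split; flra h1 h2 h3 h4.
have rng s t : piece l M s t -> s <= t -> [/\ 0 <= s <= l, 0 <= t <= l & - pi <= al t - al s <= pi].
  move=> pst st.
  have hs : 0 <= s <= l by case: pst => [] [? ?]; apply/andP; split; lra.
  have ht : 0 <= t <= l by case: pst => [] [? ?]; apply/andP; split; lra.
  by split=> //; apply: dif => //; case: pst => [] [? ?]; [left|right]; split; lra.
have al00 : al 0 = 0.
  by rewrite /al (ltW M0) /c -!expr2 -n_sq divff ?acos1 // gt_eqF // exprn_gt0.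
have all : al l = 2 * pi.
  rewrite /al leNgt Ml /= /c.
  have [E1 E2] := ar_closed H.
  have nl : n l = n 0 by rewrite /n /cnorm E1 E2.
  rewrite E1 E2 nl -!expr2 -n_sq divff ?acos1 ?subr0 //.
  by rewrite gt_eqF // exprn_gt0.
exists om; split=> //.
- move=> s t pst st; have [hs ht /andP[r1 r2]] := rng s t pst (ltW st).
  have [Ea Eb] := omE s hs; have [Ea' Eb'] := omE t ht.
  apply/andP; split; last by rewrite /om; flra r2.
  rewrite /om ltrD2l.
  have [ends|nends] := boolP ((s == 0) && (t == M) || (s == M) && (t == l)).
    have pi0 := pi_gt0 R.
    have alM : al M = pi.
      have [|_ _ /andP[h1 h2]] := al1 M; first by rewrite ltW ?lexx.
      have [|_ _ /andP[h3 h4]] := al2 M; first by rewrite lexx ltW.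
      by apply/eqP; rewrite eq_le h2 h3.
    by case/orP: ends => /andP[/eqP -> /eqP ->]; rewrite ?al00 ?alM ?all; lra.
  rewrite -subr_gt0; apply: sin_gt0_itv => //.
  have dpos : 0 < dt (a s) (b s) (a t) (b t).
    case: pst => [[s0 tM]|[sM tl]].
      apply: tu1 => //; apply/negPn/negP; rewrite negb_or -!leNgt => /andP[h1 h2].
      move: nends; rewrite negb_or => /andP[/negP + _]; apply.
      by rewrite !eq_le s0 h1 tM h2.
    apply: tu2 => //; apply/negPn/negP; rewrite negb_or -!leNgt => /andP[h1 h2].
    move: nends; rewrite negb_or => /andP[_ /negP]; apply.
    by rewrite !eq_le sM h1 tl h2.
  move: dpos; rewrite Ea Eb Ea' Eb' dt_polar pmulr_rgt0 ?mulr_gt0 //.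
  by have -> : om t - om s = al t - al s by rewrite /om; ring.
- by rewrite /om all al00; ring.
- move=> s hs e e0.
  have pi0 := pi_gt0 R.
  pose e' : R := Num.min e pi.
  have e'0 : 0 < e' by rewrite lt_min e0 pi0.
  have e'pi : e' <= pi by rewrite ge_min lexx orbT.
  have e'e : e' <= e by rewrite ge_min lexx.
  have ce1 : cos e' < 1.
    by rewrite -(cos0 R) ltr_cos ?in_itv //= ?lexx ?(ltW pi0) ?(ltW e'0).
  have cn : continuous n.
    move=> t; apply: continuous_comp; last exact: sqrt_continuous.
    by apply: cvgD; apply: cvgM; try exact: cont_a H t; exact: cont_b H t.
  pose f t := a s * a t + b s * b t - cos e' * (n s * n t).
  have cf : continuous f.
    move=> t; apply: cvgB; last first.
      by apply: cvgM; [exact: cvg_cst|apply: cvgM; [exact: cvg_cst|exact: cn]].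
    apply: cvgD; apply: cvgM; try exact: cvg_cst; [exact: cont_a H t|exact: cont_b H t].
  have fs : 0 < f s.
    have -> : f s = n s ^+ 2 * (1 - cos e') by rewrite /f -!expr2 -n_sq; ring.
    by rewrite mulr_gt0 ?exprn_gt0 // subr_gt0.
  have /continuous_epsP/(_ _ fs) [d0 d00 hd0] := cf s.
  have [d4 d40 hd4] : exists2 d4 : R, 0 < d4 & forall t : R, `|t - s| < d4 ->
      (s <= M /\ t <= M) \/ (M <= s /\ M <= t).
    have [sM|sM|->] := ltgtP s M.
    - exists (M - s); first by flra sM.
      by move=> t; rewrite ltr_norml => /andP[_ ?]; left; split; lra.
    - exists (s - M); first by flra sM.
      by move=> t; rewrite ltr_norml => /andP[? _]; right; split; lra.
    - exists 1 => // t _; have [?|/ltW ?] := leP t M; [left|right]; split=> //; lra.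
  have [m m0 [m1 m2 _]] := min3_gt0 d00 d40 d40; exists m => // t ht tm.
  apply: lt_le_trans e'e.
  have -> : om t - om s = al t - al s by rewrite /om; ring.
  have /andP[r1 r2] := dif s t hs ht (hd4 t (lt_le_trans tm m2)).
  apply: cos_lt_itv => //.
  have := hd0 t (lt_le_trans tm m1); rewrite ltr_norml => /andP[k _].
  have : 0 < f t by flra k.
  have [Ea Eb] := omE s hs; have [Ea' Eb'] := omE t ht.
  rewrite /f {1}Ea {1}Eb {1}Ea' {1}Eb' dot_polar.
  have -> : om t - om s = al t - al s by rewrite /om; ring.
  have -> : n s * n t * cos (al t - al s) - cos e' * (n s * n t) = n s * n t * (cos (al t - al s) - cos e') by ring.
  by rewrite pmulr_rgt0 ?mulr_gt0 // subr_gt0.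
Qed.


(** The tangent at the end of the parameter interval is the one at its
    beginning, because the curve closes up. *)
Lemma tangents (D : R -> R -> Prop) (l : R) (a b : R -> R) (M : R) : around D l a b -> two_turns a b l M ->
  exists T1 T2 : R -> R, [/\ forall s : R, 0 <= s <= l -> tangent_at D a b l s (T1 s) (T2 s),
  T1 l = T1 0 & T2 l = T2 0].
Proof.
move=> H [M0 Ml tu1 tu2 opp].
have ex s : exists p : R * R, 0 <= s -> s < l -> tangent_at D a b l s p.1 p.2.
  have [sM|Ms] := ltP s M.
    have [s0|s0] := leP 0 s; last by exists (0, 0).
    have tu : turning a b s M.
      by move=> u v su uv vM oo; apply: tu1 => //; [lra|move: oo => /orP[]; [move=> ?; apply/orP; left; lra|move=> ->; rewrite orbT]].
    have [T1 [T2 [n1 ra rb]]] := tangent_exists H s0 sM (ltW Ml) tu.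
    by exists (T1, T2) => _ _; split=> //; apply: (tangent_support H sM tu ra rb).
  have [sl|sl] := ltP s l; last by exists (0, 0).
  have s0 : 0 <= s by lra.
  have tu : turning a b s l.
    by move=> u v su uv vM oo; apply: tu2 => //; [lra|move: oo => /orP[]; [move=> ?; apply/orP; left; lra|move=> ->; rewrite orbT]].
  have [T1 [T2 [n1 ra rb]]] := tangent_exists H s0 sl (lexx l) tu.
  by exists (T1, T2) => _ _; split=> //; apply: (tangent_support H sl tu ra rb).
have [T hT] := choice ex.
have l0 : 0 < l by lra.
exists (fun s => if s == l then (T 0).1 else (T s).1), (fun s => if s == l then (T 0).2 else (T s).2).
split=> [s /andP[s0 sl]| |]; rewrite ?eqxx ?(lt_eqF l0) //.
have [->|nl] := eqVneq s l.
  have [h1 h2 _] := hT 0 (lexx 0) l0; have [E1 E2] := ar_closed H.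
  by split; rewrite ?ltxx // E1 E2.
by apply: hT; rewrite // lt_neqAle nl.
Qed.

(** The tangent makes an angle in (0, pi) with the position, by
    tangent_transversal; adding this angle to the polar angle gives a lift.
    Comparison with the directions of chords gives the monotonicity and, as
    the chords shrink, the right continuity. *)
Lemma tangent_angle (D : R -> R -> Prop) (l : R) (a b : R -> R) (M : R) : around D l a b -> two_turns a b l M ->
  exists th : R -> R,
  [/\ forall s : R, 0 <= s <= l -> tangent_at D a b l s (cos (th s)) (sin (th s)),
      forall s t : R, 0 <= s -> s <= t -> t <= l -> th s <= th t,
      th l = th 0 + 2 * pi,
      forall s : R, 0 <= s < l -> rcont th s &
      forall s : R, 0 < s <= l -> exists2 del : R, 0 < del &
        forall t : R, 0 <= t -> s - del < t -> t < s -> th s - th t < pi].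
Proof.
move=> H tw.
have [om [omE om_mono oml om_cont]] := polar_angle H tw.
have [T1 [T2 [hT T1l T2l]]] := tangents H tw.
move: tw => [M0 Ml tu1 tu2 opp].
pose n := cnorm a b.
have n_gt0 s : 0 < n s by exact: cnorm_gt0 H.
have n_sq s : n s ^+ 2 = a s ^+ 2 + b s ^+ 2 by exact: cnorm_sq H.
have pi0 := pi_gt0 R.
pose be s : R := acos ((a s * T1 s + b s * T2 s) / n s).
have cs s : 0 <= s <= l -> let c : R := (a s * T1 s + b s * T2 s) / n s in
    let d : R := dt (a s) (b s) (T1 s) (T2 s) / n s in c ^+ 2 + d ^+ 2 = 1 /\ 0 < d.
  move=> hs c d; have [T_1 sup _] := hT s hs.
  have dpos := tangent_transversal H T_1 sup.
  split; last by rewrite divr_gt0.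
  rewrite /c /d !expr_div_n -mulrDl.
  have -> : (a s * T1 s + b s * T2 s) ^+ 2 + dt (a s) (b s) (T1 s) (T2 s) ^+ 2 =
     (a s ^+ 2 + b s ^+ 2) * (T1 s ^+ 2 + T2 s ^+ 2) by rewrite /dt; ring.
  by rewrite T_1 mulr1 -n_sq divff // gt_eqF // exprn_gt0.
pose th s : R := om s + be s.
have thE s : 0 <= s <= l -> [/\ cos (th s) = T1 s, sin (th s) = T2 s & 0 < be s < pi].
  move=> hs; have [h1 h2] := cs s hs; have [c1 c2 c3] := acos_upper_gt0 h1 h2.
  have [Ea Eb] := omE s hs.
  have cE : cos (om s) = a s / n s by rewrite {1}Ea mulrC mulKf // gt_eqF.
  have sE : sin (om s) = b s / n s by rewrite {1}Eb mulrC mulKf // gt_eqF.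
  have nz : n s ^+ 2 != 0 by rewrite gt_eqF // exprn_gt0.
  split=> //; rewrite /th ?cosD ?sinD c1 c2 cE sE /dt.
    have -> : a s / n s * ((a s * T1 s + b s * T2 s) / n s) - b s / n s * ((a s * T2 s - b s * T1 s) / n s) =
      T1 s * (a s ^+ 2 + b s ^+ 2) / n s ^+ 2.
      by rewrite expr2 invfM; ring.
    by rewrite -n_sq mulfK.
  have -> : b s / n s * ((a s * T1 s + b s * T2 s) / n s) + a s / n s * ((a s * T2 s - b s * T1 s) / n s) =
    T2 s * (a s ^+ 2 + b s ^+ 2) / n s ^+ 2.
    by rewrite expr2 invfM; ring.
  by rewrite -n_sq mulfK.
(* the angle of the chord from s to t *)
have chord s t : piece l M s t -> s < t -> om t < om s + pi -> exists chi r : R,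
    [/\ 0 < r, a t - a s = r * cos chi /\ b t - b s = r * sin chi,
        om t < chi < om s + pi & th s <= chi <= th t].
  move=> pst st gap.
  have hs : 0 <= s <= l by case: pst => [] [? ?]; apply/andP; split; lra.
  have ht : 0 <= t <= l by case: pst => [] [? ?]; apply/andP; split; lra.
  have [Ea Eb] := omE s hs; have [Ea' Eb'] := omE t ht.
  have /andP[gp1 _] := om_mono s t pst st.
  have dpos : 0 < dt (a s) (b s) (a t) (b t).
    by rewrite Ea Eb Ea' Eb' dt_polar pmulr_rgt0 ?mulr_gt0 //; apply: sin_gt0_pi; apply/andP; split; flra gap gp1.
  pose x := a t - a s; pose y := b t - b s.
  pose r : R := Num.sqrt (x ^+ 2 + y ^+ 2).
  have r0 : 0 < r.
    rewrite sqrtr_gt0 lt0r addr_ge0 ?sqr_ge0 // andbT paddr_eq0 ?sqr_ge0 // !sqrf_eq0.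
    apply/negP => /andP[/eqP x0 /eqP y0].
    by move: dpos; rewrite (subr0_eq x0) (subr0_eq y0) /dt mulrC subrr ltxx.
  have rr : r ^+ 2 = x ^+ 2 + y ^+ 2 by rewrite sqr_sqrtr // addr_ge0 ?sqr_ge0.
  have [chi0 [c1 c2]] : exists t : R, cos t = x / r /\ sin t = y / r.
    by apply: polar_unit; rewrite !expr_div_n -mulrDl -rr divff // gt_eqF // exprn_gt0.
  have xE : x = r * cos chi0 by rewrite c1 mulrC divfK // gt_eqF.
  have yE : y = r * sin chi0 by rewrite c2 mulrC divfK // gt_eqF.
  have svpos : 0 < sin (chi0 - om s).
    have : 0 < dt (a s) (b s) x y by have -> : dt (a s) (b s) x y = dt (a s) (b s) (a t) (b t) by rewrite /x /y /dt; ring.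
    by rewrite {1}Ea {1}Eb xE yE dt_polar pmulr_rgt0 // mulr_gt0.
  (* normalise the angle to (om s, om s + pi) *)
  have [|k1 k2 /andP[k3 k4]] := acos_upper_gt0 _ svpos (c := cos (chi0 - om s)).
    by rewrite cos2Dsin2.
  pose chi : R := om s + acos (cos (chi0 - om s)).
  have cE : cos chi = cos chi0.
    by rewrite /chi cosD k1 k2 -cosD addrC subrK.
  have sE : sin chi = sin chi0.
    by rewrite /chi sinD k1 k2 -sinD addrC subrK.
  exists chi, r; rewrite cE sE; split=> //.
    have tpos : 0 < sin (chi - om t).
      have : 0 < dt (a t) (b t) x y by have -> : dt (a t) (b t) x y = dt (a s) (b s) (a t) (b t) by rewrite /x /y /dt; ring.
      by rewrite {1}Ea' {1}Eb' xE yE -cE -sE dt_polar pmulr_rgt0 // mulr_gt0.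
    have : 0 < chi - om t by apply: sin_gt0_itv => //; rewrite /chi; flra gap gp1 k3 k4.
    by move=> ?; apply/andP; split; [lra|rewrite /chi; lra].
  have chiom : om t < chi < om s + pi.
    have tpos : 0 < sin (chi - om t).
      have : 0 < dt (a t) (b t) x y by have -> : dt (a t) (b t) x y = dt (a s) (b s) (a t) (b t) by rewrite /x /y /dt; ring.
      by rewrite {1}Ea' {1}Eb' xE yE -cE -sE dt_polar pmulr_rgt0 // mulr_gt0.
    have : 0 < chi - om t by apply: sin_gt0_itv => //; rewrite /chi; flra gap gp1 k3 k4.
    by move=> ?; apply/andP; split; [lra|rewrite /chi; lra].
  case/andP: chiom => chi1 chi2.
  have [ts1 ts2 /andP[bs1 bs2]] := thE s hs; have [tt1 tt2 /andP[bt1 bt2]] := thE t ht.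
  have [_ sups _] := hT s hs; have [_ supt _] := hT t ht.
  apply/andP; split.
    rewrite -subr_ge0; apply: sin_ge0_itv; rewrite ?/th; try lra.
    have := sups _ _ (ar_D H t); rewrite -/x -/y xE yE -cE -sE -ts1 -ts2.
    have -> : dt (cos (th s)) (sin (th s)) (r * cos chi) (r * sin chi) = r * sin (chi - th s).
      by rewrite /dt sinB; ring.
    by rewrite pmulr_rge0.
  rewrite -subr_ge0; apply: sin_ge0_itv; rewrite ?/th; try lra.
  have := supt _ _ (ar_D H s).
  have -> : dt (T1 t) (T2 t) (a s - a t) (b s - b t) = dt x y (T1 t) (T2 t) by rewrite /dt /x /y; ring.
  rewrite xE yE -cE -sE -tt1 -tt2.
  have -> : dt (r * cos chi) (r * sin chi) (cos (th t)) (sin (th t)) = r * sin (th t - chi).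
    by rewrite /dt sinB; ring.
  by rewrite pmulr_rge0.
have mono1 s t : piece l M s t -> s < t -> om t < om s + pi -> th s <= th t.
  by move=> p st g; have [chi [r [_ _ _ /andP[]]]] := chord s t p st g; exact: le_trans.
have mono2 s t : piece l M s t -> s < t -> th s <= th t.
  move=> p st; have [g|g] := ltP (om t) (om s + pi); first exact: mono1.
  pose u := (s + t) / 2; have su : s < u by rewrite /u; lra. have ut : u < t by rewrite /u; lra.
  have pu : piece l M s u by case: p => [] [? ?]; [left|right]; split; lra.
  have pt : piece l M u t by case: p => [] [? ?]; [left|right]; split; lra.
  have /andP[_ g1] := om_mono s t p st.
  have /andP[g2 _] := om_mono s u pu su. have /andP[g3 _] := om_mono u t pt ut.
  by apply: (@le_trans _ _ (th u)); apply: mono1 => //; flra g1 g2 g3.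
have mono s t : 0 <= s -> s <= t -> t <= l -> th s <= th t.
  move=> s0 st tl.
  have [->//|nst] := eqVneq s t.
  have st' : s < t by rewrite lt_neqAle nst.
  have [tM|Mt] := leP t M; first by apply: mono2 => //; left.
  have [Ms|sM] := leP M s; first by apply: mono2 => //; right.
  by apply: (@le_trans _ _ (th M)); apply: mono2 => //; [left|right]; split; flra s0 tl.
have hl : 0 <= l <= l by apply/andP; split; flra M0 Ml.
have h0 : 0 <= (0 : R) <= l by apply/andP; split; flra hl.
exists th; split=> //.
- by move=> s hs; have [-> -> _] := thE s hs; exact: hT.
- have [E1 E2] := ar_closed H.
  have nl : n l = n 0 by rewrite /n /cnorm E1 E2.
  by rewrite /th oml /be T1l T2l nl E1 E2 addrAC.
- move=> s /andP[s0 sl] e e0.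
  have hs : 0 <= s <= l by apply/andP; split; flra s0 sl.
  have [q sq ps] : exists2 q : R, s < q & forall t : R, s < t -> t < q -> piece l M s t.
    have [sM|Ms] := ltP s M.
      by exists M => // t st tM; left; split=> //; flra tM.
    by exists l => // t st tl; right; split=> //; flra tl.
  pose e' : R := Num.min e (pi / 2).
  have e'0 : 0 < e' by rewrite lt_min e0; flra pi0.
  have e'pi : e' <= pi by rewrite ge_min; apply/orP; right; flra pi0.
  have e'e : e' <= e by rewrite ge_min lexx.
  have ce1 : 0 < 1 - cos e'.
    by rewrite subr_gt0 -(cos0 R) ltr_cos ?in_itv //= ?lexx ?(ltW pi0) ?(ltW e'0).
  have [ts1 ts2 /andP[bs1 bs2]] := thE s hs.
  have [T_1 sup /(_ sl) [ra rb]] := hT s hs.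
  pose g t := T1 s * a t + T2 s * b t.
  have rg : rder g s 1.
    rewrite -T_1 !expr2; apply: rderD; exact: rderZ.
  have c40 : 0 < (1 - cos e') / 2 by flra ce1.
  have [v0 v00 hv0] := rg _ c40.
  have gap0 : 0 < Num.min (be s) (pi - be s) by rewrite lt_min bs1 subr_gt0.
  have [w1 w10 hw1] := om_cont s hs _ gap0.
  have qs : 0 < q - s by flra sq.
  have [m m0 [m1 m2 m3]] := min3_gt0 v00 w10 qs.
  (* t is fixed, u tends to s *)
  pose h := m / 2; pose t := s + h.
  have h00 : 0 < h by rewrite /h; flra m0.
  have hm : h < m by rewrite /h; flra m0.
  have st : s < t by rewrite /t; flra h00.
  have gt : (1 - (1 - cos e') / 2) * h <= g t - g s.
    have := hv0 h h00 (lt_le_trans hm m1); rewrite ler_norml /t; flra st.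
  exists (h * ((1 - cos e') / 2)) => [|k k0 km]; first exact: mulr_gt0.
  have kh : k < h.
    apply: (lt_le_trans km); rewrite ger_pMr //.
    have := cos_geN1 e'; flra km.
  pose u := s + k.
  have su : s < u by rewrite ltrDl.
  have ut : u < t by rewrite ltrD2l.
  have pu : piece l M u t.
    have : piece l M s t by apply: ps => //; rewrite /t; flra hm m3.
    by case=> [] [? ?]; [left|right]; split=> //; apply/ltW => //; [exact: le_lt_trans su|exact: le_lt_trans su].
  have psu : piece l M s u by apply: ps => //; rewrite /u; flra kh hm m3.
  have tl : t <= l by case: pu => [] [_ tM]; first exact: le_trans tM (ltW Ml).
  have hu : 0 <= u <= l by rewrite (le_trans s0 (ltW su)) (le_trans (ltW ut) tl).
  have ht : 0 <= t <= l by rewrite (le_trans s0 (ltW st)) tl.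
  have ku : `|u - s| < w1 by rewrite /u addrAC subrr add0r gtr0_norm //; flra kh hm m2.
  have kt : `|t - s| < w1 by rewrite /t addrAC subrr add0r gtr0_norm //; flra hm m2.
  have := hw1 u hu ku; have := hw1 t ht kt.
  rewrite !lt_min !ltr_norml => /andP[_ /andP[ot1 ot2]] /andP[/andP[ou1 ou2] _].
  have /andP[su1 _] := om_mono s u psu su.
  have /andP[ut1 _] := om_mono u t pu ut.
  have [|chi [r [r0 [Ex Ey] /andP[chi1 chi2] /andP[chi3 chi4]]]] := chord u t pu ut; first by flra ot1 ot2 ou1 ou2 bs1 bs2 su1.
  have th_su : th s <= th u by apply: mono; [exact: s0|exact: ltW|case/andP: hu].
  rewrite ger0_norm ?subr_ge0 //; apply: le_trans e'e.
  suff : `|chi - th s| < e'.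
    by rewrite ltr_norml -/u => /andP[_ K]; flra K chi4 chi3.
  apply: cos_lt_itv => //; [flra th_su chi3 pi0|rewrite /th; flra chi2 ou1 ou2 bs1|].
  have cosE : r * cos (chi - th s) = g t - g u.
    have -> : g t - g u = T1 s * (a t - a u) + T2 s * (b t - b u) by rewrite /g; ring.
    by rewrite Ex Ey -ts1 -ts2 cosB; ring.
  rewrite -(ltr_pM2l r0) cosE.
  have gu : g u - g s <= k.
    have := ar_lip H u s; rewrite -/(a u) => lip.
    have [neg|pos] := leP (g u - g s) 0; first exact: le_trans neg (ltW k0).
    rewrite -ler_sqr ?nnegrE ?(ltW pos) ?(ltW k0) //.
    have -> : k ^+ 2 = (u - s) ^+ 2 by rewrite /u; ring.
    apply: le_trans lip.
    have -> : (a u - a s) ^+ 2 + (b u - b s) ^+ 2 = (T1 s ^+ 2 + T2 s ^+ 2) * ((a u - a s) ^+ 2 + (b u - b s) ^+ 2).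
      by rewrite T_1 mul1r.
    rewrite -subr_ge0.
    have -> : (T1 s ^+ 2 + T2 s ^+ 2) * ((a u - a s) ^+ 2 + (b u - b s) ^+ 2) - (g u - g s) ^+ 2 =
      (T1 s * (b u - b s) - T2 s * (a u - a s)) ^+ 2 by rewrite /g; ring.
    exact: sqr_ge0.
  have rh : r <= h.
    rewrite -ler_sqr ?nnegrE ?(ltW r0) ?(ltW h00) //.
    have -> : r ^+ 2 = (a t - a u) ^+ 2 + (b t - b u) ^+ 2.
      by rewrite Ex Ey !exprMn -mulrDr cos2Dsin2 mulr1.
    apply: le_trans (ar_lip H t u) _.
    by rewrite ler_sqr ?nnegrE /t /u; flra k0 kh.
  have c0 : 0 <= cos e'.
    by apply: cos_ge0_pihalf; apply/andP; split; [flra e'0 e'pi|rewrite ge_min lexx orbT].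
  have rc : r * cos e' <= h * cos e' by rewrite ler_wpM2r.
  flra rc gu gt km.
- move=> s /andP[s0 sl].
  have hs : 0 <= s <= l by apply/andP; split; flra s0 sl.
  have [ts1 ts2 /andP[bs1 bs2]] := thE s hs.
  have gap0 : 0 < pi - be s by flra bs2.
  have [w1 w10 hw1] := om_cont s hs _ gap0.
  exists w1 => // t t0 st ts.
  have ht : 0 <= t <= l by apply/andP; split; flra hs t0 ts.
  have [_ _ /andP[bt1 bt2]] := thE t ht.
  have : `|t - s| < w1 by rewrite ltr_norml; apply/andP; split; flra st ts.
  by move=> /(hw1 t ht); rewrite ltr_norml /th; flra bt1.
Qed.

End Lift.

(** * The reference arc: hyperbolic parameter and normal angle *)

Section Hyperbolic.
Context {R : realType}.
Implicit Types x y : R.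

Lemma cosh_sq x : cosh x ^+ 2 - sinh x ^+ 2 = 1.
Proof.
rewrite /cosh /sinh.
have -> : ((expR x + expR (- x)) / 2) ^+ 2 - ((expR x - expR (- x)) / 2) ^+ 2 =
  expR x * expR (- x) by field.
exact: expRxMexpNx_1.
Qed.

Lemma sinhN x : sinh (- x) = - sinh x.
Proof. by rewrite /sinh opprK -mulNr opprB. Qed.

Lemma coshN x : cosh (- x) = cosh x.
Proof. by rewrite /cosh opprK addrC. Qed.

Lemma sinhB x y : sinh (x - y) = sinh x * cosh y - cosh x * sinh y.
Proof.
rewrite /sinh /cosh opprB !expRD.
by field.
Qed.

Lemma coshB x y : cosh (x - y) = cosh x * cosh y - sinh x * sinh y.
Proof.
rewrite /sinh /cosh opprB !expRD.
by field.
Qed.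

Lemma sinhD x y : sinh (x + y) = sinh x * cosh y + cosh x * sinh y.
Proof. by rewrite -{1}[y]opprK sinhB sinhN coshN mulrN opprK. Qed.

Lemma coshD x y : cosh (x + y) = cosh x * cosh y + sinh x * sinh y.
Proof. by rewrite -{1}[y]opprK coshB sinhN coshN mulrN opprK. Qed.

Lemma sinh0 : sinh (0 : R) = 0.
Proof. by rewrite /sinh oppr0 subrr mul0r. Qed.

Lemma cosh0 : cosh (0 : R) = 1.
Proof. by rewrite /cosh oppr0 expR0 divff. Qed.

Lemma ltr_sinh : {mono (@sinh R) : x y / x < y}.
Proof.
apply: leW_mono; apply: le_mono => x y xy.
rewrite /sinh ltr_pM2r ?invr_gt0 // ltrD ?ltrN2 ?ltr_expR //.
by rewrite ltrN2.
Qed.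

Lemma sinh_gt0 x : (0 < sinh x) = (0 < x).
Proof. by rewrite -{1}sinh0 ltr_sinh. Qed.

Lemma sinh_ge0 x : (0 <= sinh x) = (0 <= x).
Proof. by rewrite -{1}sinh0 !leNgt ltr_sinh. Qed.

Lemma cosh_gt0 x : 0 < cosh x.
Proof. by rewrite /cosh divr_gt0 // addr_gt0 ?expR_gt0. Qed.

Lemma cosh_ge1 x : 1 <= cosh x.
Proof.
have c0 := cosh_gt0 x; have := cosh_sq x; have := sqr_ge0 (sinh x).
by move=> h1 h2; rewrite -(@ler_pXn2r _ 2) ?nnegrE ?(ltW c0) // expr1n; lra.
Qed.

Lemma sinh_lt_cosh x : sinh x < cosh x.
Proof.
rewrite /sinh /cosh ltr_pM2r ?invr_gt0 //.
have := expR_gt0 (- x); lra.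
Qed.

(** From exp (- d) >= 1 - d. *)
Lemma sinh_ub (d : R) : 0 <= d -> d < 1 -> (1 - d) * sinh d <= d.
Proof.
move=> d0 d1.
have e0 := expR_gt0 d; have f0 := expR_gt0 (- d).
have ef := expRxMexpNx_1 d.
have f1 := expR_ge1Dx (- d).
rewrite /sinh mulrA ler_pdivrMr //.
have h1 : (1 - d) * expR d <= 1.
  by rewrite -[leRHS]ef mulrC ler_pM2l //; lra.
have h2 : (1 - d) * (1 - d) <= (1 - d) * expR (- d) by rewrite ler_pM2l; lra.
nra.
Qed.

Lemma is_derive_sinh x : is_derive x 1 (@sinh R) (cosh x).
Proof.
apply: is_derive_eq.
rewrite /cosh /GRing.scale /=; ring.
Qed.

Lemma is_derive_cosh x : is_derive x 1 (@cosh R) (sinh x).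
Proof.
apply: is_derive_eq.
rewrite /sinh /GRing.scale /=; ring.
Qed.

End Hyperbolic.

Section RightCont.
Context {R : realType}.
Implicit Types f g : R -> R.

Lemma rcont_comp (F : R -> R) f s : {for f s, continuous F} -> rcont f s -> rcont (fun t => F (f t)) s.
Proof.
move=> /continuous_epsP cF hf e e0.
have [d d0 hd] := cF e e0.
have d20 : 0 < d / 2 by rewrite divr_gt0.
have [u u0 hu] := hf _ d20; exists u => // h h0 hh.
apply/ltW/hd; apply: le_lt_trans (hu h h0 hh) _.
by rewrite ltr_pdivrMr // mulr2n mulrDr mulr1 ltrDl.
Qed.

Lemma rcont_ext f g s : (exists2 del : R, 0 < del & forall h : R, 0 <= h -> h < del ->
  f (s + h) = g (s + h)) -> rcont f s -> rcont g s.
Proof.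
move=> [u u0 hu] hf e e0; have [v v0 hv] := hf _ e0.
have [m m0 [mu mv _]] := min3_gt0 u0 v0 v0; exists m => // h h0 hm.
have E0 : f s = g s by have := hu 0 (lexx 0) u0; rewrite addr0.
rewrite -E0 -hu; [|exact: ltW|exact: lt_le_trans mu].
by apply: hv => //; exact: lt_le_trans mv.
Qed.

(** At a zero of f the product needs only right continuity of g. *)
Lemma rderM0 f g s d : rder f s d -> f s = 0 -> rcont g s ->
  rder (fun t => f t * g t) s (d * g s).
Proof.
move=> hf f0 hg e e0.
have c0 : 0 < `|g s| + 1 by have := normr_ge0 (g s); lra.
have d0 : 0 < `|d| + 1 by have := normr_ge0 d; lra.
have e10 : 0 < e / (2 * (`|g s| + 1)) by rewrite divr_gt0 // mulr_gt0.
have e20 : 0 < Num.min 1 (e / (2 * (`|d| + 1))).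
  by rewrite lt_min ltr01 divr_gt0 // mulr_gt0.
have [u u0 hu] := hf _ e10; have [v v0 hv] := hg _ e20.
have [m m0 [mu mv _]] := min3_gt0 u0 v0 v0; exists m => // h h0 hm.
have {}hu := hu h h0 (lt_le_trans hm mu); have {}hv := hv h h0 (lt_le_trans hm mv).
have v1 : `|g (s + h) - g s| <= 1 by apply: le_trans hv _; rewrite ge_min lexx.
have v2 : `|g (s + h) - g s| <= e / (2 * (`|d| + 1)).
  by apply: le_trans hv _; rewrite ge_min lexx orbT.
have gb : `|g (s + h)| <= `|g s| + 1.
  by have := ler_normD (g (s + h) - g s) (g s); rewrite subrK; flra v1.
rewrite f0 !(mul0r, subr0) in hu *.
have -> : f (s + h) * g (s + h) - d * g s * h =
  (f (s + h) - d * h) * g (s + h) + d * h * (g (s + h) - g s) by ring.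
apply: le_trans (ler_normD _ _) _; rewrite !normrM (gtr0_norm h0).
have k1 : `|f (s + h) - d * h| * `|g (s + h)| <= e / (2 * (`|g s| + 1)) * h * (`|g s| + 1).
  by apply: ler_pM.
have k2 : `|d| * h * `|g (s + h) - g s| <= (`|d| + 1) * h * (e / (2 * (`|d| + 1))).
  apply: ler_pM => //; first by rewrite mulr_ge0 // ltW.
  by rewrite ler_pM2r //; flra k1.
have e1 : e / (2 * (`|g s| + 1)) * h * (`|g s| + 1) = e * h / 2.
  field.
  exact: lt0r_neq0.
have e2 : (`|d| + 1) * h * (e / (2 * (`|d| + 1))) = e * h / 2.
  field.
  exact: lt0r_neq0.
flra k1 k2 e1 e2.
Qed.

End RightCont.

(** The data of the reference arcs: the semi-axes B (radial) and A
    (tangential) of the hyperbola, the distance ze of its centre, the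
    parameter interval [- r, r], half the angle al of a sector and the
    distance q0 of the sides of the polygon from the origin. The equations say
    that an arc ends at the midpoints of two sides, tangentially to them. *)
Record refpar {R : realType} (k : nat) (r al A B ze q0 : R) : Prop := RefPar {
  rp_k : (3 <= k)%N; rp_al : al = pi / k%:R; rp_r : 0 < r;
  rp_A : 0 < A; rp_B : 0 < B; rp_q : 0 < q0;
  rp_hA : A * sinh r = q0 * sin al;
  rp_hB : B * sinh r * cos al = A * cosh r * sin al;
  rp_z : ze = q0 * cos al + B * cosh r }.

Section Sector.
Context {R : realType}.

(** The quantities Pp and Pm are q exp w and q exp (- w) in terms of the
    normal angle phi. *)
Definition Pp (A B phi : R) : R := cos phi / A + sin phi / B.
Definition Pm (A B phi : R) : R := cos phi / A - sin phi / B.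
(** The rate dw / ds of the hyperbolic parameter at the point of the arc with
    normal angle phi. *)
Definition qq (A B phi : R) : R := Num.sqrt (Pp A B phi * Pm A B phi).
(** The hyperbolic parameter of the point of the arc with normal angle phi. *)
Definition ww (A B phi : R) : R := ln (Pp A B phi / Pm A B phi) / 2.

Variables (k : nat) (r al A B ze q0 : R).
Hypothesis hp : refpar k r al A B ze q0.

Lemma k_gt0 : 0 < k%:R :> R.
Proof. by rewrite ltr0n; case: hp => h *; exact: leq_trans h. Qed.

Lemma al_bounds : [/\ 0 < al, al <= pi / 3 & al < pi / 2].
Proof.
have [k3 alE _ _ _ _ _ _ _] := hp; have k0 := k_gt0; have pi0 := pi_gt0 R.
have a1 : 0 < al by rewrite alE divr_gt0.
have a2 : al <= pi / 3.
  by rewrite alE ler_pM2l // lef_pV2 ?posrE // ler_nat.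
split=> //; lra.
Qed.

Lemma cos_al_gt0 : 0 < cos al.
Proof. by have [h1 h2 h3] := al_bounds; apply: cos_gt0_pihalf; apply/andP; split; lra. Qed.

Lemma sin_al_gt0 : 0 < sin al.
Proof.
have pi0 := pi_gt0 R.
by have [h1 h2 h3] := al_bounds; apply: sin_gt0_pi; apply/andP; split; lra.
Qed.

Lemma trig_sector phi : - al <= phi <= al -> cos al <= cos phi /\ `|sin phi| <= sin al.
Proof.
move=> /andP[p1 p2]; have [h1 h2 h3] := al_bounds; have pi0 := pi_gt0 R.
have na : `|phi| <= al by rewrite ler_norml p1.
split.
  rewrite -[cos phi]cos_norm leNgt ltr_cos ?in_itv /= -?leNgt //.
    by apply/andP; split; lra.
  by apply/andP; split; [exact: normr_ge0|lra].
have hs u v : - (pi / 2) <= u -> u <= v -> v <= pi / 2 -> sin u <= sin v.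
  by move=> u1 uv v1; rewrite leNgt ltr_sin ?in_itv /= -?leNgt //; apply/andP; split; flra na u1 uv v1.
rewrite ler_norml -sinN; apply/andP; split; apply: hs; lra.
Qed.

Lemma Ppm_gt0 phi : - al <= phi <= al -> 0 < Pp A B phi /\ 0 < Pm A B phi.
Proof.
move=> hphi; have [c1 s1] := trig_sector hphi.
have [_ _ r0 A0 B0 q00 hA hB _] := hp.
have c0 := cos_al_gt0; have s0 := sin_al_gt0.
have sh : 0 < sinh r by rewrite sinh_gt0.
have key : A * sin al < B * cos al.
  rewrite -(ltr_pM2r sh).
  have -> : B * cos al * sinh r = A * sin al * cosh r by rewrite mulrAC hB; ring.
  by rewrite ltr_pM2l ?mulr_gt0 // sinh_lt_cosh.
have k2 : A * `|sin phi| < B * cos phi.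
  apply: (@le_lt_trans _ _ (A * sin al)); first by rewrite ler_pM2l.
  by apply: (lt_le_trans key); rewrite ler_pM2l.
have k3 : A * `|sin phi| = `|A * sin phi| by rewrite normrM gtr0_norm.
rewrite k3 ltr_norml in k2; case/andP: k2 => k4 k5.
have AB0 : 0 < A * B by rewrite mulr_gt0.
have E1 : Pp A B phi = (B * cos phi + A * sin phi) / (A * B).
  rewrite /Pp; field; by rewrite !gt_eqF.
have E2 : Pm A B phi = (B * cos phi - A * sin phi) / (A * B).
  rewrite /Pm; field; by rewrite !gt_eqF.
by rewrite E1 E2 !divr_gt0 //; flra k4 k5 AB0 E1.
Qed.

Lemma qq_gt0 phi : - al <= phi <= al -> 0 < qq A B phi.
Proof. by move=> /Ppm_gt0[h1 h2]; rewrite sqrtr_gt0 mulr_gt0. Qed.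

Lemma qq_exp phi : - al <= phi <= al ->
  Pp A B phi = qq A B phi * expR (ww A B phi) /\ Pm A B phi = qq A B phi * expR (- ww A B phi).
Proof.
move=> hphi; have [h1 h2] := Ppm_gt0 hphi; have q1 := qq_gt0 hphi.
have qsq : qq A B phi ^+ 2 = Pp A B phi * Pm A B phi by rewrite sqr_sqrtr // ltW // mulr_gt0.
have e2 : expR (ww A B phi) ^+ 2 = Pp A B phi / Pm A B phi.
  rewrite -expRM_natr /ww mulfVK ?pnatr_eq0 // lnK // posrE divr_gt0 //.
have E1 : Pp A B phi = qq A B phi * expR (ww A B phi).
  apply/eqP; rewrite -(@eqrXn2 _ 2) ?ltW ?mulr_gt0 ?expR_gt0 // exprMn qsq e2.
  by rewrite expr2 mulrACA mulfV ?mulr1 // gt_eqF.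
split=> //; rewrite expRN.
apply: (mulfI (lt0r_neq0 h1)); rewrite -qsq {1}E1 expr2 mulrACA mulfV ?mulr1 //.
by rewrite gt_eqF // expR_gt0.
Qed.

Lemma qq_cosh phi : - al <= phi <= al -> cos phi = A * (qq A B phi * cosh (ww A B phi)) /\
  sin phi = B * (qq A B phi * sinh (ww A B phi)).
Proof.
move=> hphi; have [e1 e2] := qq_exp hphi.
have [_ _ _ A0 B0 _ _ _ _] := hp.
have c : qq A B phi * cosh (ww A B phi) = (Pp A B phi + Pm A B phi) / 2 by rewrite e1 e2 /cosh; ring.
have s : qq A B phi * sinh (ww A B phi) = (Pp A B phi - Pm A B phi) / 2 by rewrite e1 e2 /sinh; ring.
rewrite c s /Pp /Pm; split.
  field.
  by rewrite !gt_eqF.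
field.
by rewrite !gt_eqF.
Qed.

(** This exact difference formula compares turning angle and parameter
    directly, also where psi is not differentiable. *)
Lemma sinh_ww phi phi' : - al <= phi <= al -> - al <= phi' <= al ->
  sin (phi' - phi) = A * B * (qq A B phi * qq A B phi') * sinh (ww A B phi' - ww A B phi).
Proof.
move=> h h'; have [e1 e2] := qq_cosh h; have [e1' e2'] := qq_cosh h'.
rewrite sinB sinhB e1 e2 e1' e2'; ring.
Qed.

Lemma ww_mono phi phi' : - al <= phi -> phi <= phi' -> phi' <= al -> ww A B phi <= ww A B phi'.
Proof.
move=> h1 h2 h3; have [_ _ _ A0 B0 _ _ _ _] := hp.
have hh : - al <= phi <= al by apply/andP; split; lra.
have hh' : - al <= phi' <= al by apply/andP; split; lra.
have [a1 a2 a3] := al_bounds; have pi0 := pi_gt0 R.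
have : 0 <= sin (phi' - phi) by apply: sin_ge0_pi; apply/andP; split; lra.
rewrite sinh_ww // pmulr_rge0; last by rewrite !mulr_gt0 ?qq_gt0.
by rewrite sinh_ge0 subr_ge0.
Qed.

Lemma ww_al : ww A B al = r /\ ww A B (- al) = - r.
Proof.
have [_ _ r0 A0 B0 _ _ hB _] := hp; have [a1 a2 a3] := al_bounds.
have h : - al <= al <= al by apply/andP; split; lra.
have h' : - al <= - al <= al by apply/andP; split; lra.
have [e1 e2] := qq_cosh h; have q1 := qq_gt0 h.
have [e1' e2'] := qq_cosh h'; have q1' := qq_gt0 h'.
rewrite cosN in e1'; rewrite sinN in e2'.
have z1 : sinh (r - ww A B al) = 0.
  apply/eqP; rewrite sinhB -(mulrI_eq0 _ (lregP (lt0r_neq0 (mulr_gt0 (mulr_gt0 A0 B0) q1)))).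
  have -> : A * B * qq A B al * (sinh r * cosh (ww A B al) - cosh r * sinh (ww A B al)) =
    B * sinh r * (A * (qq A B al * cosh (ww A B al))) - A * cosh r * (B * (qq A B al * sinh (ww A B al))) by ring.
  by rewrite -e1 -e2 hB subrr.
have z2 : sinh (- r - ww A B (- al)) = 0.
  apply/eqP; rewrite sinhB sinhN coshN -(mulrI_eq0 _ (lregP (lt0r_neq0 (mulr_gt0 (mulr_gt0 A0 B0) q1')))).
  have -> : A * B * qq A B (- al) * (- sinh r * cosh (ww A B (- al)) - cosh r * sinh (ww A B (- al))) =
    - (B * sinh r * (A * (qq A B (- al) * cosh (ww A B (- al))))) - A * cosh r * (B * (qq A B (- al) * sinh (ww A B (- al)))) by ring.
  by rewrite -e1' -e2' hB mulrN opprK addNr.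
have inj x : sinh x = 0 -> x = 0 :> R.
  move=> E; have [x0|x0|//] := ltgtP x 0.
    by move: x0; rewrite -[x < 0]ltr_sinh sinh0 E ltxx.
  by move: x0; rewrite -[0 < x]ltr_sinh sinh0 E ltxx.
by move: (inj _ z1) (inj _ z2); lra.
Qed.

Lemma ww_range phi : - al <= phi <= al -> - r <= ww A B phi <= r.
Proof.
move=> /andP[h1 h2]; have [<- <-] : ww A B (- al) = - r /\ ww A B al = r by have [-> ->] := ww_al.
have [a1 _ _] := al_bounds.
by apply/andP; split; apply: ww_mono => //; lra.
Qed.

(** The sector that contains a normal angle: sector j is centred at 2 al j,
    and sectors are closed on the left so that they suit right continuous
    angles. *)
Definition sec (psi : R) : int := Num.floor ((psi + al) / (2 * al)).
(** The position of a normal angle in its sector. *)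
Definition ph (psi : R) : R := psi - 2 * al * (sec psi)%:~R.
(** The hyperbolic parameters of consecutive arcs, continued into a single
    continuous function of the normal angle. *)
Definition uu (psi : R) : R := 2 * r * (sec psi)%:~R + ww A B (ph psi).

Lemma ph_range psi : - al <= ph psi < al.
Proof.
have [a1 _ _] := al_bounds; have a2 : 0 < 2 * al by lra.
have /andP[f1 f2] := floor_itv ((psi + al) / (2 * al)).
rewrite ler_pdivlMr // in f1; rewrite ltr_pdivrMr // intrD in f2.
by rewrite /ph /sec; apply/andP; split; lra.
Qed.

Lemma ph_range_le psi : - al <= ph psi <= al.
Proof. by have /andP[-> /ltW ->] := ph_range psi. Qed.

Lemma sec_mono : {homo sec : x y / x <= y}.
Proof.
move=> x y xy; apply: le_floor; have [a1 _ _] := al_bounds.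
by rewrite ler_pM2r ?invr_gt0 ?mulr_gt0 // lerD2r.
Qed.

Lemma sec_unique psi (j : int) : - al <= psi - 2 * al * j%:~R < al -> sec psi = j.
Proof.
have [a1 _ _] := al_bounds; have a2 : 0 < 2 * al by lra.
move=> /andP[h1 h2]; apply/eqP; rewrite floor_eq ler_pdivlMr // ltr_pdivrMr // intrD.
by apply/andP; split; lra.
Qed.

Lemma sec_period psi : sec (psi + 2 * pi) = sec psi + k%:Z.
Proof.
have [_ alE _ _ _ _ _ _ _] := hp; have k0 := k_gt0.
have kal : k%:R * al = pi by rewrite alE mulrC divfK // gt_eqF.
apply: sec_unique; have := ph_range psi; rewrite /ph intrD -pmulrn -kal.
have -> : psi + 2 * (k%:R * al) - 2 * al * ((sec psi)%:~R + k%:R) = psi - 2 * al * (sec psi)%:~R by ring.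
by [].
Qed.

Lemma ph_period psi : ph (psi + 2 * pi) = ph psi.
Proof.
have [_ alE _ _ _ _ _ _ _] := hp; have k0 := k_gt0.
have kal : k%:R * al = pi by rewrite alE mulrC divfK // gt_eqF.
by rewrite /ph sec_period intrD -pmulrn -kal; ring.
Qed.

Lemma uu_period psi : uu (psi + 2 * pi) = uu psi + 2 * r * k%:R.
Proof. by rewrite /uu ph_period sec_period intrD -pmulrn; ring. Qed.

Lemma uu_mono : {homo uu : x y / x <= y}.
Proof.
move=> x y xy; have sxy := sec_mono xy.
have [_ _ r0 _ _ _ _ _ _] := hp.
have [E|ns] := eqVneq (sec x) (sec y).
  rewrite /uu E lerD2l; have /andP[h1 _] := ph_range x; have /andP[_ h2] := ph_range y.
  by apply: ww_mono => //; [rewrite /ph E lerD2r|exact: ltW].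
have lt : (sec x)%:~R + 1 <= (sec y)%:~R :> R.
  by rewrite -(intrD _ _ 1) ler_int -ltzD1 ltrD2r lt_neqAle ns.
have /andP[_ h1] := ww_range (ph_range_le x); have /andP[h2 _] := ww_range (ph_range_le y).
rewrite /uu; have : 2 * r * ((sec x)%:~R + 1) <= 2 * r * (sec y)%:~R by rewrite ler_pM2l ?mulr_gt0.
lra.
Qed.

(** A right continuous nondecreasing angle stays in its sector for a while. *)
Lemma sec_right (f : R -> R) s : rcont f s -> (exists2 del : R, 0 < del &
    forall h : R, 0 < h -> h < del -> f s <= f (s + h)) ->
  exists2 del : R, 0 < del & forall h : R, 0 <= h -> h < del -> sec (f (s + h)) = sec (f s).
Proof.
move=> rc [d1 d10 hd1]; have /andP[h1 h2] := ph_range (f s).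
have g0 : 0 < (al - ph (f s)) / 2 by lra.
have [u u0 hu] := rc _ g0.
have [m m0 [m1 m2 _]] := min3_gt0 u0 d10 d10; exists m => // h.
rewrite le_eqVlt => /orP[/eqP <-|h0] hm; first by rewrite addr0.
apply: sec_unique; have := hu h h0 (lt_le_trans hm m1); have := hd1 h h0 (lt_le_trans hm m2).
rewrite ler_norml /ph in h1 h2 *.
move: h2; rewrite /ph => h2' k1 /andP[_ k2]; apply/andP; split; lra.
Qed.

End Sector.

(** * Convex sets of the plane and arc-length parametrizations *)

Section Plane.
Context {R : realType}.

Lemma convex_setP (C : set (plane R)) :
  @convex_set R (plane R) C <-> convexP (fun u v => C (u, v)).
Proof.
split=> H.
  move=> u v u' v' t Cp Cq /andP[t0 t1].
  have s0 : 0 <= 1 - t by lra.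
  have s1 : 1 - t <= 1 by lra.
  have := H (u, v) (u', v') (Itv01 s0 s1); rewrite !inE => /(_ Cp Cq).
  rewrite /conv /= /GRing.scale /= /GRing.add /=.
  have -> : unstable.onem (1 - t) = t by rewrite /unstable.onem; lra.
  by [].
move=> [u v] [u' v'] t; rewrite !inE => Cp Cq.
have t01 : 0 <= 1 - t%:num <= 1.
  have h0 : 0 <= t%:num by []. have h1 : t%:num <= 1 by [].
  by apply/andP; split; lra.
have := H u v u' v' _ Cp Cq t01; rewrite subKr.
by [].
Qed.

Lemma interior_boxP (C : set (plane R)) (u v : R) : interior C (u, v) <->
  exists2 d : R, 0 < d & forall u' v' : R, `|u' - u| < d -> `|v' - v| < d -> C (u', v').
Proof.
split=> [/nbhs_ballP[d /= d0 hd]|[d d0 hd]].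
  exists d => // u' v' hu hv; apply: hd.
  by split; rewrite /ball /= distrC.
apply/nbhs_ballP; exists d => //= -[u' v'] [/= h1 h2].
by apply: hd; rewrite distrC.
Qed.

Lemma sqrt_triangle (x y x' y' : R) : Num.sqrt ((x + x') ^+ 2 + (y + y') ^+ 2) <=
  Num.sqrt (x ^+ 2 + y ^+ 2) + Num.sqrt (x' ^+ 2 + y' ^+ 2).
Proof.
set p := Num.sqrt (x ^+ 2 + y ^+ 2); set q := Num.sqrt (x' ^+ 2 + y' ^+ 2).
have p0 : 0 <= p := sqrtr_ge0 _; have q0 : 0 <= q := sqrtr_ge0 _.
have pE : p ^+ 2 = x ^+ 2 + y ^+ 2 by rewrite sqr_sqrtr // addr_ge0 ?sqr_ge0.
have qE : q ^+ 2 = x' ^+ 2 + y' ^+ 2 by rewrite sqr_sqrtr // addr_ge0 ?sqr_ge0.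
have cs : x * x' + y * y' <= p * q.
  apply: le_trans (ler_norm _) _.
  rewrite -(@ler_pXn2r _ 2) ?nnegrE ?mulr_ge0 // -normrX ger0_norm ?sqr_ge0 // exprMn pE qE.
  rewrite -subr_ge0.
  have -> : (x ^+ 2 + y ^+ 2) * (x' ^+ 2 + y' ^+ 2) - (x * x' + y * y') ^+ 2 = (x * y' - y * x') ^+ 2 by ring.
  exact: sqr_ge0.
rewrite -[leRHS]ger0_norm ?addr_ge0 // -sqrtr_sqr ler_sqrt ?sqr_ge0 //.
have -> : (p + q) ^+ 2 = p ^+ 2 + q ^+ 2 + 2 * (p * q) by ring.
rewrite pE qE; flra cs.
Qed.

Lemma enorm_triangle (p q r : plane R) : enorm (r - p) <= enorm (q - p) + enorm (r - q).
Proof.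
have := sqrt_triangle (q.1 - p.1) (q.2 - p.2) (r.1 - q.1) (r.2 - q.2).
by rewrite [_ + (r.1 - _)]addrC [_ + (r.2 - _)]addrC !subrKA.
Qed.

(** A recursive form of the length of a polygonal line, suited to
    concatenation. *)
Fixpoint chain_length (gamma : R -> plane R) (a : R) (s : seq R) : R :=
  if s is x :: s' then enorm (gamma x - gamma a) + chain_length gamma x s' else 0.

Lemma polygonal_chain gamma a b s : polygonal_length gamma a b s = chain_length gamma a s.
Proof.
elim: s a => [|x s ih] a; first by rewrite /polygonal_length big_geq.
by rewrite /polygonal_length /= big_nat_recl // -ih.
Qed.

Lemma chain_length_cat gamma a s t :
  chain_length gamma a (s ++ t) = chain_length gamma a s + chain_length gamma (last a s) t.
Proof. by elim: s a => [|x s ih] a /=; rewrite ?add0r // ih addrA. Qed.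

Lemma chain_length_le gamma (m : R -> R) (a b : R) s :
  (forall u v : R, a <= u -> u < v -> v <= b -> enorm (gamma v - gamma u) <= m v - m u) ->
  path <%R a s -> last a s <= b -> chain_length gamma a s <= m (last a s) - m a.
Proof.
elim: s a => [|x s ih] a hm /=; first by rewrite subrr.
move=> /andP[ax px] lb.
have xl : x <= last x s.
  by move: px => /(order_path_min (@lt_trans _ _)); elim: (s) => //= y s' ih' /andP[/ltW xy /ih']; case: (s') xy => //= z s''; lra.
have h1 := hm a x (lexx a) ax (le_trans xl lb).
have h2 := ih x (fun u v xu => hm u v (le_trans (ltW ax) xu)) px lb.
by flra h1 h2.
Qed.

Lemma curve_length_ge gamma a b s : itv_partition a b s ->
  ((chain_length gamma a s)%:E <= curve_length gamma a b)%E.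
Proof. by move=> hs; apply: ereal_sup_ubound; exists s => //; rewrite polygonal_chain. Qed.

Lemma curve_length_le gamma a b (x : R) :
  (forall s, itv_partition a b s -> chain_length gamma a s <= x) ->
  (curve_length gamma a b <= x%:E)%E.
Proof.
move=> H; apply: ge_ereal_sup => _ [s hs <-]; rewrite lee_fin polygonal_chain; exact: H.
Qed.

Lemma unit_speed_chord gamma (l : R) :
  (forall t, t \in `[0, l] -> curve_length gamma 0 t = t%:E) ->
  forall s t : R, 0 <= s -> s <= t -> t <= l -> enorm (gamma t - gamma s) <= t - s.
Proof.
move=> H s t s0; rewrite le_eqVlt => /orP[/eqP<- _|st tl].
  by rewrite !subrr /enorm /= expr0n addr0 sqrtr0.
have Hs : curve_length gamma 0 s = s%:E by apply: H; rewrite in_itv /= s0; lra.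
have Ht : curve_length gamma 0 t = t%:E by apply: H; rewrite in_itv /= tl andbT; lra.
rewrite lerBrDl -lerBrDr -lee_fin -Hs; apply: curve_length_le => p hp.
rewrite lerBrDr -lee_fin -Ht.
have h2 : itv_partition s t [:: t] by exact: itv_partition1.
have [_ /eqP lp] := hp.
have := curve_length_ge gamma (itv_partition_cat hp h2).
by rewrite chain_length_cat lp /= addr0.
Qed.

(** A bound for all chords of an arc bounds its length, which is the
    difference of the parameters. *)
Lemma unit_speed_length gamma (l : R) :
  (forall t, t \in `[0, l] -> curve_length gamma 0 t = t%:E) ->
  forall (s t : R) (m : R -> R), 0 <= s -> s < t -> t <= l ->
  (forall u v : R, s <= u -> u < v -> v <= t -> enorm (gamma v - gamma u) <= m v - m u) ->
  t - s <= m t - m s.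
Proof.
move=> H s t m s0 st tl hm.
pose M (u : R) : R := if u <= s then u else s + (m u - m s).
have Ht : curve_length gamma 0 t = t%:E by apply: H; rewrite in_itv /= tl andbT; lra.
suff : (t%:E <= (s + (m t - m s))%:E)%E by rewrite lee_fin; lra.
rewrite -Ht; apply: curve_length_le => p [pp /eqP pl].
have -> : s + (m t - m s) = M (last 0 p) - M 0.
  by rewrite pl /M s0 leNgt st /= subr0.
apply: (chain_length_le (b := t)) => //; last by rewrite pl.
move=> u v u0 uv vt; rewrite /M.
have [us|us] := leP u s; have [vs|vs] := leP v s.
- apply: (unit_speed_chord H) => //; [exact: ltW|lra].
- apply: le_trans (enorm_triangle (gamma u) (gamma s) (gamma v)) _.
  have h1 := unit_speed_chord H u0 us (ltW (lt_le_trans st tl)).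
  have h2 := hm s v (lexx s) vs vt.
  by flra h1 h2.
- lra.
- have h := hm u v (ltW us) uv vt; by flra h.
Qed.

End Plane.

Section Param.
Context {R : realType}.

(** Curves given on [0, l] are extended by constants so as to be defined and
    Lipschitz on the whole line. *)
Definition clamp (l s : R) : R := Num.max 0 (Num.min s l).

Lemma clamp_itv (l s : R) : 0 < l -> 0 <= clamp l s <= l.
Proof. by move=> l0; rewrite /clamp le_max lexx /= ge_max ge_min lexx orbT (ltW l0). Qed.

Lemma clamp_id (l s : R) : 0 <= s -> s <= l -> clamp l s = s.
Proof. by move=> s0 sl; rewrite /clamp (min_idPl sl); apply/max_idPr. Qed.

Lemma clamp_lip (l s t : R) : 0 < l -> `|clamp l s - clamp l t| <= `|s - t|.
Proof.
move=> l0; wlog st : s t / s <= t.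
  by move=> W; have [/W//|/ltW/W] := leP s t; rewrite distrC [leRHS]distrC.
rewrite ler_distlC (ler0_norm (x := s - t)) ?subr_le0 //.
rewrite /clamp; case: (leP s l) => h1; case: (leP t l) => h2;
  case: (leP 0 s) => h3; case: (leP 0 t) => h4; case: (leP 0 l) => h5; apply/andP; split; lra.
Qed.

Lemma enorm_ge0 (p : plane R) : 0 <= enorm p. Proof. exact: sqrtr_ge0. Qed.

Lemma enorm_sq (p : plane R) : enorm p ^+ 2 = p.1 ^+ 2 + p.2 ^+ 2.
Proof. by rewrite sqr_sqrtr // addr_ge0 ?sqr_ge0. Qed.

Lemma boundaryP (C : set (plane R)) (u v : R) : compact C ->
  boundary C (u, v) <-> C (u, v) /\ ~ interior C (u, v).
Proof.
move=> cC; have cl : closed C by apply: compact_closed => //; exact: norm_hausdorff.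
by rewrite /boundary -(closure_id C).1.
Qed.

Lemma compact_box (C : set (plane R)) : compact C ->
  exists2 M : R, 0 < M & forall u v : R, C (u, v) -> `|u| <= M /\ `|v| <= M.
Proof.
move=> /compact_bounded[M [_ hM]]; exists (`|M| + 1); first by have := normr_ge0 M; lra.
have MM : M < `|M| + 1 by have := ler_norm M; lra.
move=> u v /(hM _ MM) /=; rewrite prod_normE ge_max => /andP[h1 h2]; split=> //.
Qed.

Lemma closed_eps (C : set (plane R)) (u v : R) : compact C ->
  (forall e : R, 0 < e -> exists u' v' : R, [/\ C (u', v'), `|u' - u| < e & `|v' - v| < e]) -> C (u, v).
Proof.
move=> cC H; have cl : closed C by apply: compact_closed => //; exact: norm_hausdorff.
apply: cl => B /nbhs_ballP[d /= d0 hd]; have [u' [v' [h1 h2 h3]]] := H d d0.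
by exists (u', v'); split=> //; apply: hd; split; rewrite /ball /= distrC.
Qed.

(** The supremum of the multiples that stay in C is attained because C is
    compact, and it is a boundary point. *)
Lemma ray_hit (C : set (plane R)) (o1 o2 : R) (cC : compact C) (vC : @convex_set R (plane R) C)
  (iC : interior C (o1, o2)) (u v : R) : (u != 0) || (v != 0) ->
  exists2 c : R, 0 < c & boundary C (o1 + c * u, o2 + c * v).
Proof.
move=> uv0; have hC := (convex_setP C).1 vC; have [M M0 hM] := compact_box cC.
have [d d0 hd] := (interior_boxP C o1 o2).1 iC.
have Co : C (o1, o2) by apply: hd; rewrite subrr normr0.
pose E := [set c : R | 0 <= c /\ C (o1 + c * u, o2 + c * v)].
have E0 : E 0 by split=> //; rewrite !mul0r !addr0.
have supE : has_sup E.
  split; first by exists 0.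
  have [un0|un0] := eqVneq u 0.
    have vn0 : 0 < `|v| by rewrite normr_gt0; move: uv0; rewrite un0 eqxx.
    exists ((M + `|o2|) / `|v|) => c [c0 /hM[_ h]].
    rewrite ler_pdivlMr // -(ger0_norm c0) -normrM.
    have := ler_normB (o2 + c * v) o2; rewrite addrC addKr; flra h.
  have un1 : 0 < `|u| by rewrite normr_gt0.
  exists ((M + `|o1|) / `|u|) => c [c0 /hM[h _]].
  rewrite ler_pdivlMr // -(ger0_norm c0) -normrM.
  have := ler_normB (o1 + c * u) o1; rewrite addrC addKr; flra h.
pose S := `|u| + `|v| + 1.
have u0 := normr_ge0 u; have v0 := normr_ge0 v.
have S0 : 0 < S by rewrite /S; flra u0 v0.
have small (x : R) : `|x| <= S -> forall h e : R, 0 < e -> `|h| < e / S -> `|h * x| < e.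
  move=> xS h e e0; rewrite ltr_pdivlMr // => hh; rewrite normrM.
  by apply: le_lt_trans hh; rewrite ler_wpM2l.
have uS : `|u| <= S by rewrite /S; flra v0.
have vS : `|v| <= S by rewrite /S; flra u0.
pose c := sup E.
have dS : 0 < d / S by rewrite divr_gt0.
have c_gt0 : 0 < c.
  have Eh : E (d / S / 2).
    have h0 : 0 <= d / S / 2 by rewrite divr_ge0 // ltW.
    have h1 : `|d / S / 2| < d / S by rewrite ger0_norm //; flra dS.
    by split=> //; apply: hd; rewrite addrC addKr; exact: small h1.
  apply: lt_le_trans (ub_le_sup (proj2 supE) Eh); by rewrite divr_gt0.
exists c => //; apply/boundaryP => //; split.
  apply: closed_eps => // e e0; have eS : 0 < e / S by rewrite divr_gt0.
  have [t [t0 Ct] ht] := sup_adherent eS supE.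
  have tc : t <= c by apply: ub_le_sup => //; case: supE.
  have k : `|t - c| < e / S.
    by rewrite ler0_norm; move: ht; rewrite -/c; [flra tc|flra tc].
  exists (o1 + t * u), (o2 + t * v); split=> //; rewrite opprD addrACA subrr add0r -mulrBl; exact: small k.
move=> /interior_boxP[f f0 hf].
have fS : 0 < f / S by rewrite divr_gt0.
have k : `|f / S / 2| < f / S by rewrite gtr0_norm ?divr_gt0 //; flra fS.
have : E (c + f / S / 2).
  split; first by flra c_gt0 fS.
  have e (o x : R) : o + (c + f / S / 2) * x - (o + c * x) = f / S / 2 * x by ring.
  by apply: hf; rewrite e; exact: small k.
move=> /(ub_le_sup (proj2 supE)); rewrite -/c; flra fS.
Qed.

Lemma around_of_param (C : set (plane R)) (l : R) (gamma : R -> plane R) (o1 o2 : R)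
  (cC : compact C) (vC : @convex_set R (plane R) C) (iC : interior C (o1, o2))
  (gC : arc_length_param C l gamma) : around (fun u v => C (o1 + u, o2 + v)) l
  (fun s => (gamma (clamp l s)).1 - o1) (fun s => (gamma (clamp l s)).2 - o2).
Proof.
have hC := (convex_setP C).1 vC; have [l0 cg [ig gl] gb len] := gC.
have [d d0 hd] := (interior_boxP C o1 o2).1 iC.
have oK (o x : R) : o + (x - o) = x by rewrite addrC subrK.
have bd s : boundary C ((gamma (clamp l s)).1, (gamma (clamp l s)).2).
  rewrite -surjective_pairing -gb; exists (clamp l s) => //=.
  by rewrite in_itv /=; exact: clamp_itv.
split.
- move=> u v u' v' t Cp Cq t01; have := hC _ _ _ _ t Cp Cq t01.
  have e (o x y : R) : (1 - t) * (o + x) + t * (o + y) = o + ((1 - t) * x + t * y) by ring.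
  by rewrite !e.
- by exists d => // u v hu hv; apply: hd; rewrite addrC addKr.
- by [].
- by move=> s; rewrite !oK; have [] := (boundaryP _ _ cC).1 (bd s).
- move=> s c c1 Dc; have [_] := (boundaryP _ _ cC).1 (bd s); apply; apply/interior_boxP.
  set g1 := (gamma _).1 in Dc *; set g2 := (gamma _).2 in Dc *.
  have c0 : 0 < c by flra c1.
  have k0 : 0 < 1 - c^-1 by rewrite subr_gt0 invf_lt1.
  exists (d * (1 - c^-1)); first exact: mulr_gt0.
  move=> u v hu hv.
  have t01 : 0 <= c^-1 <= 1 by rewrite invr_ge0 ltW //= invf_le1 // ltW.
  have e (o x g : R) : x = (1 - c^-1) * (o + (x - g) / (1 - c^-1)) + c^-1 * (o + c * (g - o)).
    field.
    by rewrite (gt_eqF c0) /= subr_eq0 gt_eqF.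
  rewrite [u](e o1 _ g1) [v](e o2 _ g2); apply: hC => //.
  by apply: hd; rewrite addrC addKr normrM normfV (gtr0_norm k0) ltr_pdivrMr.
- move=> s t; have e (o x y : R) : x - o - (y - o) = x - y by ring.
  rewrite !e.
  have main x y : 0 <= x -> x <= y -> y <= l -> ((gamma y).1 - (gamma x).1) ^+ 2 + ((gamma y).2 - (gamma x).2) ^+ 2 <= (y - x) ^+ 2.
    move=> x0 xy yl; rewrite -[leLHS](enorm_sq (gamma y - gamma x)).
    by rewrite ler_sqr ?nnegrE ?enorm_ge0 ?subr_ge0 //; exact: unit_speed_chord len _ _ x0 xy yl.
  have /andP[s0 sl] := clamp_itv s l0; have /andP[t0 tl] := clamp_itv t l0.
  have cl : (clamp l s - clamp l t) ^+ 2 <= (s - t) ^+ 2.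
    have := clamp_lip s t l0; by rewrite -(@ler_pXn2r _ 2) ?nnegrE // -!normrX !ger0_norm ?sqr_ge0.
  apply: le_trans cl; have [st|/ltW st] := leP (clamp l s) (clamp l t).
    have sy (p q : R) : (p - q) ^+ 2 = (q - p) ^+ 2 by ring.
    by rewrite sy [X in _ + X]sy [leRHS]sy; exact: main.
  exact: main.
- move=> s t /andP[s0 sl] /andP[t0 tl]; rewrite !clamp_id ?(ltW sl) ?(ltW tl) //.
  move=> /(addIr _) e1 /(addIr _) e2; apply: ig; [by rewrite in_itv /= s0|by rewrite in_itv /= t0|].
  by rewrite [LHS]surjective_pairing e1 e2 -surjective_pairing.
- by rewrite !clamp_id ?lexx ?ltW // gl.
- move=> u v /(ray_hit cC vC iC)[c c0]; rewrite -gb => -[s /=]; rewrite in_itv /= => /andP[s0 sl] E.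
  have [s' /andP[s'0 s'l] E'] : exists2 s', 0 <= s' < l & gamma s' = gamma s.
    have [sl'|sl'] := ltP s l; first by exists s => //; rewrite s0.
    exists 0; first by rewrite lexx.
    by rewrite -gl; congr gamma; apply/eqP; rewrite eq_le sl sl'.
  exists s', c; rewrite s'0 clamp_id ?(ltW s'l) // E' E /=.
  by split=> //; rewrite addrC addKr.
- move=> s t m s0 st tl hm; apply: (unit_speed_length len s0 st tl) => u v su uv vt.
  have := hm u v su uv vt.
  have e (o x y : R) : x - o - (y - o) = x - y by ring.
  by rewrite !e !clamp_id //; flra s0 su uv vt tl.
Qed.

End Param.

(** * Counterclockwise boundary curves *)

Section Oriented.
Context {R : realType}.

(** The boundary of a convex body, run counterclockwise at unit speed, with
    psi the angle of the outer normal. At a corner psi takes its right limit,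
    and it jumps by less than pi. The field cc_sup is the support property,
    cc_surj the surjectivity onto the boundary. *)
Record ccw (D : R -> R -> Prop) (l : R) (x y psi : R -> R) : Prop := Ccw {
  cc_l : 0 < l;
  cc_D : forall s : R, D (x s) (y s);
  cc_lip : forall s t : R, (x s - x t) ^+ 2 + (y s - y t) ^+ 2 <= (s - t) ^+ 2;
  cc_closed : x l = x 0 /\ y l = y 0;
  cc_der : forall s : R, 0 <= s -> s < l -> rder x s (- sin (psi s)) /\ rder y s (cos (psi s));
  cc_mono : forall s t : R, 0 <= s -> s <= t -> t <= l -> psi s <= psi t;
  cc_turn : psi l = psi 0 + 2 * pi;
  cc_rcont : forall s : R, 0 <= s -> s < l -> rcont psi s;
  cc_jump : forall s : R, 0 < s -> s <= l -> exists2 del : R, 0 < del &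
        forall t : R, 0 <= t -> s - del < t -> t < s -> psi s - psi t < pi;
  cc_sup : forall s u v : R, 0 <= s -> s <= l -> D u v ->
    (u - x s) * cos (psi s) + (v - y s) * sin (psi s) <= 0;
  cc_surj : forall u v : R, D u v ->
    (forall d : R, 0 < d -> exists u' v' : R, [/\ `|u' - u| < d, `|v' - v| < d & ~ D u' v']) ->
    exists s : R, [/\ 0 <= s, s < l, x s = u & y s = v] }.

Lemma around_reflect (D : R -> R -> Prop) (l : R) (a b : R -> R) : around D l a b ->
  around (fun u v => D u (- v)) l a (fun s => - b s).
Proof.
move=> [h1 [d d0 h2] h3 h4 h5 h6 h7 [h8 h8'] h9 h10]; split=> //.
- move=> u v u' v' t Dp Dq t01; have := h1 _ _ _ _ t Dp Dq t01.
  by rewrite !mulrN -opprD.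
- by exists d => // u v hu hv; apply: h2; rewrite ?normrN.
- by move=> s; rewrite opprK.
- by move=> s c c1; rewrite mulrN opprK; exact: h5.
- move=> s t; have -> : - b s - - b t = - (b s - b t) by ring.
  by rewrite sqrrN; exact: h6.
- by move=> s t hs ht e1 /oppr_inj e2; exact: h7.
- by rewrite h8 h8'.
- move=> u v uv0; have [|s [c [hs c0 e1 e2]]] := h9 u (- v); first by rewrite oppr_eq0.
  by exists s, c; split=> //; rewrite e2 mulrN opprK.
- move=> s t m s0 st tl hm; apply: h10 => // u v su uv vt.
  by have := hm u v su uv vt; rewrite -opprD sqrrN.
Qed.

Lemma not_interior_hit (D : R -> R -> Prop) (l : R) (a b : R -> R) (u v : R) :
  around D l a b -> D u v ->
  (forall d : R, 0 < d -> exists u' v' : R, [/\ `|u' - u| < d, `|v' - v| < d & ~ D u' v']) ->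
  exists s : R, [/\ 0 <= s, s < l, a s = u & b s = v].
Proof.
move=> H Duv bd; have [d d0 hd] := ar_ball H.
have uv0 : (u != 0) || (v != 0).
  rewrite -negb_and; apply/negP => /andP[/eqP u0 /eqP v0].
  have [u' [v' [h1 h2]]] := bd d d0; apply; apply: hd.
    by rewrite u0 subr0 in h1.
  by rewrite v0 subr0 in h2.
have [s [c [/andP[s0 sl] c0 e1 e2]]] := ar_surj H uv0.
exists s; suff E : c = 1 by rewrite e1 e2 E !mul1r.
have [c1|c1|//] := ltgtP c 1.
  exfalso; apply: (ar_radial H (s := s) (c := c^-1)); first by rewrite invf_gt1.
  by rewrite e1 e2 !mulKf // gt_eqF.
exfalso; have k0 : 0 < 1 - c^-1 by rewrite subr_gt0 invf_lt1.
have [u' [v' [hu hv]]] := bd _ (mulr_gt0 d0 k0); apply.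
have t01 : 0 <= c^-1 <= 1 by rewrite invr_ge0 ltW //= invf_le1 // ltW.
have e (x g : R) : x = (1 - c^-1) * ((x - g) / (1 - c^-1)) + c^-1 * (c * g).
  field.
  by rewrite (gt_eqF c0) /= subr_eq0 gt_eqF.
rewrite [u'](e _ u) [v'](e _ v); apply: (ar_convex H) => //; last by rewrite -e1 -e2; exact: ar_D H s.
by apply: hd; rewrite normrM normfV (gtr0_norm k0) ltr_pdivrMr.
Qed.

(** The normal angle is the tangent angle minus a quarter turn. *)
Lemma ccw_of_around (D : R -> R -> Prop) (l : R) (a b : R -> R) (M c0 : R) :
  around D l a b -> 0 < M < l -> 0 < c0 -> a M = - c0 * a 0 /\ b M = - c0 * b 0 ->
  (forall t : R, 0 < t < M -> 0 < dt (a 0) (b 0) (a t) (b t)) ->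
  (forall t : R, M < t < l -> 0 < dt (a M) (b M) (a t) (b t)) ->
  exists psi : R -> R, ccw D l a b psi.
Proof.
move=> H /andP[M0 Ml] c00 [EM1 EM2] p1 p2.
have [Ca Cb] := ar_closed H.
have tw : two_turns a b l M.
  split=> //.
  - by apply: (half_turn H (c0 := c0)) => //; lra.
  - apply: (half_turn H (c0 := c0^-1)) => //; try lra; first by rewrite invr_gt0.
    + by rewrite Ca EM1; field; rewrite gt_eqF.
    + by rewrite Cb EM2; field; rewrite gt_eqF.
  - by exists c0.
have [th [tT tmono tturn trc tjump]] := tangent_angle H tw.
have shift (z : R) : cos (z - pi / 2) = sin z /\ sin (z - pi / 2) = - cos z.
  by rewrite cosB sinB cos_pihalf sin_pihalf !mulr0 !mulr1 add0r sub0r.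
exists (fun s => th s - pi / 2); split=> //.
- exact: ar_l H.
- exact: ar_D H.
- exact: ar_lip H.
- move=> s s0 sl; have [-> ->] := shift (th s); rewrite opprK.
  have hs : 0 <= s <= l by rewrite s0 ltW.
  by have [_ _ /(_ sl)] := tT s hs.
- by move=> s t s0 st tl; rewrite lerD2r; exact: tmono.
- by rewrite tturn addrAC.
- move=> s s0 sl e e0; have hs : 0 <= s < l by rewrite s0.
  have [u u0 hu] := trc s hs e e0; exists u => // h h0 hh.
  by have := hu h h0 hh; rewrite addrKA subrKA || (have -> : th (s + h) - pi / 2 - (th s - pi / 2) = th (s + h) - th s by ring).
- move=> s s0 sl; have hs : 0 < s <= l by rewrite s0.
  have [u u0 hu] := tjump s hs; exists u => // t t0 st ts.
  have -> : th s - pi / 2 - (th t - pi / 2) = th s - th t by ring.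
  exact: hu.
- move=> s u v s0 sl Duv; have [-> ->] := shift (th s).
  have hs : 0 <= s <= l by rewrite s0.
  have [_ /(_ u v Duv) + _] := tT s hs; rewrite /dt; lra.
- by move=> u v; exact: not_interior_hit H.
Qed.

Lemma ccw_translate (D : R -> R -> Prop) (l : R) (a b psi : R -> R) (p q : R) :
  ccw (fun u v => D (p + u) (q + v)) l a b psi ->
  ccw D l (fun s => p + a s) (fun s => q + b s) psi.
Proof.
have e (o x y : R) : o + x - (o + y) = x - y by ring.
move=> [h1 h2 h3 [h4 h4'] h5 h6 h7 h8 h9 h10 h11]; split=> //.
- by move=> s t; rewrite !e.
- by rewrite h4 h4'.
- move=> s s0 sl; have [r1 r2] := h5 s s0 sl; rewrite -[- sin _]add0r -[cos _]add0r.
  by split; apply: rderD => //; exact: rder_cst.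
- move=> s u v s0 sl; have e' (o x y : R) : x - (o + y) = x - o - y by ring.
  by rewrite -{1}[u](subrKC p) -{1}[v](subrKC q) !e' => /(h10 _ _ _ s0 sl).
- move=> u v Duv bd; have [||s [s0 sl e1 e2]] := h11 (u - p) (v - q).
  + by rewrite !subrKC.
  + move=> d /bd[u' [v' [k1 k2 k3]]]; exists (u' - p), (v' - q); rewrite !subrKC.
    have e' (o x y : R) : x - o - (y - o) = x - y by ring.
    by rewrite !e'.
  + by exists s; rewrite e1 e2 !subrKC.
Qed.

(** A parametrization may run clockwise; then e = -1 and the body is reflected
    in the first axis, which preserves lengths and curvatures. *)
Lemma ccw_of_param (C : set (plane R)) (l : R) (gamma : R -> plane R) (o1 o2 : R) :
  compact C -> @convex_set R (plane R) C -> interior C (o1, o2) ->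
  arc_length_param C l gamma ->
  exists (e : R) (psi : R -> R), [/\ (e == 1) || (e == -1),
    ccw (fun u v => C (u, e * v)) l (fun s => (gamma (clamp l s)).1)
       (fun s => e * (gamma (clamp l s)).2) psi &
    forall s : R, 0 <= s -> s < l -> tangent gamma s = (- sin (psi s), e * cos (psi s))].
Proof.
move=> cC vC iC gC; pose a : R -> R := fun s => (gamma (clamp l s)).1 - o1.
pose b : R -> R := fun s => (gamma (clamp l s)).2 - o2.
have H : around (fun u v => C (o1 + u, o2 + v)) l a b := around_of_param cC vC iC gC.
have [M [e [c0 [hM he c00 EM [p1 p2]]]]] := orientation H.
have ee : e * e = 1 by case/orP: he => /eqP ->; rewrite ?mulr1 // mulrNN mulr1.
have He : around (fun u v => C (o1 + u, o2 + e * v)) l a (fun s => e * b s).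
  case/orP: he => /eqP ->.
    have -> : (fun s => 1 * b s) = b by apply/funext => s; rewrite mul1r.
    have -> // : (fun u v : R => C (o1 + u, o2 + 1 * v)) = (fun u v : R => C (o1 + u, o2 + v)).
    by apply/funext => u; apply/funext => v; rewrite mul1r.
  have -> : (fun s => -1 * b s) = (fun s => - b s) by apply/funext => s; rewrite mulN1r.
  have -> : (fun u v : R => C (o1 + u, o2 + -1 * v)) = (fun u v : R => C (o1 + u, o2 - v)).
    by apply/funext => u; apply/funext => v; rewrite mulN1r.
  exact: around_reflect H.
have dte (u v u' v' : R) : dt u (e * v) u' (e * v') = e * dt u v u' v' by rewrite /dt; ring.
have [|||psi hpsi] := ccw_of_around He hM c00.
- by case: EM => -> ->; split=> //; ring.
- by move=> t ht; rewrite dte; exact: p1.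
- by move=> t ht; rewrite dte; exact: p2.
exists e, psi.
have hc : ccw (fun u v => C (u, e * v)) l (fun s => (gamma (clamp l s)).1)
       (fun s => e * (gamma (clamp l s)).2) psi.
  have -> : (fun s => (gamma (clamp l s)).1) = (fun s => o1 + a s).
    by apply/funext => s; rewrite /a subrKC.
  have -> : (fun s => e * (gamma (clamp l s)).2) = (fun s => e * o2 + e * b s).
    by apply/funext => s; rewrite /b -mulrDr subrKC.
  apply: ccw_translate.
  have -> // : (fun u v : R => C (o1 + u, e * (e * o2 + v))) = (fun u v : R => C (o1 + u, o2 + e * v)).
  by apply/funext => u; apply/funext => v; rewrite mulrDr mulrA ee mul1r.
split=> // s s0 sl; have [r1 r2] := cc_der hc s0 sl.
have r3 : rder (fun s => (gamma (clamp l s)).2) s (e * cos (psi s)).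
  have := rderZ e r2; apply: rder_ext; exists 1 => // h _ _.
  by rewrite mulrA ee mul1r.
suff cv : (fun h : R => h^-1 *: (gamma (s + h) - gamma s)) @ 0^'+ --> ((- sin (psi s), e * cos (psi s)) : plane R).
  exact: (cvg_lim (@norm_hausdorff _ _) cv).
apply/cvgrPdist_le => f f0; have [u u0 hu] := r1 f f0; have [v v0 hv] := r3 f f0.
have ls0 : 0 < l - s by rewrite subr_gt0.
have [m m0 [m1 m2 m3]] := min3_gt0 u0 v0 ls0.
near=> h.
have h0 : 0 < h by near: h; exact: nbhs_right_gt.
have hm : h < m by near: h; exact: nbhs_right_lt.
have {}hu := hu h h0 (lt_le_trans hm m1); have {}hv := hv h h0 (lt_le_trans hm m2).
have hl := lt_le_trans hm m3.
have c1 : clamp l s = s by apply: clamp_id => //; exact: ltW.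
have c2 : clamp l (s + h) = s + h by apply: clamp_id; flra s0 sl h0 hl.
rewrite c1 c2 in hu hv.
have key (T x y : R) : `|x - y - T * h| <= f * h -> `|T - h^-1 * (x - y)| <= f.
  have -> : T - h^-1 * (x - y) = - ((x - y - T * h) / h) by field; rewrite gt_eqF.
  by rewrite normrN normrM normfV (gtr0_norm h0) ler_pdivrMr.
by rewrite prod_normE /= ge_max /GRing.scale /= !key.
Unshelve. all: by end_near.
Qed.

End Oriented.

(** * Convex bodies between two graphs, and their areas *)

Section Body.
Context {R : realType}.

(** The functions Fb and Ft are antiderivatives of the lower and upper
    boundary functions, so that area is Ft b - Fb b; carrying them avoids
    integrals in the transport argument. *)
Record body (D : R -> R -> Prop) (a b : R) (bot top Fb Ft : R -> R) : Prop := Body {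
  bd_ab : a < b;
  bd_P : forall u v : R, D u v <-> [/\ a <= u, u <= b, bot u <= v & v <= top u];
  bd_cb : continuous bot; bd_ct : continuous top;
  bd_le : forall u : R, a <= u -> u <= b -> bot u <= top u;
  bd_Fb : forall u : R, a <= u -> u <= b -> is_derive u 1 Fb (bot u);
  bd_Ft : forall u : R, a <= u -> u <= b -> is_derive u 1 Ft (top u);
  bd_0 : Fb a = 0 /\ Ft a = 0 }.

(** The product measure is by definition an integral over fibers. *)
Lemma area_fiber (C : set (plane R)) :
  area C = (\int[lebesgue_measure]_x lebesgue_measure [set y : R | C (x, y)])%E.
Proof.
rewrite /area /product_measure1; apply: eq_integral => x _ /=.
by congr (lebesgue_measure _); apply/seteqP; split=> y /=; rewrite /xsection /= inE.
Qed.

(** The fibers are compact. *)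
Lemma fiber_top (C : set (plane R)) : compact C -> exists top : R -> R,
  forall u v : R, C (u, v) -> C (u, top u) /\ v <= top u.
Proof.
move=> cC; have [M M0 hM] := compact_box cC.
exists (fun u => sup [set v | C (u, v)]) => u v Cuv.
have hs : has_sup [set v | C (u, v)].
  split; first by exists v.
  by exists M => w /= /hM[_]; rewrite ler_norml => /andP[].
split; last by apply: ub_le_sup => //; case: hs.
apply: closed_eps => // e e0; have [w /= Cw hw] := sup_adherent e0 hs.
exists u, w; split=> //; first by rewrite subrr normr0.
have : w <= sup [set v | C (u, v)] by apply: ub_le_sup => //; case: hs.
by move=> h; rewrite ler0_norm; [flra hw|flra h].
Qed.

(** A concave function on a segment is lower semicontinuous, end points
    included; compactness of C gives the upper semicontinuity. *)
Lemma upper_boundary_continuous (C : set (plane R)) (a b : R) (f : R -> R) : compact C ->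
  convexP (fun u v => C (u, v)) -> a < b ->
  (forall u : R, a <= u -> u <= b -> C (u, f u)) ->
  (forall u v : R, C (u, v) -> v <= f u) ->
  forall u : R, a <= u -> u <= b -> forall e : R, 0 < e -> exists2 del : R, 0 < del &
    forall u' : R, a <= u' -> u' <= b -> `|u' - u| < del -> `|f u' - f u| < e.
Proof.
move=> cC vC ab Cf fmax u au ub e e0.
have [M M0 hM] := compact_box cC.
(* lower semicontinuity, from the chords to the endpoints of the segment *)
have low w : a <= w -> w <= b -> w != u -> exists2 del : R, 0 < del &
   forall u' : R, 0 <= (u' - u) / (w - u) -> `|u' - u| < del -> f u - e < f u'.
  move=> aw wb wu; have wu0 : 0 < `|w - u| by rewrite normr_gt0 subr_eq0.
  pose S := `|f w - f u| + 1; have S0 : 0 < S by rewrite /S; have := normr_ge0 (f w - f u); lra.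
  exists (`|w - u| * Num.min 1 (e / S)); first by rewrite mulr_gt0 // lt_min ltr01 divr_gt0.
  move=> u' t0 hu'; set t := (u' - u) / (w - u) in t0.
  have tn : t < Num.min 1 (e / S).
    rewrite -[t]ger0_norm // /t normrM normfV ltr_pdivrMr // mulrC.
    exact: hu'.
  have [t1 t2] : t < 1 /\ t < e / S by apply/andP; rewrite -lt_min.
  have t01 : 0 <= t <= 1 by rewrite t0 ltW.
  have := vC _ _ _ _ _ (Cf u au ub) (Cf w aw wb) t01.
  have -> : (1 - t) * u + t * w = u'.
    have : t * (w - u) = u' - u by rewrite /t divfK // subr_eq0.
    by move=> h; flra h.
  move=> /fmax.
  have : `|t * (f w - f u)| < e.
    rewrite normrM (ger0_norm t0); apply: (@le_lt_trans _ _ (t * S)).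
      by rewrite ler_wpM2l // /S lerDl.
    by rewrite -ltr_pdivlMr.
  rewrite ltr_norml => /andP[h1 _] h2.
  have h3 : (1 - t) * f u + t * f w = f u + t * (f w - f u) by ring.
  by flra h1 h2 h3.
(* upper semicontinuity, from compactness *)
have up : exists2 del : R, 0 < del &
   forall u' : R, a <= u' -> u' <= b -> `|u' - u| < del -> f u' < f u + e.
  apply: contrapT => no.
  suff : C (u, f u + e) by move=> /fmax; flra e0.
  pose A := [set p : plane R | C p /\ f u + e <= p.2].
  have cA : compact A.
    apply: (subclosed_compact _ cC); last by move=> p [].
    apply: closedI; first by apply: compact_closed => //; exact: norm_hausdorff.
    apply: (@preimage_closed (R^o * R^o)%type R^o snd [set x : R^o | f u + e <= x]).
    by move=> ? _; exact: cvg_snd.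
  exact: closed_ge.
  have vA : convexP (fun x y => A (x, y)).
    move=> x y x' y' t [/= h1 h2] [/= h3 h4] t01; split; first exact: vC.
    by move: t01 => /= /andP[t0 t1]; nra.
  have near d : 0 < d -> exists u', [/\ a <= u', u' <= b, `|u' - u| < d & f u + e <= f u'].
    move=> d0; apply: contrapT => no'; apply: no; exists d => // u' h1 h2 h3.
    by rewrite ltNge; apply/negP => h4; apply: no'; exists u'.
  have cP : closed (fst @` A).
    apply: compact_closed; first exact: norm_hausdorff.
    by apply: continuous_compact => //; apply: continuous_subspaceT => p; exact: cvg_fst.
  have [[x y] [Cxy /= hy] /= xu] : (fst @` A) u.
    apply: cP => B /nbhs_ballP[d /= d0 hd]; have [u' [h1 h2 h3 h4]] := near d d0.
    exists u'; split; first by exists (u', f u') => //; split=> //=; exact: Cf.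
    by apply: hd; rewrite /ball /= distrC.
  rewrite xu in Cxy; have h1 := fmax _ _ Cxy.
  by exfalso; flra h1 hy e0.
have [d1 d10 h1] := up.
have lowR : exists2 d : R, 0 < d & forall u' : R, u <= u' -> u' <= b -> `|u' - u| < d -> f u - e < f u'.
  have [E|ub'] := eqVneq b u.
    exists 1 => // u' h h' _; have -> : u' = u by apply/eqP; rewrite eq_le h -E h'.
    by flra e0.
  have [d d0 hd] := low b (ltW ab) (lexx b) ub'; exists d => // u' h _; apply: hd.
  by rewrite divr_ge0 ?subr_ge0.
have lowL : exists2 d : R, 0 < d & forall u' : R, u' <= u -> a <= u' -> `|u' - u| < d -> f u - e < f u'.
  have [E|ua'] := eqVneq a u.
    exists 1 => // u' h h' _; have -> : u' = u by apply/eqP; rewrite eq_le h -E h'.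
    by flra e0.
  have [d d0 hd] := low a (lexx a) (ltW ab) ua'; exists d => // u' h _; apply: hd.
  by rewrite -mulrNN -invrN divr_ge0 // oppr_ge0 subr_le0.
have [d2 d20 h2] := lowR; have [d3 d30 h3] := lowL.
have [m m0 [m1 m2 m3]] := min3_gt0 d10 d20 d30; exists m => // u' au' ub' hu.
have k1 := h1 u' au' ub' (lt_le_trans hu m1).
rewrite ltr_norml; apply/andP; split; last by flra k1.
have [uu|/ltW uu] := leP u u'.
  by have := h2 u' uu ub' (lt_le_trans hu m2); flra uu.
by have := h3 u' uu au' (lt_le_trans hu m3); flra uu.
Qed.

Lemma compact_proj (C : set (plane R)) (v0 : plane R) : compact C -> C v0 ->
  exists a b : R, [/\ (exists v : R, C (a, v)), (exists v : R, C (b, v)) &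
    forall u v : R, C (u, v) -> a <= u /\ u <= b].
Proof.
move=> cC C0.
have ext (s : R) : exists2 p : plane R, C p & forall q, C q -> s * q.1 <= s * p.1.
  have cf : {within C, continuous (fun p : plane R => s * p.1)}.
    apply: continuous_subspaceT => p; apply: cvgM; [exact: cvg_cst|exact: cvg_fst].
  have [|p] := compact_EVT_max _ cC cf; first by exists v0.
  by rewrite inE => Cp hp; exists p => // q Cq; apply: hp; rewrite inE.
have [[b w] Cb hb] := ext 1; have [[a v] Ca ha] := ext (-1).
exists a, b; split; [by exists v|by exists w|move=> x y Cxy].
by have := hb _ Cxy; have := ha _ Cxy; rewrite /= !mulN1r lerN2 !mul1r.
Qed.

Definition mirror (C : set (plane R)) : set (plane R) := [set p | C (p.1, - p.2)].

Lemma mirror_compact (C : set (plane R)) : compact C -> compact (mirror C).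
Proof.
move=> cC; have -> : mirror C = (fun p : plane R => (p.1, - p.2) : plane R) @` C.
  apply/seteqP; split=> [[u v] /= h|_ [[u v] /= h <-]]; first by exists (u, - v) => //=; rewrite opprK.
  by rewrite /mirror /= opprK.
apply: continuous_compact => //; apply: continuous_subspaceT => p.
apply/(@cvgrPdist_lt _ (plane R)) => e e0; apply/(@nbhs_ballP R (plane R)); exists e => //= -[u v] [/= h1 h2].
rewrite prod_normE /= gt_max; apply/andP; split=> //.
by rewrite -opprD normrN.
Qed.

Lemma mirror_convex (C : set (plane R)) : convexP (fun u v => C (u, v)) -> convexP (fun u v => mirror C (u, v)).
Proof.
move=> h u v u' v' t Cp Cq t01; have := h _ _ _ _ _ Cp Cq t01.
by rewrite /mirror /= !mulrN -opprD.
Qed.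

Lemma clamp_continuous (a b : R) (f : R -> R) : a < b ->
  (forall u : R, a <= u -> u <= b -> forall e : R, 0 < e -> exists2 del : R, 0 < del &
    forall u' : R, a <= u' -> u' <= b -> `|u' - u| < del -> `|f u' - f u| < e) ->
  continuous (fun u => f (a + clamp (b - a) (u - a))).
Proof.
move=> ab hf u; apply/continuous_epsP => e e0.
have ba : 0 < b - a by rewrite subr_gt0.
have cl x : a <= a + clamp (b - a) (x - a) <= b.
  by have /andP[h1 h2] := clamp_itv (x - a) ba; apply/andP; split; lra.
have /andP[c1 c2] := cl u; have [d d0 hd] := hf _ c1 c2 e e0; exists d => // u' hu.
have /andP[c3 c4] := cl u'; apply: hd => //.
apply: le_lt_trans hu.
have -> : u' - u = (u' - a) - (u - a) by ring.
have -> : a + clamp (b - a) (u' - a) - (a + clamp (b - a) (u - a)) = clamp (b - a) (u' - a) - clamp (b - a) (u - a) by ring.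
exact: clamp_lip.
Qed.

Lemma area_segment0 (C : set (plane R)) (a : R) : (forall u v : R, C (u, v) -> u = a) -> area C = 0%E.
Proof.
move=> h; rewrite area_fiber.
transitivity (\int[lebesgue_measure]_(x in [set a]) lebesgue_measure [set y : R | C (x, y)])%E.
  rewrite [RHS]integral_mkcond; apply: eq_integral => x _; rewrite patchE.
  case: ifPn => //; rewrite notin_setE /= => xa.
  suff -> : [set y | C (x, y)] = set0 by rewrite measure0.
  by rewrite -subset0 => y /= /h.
by rewrite integral_set1 // lebesgue_measure_set1 mule0.
Qed.

(** A compact convex set of positive area projects onto a nondegenerate
    segment, and its fibers are segments between continuous functions. *)
Lemma body_exists (C : set (plane R)) : compact C -> convexP (fun u v => C (u, v)) ->
  (0 < area C)%E -> exists (a b : R) (bot top Fb Ft : R -> R),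
  [/\ body (fun u v => C (u, v)) a b bot top Fb Ft, area C = (Ft b - Fb b)%:E,
     0 < Ft b - Fb b & exists o1 o2 : R, interior C (o1, o2)].
Proof.
move=> cC vC A0.
have [v0 C0] : exists v0, C v0.
  apply: contrapT => no; move: A0; rewrite (@area_segment0 C 0) ?ltxx // => u v Cuv.
  by exfalso; apply: no; exists (u, v).
have [a [b [[va Ca] [vb Cb] ab]]] := compact_proj cC C0.
have a_b : a < b.
  have [h _] := ab _ _ Cb; rewrite lt_neqAle h andbT; apply/eqP => E.
  move: A0; rewrite (@area_segment0 C a) ?ltxx // => u v /ab[h1 h2].
  by apply/eqP; rewrite eq_le h1 andbT [X in _ <= X]E.
have inD u : a <= u -> u <= b -> exists v, C (u, v).
  move=> au ub; pose t := (u - a) / (b - a).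
  have ba : 0 < b - a by rewrite subr_gt0.
  have t01 : 0 <= t <= 1.
    by rewrite /t divr_ge0 ?subr_ge0 ?(ltW a_b) //= ler_pdivrMr // mul1r lerD2r.
  have := vC _ _ _ _ _ Ca Cb t01.
  have -> : (1 - t) * a + t * b = u by rewrite /t; field; rewrite gt_eqF.
  by move=> h; exists ((1 - t) * va + t * vb).
have [tp htp] := fiber_top cC; have [bt' hbt'] := fiber_top (mirror_compact cC).
pose bt u : R := - bt' u.
have hbt u v : C (u, v) -> C (u, bt u) /\ bt u <= v.
  move=> Cuv; have [|h1 h2] := hbt' u (- v); first by rewrite /mirror /= opprK.
  by split=> //; rewrite /bt lerNl.
have ctp := upper_boundary_continuous cC vC a_b
  (fun u au ub => let: ex_intro v h := inD u au ub in (htp u v h).1) (fun u v h => (htp u v h).2).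
have cbt := upper_boundary_continuous (mirror_compact cC) (mirror_convex vC) a_b
  (f := bt').
have {}cbt : forall u : R, a <= u -> u <= b -> forall e : R, 0 < e -> exists2 del : R, 0 < del &
    forall u' : R, a <= u' -> u' <= b -> `|u' - u| < del -> `|bt u' - bt u| < e.
  move=> u au ub e e0; have [||d d0 hd] := cbt _ _ u au ub e e0.
  - by move=> w aw wb; have [v h] := inD w aw wb; rewrite /mirror /=; have [] := hbt w v h.
  - by move=> w v; rewrite /mirror /= => /hbt[_]; rewrite /bt lerN2.
  exists d => // u' au' ub' hu; rewrite /bt -opprD normrN; exact: hd.
pose cl u := a + clamp (b - a) (u - a).
pose top u := tp (cl u); pose bot u := bt (cl u).
have clK u : a <= u -> u <= b -> cl u = u.
  by move=> au ub; rewrite /cl clamp_id ?subr_ge0 ?lerD2r // addrC subrK.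
have ct : continuous top := clamp_continuous a_b ctp.
have cb : continuous bot := clamp_continuous a_b cbt.
have [Fb0 [dFb _]] := antiderivative a_b cb.
have [G0 [dG IG]] := antiderivative a_b (fun u => cvgB (ct u) (cb u)).
pose Fb u := Fb0 u - Fb0 a; pose Ft u := Fb u + (G0 u - G0 a).
have P u v : C (u, v) <-> [/\ a <= u, u <= b, bot u <= v & v <= top u].
  split=> [Cuv|[au ub]].
    by have [au ub] := ab _ _ Cuv; rewrite /bot /top clK //; split=> //; [exact: (hbt _ _ Cuv).2|exact: (htp _ _ Cuv).2].
  rewrite /bot /top clK // => h1 h2; have [w Cw] := inD u au ub.
  have [[Cb' _] [Ct' _]] := (hbt _ _ Cw, htp _ _ Cw).
  have [E|ne] := eqVneq (bt u) (tp u).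
    by have -> : v = tp u by apply/eqP; rewrite eq_le h2 -E h1.
  have p0 : 0 < tp u - bt u by rewrite subr_gt0 lt_neqAle ne (le_trans h1 h2).
  have t01 : 0 <= (v - bt u) / (tp u - bt u) <= 1.
    by rewrite divr_ge0 ?subr_ge0 ?(le_trans h1 h2) //= ler_pdivrMr // mul1r lerD2r.
  have := vC _ _ _ _ _ Cb' Ct' t01; set t := (_ / _).
  have -> : (1 - t) * u + t * u = u by ring.
  have -> // : (1 - t) * bt u + t * tp u = v by rewrite /t; field; rewrite gt_eqF.
have le u : a <= u -> u <= b -> bot u <= top u.
  by move=> au ub; have [v /P[_ _ h1 h2]] := inD u au ub; exact: le_trans h2.
have areaE : area C = (Ft b - Fb b)%:E.
  rewrite area_fiber.
  transitivity (\int[lebesgue_measure]_(x in `[a, b]) (top x - bot x)%:E)%E.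
    rewrite [RHS]integral_mkcond; apply: eq_integral => x _; rewrite patchE.
    case: ifPn; rewrite ?inE ?notin_setE /= in_itv /= => hx.
      have /andP[ax xb] := hx.
      have -> : [set y | C (x, y)] = `[bot x, top x]%classic.
        apply/seteqP; split=> y /=; first by move=> /P[_ _ h1 h2]; rewrite in_itv /= h1.
        by rewrite in_itv /= => /andP[h1 h2]; apply/P.
      rewrite lebesgue_measure_itv /= lte_fin.
      have h1 := le x ax xb.
      case: ltP => h2; first by rewrite EFinB.
      by have -> : top x = bot x; [apply/eqP; rewrite eq_le h2 h1|rewrite subrr].
    suff -> : [set y | C (x, y)] = set0 by rewrite measure0.
    by rewrite -subset0 => y /= /P[h1 h2 _ _]; apply: hx; rewrite h1.
  by rewrite IG /Ft; congr (_%:E); ring.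
have Apos : 0 < Ft b - Fb b by rewrite -lte_fin -areaE.
exists a, b, bot, top, Fb, Ft; split=> //.
- split=> //.
  + by move=> u au ub; rewrite -[bot u]subr0; apply: is_deriveB; apply: dFb; rewrite au.
  + move=> u au ub; have -> : top u = (bot u - 0) + ((top u - bot u) - 0) by rewrite !subr0 addrC subrK.
    have i1 : is_derive u 1 Fb0 (bot u) by apply: dFb; rewrite au.
    have i2 : is_derive u 1 G0 (top u - bot u) by apply: dG; rewrite au.
    by apply: is_deriveD.
  + by rewrite /Ft /Fb !subrr addr0.
have [u [au ub hu]] : exists u, [/\ a <= u, u <= b & bot u < top u].
  apply: contrapT => no.
  suff E0 : (\int[lebesgue_measure]_(x in `[a, b]) (top x - bot x)%:E = 0)%E.
    by move: Apos; rewrite -lte_fin -areaE areaE; move: IG; rewrite E0 => -[E]; rewrite /Ft lte_fin; lra.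
  rewrite -[RHS](@integral0 _ _ _ lebesgue_measure `[a, b]%classic).
  apply: eq_integral => x; rewrite inE /= in_itv /= => /andP[ax xb].
  have h := le x ax xb; congr (_%:E); apply/eqP; rewrite subr_eq0 eq_le h andbT leNgt.
  by apply/negP => h'; apply: no; exists x.
pose m := (u + (a + b) / 2) / 2.
have [am mb] : a < m /\ m < b by rewrite /m; split; flra a_b au ub.
have half : 0 <= (2^-1 : R) <= 1 by rewrite invr_ge0 ler0n invf_le1 ?ler1n ?ltr0n.
have hm : bot m < top m.
  have c1 : a <= (a + b) / 2 by lra. have c2 : (a + b) / 2 <= b by lra.
  have [w /P[_ _ hw1 hw2]] := inD _ c1 c2.
  have Cw : C ((a + b) / 2, w) by apply/P.
  have C1 : C (u, bot u) by apply/P; split=> //; exact: ltW.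
  have C2 : C (u, top u) by apply/P; split=> //; exact: ltW.
  have mE : (1 - 2^-1) * u + 2^-1 * ((a + b) / 2) = m by rewrite /m; field.
  have := vC _ _ _ _ _ C1 Cw half; have := vC _ _ _ _ _ C2 Cw half.
  by rewrite mE => /P[_ _ _ h1] /P[_ _ h2 _]; lra.
exists m, ((bot m + top m) / 2); apply/interior_boxP.
have g0 : 0 < (top m - bot m) / 4 by lra.
have [d1 d10 h1] := (continuous_epsP _ _).1 (ct m) _ g0.
have [d2 d20 h2] := (continuous_epsP _ _).1 (cb m) _ g0.
have e1 : 0 < m - a by flra am. have e2 : 0 < b - m by flra mb.
have [f1 f10 [f1a f1b f1c]] := min3_gt0 d10 d20 g0.
have [f2 f20 [f2a f2b f2c]] := min3_gt0 f10 e1 e2.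
exists f2 => // u' v' hu' hv'.
have k1 := h1 u' (lt_le_trans hu' (le_trans f2a f1a)).
have k2 := h2 u' (lt_le_trans hu' (le_trans f2a f1b)).
rewrite !ltr_norml in hu' hv' k1 k2.
by apply/P; split; flra f1c f2a f2b f2c hu' hv' k1 k2.
Qed.

End Body.

(** * The phases of the normal angle and the transport between two bodies *)

Section Phase.
Context {R : realType}.

Lemma sin_cos_2pi_int (x : R) (j : int) : sin (x + 2 * pi * j%:~R) = sin x /\ cos (x + 2 * pi * j%:~R) = cos x.
Proof.
have step (z : R) : sin (z + 2 * pi) = sin z /\ cos (z + 2 * pi) = cos z.
  by rewrite sinD cosD mulr_natl cos2pi sin2pi !mulr1 !mulr0 addr0 subr0.
have pos (z : R) (n : nat) : sin (z + 2 * pi * n%:R) = sin z /\ cos (z + 2 * pi * n%:R) = cos z.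
  elim: n => [|n [ih1 ih2]]; first by rewrite mulr0 addr0.
  have -> : z + 2 * pi * n.+1%:R = z + 2 * pi * n%:R + 2 * pi by rewrite -natr1; ring.
  by have [-> ->] := step (z + 2 * pi * n%:R).
case: j => n; first exact: pos.
have [h1 h2] := pos (x + 2 * pi * (Negz n)%:~R) n.+1.
by rewrite -h1 -h2 NegzE mulrNz mulrN -pmulrn subrK.
Qed.

(** The floor is right continuous, and stays constant along nondecreasing
    functions. *)
Lemma floor_right (g : R -> R) s : rcont g s -> (exists2 del : R, 0 < del &
    forall h : R, 0 < h -> h < del -> g s <= g (s + h)) ->
  exists2 del : R, 0 < del & forall h : R, 0 <= h -> h < del -> Num.floor (g (s + h)) = Num.floor (g s).
Proof.
move=> rc [d1 d10 hd1]; have /andP[h1 h2] := floor_itv (g s); rewrite intrD in h2.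
have g0 : 0 < ((Num.floor (g s))%:~R + 1 - g s) / 2 by lra.
have [u u0 hu] := rc _ g0.
have [m m0 [m1 m2 _]] := min3_gt0 u0 d10 d10; exists m => // h.
rewrite le_eqVlt => /orP[/eqP <-|h0] hm; first by rewrite addr0.
have k1 := hd1 h h0 (lt_le_trans hm m2).
have := hu h h0 (lt_le_trans hm m1); rewrite ler_norml => /andP[_ k2].
by apply/eqP; rewrite floor_eq intrD; apply/andP; split; flra h1 h2 k1 k2.
Qed.

(** In an even phase the normal points upwards, so that the curve runs along
    the upper graph from right to left; in an odd phase it runs along the
    lower graph. *)
Definition phase (psi : R) : int := Num.floor (psi / pi).

Lemma int_parity (i : int) : exists j : int, i = 2 * j \/ i = 2 * j + 1.
Proof.
exists (i %/ 2)%Z; have E := divz_eq i 2; have h1 := modz_ge0 i (d := 2) isT.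
have h2 := ltz_mod i (d := 2) isT.
have : (i %% 2)%Z = 0 \/ (i %% 2)%Z = 1 by move: (i %% 2)%Z h1 h2 => [[|[|n]]|n] // _ _; [left|right].
by move=> [] e; rewrite e mulrC ?addr0 in E; [left|right].
Qed.

Lemma phase_itv psi : (phase psi)%:~R * pi <= psi < ((phase psi)%:~R + 1) * pi :> bool.
Proof.
have pi0 := pi_gt0 R; have /andP[f1 f2] := floor_itv (psi / pi).
by rewrite ler_pdivlMr // in f1; rewrite ltr_pdivrMr // intrD in f2; rewrite /phase f1.
Qed.

Lemma phase_uniq psi (i : int) : i%:~R * pi <= psi -> psi < (i%:~R + 1) * pi -> phase psi = i.
Proof.
move=> h1 h2; apply/eqP; rewrite floor_eq ler_pdivlMr ?pi_gt0 // ltr_pdivrMr ?pi_gt0 // intrD.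
by rewrite h1.
Qed.

Lemma phase_mono psi psi' : psi <= psi' -> phase psi <= phase psi'.
Proof. by move=> h; apply: le_floor; rewrite ler_pM2r ?invr_gt0 ?pi_gt0. Qed.

Lemma phase_even_sin psi j : phase psi = 2 * j -> 0 <= sin psi /\ (sin psi = 0 -> psi = 2 * pi * j%:~R).
Proof.
move=> E; have pi0 := pi_gt0 R; have := phase_itv psi; rewrite E intrM => /andP[h1 h2].
have {}h1 : 0 <= psi - 2 * pi * j%:~R by flra h1.
have {}h2 : psi - 2 * pi * j%:~R < pi by flra h2.
have [sE _] := sin_cos_2pi_int (psi - 2 * pi * j%:~R) j; rewrite subrK in sE; rewrite sE.
split; first by apply: sin_ge0_pi; rewrite h1 ltW.
move=> s0; apply/eqP; rewrite -subr_eq0; apply/negPn/negP => n0.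
have : 0 < sin (psi - 2 * pi * j%:~R) by apply: sin_gt0_pi; rewrite h2 andbT lt_neqAle eq_sym n0.
by rewrite s0 ltxx.
Qed.

Lemma phase_odd_sin psi j : phase psi = 2 * j + 1 -> sin psi <= 0 /\ (sin psi = 0 -> psi = pi + 2 * pi * j%:~R).
Proof.
move=> E; have pi0 := pi_gt0 R; have sp : sin (psi - pi) = - sin psi.
  by rewrite sinB cospi sinpi mulr0 subr0 mulrN1.
have E' : phase (psi - pi) = 2 * j.
  have := phase_itv psi; rewrite E intrD => /andP[k1 k2].
  by apply: phase_uniq; [flra k1|flra k2].
have [h1 h2] := phase_even_sin E'; rewrite sp in h1 h2; split; first by flra h1.
move=> s0; have := h2 _; rewrite s0 oppr0 => /(_ erefl) h; flra h.
Qed.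

Definition graph (bot top : R -> R) (i : int) : R -> R := if (i %% 2)%Z == 0 then top else bot.
(** An antiderivative of the ordinate along the current graph; the multiples
    of the total area make it continuous at the changes of phase. *)
Definition pot (Fb Ft : R -> R) (A : R) (i : int) (X : R) : R := - graph Fb Ft i X + (i %/ 2)%Z%:~R * A.

Lemma graph_even bot top j : graph bot top (2 * j) = top.
Proof. by rewrite /graph mulrC modzMl. Qed.

Lemma graph_odd bot top j : graph bot top (2 * j + 1) = bot.
Proof. by rewrite /graph mulrC modzMDl. Qed.

Lemma pot_even Fb Ft A j X : pot Fb Ft A (2 * j) X = - Ft X + j%:~R * A.
Proof. by rewrite /pot graph_even mulKz. Qed.

Lemma pot_odd Fb Ft A j X : pot Fb Ft A (2 * j + 1) X = - Fb X + j%:~R * A.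
Proof. by rewrite /pot graph_odd [2 * j]mulrC divzMDl // divz_small // addr0. Qed.

Lemma rder_comp_derive (F g : R -> R) s d f : is_derive (g s) 1 F f -> rder g s d -> rder (fun t => F (g t)) s (f * d).
Proof.
move=> dF hg e e0.
have fp : 0 < `|f| + 1 by have := normr_ge0 f; lra.
have dp : 0 < `|d| + 1 by have := normr_ge0 d; lra.
have e1 : 0 < e / (2 * (`|f| + 1)) by rewrite divr_gt0 // mulr_gt0.
have e2 : 0 < e / (2 * (`|d| + 1)) by rewrite divr_gt0 // mulr_gt0.
have [u u0 hu] := is_derive_eps dF e2.
have [v v0 hv] := hg _ e1; have [w w0 hw] := hg _ ltr01.
have u2 : 0 < u / (`|d| + 1) by rewrite divr_gt0.
have [m m0 [m1 m2 m3]] := min3_gt0 v0 w0 u2; exists m => // h h0 hm.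
have {}hv := hv h h0 (lt_le_trans hm m1); have {}hw := hw h h0 (lt_le_trans hm m2).
have hd : `|g (s + h) - g s| <= (`|d| + 1) * h.
  have := ler_normD (g (s + h) - g s - d * h) (d * h); rewrite subrK normrM (gtr0_norm h0).
  by flra hw.
have hu1 : `|g (s + h) - g s| < u.
  apply: le_lt_trans hd _; rewrite mulrC -ltr_pdivlMr //; exact: lt_le_trans m3.
have := hu _ hu1; rewrite subrKC => {}hu.
have -> : F (g (s + h)) - F (g s) - f * d * h =
  (F (g (s + h)) - F (g s) - f * (g (s + h) - g s)) + f * (g (s + h) - g s - d * h) by ring.
apply: le_trans (ler_normD _ _) _; rewrite [X in _ + X]normrM.
have k1 : `|f| * `|g (s + h) - g s - d * h| <= (`|f| + 1) * (e / (2 * (`|f| + 1)) * h).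
  by apply: ler_pM => //; flra hu.
have k2 : e / (2 * (`|d| + 1)) * `|g (s + h) - g s| <= e / (2 * (`|d| + 1)) * ((`|d| + 1) * h).
  by rewrite ler_pM2l.
have E1 : (`|f| + 1) * (e / (2 * (`|f| + 1)) * h) = e * h / 2.
  field.
  by rewrite gt_eqF.
have E2 : e / (2 * (`|d| + 1)) * ((`|d| + 1) * h) = e * h / 2.
  field.
  by rewrite gt_eqF.
by flra hu k1 k2 E1 E2.
Qed.

End Phase.

Section Sweep.
Context {R : realType}.

(** The normal directions between a value shortly before s and the value at s
    are nonnegative combinations of two support directions. *)
Lemma left_support (D : R -> R -> Prop) (l : R) (x y psi : R -> R) (s be t0 : R) : ccw D l x y psi ->
  0 < s -> s <= l -> 0 <= t0 -> t0 < s -> (forall t : R, t0 <= t -> t < s -> psi t < be) ->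
  psi s - psi t0 < pi -> be <= psi s ->
  forall u v : R, D u v -> (u - x s) * cos be + (v - y s) * sin be <= 0.
Proof.
move=> H s0 sl t00 t0s hb jump be_s u v Duv; have pi0 := pi_gt0 R.
have [E|ne] := eqVneq be (psi s); first by rewrite E; apply: (cc_sup H) => //; exact: ltW.
have lt : be < psi s by rewrite lt_neqAle ne.
have bt0 := hb t0 (lexx _) t0s.
pose c0 := Num.min (sin (psi s - be)) (sin (psi s - psi t0)).
have sb : 0 < sin (psi s - be) by apply: sin_gt0_pi; apply/andP; split; lra.
have st0 : 0 < sin (psi s - psi t0) by apply: sin_gt0_pi; apply/andP; split; flra jump lt bt0.
have c00 : 0 < c0 by rewrite lt_min sb.
set X := (u - x s) * cos be + (v - y s) * sin be.
rewrite leNgt; apply/negP => X0.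
have XN : 0 < c0 * X by rewrite mulr_gt0.
have ts : 0 < s - t0 by lra.
have e0 : 0 < Num.min (s - t0) (c0 * X / 4) by rewrite lt_min ts divr_gt0.
pose t := s - Num.min (s - t0) (c0 * X / 4) / 2.
have [k1 k2] : t0 <= t /\ t < s.
  have : Num.min (s - t0) (c0 * X / 4) <= s - t0 by rewrite ge_min lexx.
  by rewrite /t; move: (Num.min _ _) e0 => z z0 z1; split; lra.
have k3 : s - t <= c0 * X / 8.
  have : Num.min (s - t0) (c0 * X / 4) <= c0 * X / 4 by rewrite ge_min lexx orbT.
  by rewrite /t; flra k2.
have btl := hb t k1 k2.
have tmono : psi t0 <= psi t by apply: (cc_mono H) => //; flra sl k2.
have S1 : (u - x s) * cos (psi s) + (v - y s) * sin (psi s) <= 0 by apply: (cc_sup H) => //; exact: ltW.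
have S2 : (u - x t) * cos (psi t) + (v - y t) * sin (psi t) <= 0.
  by apply: (cc_sup H) => //; flra sl t00 k1 k2.
have lp := cc_lip H s t.
have n1 : `|x s - x t| <= s - t.
  rewrite -(@ler_pXn2r _ 2) ?nnegrE //; last flra k2.
  by rewrite -normrX ger0_norm ?sqr_ge0 //; apply: le_trans lp; rewrite lerDl sqr_ge0.
have n2 : `|y s - y t| <= s - t.
  rewrite -(@ler_pXn2r _ 2) ?nnegrE //; last flra k2.
  by rewrite -normrX ger0_norm ?sqr_ge0 //; apply: le_trans lp; rewrite lerDr sqr_ge0.
have cb (z w : R) : `|z * cos w| <= `|z|.
  by rewrite normrM ler_piMr // ler_norml cos_geN1 cos_le1.
have sb' (z w : R) : `|z * sin w| <= `|z|.
  by rewrite normrM ler_piMr // ler_norml sin_geN1 sin_le1.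
have S3 : (u - x s) * cos (psi t) + (v - y s) * sin (psi t) <= 2 * (s - t).
  have := cb (x s - x t) (psi t); have := sb' (y s - y t) (psi t).
  rewrite !ler_norml => /andP[z1 _] /andP[z2 _].
  have z3 : (u - x s) * cos (psi t) + (v - y s) * sin (psi t) =
    (u - x t) * cos (psi t) + (v - y t) * sin (psi t) - (x s - x t) * cos (psi t) - (y s - y t) * sin (psi t) by ring.
  by flra z1 z2 z3 S2 n1 n2.
have sbt : 0 < sin (be - psi t) by apply: sin_gt0_pi; apply/andP; split; flra jump be_s btl tmono.
have E1 : sin (psi s - psi t) * X = sin (psi s - be) * ((u - x s) * cos (psi t) + (v - y s) * sin (psi t)) +
   sin (be - psi t) * ((u - x s) * cos (psi s) + (v - y s) * sin (psi s)).
  have id1 : sin (psi s - psi t) * cos be = sin (psi s - be) * cos (psi t) + sin (be - psi t) * cos (psi s).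
    by rewrite !sinB; ring.
  have id2 : sin (psi s - psi t) * sin be = sin (psi s - be) * sin (psi t) + sin (be - psi t) * sin (psi s).
    by rewrite !sinB; ring.
  have -> : sin (psi s - psi t) * X = (u - x s) * (sin (psi s - psi t) * cos be) + (v - y s) * (sin (psi s - psi t) * sin be) by rewrite /X; ring.
  by rewrite id1 id2; ring.
have c0s : c0 <= sin (psi s - psi t).
  (* the sine is concave on [0, pi] *)
  rewrite /c0 ge_min; have [hh|hh] := leP (psi s - psi t) (pi / 2).
    apply/orP; left; rewrite leNgt ltr_sin ?in_itv /= -?leNgt; try (apply/andP; split); flra pi0 bt0 tmono btl be_s lt jump hh.
  apply/orP; right; have sp (z : R) : sin (pi - z) = sin z.
    by rewrite sinB sinpi cospi mul0r mulN1r sub0r opprK.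
  rewrite -sp -[leRHS]sp leNgt ltr_sin ?in_itv /= -?leNgt; try (apply/andP; split); flra pi0 bt0 tmono btl be_s lt jump hh.
have h2 : sin (psi s - be) <= 1 by exact: sin_le1.
have p1 : sin (psi s - be) * ((u - x s) * cos (psi t) + (v - y s) * sin (psi t)) <= 2 * (s - t).
  have z0 : 0 <= 2 * (s - t) by flra k2.
  have : sin (psi s - be) * ((u - x s) * cos (psi t) + (v - y s) * sin (psi t)) <= sin (psi s - be) * (2 * (s - t)) by rewrite ler_pM2l.
  have : sin (psi s - be) * (2 * (s - t)) <= 1 * (2 * (s - t)) by rewrite ler_wpM2r.
  flra z0.
have p2 : sin (be - psi t) * ((u - x s) * cos (psi s) + (v - y s) * sin (psi s)) <= 0 by rewrite pmulr_rle0.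
have p3 : c0 * X <= sin (psi s - psi t) * X by rewrite ler_pM2r.
by flra E1 p1 p2 p3 k3 XN.
Qed.

Lemma floor_div_right (x y psi : R -> R) (D : R -> R -> Prop) (l s c d : R) : ccw D l x y psi -> 0 <= s -> s < l -> 0 < c ->
  exists2 del : R, 0 < del & forall h : R, 0 <= h -> h < del ->
    Num.floor ((psi (s + h) + d) / c) = Num.floor ((psi s + d) / c).
Proof.
move=> H s0 sl c0; apply: (floor_right (g := fun t => (psi t + d) / c)).
  move=> e e0; have [u u0 hu] := cc_rcont H s0 sl (mulr_gt0 e0 c0); exists u => // h h0 hh.
  have -> : (psi (s + h) + d) / c - (psi s + d) / c = (psi (s + h) - psi s) / c by ring.
  by rewrite normrM normfV (gtr0_norm c0) ler_pdivrMr //; exact: hu.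
exists (l - s); first by rewrite subr_gt0.
move=> h h0 hh; rewrite ler_pM2r ?invr_gt0 // lerD2r; apply: (cc_mono H) => //; lra.
Qed.

Lemma phase_right (x y psi : R -> R) (D : R -> R -> Prop) (l s : R) : ccw D l x y psi -> 0 <= s -> s < l ->
  exists2 del : R, 0 < del & forall h : R, 0 <= h -> h < del -> phase (psi (s + h)) = phase (psi s).
Proof.
move=> H s0 sl; have [u u0 hu] := floor_div_right 0 H s0 sl (pi_gt0 R).
by exists u => // h h0 hh; have := hu h h0 hh; rewrite !addr0.
Qed.

(** When the phase changes at s, a vertical support line is passed at s. *)
Lemma phase_left (x y psi : R -> R) (D : R -> R -> Prop) (l s : R) : ccw D l x y psi -> 0 < s -> s <= l ->
  exists2 del : R, 0 < del &
    (forall t : R, 0 <= t -> s - del < t -> t < s -> phase (psi t) = phase (psi s)) \/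
    (forall t : R, 0 <= t -> s - del < t -> t < s -> phase (psi t) = phase (psi s) - 1) /\
    forall u v : R, D u v -> (u - x s) * cos ((phase (psi s))%:~R * pi) <= 0.
Proof.
move=> H s0 sl; have [d d0 hd] := cc_jump H s0 sl; have pi0 := pi_gt0 R.
have mono t : 0 <= t -> t <= s -> phase (psi t) <= phase (psi s).
  by move=> t0 ts; apply: phase_mono; apply: (cc_mono H).
have [[t0 [t00 t0d t0s t0E]]|no] := pselect (exists t0, [/\ 0 <= t0, s - d < t0, t0 < s & phase (psi t0) = phase (psi s)]).
  exists (s - t0); first by rewrite subr_gt0.
  left=> t tt t1 t2; apply/eqP; rewrite eq_le mono ?(ltW t2) //= -t0E.
  by apply: phase_mono; apply: (cc_mono H) => //; lra.
have below t : 0 <= t -> s - d < t -> t < s -> phase (psi t) = phase (psi s) - 1.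
  move=> t1 t2 t3; apply/eqP; rewrite eq_le; apply/andP; split.
    rewrite -ltzD1 subrK lt_neqAle mono ?(ltW t3) // andbT.
    by apply/eqP => E; apply: no; exists t.
  rewrite lerBlDr -ltzD1 -(ltr_int R) !intrD.
  have := hd t t1 t2 t3; have /andP[k1 _] := phase_itv (psi s); have /andP[_ k2] := phase_itv (psi t).
  by move=> k3; rewrite -(ltr_pM2r pi0); flra k1 k2 k3.
exists d => //; right; split=> // u v Duv.
pose t0 := Num.max 0 (s - d / 2).
have [k1 k2 k3] : [/\ 0 <= t0, s - d < t0 & t0 < s].
  by rewrite /t0; have [h|h] := leP 0 (s - d / 2); split; flra s0 d0 h.
have := left_support (be := (phase (psi s))%:~R * pi) H s0 sl k1 k3 _ (hd t0 k1 k2 k3) _ Duv.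
have -> : sin ((phase (psi s))%:~R * pi) = 0 :> R.
  have [j [->|->]] := int_parity (phase (psi s)).
    have [+ _] := @sin_cos_2pi_int R 0 j; rewrite add0r sin0 => <-; congr sin; rewrite intrM; ring.
  have [+ _] := @sin_cos_2pi_int R pi j; rewrite sinpi => <-; congr sin; rewrite intrD intrM; ring.
rewrite mulr0 addr0; apply; last by have /andP[] := phase_itv (psi s).
move=> t t1 t2; have /andP[_] := phase_itv (psi t); rewrite below ?intrB ?subrK //; lra.
Qed.

Section Transport.
Variables (D C : R -> R -> Prop) (l : R) (x y psi : R -> R) (a b a' b' : R).
Variables (bot top Fb Ft bot' top' Fb' Ft' : R -> R).

(** The abscissae of D and C are matched by the affine map u |-> ratio * u +
    shift. *)
Definition ratio : R := (b' - a') / (b - a).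
Definition shift : R := a' - ratio * a.
Definition cx s : R := ratio * x s + shift.
(** The transported point lies on the graph of C that corresponds to the graph
    of D on which the curve is running. *)
Definition cy s : R := graph bot' top' (phase (psi s)) (cx s).

Lemma cx_itv s : ccw D l x y psi -> body D a b bot top Fb Ft -> body C a' b' bot' top' Fb' Ft' ->
  a' <= cx s /\ cx s <= b'.
Proof.
move=> H HD HC; have [h1 h2 _ _] := (bd_P HD _ _).1 (cc_D H s).
have p1 : 0 < b - a by rewrite subr_gt0 (bd_ab HD). have p2 : 0 < b' - a' by rewrite subr_gt0 (bd_ab HC).
have r0 : 0 < ratio by rewrite divr_gt0.
have rE : ratio * (b - a) = b' - a' by rewrite /ratio divfK // gt_eqF.
have k1 : 0 <= ratio * (x s - a) by apply: mulr_ge0; [exact: ltW|rewrite subr_ge0].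
have k2 : 0 <= ratio * (b - x s) by apply: mulr_ge0; [exact: ltW|rewrite subr_ge0].
by rewrite /cx /shift; split; lra.
Qed.

Lemma c_in s : ccw D l x y psi -> body D a b bot top Fb Ft -> body C a' b' bot' top' Fb' Ft' -> C (cx s) (cy s).
Proof.
move=> H HD HC; have [h1 h2] := cx_itv s H HD HC; apply/(bd_P HC).
by rewrite /cy /graph; case: ifP => _; split=> //; exact: (bd_le HC).
Qed.

Lemma rder_cx s : ccw D l x y psi -> 0 <= s -> s < l -> rder cx s (- ratio * sin (psi s)).
Proof.
move=> H s0 sl; have [h _] := cc_der H s0 sl.
rewrite -[_ * sin _]addr0; apply: rderD; last exact: rder_cst.
by rewrite mulNr -mulrN; exact: rderZ.
Qed.

Lemma graph_continuous i : body C a' b' bot' top' Fb' Ft' -> continuous (graph bot' top' i).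
Proof. by move=> HC; rewrite /graph; case: ifP => _; [exact: bd_ct HC|exact: bd_cb HC]. Qed.

Lemma rcont_cy s : ccw D l x y psi -> body C a' b' bot' top' Fb' Ft' -> 0 <= s -> s < l -> rcont cy s.
Proof.
move=> H HC s0 sl; have [d d0 hd] := phase_right H s0 sl.
apply: (@rcont_ext _ (fun t => graph bot' top' (phase (psi s)) (cx t))).
  by exists d => // h h0 hh; rewrite /cy hd.
by apply: rcont_comp; [exact: graph_continuous HC _|exact: rder_rcont (rder_cx H s0 sl)].
Qed.

Definition Qpot s : R := pot Fb' Ft' (Ft' b' - Fb' b') (phase (psi s)) (cx s).

(** Within a phase Qpot is the antiderivative of the ordinate of C along the
    transported abscissa. *)
Lemma rder_Qpot s : ccw D l x y psi -> body D a b bot top Fb Ft -> body C a' b' bot' top' Fb' Ft' -> 0 <= s -> s < l ->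
  rder Qpot s (ratio * (cy s * sin (psi s))).
Proof.
move=> H HD HC s0 sl; have [d d0 hd] := phase_right H s0 sl; have [h1 h2] := cx_itv s H HD HC.
set i := phase (psi s) in hd.
apply: (@rder_ext _ (fun t => - graph Fb' Ft' i (cx t) + (i %/ 2)%Z%:~R * (Ft' b' - Fb' b'))).
  by exists d => // h h0 hh; rewrite /Qpot hd.
rewrite -[ratio * _]addr0; apply: rderD; last exact: rder_cst.
have -> : ratio * (cy s * sin (psi s)) = - (graph bot' top' i (cx s) * (- ratio * sin (psi s))).
  by rewrite /cy -/i; ring.
apply/rderN/rder_comp_derive; last exact: rder_cx H s0 sl.
by rewrite /graph; case: ifP => _; [exact: bd_Ft HC _ h1 h2|exact: bd_Fb HC _ h1 h2].
Qed.

Lemma lip_cx s t : ccw D l x y psi -> `|cx s - cx t| <= `|ratio| * `|s - t|.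
Proof.
move=> H; have -> : cx s - cx t = ratio * (x s - x t) by rewrite /cx; ring.
rewrite normrM ler_wpM2l // -ler_sqr ?nnegrE // -!normrX !ger0_norm ?sqr_ge0 //.
by apply: le_trans (cc_lip H s t); rewrite lerDl sqr_ge0.
Qed.

(** At a change of phase the transported abscissa is at an end of [a', b'],
    where the two branches of the potential agree. *)
Lemma left_Qpot s : ccw D l x y psi -> body D a b bot top Fb Ft -> body C a' b' bot' top' Fb' Ft' -> 0 < s -> s <= l ->
  forall e : R, 0 < e -> exists2 del : R, 0 < del &
     forall t : R, 0 <= t -> s - del < t -> t < s -> `|Qpot t - Qpot s| <= e.
Proof.
move=> H HD HC s0 sl e e0; have [h1 h2] := cx_itv s H HD HC.
have cF i : exists2 del : R, 0 < del & forall t : R, `|t - s| < del ->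
   `|pot Fb' Ft' (Ft' b' - Fb' b') i (cx t) - pot Fb' Ft' (Ft' b' - Fb' b') i (cx s)| <= e.
  have dg : is_derive (cx s) 1 (graph Fb' Ft' i) (graph bot' top' i (cx s)).
    by rewrite /graph; case: ifP => _; [exact: bd_Ft HC _ h1 h2|exact: bd_Fb HC _ h1 h2].
  have cg : {for cx s, continuous (graph Fb' Ft' i)}.
    by apply: differentiable_continuous; apply/derivable1_diffP; case: dg.
  have [d d0 hd] := (continuous_epsP _ _).1 cg e e0.
  have r1 : 0 < `|ratio| + 1 by have := normr_ge0 ratio; lra.
  exists (d / (`|ratio| + 1)); first by rewrite divr_gt0.
  move=> t; rewrite ltr_pdivlMr // => ht.
  have -> : pot Fb' Ft' (Ft' b' - Fb' b') i (cx t) - pot Fb' Ft' (Ft' b' - Fb' b') i (cx s) =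
    - (graph Fb' Ft' i (cx t) - graph Fb' Ft' i (cx s)) by rewrite /pot; ring.
  rewrite normrN; apply/ltW/hd; apply: le_lt_trans (lip_cx t s H) _.
  apply: le_lt_trans ht; rewrite mulrC ler_wpM2l // lerDl //.
have [d d0 [same|[prev ext]]] := phase_left H s0 sl.
  have [d1 d10 hd1] := cF (phase (psi s)).
  have [m m0 [m1 m2 _]] := min3_gt0 d0 d10 d0; exists m => // t t0 t1 t2.
  rewrite /Qpot same //; last lra.
  by apply: hd1; rewrite ltr0_norm; lra.
have [d1 d10 hd1] := cF (phase (psi s) - 1).
have [m m0 [m1 m2 _]] := min3_gt0 d0 d10 d0; exists m => // t t0 t1 t2.
suff E : Qpot s = pot Fb' Ft' (Ft' b' - Fb' b') (phase (psi s) - 1) (cx s).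
  rewrite E /Qpot prev //; last lra.
  by apply: hd1; rewrite ltr0_norm; flra m2 t0 t1 t2 E.
rewrite /Qpot; have [F1 F2] := bd_0 HC.
have p1 : 0 < b - a by rewrite subr_gt0 (bd_ab HD).
have [hx1 hx2 _ _] := (bd_P HD _ _).1 (cc_D H s).
have [j [E|E]] := int_parity (phase (psi s)); rewrite E in ext *.
  have Db : D b (top b) by apply/(bd_P HD); split=> //; [exact/ltW/(bd_ab HD)|exact: (bd_le HD) (ltW (bd_ab HD)) _].
  have xb : x s = b.
    have [_ c1] := @sin_cos_2pi_int R 0 j; rewrite add0r cos0 in c1.
    have := ext _ _ Db; have -> : (2 * j)%:~R * pi = 2 * pi * j%:~R :> R by rewrite intrM; ring.
    by rewrite c1 mulr1 subr_le0 => h; apply/eqP; rewrite eq_le hx2 h.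
  have cb : cx s = b' by rewrite /cx xb /shift /ratio; field; rewrite gt_eqF.
  have -> : 2 * j - 1 = 2 * (j - 1) + 1 by ring.
  by rewrite pot_even pot_odd cb intrB; ring.
have Da : D a (top a) by apply/(bd_P HD); split=> //; [exact/ltW/(bd_ab HD)|exact: (bd_le HD) (ltW (bd_ab HD))].
have xa : x s = a.
  have [_ c1] := @sin_cos_2pi_int R pi j; rewrite cospi in c1.
  have := ext _ _ Da; have -> : (2 * j + 1)%:~R * pi = pi + 2 * pi * j%:~R :> R by rewrite intrD intrM; ring.
  by rewrite c1 mulrN1 oppr_le0 subr_ge0 => h; apply/eqP; rewrite eq_le hx1 h.
have ca : cx s = a' by rewrite /cx xa /shift; ring.
by rewrite addrK pot_even pot_odd ca F1 F2.
Qed.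

(** A full turn runs through two phases and sweeps the area once. *)
Lemma turn_Qpot : ccw D l x y psi -> Qpot l - Qpot 0 = Ft' b' - Fb' b'.
Proof.
move=> H; have pi0 := pi_gt0 R.
have pE : phase (psi l) = phase (psi 0) + 2.
  have /andP[h1 h2] := phase_itv (psi 0); apply: phase_uniq; rewrite (cc_turn H) intrD; lra.
have cE : cx l = cx 0 by rewrite /cx (cc_closed H).1.
rewrite /Qpot pE cE; have [j [->|->]] := int_parity (phase (psi 0)).
  have -> : 2 * j + 2 = 2 * (j + 1) by ring.
  by rewrite !pot_even intrD; ring.
have -> : 2 * j + 1 + 2 = 2 * (j + 1) + 1 by ring.
by rewrite !pot_odd intrD; ring.
Qed.

End Transport.

End Sweep.

(** * The potential of the transport *)

Section Schmidt.
Context {R : realType}.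

(** If the boundary point is not on the graph of the current phase then it
    lies on a vertical side, where the sine of the normal angle vanishes. *)
Lemma graph_sin (D : R -> R -> Prop) (l : R) (x y psi : R -> R) (a b : R) (bot top Fb Ft : R -> R) (s : R) :
  ccw D l x y psi -> body D a b bot top Fb Ft -> 0 <= s -> s <= l ->
  graph bot top (phase (psi s)) (x s) * sin (psi s) = y s * sin (psi s).
Proof.
move=> H HD s0 sl; have [h1 h2 h3 h4] := (bd_P HD _ _).1 (cc_D H s).
have sup v : bot (x s) <= v -> v <= top (x s) -> (v - y s) * sin (psi s) <= 0.
  move=> v1 v2; have Dv : D (x s) v by apply/(bd_P HD).
  by have := cc_sup H s0 sl Dv; rewrite subrr mul0r add0r.
have bt := bd_le HD h1 h2.
have [j [E|E]] := int_parity (phase (psi s)); rewrite E ?graph_even ?graph_odd.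
  have [p _] := phase_even_sin E; have := sup _ bt (lexx _).
  have : 0 <= (top (x s) - y s) * sin (psi s) by rewrite mulr_ge0 // subr_ge0.
  lra.
have [p _] := phase_odd_sin E; have := sup _ (lexx _) bt.
have : 0 <= (bot (x s) - y s) * sin (psi s) by rewrite mulr_le0 // subr_le0.
lra.
Qed.

(** A potential for the scalar product of the transported point with the
    normal. The abscissa contributes shift * y and ratio times an area of D;
    the ordinate contributes 1 / ratio times an area of C, because the
    transported abscissa moves ratio times as fast as that of D. *)
Definition Spot (x y psi : R -> R) (a b a' b' : R) (Fb Ft Fb' Ft' : R -> R) (s : R) : R :=
  shift a b a' b' * y s + ratio a b a' b' * (x s * y s + Qpot x psi a b a b Fb Ft s)
  + (ratio a b a' b')^-1 * Qpot x psi a b a' b' Fb' Ft' s.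

Lemma rderM (f g : R -> R) s d1 d2 : rder f s d1 -> rder g s d2 ->
  rder (fun t => f t * g t) s (d1 * g s + f s * d2).
Proof.
move=> hf hg; have h0 : rder (fun t => f t - f s) s d1.
  by rewrite -[d1]subr0; apply: rderB => //; exact: rder_cst.
have h1 := rderM0 h0 (subrr _) (rder_rcont hg).
have := rderD h1 (rderZ (f s) hg); apply: rder_ext; exists 1 => // h _ _; ring.
Qed.

Variables (D C : R -> R -> Prop) (l : R) (x y psi : R -> R) (a b a' b' : R).
Variables (bot top Fb Ft bot' top' Fb' Ft' : R -> R).
Hypotheses (H : ccw D l x y psi) (HD : body D a b bot top Fb Ft) (HC : body C a' b' bot' top' Fb' Ft').

Lemma ratio_gt0 : 0 < ratio a b a' b'.
Proof. by rewrite divr_gt0 // subr_gt0; [exact: bd_ab HC|exact: bd_ab HD]. Qed.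

Lemma ratio_self : ratio a b a b = 1.
Proof. by rewrite /ratio divff // subr_eq0 gt_eqF // (bd_ab HD). Qed.

Lemma cx_self s : cx x a b a b s = x s.
Proof. by rewrite /cx /shift ratio_self !mul1r subrr addr0. Qed.

Lemma rder_Spot s : 0 <= s -> s < l -> rder (Spot x y psi a b a' b' Fb Ft Fb' Ft') s
  (cx x a b a' b' s * cos (psi s) + cy x psi a b a' b' bot' top' s * sin (psi s)).
Proof.
move=> s0 sl; have [hx hy] := cc_der H s0 sl.
have h1 := rderZ (shift a b a' b') hy.
have h2 := rderD (rderM hx hy) (rder_Qpot H HD HD s0 sl).
have h3 := rderZ (ratio a b a' b')^-1 (rder_Qpot H HD HC s0 sl).
have := rderD (rderD h1 (rderZ (ratio a b a' b') h2)) h3.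
congr rder; have gs := graph_sin H HD s0 (ltW sl).
rewrite {1}/cy ratio_self cx_self gs mulKf ?gt_eqF ?ratio_gt0 // /cx; ring.
Qed.

Lemma lip_xy s t : `|x s - x t| <= `|s - t| /\ `|y s - y t| <= `|s - t|.
Proof.
have lp := cc_lip H s t; split.
  rewrite -ler_sqr ?nnegrE // -!normrX !ger0_norm ?sqr_ge0 //.
  by apply: le_trans lp; rewrite lerDl sqr_ge0.
rewrite -ler_sqr ?nnegrE // -!normrX !ger0_norm ?sqr_ge0 //.
by apply: le_trans lp; rewrite lerDr sqr_ge0.
Qed.

Lemma cont_xy : continuous x /\ continuous y.
Proof. by split; apply: lip_continuous => s t; have [] := lip_xy s t. Qed.

Definition lcont (f : R -> R) (s : R) := forall e : R, 0 < e -> exists2 del : R, 0 < del &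
  forall t : R, 0 <= t -> s - del < t -> t < s -> `|f t - f s| <= e.

Lemma lcontD f g s : lcont f s -> lcont g s -> lcont (fun t => f t + g t) s.
Proof.
move=> hf hg e e0; have e20 : 0 < e / 2 by rewrite divr_gt0.
have [u u0 hu] := hf _ e20; have [v v0 hv] := hg _ e20.
have [m m0 [mu mv _]] := min3_gt0 u0 v0 v0; exists m => // t t0 t1 t2.
have k1 : s - u < t by apply: le_lt_trans t1; rewrite lerD2l lerN2.
have k2 : s - v < t by apply: le_lt_trans t1; rewrite lerD2l lerN2.
have := hu t t0 k1 t2; have := hv t t0 k2 t2; rewrite !ler_norml.
by move=> /andP[a1 a2] /andP[b1 b2]; apply/andP; split; lra.
Qed.

Lemma lcontZ f s c : lcont f s -> lcont (fun t => c * f t) s.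
Proof.
move=> hf e e0; have c0 : 0 < `|c| + 1 by have := normr_ge0 c; lra.
have [u u0 hu] := hf _ (divr_gt0 e0 c0); exists u => // t t0 t1 t2.
have := hu t t0 t1 t2; rewrite ler_pdivlMr // => k; rewrite -mulrBr normrM mulrC.
by apply: le_trans k; rewrite ler_wpM2l // lerDl.
Qed.

Lemma lcont_continuous f s : {for s, continuous f} -> lcont f s.
Proof.
move=> /continuous_epsP hf e e0; have [d d0 hd] := hf e e0; exists d => // t t0 t1 t2.
by apply/ltW/hd; rewrite ltr0_norm ?subr_lt0 //; lra.
Qed.

Lemma left_Spot s : 0 < s -> s <= l -> lcont (Spot x y psi a b a' b' Fb Ft Fb' Ft') s.
Proof.
move=> s0 sl; have [cx cy] := cont_xy.
apply: lcontD; last by apply: lcontZ; exact: left_Qpot H HD HC s0 sl.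
apply: lcontD; first by apply: lcontZ; apply: lcont_continuous; exact: cy.
apply: lcontZ; apply: lcontD; last exact: left_Qpot H HD HD s0 sl.
by apply: lcont_continuous; apply: cvgM; [exact: cx|exact: cy].
Qed.

Lemma turn_Spot : Spot x y psi a b a' b' Fb Ft Fb' Ft' l - Spot x y psi a b a' b' Fb Ft Fb' Ft' 0 =
  ratio a b a' b' * (Ft b - Fb b) + (ratio a b a' b')^-1 * (Ft' b' - Fb' b').
Proof.
have q1 := turn_Qpot a b a b Fb Ft H; have q2 := turn_Qpot a b a' b' Fb' Ft' H.
by rewrite /Spot -q1 -q2; have [-> ->] := cc_closed H; ring.
Qed.

End Schmidt.

(** * The bound for the affine length *)

Section Curvature.
Context {R : realType}.

(** With cos psi and sin psi both having a right derivative at s, the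
    derivative of sin (psi - psi(s)) is the length of the vector of the two,
    by orthogonality and monotonicity of psi. *)
Lemma rder_turn (psi : R -> R) s d1 d2 : rcont psi s ->
  rder (fun t => cos (psi t)) s d1 -> rder (fun t => sin (psi t)) s d2 ->
  (exists2 del : R, 0 < del & forall h : R, 0 < h -> h < del -> psi s <= psi (s + h)) ->
  rder (fun t => sin (psi t - psi s)) s (Num.sqrt (d1 ^+ 2 + d2 ^+ 2)).
Proof.
move=> rc h1 h2 mono.
have hs : rder (fun t => sin (psi t - psi s)) s (cos (psi s) * d2 - sin (psi s) * d1).
  apply: (@rder_ext _ (fun t => cos (psi s) * sin (psi t) - sin (psi s) * cos (psi t))).
    by exists 1 => // h _ _; rewrite sinB; ring.
  by apply: rderB; apply: rderZ.
have hc : rder (fun t => cos (psi t - psi s) - 1) s (cos (psi s) * d1 + sin (psi s) * d2).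
  rewrite -[_ + _]subr0; apply: rderB; last exact: rder_cst.
  apply: (@rder_ext _ (fun t => cos (psi s) * cos (psi t) + sin (psi s) * sin (psi t))).
    by exists 1 => // h _ _; rewrite cosB; ring.
  by apply: rderD; apply: rderZ.
have cB (z : R) : {for z, continuous (fun t : R => t - psi s)}.
  by apply: cvgB; [exact: cvg_id|exact: cvg_cst].
have rcC : rcont (fun t => cos (psi t - psi s) + 1) s.
  apply: (rcont_comp (F := fun z : R => cos (z - psi s) + 1)) => //.
  apply: cvgD; last exact: cvg_cst.
  by apply: (continuous_comp (f := fun t : R => t - psi s) (g := @cos R)); [exact: cB|exact: continuous_cos].
have rcS : rcont (fun t => - sin (psi t - psi s)) s.
  apply: (rcont_comp (F := fun z : R => - sin (z - psi s))) => //.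
  apply: cvgN; by apply: (continuous_comp (f := fun t : R => t - psi s) (g := @sin R)); [exact: cB|exact: continuous_sin].
have k1 := rderM0 hc _ rcC; have k2 := rderM0 hs _ rcS.
rewrite !subrr ?cos0 ?sin0 ?subrr ?oppr0 ?mulr0 in k1 k2.
have E : cos (psi s) * d1 + sin (psi s) * d2 = 0.
  have k3 := rder_uniq (k1 erefl) (rder_ext _ (k2 erefl)).
  have : (cos (psi s) * d1 + sin (psi s) * d2) * (1 + 1) = 0.
    apply: k3; exists 1 => // h _ _.
    have := cos2Dsin2 (psi (s + h) - psi s); lra.
  by move=> /eqP; rewrite mulf_eq0 => /orP[/eqP//|]; rewrite gt_eqF //; lra.
have p0 : 0 <= cos (psi s) * d2 - sin (psi s) * d1.
  apply: (rder_ge0 hs); have [d d0 hd] := mono; have [u u0 hu] := rc pi (pi_gt0 R).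
  have [m m0 [m1 m2 _]] := min3_gt0 d0 u0 u0; exists m => // h h0 hm.
  rewrite subrr sin0; have := hd h h0 (lt_le_trans hm m1); have := hu h h0 (lt_le_trans hm m2).
  rewrite ler_norml => /andP[_ a1] a2; apply: sin_ge0_pi; apply/andP; split; lra.
suff -> : Num.sqrt (d1 ^+ 2 + d2 ^+ 2) = cos (psi s) * d2 - sin (psi s) * d1 by [].
rewrite -[RHS]ger0_norm // -sqrtr_sqr; congr Num.sqrt.
have := cos2Dsin2 (psi s); set c := cos _ in E *; set d := sin _ in E *.
move=> cd; have -> : d1 ^+ 2 + d2 ^+ 2 = (c ^+ 2 + d ^+ 2) * (d1 ^+ 2 + d2 ^+ 2) by rewrite cd mul1r.
have -> : (c * d2 - d * d1) ^+ 2 = (c ^+ 2 + d ^+ 2) * (d1 ^+ 2 + d2 ^+ 2) - (c * d1 + d * d2) ^+ 2 by ring.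
by rewrite E; ring.
Qed.

Lemma qq_continuous (A B : R) : continuous (qq A B).
Proof.
move=> z; apply: (@continuous_comp _ _ _ (fun t => Pp A B t * Pm A B t) (@Num.sqrt R)); last exact: sqrt_continuous.
apply: cvgM.
  by apply: cvgD; apply: cvgM; try exact: cvg_cst; [exact: continuous_cos|exact: continuous_sin].
by apply: cvgB; apply: cvgM; try exact: cvg_cst; [exact: continuous_cos|exact: continuous_sin].
Qed.

Lemma sinh_near (u : R) : 0 <= u -> u < 1 -> `|u - sinh u| <= u * sinh u.
Proof.
move=> u0 u1; have ub := sinh_ub u0 u1.
have f1 := expR_ge1Dx u; have f2 := expR_gt0 (- u); have ef := expRxMexpNx_1 u.
have k : (1 + u) * expR (- u) <= 1 by rewrite -[leRHS]ef ler_pM2r.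
have lb : u <= (1 + u) * sinh u.
  have : (1 + u) * (1 + u) <= (1 + u) * expR u by rewrite ler_wpM2l //; flra u0.
  have : 0 <= u * u by rewrite mulr_ge0.
  by rewrite /sinh; flra k u0.
by rewrite ler_norml; apply/andP; split; [flra ub|flra lb].
Qed.

(** Near 0 the function sinh differs from the identity by a relative error
    that vanishes. *)
Lemma rder_of_sinh (f : R -> R) s K :
  (exists2 del : R, 0 < del & forall h : R, 0 < h -> h < del -> f s <= f (s + h)) ->
  rder (fun t => sinh (f t - f s)) s K -> rder f s K.
Proof.
move=> [d0 d00 mono] hw e e0; have K1 : 0 < `|K| + 1 by have := normr_ge0 K; lra.
have e2 : 0 < e / 2 by rewrite divr_gt0.
have e3 : 0 < e / (4 * (`|K| + 1 + e)) by rewrite divr_gt0 // mulr_gt0 // addr_gt0.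
have em : 0 < Num.min (1 / 4) (e / (4 * (`|K| + 1 + e))).
  by rewrite lt_min; apply/andP; split; [lra|].
have [d3 d30 h3] := hw _ e2; have [d4 d40 h4] := rder_rcont hw em.
have [m m0 [m1 m2 m3]] := min3_gt0 d00 d30 d40; exists m => // h hh0 hm.
have up : 0 <= f (s + h) - f s by rewrite subr_ge0; apply: mono => //; exact: lt_le_trans m1.
have {}h3 := h3 h hh0 (lt_le_trans hm m2); have {}h4 := h4 h hh0 (lt_le_trans hm m3).
rewrite subrr sinh0 !subr0 in h3 h4.
set u := f (s + h) - f s in up h3 h4 *.
have su0 : 0 <= sinh u by rewrite sinh_ge0.
rewrite (ger0_norm su0) in h4.
have us : u <= 2 * sinh u.
  have k1 := expR_ge1Dx u; have k2 : expR (- u) <= 1 by rewrite -expR0 ler_expR oppr_le0.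
  by rewrite /sinh; flra k1 k2.
have [h41 h42] : sinh u <= 1 / 4 /\ sinh u <= e / (4 * (`|K| + 1 + e)).
  by split; apply: le_trans h4 _; rewrite ge_min lexx ?orbT.
have u1 : u < 1 by flra us h41.
have ub := sinh_near up u1.
have s1 : sinh u <= (`|K| + 1 + e) * h.
  have k1 : K * h <= `|K| * h by rewrite ler_pM2r // ler_norm.
  have k2 : 0 < e * h by rewrite mulr_gt0.
  by move: h3; rewrite ler_norml => /andP[_ h3]; flra h3 hh0 k1 k2.
have s2 : u * sinh u <= e / 2 * h.
  have u2 : u <= e / (2 * (`|K| + 1 + e)).
    have E : e / (2 * (`|K| + 1 + e)) = 2 * (e / (4 * (`|K| + 1 + e))).
      field.
      by rewrite gt_eqF // addr_gt0.
    by flra us h42 E.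
  have := ler_pM up su0 u2 s1.
  have -> // : e / (2 * (`|K| + 1 + e)) * ((`|K| + 1 + e) * h) = e / 2 * h.
  field.
  by rewrite gt_eqF // addr_gt0.
rewrite !ler_norml in ub h3 *; move: ub h3 => /andP[p1 p2] /andP[p3 p4].
by apply/andP; split; [flra p1 p3 s2|flra p2 p4 s2].
Qed.

(** From sinh_ww: the sine of the turn is N q q' times the hyperbolic sine of
    the gap of the parameters. *)
Lemma uu_growth (k : nat) (r al A B ze q0 : R) (psi : R -> R) s c :
  refpar k r al A B ze q0 -> rcont psi s ->
  (exists2 del : R, 0 < del & forall h : R, 0 < h -> h < del -> psi s <= psi (s + h)) ->
  rder (fun t => sin (psi t - psi s)) s c ->
  rder (fun t => uu r al A B (psi t)) s (c / (A * B * qq A B (ph al (psi s)) ^+ 2)).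
Proof.
move=> hp rc mono hc; have [_ _ r0 A0 B0 _ _ _ _] := hp.
pose Q := qq A B (ph al (psi s)); have Q0 : 0 < Q by exact: (qq_gt0 hp (ph_range_le hp _)).
pose j := sec al (psi s).
pose G (z : R) : R := (A * B * (Q * qq A B (z - 2 * al * j%:~R)))^-1.
have Gs : G (psi s) = (A * B * Q ^+ 2)^-1 by rewrite /G expr2.
have rG : rcont (fun t => G (psi t)) s.
  apply: rcont_comp => //; apply: cvgV; first by rewrite gt_eqF // !mulr_gt0.
  apply: cvgM; first exact: cvg_cst.
  apply: cvgM; first exact: cvg_cst.
  apply: (continuous_comp (f := fun z : R => z - 2 * al * j%:~R) (g := qq A B)); last exact: qq_continuous.
  by apply: cvgB; [exact: cvg_id|exact: cvg_cst].
have [d1 d10 h1] := sec_right hp rc mono; have [d2 d20 h2] := mono.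
apply: rder_of_sinh; first by exists d2 => // h h0 hh; apply: (uu_mono hp); exact: h2.
rewrite -Gs; apply: (rder_ext _ (rderM0 hc _ rG)); last by rewrite subrr sin0.
exists d1 => // h h0 hh; have E := h1 h h0 hh.
have -> : uu r al A B (psi (s + h)) - uu r al A B (psi s) = ww A B (ph al (psi (s + h))) - ww A B (ph al (psi s)).
  by rewrite /uu E; ring.
have -> : psi (s + h) - psi s = ph al (psi (s + h)) - ph al (psi s) by rewrite /ph E; ring.
rewrite (sinh_ww hp (ph_range_le hp _) (ph_range_le hp _)) /G /j -E -/(ph al (psi (s + h))) -/Q.
have q0' := qq_gt0 hp (ph_range_le hp (psi (s + h))).
by field; rewrite !gt_eqF.
Qed.

(** The potential of ze cos phi in sector j: the derivative of det(n_j, p)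
    along the boundary is the scalar product of n_j with the outer normal,
    that is cos phi. The constants are chosen for Vj_mono. *)
Definition Vj (ze q0 al : R) (j : int) (u v : R) : R :=
  ze * (cos (2 * al * j%:~R) * v - sin (2 * al * j%:~R) * u) + 2 * ze * sin al * q0 * j%:~R.

Lemma ze_gt0 (k : nat) (r al A B ze q0 : R) : refpar k r al A B ze q0 -> 0 < ze.
Proof.
move=> hp; have c0 := cos_al_gt0 hp; have [_ _ _ _ B0 q00 _ _ ->] := hp.
by rewrite addr_gt0 // mulr_gt0 // cosh_gt0.
Qed.

(** The jump between consecutive sectors is a positive multiple of q0 - p . n,
    with n the direction of the midpoint between them. *)
Lemma Vj_mono (k : nat) (r al A B ze q0 : R) (u v : R) : refpar k r al A B ze q0 ->
  (forall j : int, u * cos (2 * al * j%:~R + al) + v * sin (2 * al * j%:~R + al) <= q0) ->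
  forall j j' : int, j <= j' -> Vj ze q0 al j u v <= Vj ze q0 al j' u v.
Proof.
move=> hp hK; have z0 := ze_gt0 hp; have s0 := sin_al_gt0 hp.
have step j : Vj ze q0 al j u v <= Vj ze q0 al (j + 1) u v.
  have h := hK j; set be := 2 * al * j%:~R in h *.
  have E : 2 * al * (j + 1)%:~R = be + al + al by rewrite intrD /be; ring.
  have E2 : be = be + al - al by ring.
  rewrite /Vj E -/be -subr_ge0 intrD.
  have -> : ze * (cos (be + al + al) * v - sin (be + al + al) * u) + 2 * ze * sin al * q0 * (j%:~R + 1%:~R) -
    (ze * (cos be * v - sin be * u) + 2 * ze * sin al * q0 * j%:~R) =
    2 * ze * sin al * (q0 - (u * cos (be + al) + v * sin (be + al))).
    have c1 : cos be = cos (be + al) * cos al + sin (be + al) * sin al by rewrite {1}E2 cosB.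
    have c2 : sin be = sin (be + al) * cos al - cos (be + al) * sin al by rewrite {1}E2 sinB.
    rewrite c1 c2 (cosD (be + al)) (sinD (be + al)) mulr1z.
    by move: (cos _) (sin _) => p q; ring.
  by rewrite !mulr_ge0 ?subr_ge0 // ltW.
move=> j j' jj; have -> : j' = j + `|j' - j|%N%:Z by rewrite gez0_abs ?subr_ge0 // subrKC.
elim: `|_|%N => [|n ih]; first by rewrite addr0.
by apply: le_trans ih _; rewrite -addn1 PoszD addrA.
Qed.

Lemma Vj_rder (k : nat) (r al A B ze q0 : R) (D : R -> R -> Prop) (l : R) (x y psi : R -> R) (s : R) :
  refpar k r al A B ze q0 -> ccw D l x y psi -> 0 <= s -> s < l ->
  rder (fun t => Vj ze q0 al (sec al (psi t)) (x t) (y t)) s (ze * cos (ph al (psi s))).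
Proof.
move=> hp H s0 sl; have psi_r : exists2 del : R, 0 < del & forall h : R, 0 < h -> h < del -> psi s <= psi (s + h).
  exists (l - s); first by rewrite subr_gt0.
  by move=> h h0 hh; apply: (cc_mono H) => //; lra.
have [d d0 hd] := sec_right hp (cc_rcont H s0 sl) psi_r.
have [hx hy] := cc_der H s0 sl; set J := sec al (psi s) in hd.
apply: (@rder_ext _ (fun t => ze * (cos (2 * al * J%:~R) * y t - sin (2 * al * J%:~R) * x t) + 2 * ze * sin al * q0 * J%:~R)).
  by exists d => // h h0 hh; rewrite /Vj hd.
have -> : ze * cos (ph al (psi s)) = ze * (cos (2 * al * J%:~R) * cos (psi s) - sin (2 * al * J%:~R) * - sin (psi s)) + 0.
  by rewrite /ph -/J cosB; ring.
apply: rderD; last exact: rder_cst.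
by apply: rderZ; apply: rderB; apply: rderZ.
Qed.

(** After a full turn the curve is back and the sector index has increased by
    k. *)
Lemma Vj_turn (k : nat) (r al A B ze q0 : R) (D : R -> R -> Prop) (l : R) (x y psi : R -> R) :
  refpar k r al A B ze q0 -> ccw D l x y psi ->
  Vj ze q0 al (sec al (psi l)) (x l) (y l) - Vj ze q0 al (sec al (psi 0)) (x 0) (y 0) = 2 * ze * sin al * q0 * k%:R.
Proof.
move=> hp H; have [_ alE _ _ _ _ _ _ _] := hp.
have sE : sec al (psi l) = sec al (psi 0) + k%:Z by rewrite (cc_turn H) (sec_period hp).
have k0 : 0 < k%:R :> R := k_gt0 hp.
have aE : 2 * al * (sec al (psi l))%:~R = 2 * al * (sec al (psi 0))%:~R + 2 * pi * (1 : int)%:~R.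
  by rewrite sE intrD -pmulrn alE; field; rewrite gt_eqF.
have [s1 c1] := sin_cos_2pi_int (2 * al * (sec al (psi 0))%:~R) 1.
rewrite /Vj aE s1 c1 sE intrD -pmulrn.
have [-> ->] := cc_closed H; ring.
Qed.

(** The inequality of the arithmetic and the geometric means for c^3 / q^2, N
    q and N q, where N = M3^3. *)
Lemma cube_root_bound (M3 q c : R) : 0 < M3 -> 0 < q -> 0 <= c ->
  3 * c * M3 ^+ 2 <= c ^+ 3 / q ^+ 2 + 2 * M3 ^+ 3 * q.
Proof.
move=> M0 q_gt0 c0; rewrite -subr_ge0.
have -> : c ^+ 3 / q ^+ 2 + 2 * M3 ^+ 3 * q - 3 * c * M3 ^+ 2 =
  (c - M3 * q) ^+ 2 * (c + 2 * (M3 * q)) / q ^+ 2.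
  field.
  by rewrite gt_eqF.
by rewrite divr_ge0 ?sqr_ge0 // mulr_ge0 ?sqr_ge0 // addr_ge0 // !mulr_ge0 // ltW.
Qed.

Lemma powR_third (x : R) : 0 <= x -> 0 <= x `^ (3%:R^-1) /\ (x `^ (3%:R^-1)) ^+ 3 = x.
Proof.
move=> x0; split; first exact: powR_ge0.
by rewrite -powR_mulrn ?powR_ge0 // -powRrM mulVf ?pnatr_eq0 // powRr1.
Qed.

(** The function W = (2 (V - S) + N u) / (3 N^(2/3)) - g has a right
    derivative of at least kap^(1/3) and can only jump upwards; its total
    increment is the right-hand side. Here S is the potential of the
    transported point, and the slack hypothesis is H >= c . n. The function g
    records a loss of up to the slack that the first estimate leaves; it is 0
    for the bound itself, and serves to show that equality leaves no slack. *)
Lemma affine_length_bound (k : nat) (r al A B ze q0 M3 : R) (D : R -> R -> Prop) (l : R)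
  (x y psi S cX cY kap g : R -> R) :
  refpar k r al A B ze q0 -> ccw D l x y psi -> 0 < M3 -> M3 ^+ 3 = A * B ->
  (forall u v : R, D u v -> forall j : int, u * cos (2 * al * j%:~R + al) + v * sin (2 * al * j%:~R + al) <= q0) ->
  (forall s : R, 0 <= s -> s < l -> rder S s (cX s * cos (psi s) + cY s * sin (psi s))) ->
  (forall s : R, 0 < s -> s <= l -> lcont S s) ->
  (forall s : R, 0 <= s -> s < l ->
     cX s * cos (psi s) + cY s * sin (psi s) <= ze * cos (ph al (psi s)) - A * B * qq A B (ph al (psi s))) ->
  (forall s : R, 0 <= s -> s < l -> kap s = 0 \/ exists d1 d2 : R,
     [/\ rder (fun t => cos (psi t)) s d1, rder (fun t => sin (psi t)) s d2 & kap s = Num.sqrt (d1 ^+ 2 + d2 ^+ 2)]) ->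
  (forall s : R, 0 <= s -> s < l -> forall e : R, 0 < e -> exists2 del : R, 0 < del & forall h : R, 0 < h -> h < del ->
     g (s + h) - g s <= (2 / (3 * M3 ^+ 2) * (ze * cos (ph al (psi s)) - A * B * qq A B (ph al (psi s)) -
         (cX s * cos (psi s) + cY s * sin (psi s))) + e) * h) ->
  (forall s : R, 0 < s -> s <= l -> lcont g s) ->
  (\int[lebesgue_measure]_(s in `[0%R, l]) ((kap s) `^ (3%:R^-1))%:E <=
    ((3 * M3 ^+ 2)^-1 * (2 * (2 * ze * sin al * q0 * k%:R - (S l - S 0)) + A * B * (2 * r * k%:R)) - (g l - g 0))%:E)%E.
Proof.
move=> hp H M0 ME hK dS lS slack hk dg lg; have [_ alE r0 A0 B0 _ _ _ _] := hp.
have N0 : 0 < A * B by rewrite mulr_gt0.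
have l0 := cc_l H; have c30 : 0 < 3 * M3 ^+ 2 by rewrite mulr_gt0 // exprn_gt0.
pose J s := sec al (psi s).
pose V s := Vj ze q0 al (J s) (x s) (y s).
pose u s := uu r al A B (psi s).
(* N^(2/3) is M3^2 *)
pose W s := (3 * M3 ^+ 2)^-1 * (2 * (V s - S s) + A * B * u s) - g s.
have psi_r s : 0 <= s -> s < l -> exists2 del : R, 0 < del & forall h : R, 0 < h -> h < del -> psi s <= psi (s + h).
  move=> s0 sl; exists (l - s); first by rewrite subr_gt0.
  by move=> h h0 hh; apply: (cc_mono H) => //; flra h0 hh.
have dV s : 0 <= s -> s < l -> rder V s (ze * cos (ph al (psi s))) by exact: Vj_rder hp H.
have right s : 0 <= s -> s < l -> forall e : R, 0 < e -> exists2 del : R, 0 < del & forall h : R, 0 < h -> h < del ->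
    ((kap s) `^ (3%:R^-1) - e) * h <= W (s + h) - W s.
  move=> s0 sl e e0.
  have q_gt0 := qq_gt0 hp (ph_range_le hp (psi s)).
  set q := qq A B (ph al (psi s)) in q_gt0 dg slack *.
  have M2n : M3 != 0 by rewrite gt_eqF.
  have e1 : 0 < e * M3 ^+ 2 / 4 by rewrite divr_gt0 // mulr_gt0 // exprn_gt0.
  have e2 : 0 < e * M3 ^+ 2 / (4 * (A * B)) by rewrite divr_gt0 ?mulr_gt0 // exprn_gt0.
  have e3 : 0 < e / 4 by rewrite divr_gt0.
  have ub : exists2 del : R, 0 < del & forall h : R, 0 < h -> h < del ->
      (kap s / (A * B * q ^+ 2) - e * M3 ^+ 2 / (4 * (A * B))) * h <= u (s + h) - u s.
    have [k0|[d1 [d2 [h1 h2 kE]]]] := hk s s0 sl.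
      have [d d0 hd] := psi_r s s0 sl; exists d => // h h0 hh; rewrite k0 mul0r sub0r.
      have : 0 <= u (s + h) - u s by rewrite subr_ge0; apply: (uu_mono hp); exact: hd.
      by apply: le_trans; rewrite mulNr oppr_le0 mulr_ge0 // ltW.
    have hu := uu_growth hp (cc_rcont H s0 sl) (psi_r s s0 sl)
      (rder_turn (cc_rcont H s0 sl) h1 h2 (psi_r s s0 sl)).
    have [d d0 hd] := hu _ e2; exists d => // h h0 hh; rewrite kE.
    by have := hd h h0 hh; rewrite ler_norml -/q /u => /andP[h3 _]; flra h3.
  have k0 : 0 <= kap s by have [->//|[d1 [d2 [_ _ ->]]]] := hk s s0 sl; exact: sqrtr_ge0.
  have [c0 cE] := powR_third k0; set c := _ `^ _ in c0 cE *.
  have [d1 d10 h1] := rderB (dV s s0 sl) (dS s s0 sl) e1.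
  have [d2 d20 h2] := ub; have [d3 d30 h3] := dg s s0 sl _ e3.
  have [m m0 [m1 m2 m3]] := min3_gt0 d10 d20 d30; exists m => // h h0 hm.
  have {}h1 := h1 h h0 (lt_le_trans hm m1); have {}h2 := h2 h h0 (lt_le_trans hm m2).
  have {}h3 := h3 h h0 (lt_le_trans hm m3).
  move: h1; rewrite ler_norml => /andP[h1 _].
  set P := ze * cos (ph al (psi s)) in h1 h3; set Y := cX s * cos (psi s) + cY s * sin (psi s) in h1 h3.
  have am := cube_root_bound M0 q_gt0 c0; rewrite cE ME in am.
  have -> : W (s + h) - W s = (3 * M3 ^+ 2)^-1 * (2 * ((V (s + h) - S (s + h)) - (V s - S s)) + A * B * (u (s + h) - u s)) - (g (s + h) - g s).
    by rewrite /W; ring.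
  have t1 : 2 * ((P - Y) * h - e * M3 ^+ 2 / 4 * h) <= 2 * ((V (s + h) - S (s + h)) - (V s - S s)) by flra h1.
  have t2 : (kap s / q ^+ 2 - e * M3 ^+ 2 / 4) * h <= A * B * (u (s + h) - u s).
    have := h2; rewrite -(ler_pM2l N0).
    have -> // : A * B * ((kap s / (A * B * q ^+ 2) - e * M3 ^+ 2 / (4 * (A * B))) * h) = (kap s / q ^+ 2 - e * M3 ^+ 2 / 4) * h.
    field.
    by rewrite !gt_eqF.
  have t3 : (3 * M3 ^+ 2)^-1 * (2 * ((P - Y) * h - e * M3 ^+ 2 / 4 * h) + (kap s / q ^+ 2 - e * M3 ^+ 2 / 4) * h) <=
     (3 * M3 ^+ 2)^-1 * (2 * ((V (s + h) - S (s + h)) - (V s - S s)) + A * B * (u (s + h) - u s)).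
    by rewrite ler_pM2l ?invr_gt0 //; apply: lerD.
  have t4 : (3 * M3 ^+ 2)^-1 * (3 * c * M3 ^+ 2) * h <= (3 * M3 ^+ 2)^-1 * (kap s / q ^+ 2 + 2 * (A * B) * q) * h.
    by rewrite ler_pM2r // ler_pM2l ?invr_gt0.
  have E4 : (3 * M3 ^+ 2)^-1 * (3 * c * M3 ^+ 2) * h = c * h.
    by field.
  have E5 : (3 * M3 ^+ 2)^-1 * (2 * ((P - Y) * h - e * M3 ^+ 2 / 4 * h) + (kap s / q ^+ 2 - e * M3 ^+ 2 / 4) * h) =
    (3 * M3 ^+ 2)^-1 * (kap s / q ^+ 2 + 2 * (A * B) * q) * h + 2 / (3 * M3 ^+ 2) * (P - A * B * q - Y) * h - e / 4 * h.
    field.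
    by rewrite !gt_eqF.
  have eh : 0 < e * h by rewrite mulr_gt0.
  rewrite E4 in t4; rewrite E5 in t3.
  rewrite -/q in h3.
  by flra t3 t4 h3 eh.
have left s : 0 < s -> s <= l -> forall e : R, 0 < e -> exists2 del : R, 0 < del &
     forall t : R, 0 <= t -> s - del < t -> t < s -> W t <= W s + e.
  move=> s0 sl e e0.
  have [cx cy] := cont_xy H.
  have lV : lcont (fun t => Vj ze q0 al (J s) (x t) (y t)) s.
    apply: lcont_continuous; apply: cvgD; last exact: cvg_cst.
    by apply: cvgM; [exact: cvg_cst|apply: cvgB; apply: cvgM; try exact: cvg_cst; [exact: cy|exact: cx]].
  have LL : lcont (fun t => (2 * (3 * M3 ^+ 2)^-1) * (Vj ze q0 al (J s) (x t) (y t) + (-1) * S t) + (-1) * g t) s.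
    apply: lcontD; last exact/lcontZ/lg.
    by apply: lcontZ; apply: lcontD => //; exact/lcontZ/lS.
  have [d d0 hd] := LL e e0; exists d => // t t0 t1 t2.
  have := hd t t0 t1 t2; rewrite ler_norml => /andP[_ h1].
  have pts : psi t <= psi s by apply: (cc_mono H) => //; exact: ltW.
  have h2 : V t <= Vj ze q0 al (J s) (x t) (y t).
    by apply: (Vj_mono hp (hK _ _ (cc_D H t))); apply: (sec_mono hp).
  have h3 : u t <= u s by apply: (uu_mono hp).
  have i0 : 0 < (3 * M3 ^+ 2)^-1 by rewrite invr_gt0.
  have h4 : (3 * M3 ^+ 2)^-1 * (2 * (Vj ze q0 al (J s) (x t) (y t) - V t) + A * B * (u s - u t)) >= 0.
    apply: mulr_ge0; first exact: ltW.
    by apply: addr_ge0; apply: mulr_ge0; rewrite ?subr_ge0 // ltW.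
  move: h1 h4; rewrite /W -/(V s).
  move: ((3 * M3 ^+ 2)^-1) => i; flra i0.
have mono : {in `[0, l] &, {homo W : p q / p <= q}}.
  move=> p q; rewrite !in_itv /= => /andP[p0 _] /andP[_ ql] pq.
  apply: (@dini_nondecreasing _ W 0 l) => //.
    move=> s /andP[s0 sl] e e0; have [d d0 hd] := right s s0 sl e e0; exists d => // h h0 hh.
    have := hd h h0 hh; have : 0 <= (kap s) `^ (3%:R^-1) * h by rewrite mulr_ge0 ?powR_ge0 // ltW.
    flra hh.
  by move=> s /andP[s0 sl] e e0; have [d d0 hd] := left s s0 sl e e0; exists d.
have phi0 s : s \in `[0, l] -> 0 <= (kap s) `^ (3%:R^-1) by move=> _; exact: powR_ge0.
have WE : W l - W 0 = (3 * M3 ^+ 2)^-1 * (2 * (2 * ze * sin al * q0 * k%:R - (S l - S 0)) + A * B * (2 * r * k%:R)) - (g l - g 0).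
  have tV := Vj_turn hp H; rewrite -/(J l) -/(J 0) -/(V l) -/(V 0) in tV.
  by rewrite /W /u (cc_turn H) (uu_period hp) -tV; ring.
rewrite -WE; apply: integral_le_increment => //.
by move=> s /andP[s0 sl] e e0; exact: right.
Qed.

End Curvature.

(** * The reference body *)

Section Reference.
Context {R : realType}.

(** The support function of the reference body at the offset phi in a sector:
    N q is the distance from the centre of the hyperbola to its tangent with
    this normal. *)
Definition Hs (A B ze phi : R) : R := ze * cos phi - A * B * qq A B phi.

(** The body is given by its support function; the sectors are indexed by all
    integers, which avoids residues modulo k. *)
Definition refbody (al A B ze : R) (u v : R) : Prop := forall (j : int) (phi : R), - al <= phi -> phi <= al ->
  u * cos (2 * al * j%:~R + phi) + v * sin (2 * al * j%:~R + phi) <= Hs A B ze phi.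

(** The radial coordinate of a point of the arc. *)
Definition aP (B ze w : R) : R := ze - B * cosh w.
Definition ax (al A B ze : R) (j : int) (w : R) : R :=
  aP B ze w * cos (2 * al * j%:~R) - A * sinh w * sin (2 * al * j%:~R).
Definition ay (al A B ze : R) (j : int) (w : R) : R :=
  aP B ze w * sin (2 * al * j%:~R) + A * sinh w * cos (2 * al * j%:~R).

Lemma arc_dot (al A B ze : R) j w t : ax al A B ze j w * cos t + ay al A B ze j w * sin t =
  aP B ze w * cos (t - 2 * al * j%:~R) + A * sinh w * sin (t - 2 * al * j%:~R).
Proof. by rewrite /ax /ay cosB sinB; ring. Qed.

(** The cosine decreases with the distance to the multiples of 2 pi. *)
Lemma cos_le_dist (t d : R) : 0 <= d -> d <= pi -> (forall n : int, d <= `|t - 2 * pi * n%:~R|) -> cos t <= cos d.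
Proof.
move=> d0 dpi hd; have pi0 := pi_gt0 R; have pi2 : 0 < 2 * pi :> R by rewrite mulr_gt0.
pose n := Num.floor ((t + pi) / (2 * pi)).
have /andP[f1 f2] := floor_itv ((t + pi) / (2 * pi)); rewrite -/n in f1 f2.
rewrite ler_pdivlMr // in f1; rewrite ltr_pdivrMr // intrD mulr1z in f2.
have [_ cE] := sin_cos_2pi_int (t - 2 * pi * n%:~R) n; rewrite subrK in cE.
rewrite cE -cos_norm leNgt ltr_cos ?in_itv /= -?leNgt ?hd ?d0 ?dpi //.
by rewrite normr_ge0 ler_norml; apply/andP; split; lra.
Qed.

Lemma odd_int_norm (m : int) : 1 <= `|(2 * m - 1)%:~R| :> R.
Proof.
rewrite -intr_norm -[1]/(1%:~R) ler_int.
by case: m => [[|n]|n] //=; rewrite ?normrN; lia.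
Qed.

Section Par.
Variables (k : nat) (r al A B ze q0 : R).
Hypothesis hp : refpar k r al A B ze q0.

Lemma kal : k%:R * al = pi.
Proof. by have [_ -> _ _ _ _ _ _ _] := hp; rewrite mulrC divfK // gt_eqF // (k_gt0 hp). Qed.

(** No midpoint direction is closer than the ends of the sector. *)
Lemma cos_midpoint (phi : R) (m : int) : - al <= phi -> phi <= al ->
  cos (phi + (2 * m - 1)%:~R * al) <= cos (al - `|phi|).
Proof.
move=> h1 h2; have [a1 a2 a3] := al_bounds hp; have pi0 := pi_gt0 R.
have na : `|phi| <= al by rewrite ler_norml h1.
have n0 := normr_ge0 phi.
apply: cos_le_dist; try lra.
move=> n; have -> : phi + (2 * m - 1)%:~R * al - 2 * pi * n%:~R = phi + (2 * (m - k%:Z * n) - 1)%:~R * al.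
  by rewrite -kal !(intrD, intrM, mulrNz, intrB); ring.
have := odd_int_norm (m - k%:Z * n); set z := _%:~R => z1.
have : `|z * al| <= `|phi| + `|phi + z * al|.
  by have := ler_normB (phi + z * al) phi; rewrite addrC addKr; lra.
rewrite normrM (gtr0_norm a1).
have : al <= `|z| * al by rewrite -[leLHS]mul1r ler_pM2r.
lra.
Qed.

Lemma aP_end w : `|w| = r -> aP B ze w = q0 * cos al.
Proof.
have [_ _ _ _ _ _ _ _ hz] := hp; move=> E; rewrite /aP hz.
have -> : cosh w = cosh r by rewrite -E; have [_|_] := ger0P w; rewrite ?coshN.
ring.
Qed.

Lemma cosh_le (v w : R) : `|v| <= `|w| -> cosh v <= cosh w.
Proof.
move=> h; have c (z : R) : cosh z = Num.sqrt (1 + sinh `|z| ^+ 2).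
  have e : cosh z = cosh `|z| by have [_|_] := ger0P z; rewrite ?coshN.
  rewrite e -[LHS]ger0_norm ?(ltW (cosh_gt0 _)) // -sqrtr_sqr; congr Num.sqrt.
  by have := cosh_sq `|z|; lra.
rewrite !c ler_sqrt; last by rewrite addr_ge0 ?sqr_ge0.
rewrite lerD2l ler_sqr ?nnegrE ?sinh_ge0 //.
by rewrite !leNgt ltr_sinh -leNgt in h *.
Qed.

Lemma aP_ge w : `|w| <= r -> q0 * cos al <= aP B ze w.
Proof.
have [_ _ r0 _ B0 _ _ _ _] := hp; move=> h.
have rr : `|r| = r by rewrite gtr0_norm.
by rewrite -(aP_end rr) /aP lerB // ler_pM2l //; apply: cosh_le; rewrite rr.
Qed.

(** With cos phi and sin phi expressed through the parameter of phi, this is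
    the addition formula for cosh. *)
Lemma sector_dot (phi w : R) : - al <= phi -> phi <= al ->
  aP B ze w * cos phi + A * sinh w * sin phi = ze * cos phi - A * B * qq A B phi * cosh (w - ww A B phi).
Proof.
move=> h1 h2; have h : - al <= phi <= al by rewrite h1.
have [e1 e2] := qq_cosh hp h; rewrite coshB /aP.
by rewrite e1 e2; ring.
Qed.

Lemma sector_dot_le (phi w : R) : - al <= phi -> phi <= al -> aP B ze w * cos phi + A * sinh w * sin phi <= Hs A B ze phi.
Proof.
move=> h1 h2; have h : - al <= phi <= al by rewrite h1.
have [_ _ _ A0 B0 _ _ _ _] := hp; have q1 := qq_gt0 hp h.
rewrite sector_dot // /Hs lerD2l lerN2 -[leLHS]mulr1 ler_pM2l ?cosh_ge1 // !mulr_gt0 //.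
Qed.

Lemma Hs_al : Hs A B ze al = q0 /\ Hs A B ze (- al) = q0.
Proof.
have [_ _ r0 A0 B0 q00 hA hB hz] := hp; have [a1 a2 a3] := al_bounds hp.
have rr : `|r| = r by rewrite gtr0_norm. have rn : `|- r| = r by rewrite normrN.
have cs := cos2Dsin2 al; have [w1 w2] := ww_al hp.
split.
  have := @sector_dot al r; rewrite w1 subrr cosh0 mulr1 aP_end // hA -/(Hs A B ze al).
  move=> <-; try lra; have -> : q0 * cos al * cos al + q0 * sin al * sin al = q0 * (cos al ^+ 2 + sin al ^+ 2) by ring.
  by rewrite cs mulr1.
have := @sector_dot (- al) (- r); rewrite w2 subrr cosh0 mulr1 aP_end // sinhN mulrN hA -/(Hs A B ze (- al)) cosN sinN.
move=> <-; try lra; have -> : q0 * cos al * cos al + - (q0 * sin al) * - sin al = q0 * (cos al ^+ 2 + sin al ^+ 2) by ring.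
by rewrite cs mulr1.
Qed.

(** The arc ends at the midpoints, which belong to the body. *)
Lemma Hs_mid phi : - al <= phi -> phi <= al -> q0 * cos (al - `|phi|) <= Hs A B ze phi.
Proof.
move=> h1 h2; have [_ _ r0 _ _ _ hA _ _] := hp; have rr : `|r| = r by rewrite gtr0_norm.
have rn : `|- r| = r by rewrite normrN.
have [p0|p0] := ger0P phi.
  have := @sector_dot_le phi r h1 h2; rewrite aP_end // hA cosB.
  by apply: le_trans; rewrite mulrDr; lra.
have := @sector_dot_le phi (- r) h1 h2; rewrite aP_end // sinhN mulrN hA opprK cosD.
by apply: le_trans; rewrite mulrBr; lra.
Qed.

(** In the directions outside of its sector, an arc is supported by its end
    point, the midpoint of a side. *)
Lemma arc_outside (w t : R) : `|w| <= r -> al <= t -> t <= pi ->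
  aP B ze w * cos t + A * sinh w * sin t <= q0 * cos (t - al).
Proof.
move=> hw h1 h2; have pi0 := pi_gt0 R; have [a1 a2 a3] := al_bounds hp; have [_ _ r0 _ _ q00 _ _ _] := hp.
have P1 := aP_ge hw; have := @sector_dot_le al w; rewrite Hs_al.1 => P2.
have {}P2 : aP B ze w * cos al + A * sinh w * sin al <= q0 by apply: P2; lra.
have sp : sin (pi - al) = sin al by rewrite sinB sinpi cospi mul0r mulN1r sub0r opprK.
have st : sin (pi - t) = sin t by rewrite sinB sinpi cospi mul0r mulN1r sub0r opprK.
have s0 := sin_al_gt0 hp; have cs := cos2Dsin2 al.
have t0 : 0 <= sin t by apply: sin_ge0_pi; apply/andP; split; lra.
have t1 : 0 <= sin (t - al) by apply: sin_ge0_pi; apply/andP; split; lra.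
rewrite -(ler_pM2l s0) -subr_ge0.
have -> : sin al * (q0 * cos (t - al)) - sin al * (aP B ze w * cos t + A * sinh w * sin t) =
  sin t * (q0 - (aP B ze w * cos al + A * sinh w * sin al)) + sin (t - al) * (aP B ze w - q0 * cos al).
  rewrite cosB sinB.
  have -> : sin t * (q0 - (aP B ze w * cos al + A * sinh w * sin al)) =
    sin t * (q0 * (cos al ^+ 2 + sin al ^+ 2) - (aP B ze w * cos al + A * sinh w * sin al)) by rewrite cs mulr1.
  ring.
by rewrite addr_ge0 // mulr_ge0 // subr_ge0.
Qed.

(** Inside the sector by sector_dot_le, in the other sectors by arc_outside
    and Hs_mid. *)
Lemma arc_in_refbody (j : int) (w : R) : `|w| <= r -> refbody al A B ze (ax al A B ze j w) (ay al A B ze j w).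
Proof.
move=> hw i phi h1 h2; rewrite arc_dot; have [a1 a2 a3] := al_bounds hp; have pi0 := pi_gt0 R.
set t := 2 * al * i%:~R + phi - _.
have tE (n : int) : t - 2 * pi * n%:~R = phi + 2 * (i - j - k%:Z * n)%:~R * al.
  by rewrite /t -kal !(intrD, intrM, mulrNz, intrB); ring.
have pi2 : 0 < 2 * pi :> R by rewrite mulr_gt0.
pose n := Num.floor ((t + pi) / (2 * pi)).
have /andP[f1 f2] := floor_itv ((t + pi) / (2 * pi)); rewrite -/n in f1 f2.
rewrite ler_pdivlMr // in f1; rewrite ltr_pdivrMr // intrD mulr1z in f2.
have [sE cE] := sin_cos_2pi_int (t - 2 * pi * n%:~R) n; rewrite subrK in sE cE.
rewrite sE cE; set t' := t - _ in sE cE *.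
have t1 : - pi <= t' by rewrite /t'; flra f1.
have t2 : t' < pi by rewrite /t'; flra f2.
have mid (e : int) : q0 * cos (phi + (2 * e - 1)%:~R * al) <= Hs A B ze phi.
  by apply: le_trans (Hs_mid h1 h2); have [_ _ _ _ _ q00 _ _ _] := hp; rewrite ler_pM2l // cos_midpoint.
have [m0|m0] := eqVneq (i - j - k%:Z * n) 0.
  have -> : t' = phi by rewrite /t' tE m0 mulr0 mul0r addr0.
  exact: sector_dot_le.
have tE' := tE n; rewrite -/t' in tE'; set m := i - j - k%:Z * n in m0 tE'; clearbody m.
have out : al <= `|t'|.
  rewrite tE'; have z1 : 1 <= `|m%:~R| :> R by rewrite -intr_norm -[1]/(1%:~R) ler_int; move: m0; case: (m) => [[|?]|?] //=; lia.
  have : `|2 * m%:~R * al| <= `|phi| + `|phi + 2 * m%:~R * al|.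
    by have := ler_normB (phi + 2 * m%:~R * al) phi; rewrite addrC addKr; lra.
  have na : `|phi| <= al by rewrite ler_norml h1.
  rewrite !normrM (gtr0_norm a1) ger0_norm //.
  have : 2 * 1 * al <= 2 * `|m%:~R| * al by rewrite ler_pM2r // ler_pM2l.
  lra.
have [p0|p0] := leP 0 t'.
  rewrite ger0_norm // in out.
  apply: le_trans (arc_outside hw out (ltW t2)) _; apply: le_trans (mid m).
  by have -> : t' - al = phi + (2 * m - 1)%:~R * al by rewrite tE' intrB intrM; ring.
rewrite ltr0_norm // in out.
have hw' : `|- w| <= r by rewrite normrN.
have n2 : - t' <= pi by flra t1.
have := arc_outside hw' out n2; rewrite sinhN /aP coshN -/(aP B ze w) cosN sinN.
have -> : A * - sinh w * - sin t' = A * sinh w * sin t' by ring.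
move=> h; apply: le_trans h _; apply: le_trans (mid (m + 1)).
have -> // : phi + (2 * (m + 1) - 1)%:~R * al = - (- t' - al).
  by rewrite tE' intrB intrM intrD; ring.
by rewrite cosN.
Qed.

(** The normal angle at a point of the arc; the inverse of ww. *)
Definition fi (w : R) : R := atan (B / A * (sinh w / cosh w)).

Lemma fi_ww phi : - al <= phi -> phi <= al -> fi (ww A B phi) = phi.
Proof.
move=> h1 h2; have h : - al <= phi <= al by rewrite h1.
have [a1 a2 a3] := al_bounds hp; have [_ _ _ A0 B0 _ _ _ _] := hp.
have [e1 e2] := qq_cosh hp h; have q1 := qq_gt0 hp h; have c1 := cosh_gt0 (ww A B phi).
rewrite /fi; have -> : B / A * (sinh (ww A B phi) / cosh (ww A B phi)) = tan phi.
  rewrite /tan e1 e2; field.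
  by rewrite !gt_eqF.
by apply: tanK; rewrite in_itv /=; apply/andP; split; lra.
Qed.

Lemma fi_le v w : v <= w -> fi v <= fi w.
Proof.
move=> vw; have [_ _ _ A0 B0 _ _ _ _] := hp; apply: le_atan.
rewrite ler_pM2l ?divr_gt0 // ler_pdivrMr ?cosh_gt0 // mulrAC ler_pdivlMr ?cosh_gt0 //.
have : 0 <= sinh (w - v) by rewrite sinh_ge0 subr_ge0.
by rewrite sinhB; lra.
Qed.

Lemma fi_range w : `|w| <= r -> - al <= fi w /\ fi w <= al.
Proof.
rewrite ler_norml => /andP[h1 h2]; have [w1 w2] := ww_al hp; have [a1 _ _] := al_bounds hp.
have nal : - al <= al by lra.
have f1 := fi_ww nal (lexx al); rewrite w1 in f1; have f2 := fi_ww (lexx (- al)) nal; rewrite w2 in f2.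
by split; [rewrite -f2|rewrite -[leRHS]f1]; exact: fi_le.
Qed.

Lemma sinh_inj (v w : R) : sinh v = sinh w -> v = w.
Proof.
move=> E; have [h|h|//] := ltgtP v w; by move: h; rewrite -ltr_sinh E ltxx.
Qed.

Lemma ww_fi w : `|w| <= r -> ww A B (fi w) = w.
Proof.
move=> hw; have [f1 f2] := fi_range hw; have := fi_ww f1 f2.
have [_ _ _ A0 B0 _ _ _ _] := hp.
move=> /(congr1 tan); rewrite /fi !atanK => /(mulfI (lt0r_neq0 (divr_gt0 B0 A0))) /eqP.
set v := ww _ _ _; rewrite eqr_div; [move=> /eqP E|by rewrite gt_eqF // cosh_gt0|by rewrite gt_eqF // cosh_gt0].
have : sinh (v - w) = sinh 0 by rewrite sinhB E sinh0; ring.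
by move=> /sinh_inj/eqP; rewrite subr_eq0 => /eqP.
Qed.

Lemma is_derive_fi phi : - al <= phi -> phi <= al -> is_derive (ww A B phi) 1 fi (A * B * qq A B phi ^+ 2).
Proof.
move=> h1 h2; have h : - al <= phi <= al by rewrite h1.
have [_ _ _ A0 B0 _ _ _ _] := hp; have [e1 e2] := qq_cosh hp h; have q1 := qq_gt0 hp h.
set w := ww A B phi in e1 e2 *; set q := qq A B phi in e1 e2 q1 *.
have c1 := cosh_gt0 w; have cn : cosh w != 0 by rewrite gt_eqF.
have An : A != 0 by rewrite gt_eqF.
have ds := is_derive_sinh w; have dc := is_derive_cosh w.
have di := is_deriveV cn dc.
have dt := is_deriveM ds di.
have dz : is_derive w 1 (fun w => B / A * (sinh w / cosh w)) (B / A * (sinh w *: (- (cosh w) ^- 2 *: sinh w) + (cosh w)^-1 *: cosh w)).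
  exact: is_deriveZ.
have da := is_derive1_atan (B / A * (sinh w / cosh w)).
have -> : A * B * q ^+ 2 = (1 + (B / A * (sinh w / cosh w)) ^+ 2)^-1 * (B / A * (sinh w *: (- (cosh w) ^- 2 *: sinh w) + (cosh w)^-1 *: cosh w)).
  have k1 : q ^+ 2 * (A ^+ 2 * cosh w ^+ 2 + B ^+ 2 * sinh w ^+ 2) = 1.
    by rewrite -(cos2Dsin2 phi) e1 e2; ring.
  have k2 : 0 < A ^+ 2 * cosh w ^+ 2 + B ^+ 2 * sinh w ^+ 2.
    by rewrite -(pmulr_rgt0 _ (exprn_gt0 2 q1)) k1.
  have -> : q ^+ 2 = (A ^+ 2 * cosh w ^+ 2 + B ^+ 2 * sinh w ^+ 2)^-1.
    by apply: (mulIf (lt0r_neq0 k2)); rewrite k1 mulVf // gt_eqF.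
  have k3 : sinh w ^+ 2 = cosh w ^+ 2 - 1 by have := cosh_sq w; lra.
  rewrite /GRing.scale /=.
  have -> : B / A * (sinh w * (- (cosh w) ^- 2 * sinh w) + (cosh w)^-1 * cosh w) = B / A * ((cosh w ^+ 2 - sinh w ^+ 2) / cosh w ^+ 2).
    field.
    by rewrite An cn.
  have -> : 1 + (B / A * (sinh w / cosh w)) ^+ 2 = (A ^+ 2 * cosh w ^+ 2 + B ^+ 2 * sinh w ^+ 2) / (A ^+ 2 * cosh w ^+ 2).
    field.
    by rewrite An cn.
  rewrite cosh_sq; field.
  by apply/and3P; split=> //; have := lt0r_neq0 k2; rewrite -!exprMn.
exact: is_derive1_comp.
Qed.

Lemma arc_tight (j : int) (w : R) : `|w| <= r ->
  ax al A B ze j w * cos (2 * al * j%:~R + fi w) + ay al A B ze j w * sin (2 * al * j%:~R + fi w) = Hs A B ze (fi w).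
Proof.
move=> hw; have [f1 f2] := fi_range hw.
by rewrite arc_dot [2 * al * _ + _]addrC addrK sector_dot // ww_fi // subrr cosh0 mulr1.
Qed.

Lemma Hs_gt0 phi : - al <= phi -> phi <= al -> q0 * cos al <= Hs A B ze phi.
Proof.
move=> h1 h2; apply: le_trans (Hs_mid h1 h2); have [_ _ _ _ _ q00 _ _ _] := hp.
have [a1 a2 a3] := al_bounds hp; have pi0 := pi_gt0 R.
rewrite ler_pM2l //; have [] := @trig_sector _ _ _ _ _ _ _ _ hp (al - `|phi|) => //.
have : `|phi| <= al by rewrite ler_norml h1.
by have := normr_ge0 phi; move=> *; apply/andP; split; lra.
Qed.

Lemma Hs_le phi : - al <= phi -> phi <= al -> Hs A B ze phi <= ze.
Proof.
move=> h1 h2; have h : - al <= phi <= al by rewrite h1.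
have [_ _ _ A0 B0 _ _ _ _] := hp; have q1 := qq_gt0 hp h; have z0 := ze_gt0 hp.
have : 0 <= A * B * qq A B phi by rewrite !mulr_ge0 // ltW.
have : ze * cos phi <= ze * 1 by rewrite ler_pM2l // cos_le1.
by rewrite /Hs; lra.
Qed.

Lemma refbody_dir (u v t : R) : refbody al A B ze u v -> u * cos t + v * sin t <= Hs A B ze (ph al t).
Proof.
move=> h; have /andP[h1 h2] := ph_range_le hp t.
have := h (sec al t) (ph al t) h1 h2.
by have -> : 2 * al * (sec al t)%:~R + ph al t = t by rewrite /ph addrC subrK.
Qed.

Lemma refbody_bound (u v : R) : refbody al A B ze u v -> `|u| <= ze /\ `|v| <= ze.
Proof.
move=> h; have d t : u * cos t + v * sin t <= ze.
  by have /andP[h1 h2] := ph_range_le hp t; exact: le_trans (refbody_dir t h) (Hs_le h1 h2).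
have := d 0; have := d pi; have := d (pi / 2); have := d (- (pi / 2)).
rewrite cosN sinN cos0 sin0 cospi sinpi cos_pihalf sin_pihalf => *.
by rewrite !ler_norml; split; apply/andP; split; lra.
Qed.

Lemma refbody_convex : convexP (refbody al A B ze).
Proof.
move=> u v u' v' t h h' /andP[t0 t1] j phi p1 p2.
have k1 := h j phi p1 p2; have k2 := h' j phi p1 p2.
have k3 : (1 - t) * (u * cos (2 * al * j%:~R + phi) + v * sin (2 * al * j%:~R + phi)) <= (1 - t) * Hs A B ze phi.
  by rewrite ler_wpM2l // subr_ge0.
have k4 : t * (u' * cos (2 * al * j%:~R + phi) + v' * sin (2 * al * j%:~R + phi)) <= t * Hs A B ze phi.
  by rewrite ler_wpM2l.
by move: k3 k4; move: (Hs _ _ _ _) (cos _) (sin _) => *; lra.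
Qed.

Lemma refbody_compact : compact [set p : plane R | refbody al A B ze p.1 p.2].
Proof.
have z0 := ze_gt0 hp.
apply: (@subclosed_compact _ _ (`[- ze, ze]%classic `*` `[- ze, ze]%classic : set (plane R))).
- have -> : [set p : plane R | refbody al A B ze p.1 p.2] = \bigcap_(q in [set q : int * R | - al <= q.2 /\ q.2 <= al])
     [set p : plane R | p.1 * cos (2 * al * q.1%:~R + q.2) + p.2 * sin (2 * al * q.1%:~R + q.2) <= Hs A B ze q.2].
    apply/seteqP; split=> [p hpp [j phi] [/= h1 h2]|p hpp j phi h1 h2]; first exact: hpp.
    exact: (hpp (j, phi)).
  apply: closed_bigI => -[j phi] _ /=.
  set c := cos _; set s := sin _.
  apply: (@preimage_closed (R^o * R^o)%type R^o (fun p => p.1 * c + p.2 * s) [set x : R^o | x <= Hs A B ze phi]).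
    move=> p _; apply: cvgD; apply: cvgM; try exact: cvg_cst; [exact: cvg_fst|exact: cvg_snd].
  exact: closed_le.
- by apply: compact_setX; exact: segment_compact.
- by move=> [u v] /= /refbody_bound[h1 h2]; split; rewrite /= in_itv /= -ler_norml.
Qed.

Lemma refbody_ball : exists2 d : R, 0 < d & forall u v : R, `|u| < d -> `|v| < d -> refbody al A B ze u v.
Proof.
have c0 := cos_al_gt0 hp; have [_ _ _ _ _ q00 _ _ _] := hp.
have d0 : 0 < q0 * cos al / 2 by rewrite divr_gt0 // mulr_gt0.
exists (q0 * cos al / 2) => // u v hu hv j phi h1 h2; apply: le_trans (Hs_gt0 h1 h2).
set t := _ + phi; have cu : `|u * cos t| <= `|u| by rewrite normrM ler_piMr // ler_norml cos_geN1 cos_le1.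
have cv : `|v * sin t| <= `|v| by rewrite normrM ler_piMr // ler_norml sin_geN1 sin_le1.
have := ler_norm (u * cos t); have := ler_norm (v * sin t); lra.
Qed.

(** The radial and tangential coordinates of an arc run from one side of its
    sector to the other; use the intermediate value theorem in the sector of
    the ray. *)
Lemma arc_ray (u v : R) : (u != 0) || (v != 0) -> exists (j : int) (w c : R),
  [/\ `|w| <= r, 0 < c, ax al A B ze j w = c * u & ay al A B ze j w = c * v].
Proof.
move=> uv0; have [a1 a2 a3] := al_bounds hp; have pi0 := pi_gt0 R; have [_ _ r0 A0 B0 q00 hA _ _] := hp.
have n0 : 0 < u ^+ 2 + v ^+ 2.
  rewrite lt_neqAle addr_ge0 ?sqr_ge0 // andbT eq_sym paddr_eq0 ?sqr_ge0 // !sqrf_eq0 negb_and //.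
pose m := Num.sqrt (u ^+ 2 + v ^+ 2); have m0 : 0 < m by rewrite sqrtr_gt0.
have m2 : m ^+ 2 = u ^+ 2 + v ^+ 2 by rewrite sqr_sqrtr // ltW.
have [|t [ct st]] := @polar_unit R (u / m) (v / m).
  by rewrite !expr_div_n -mulrDl m2 divff // gt_eqF.
pose j := sec al t; have /andP[p1 p2] := ph_range_le hp t; set phi := ph al t in p1 p2.
pose f w := aP B ze w * sin phi - A * sinh w * cos phi.
have rr : `|r| = r by rewrite gtr0_norm. have rn : `|- r| = r by rewrite normrN.
have cf : continuous f.
  move=> w; have i1 := is_derive_sinh w; have i2 := is_derive_cosh w.
  have c1 : {for w, continuous (@sinh R)} by apply: differentiable_continuous; apply/derivable1_diffP; case: i1.
  have c2 : {for w, continuous (@cosh R)} by apply: differentiable_continuous; apply/derivable1_diffP; case: i2.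
  apply: cvgB; apply: cvgM; try exact: cvg_cst.
    by apply: cvgB; [exact: cvg_cst|apply: cvgM; [exact: cvg_cst|exact: c2]].
  by apply: cvgM; [exact: cvg_cst|exact: c1].
have fr : f r <= 0.
  rewrite /f (aP_end rr) hA.
  have -> : q0 * cos al * sin phi - q0 * sin al * cos phi = - (q0 * sin (al - phi)) by rewrite sinB; ring.
  by rewrite oppr_le0 mulr_ge0 ?(ltW q00) // sin_ge0_pi //; apply/andP; split; flra a3 p1 p2 rr.
have fn : 0 <= f (- r).
  rewrite /f (aP_end rn) sinhN mulrN hA.
  have -> : q0 * cos al * sin phi - - (q0 * sin al) * cos phi = q0 * sin (al + phi) by rewrite sinD; ring.
  by rewrite mulr_ge0 ?(ltW q00) // sin_ge0_pi //; apply/andP; split; flra a3 p1 p2 rr.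
have nr : - r <= r by lra.
have f0 : Num.min (f (- r)) (f r) <= 0 <= Num.max (f (- r)) (f r) by rewrite ge_min le_max fr fn orbT.
have [w] := IVT nr (continuous_subspaceT cf) f0.
rewrite in_itv /= -ler_norml => hw fw.
have [cc _] := trig_sector hp (ph_range_le hp t); rewrite -/phi in cc.
have c0 : 0 < cos phi := lt_le_trans (cos_al_gt0 hp) cc.
have P0 : 0 < aP B ze w by apply: lt_le_trans (aP_ge hw); rewrite mulr_gt0 // (cos_al_gt0 hp).
have E : A * sinh w = aP B ze w / cos phi * sin phi.
  apply: (mulIf (lt0r_neq0 c0)).
  have -> : aP B ze w / cos phi * sin phi * cos phi = aP B ze w * sin phi.
    field.
    by rewrite gt_eqF.
  by move: fw; rewrite /f; lra.
have E2 : aP B ze w = aP B ze w / cos phi * cos phi by rewrite divfK // gt_eqF.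
have tE : t = 2 * al * j%:~R + phi by rewrite /phi /ph addrC subrK.
clearbody phi j; set Z := aP B ze w / cos phi in E E2 *.
exists j, w, (Z / m); split=> //; first by rewrite !divr_gt0.
  have -> : u = m * cos t by rewrite ct mulrC divfK // gt_eqF.
  by rewrite (mulrA _ m) (divfK (lt0r_neq0 m0)) tE cosD /ax E E2; ring.
have -> : v = m * sin t by rewrite st mulrC divfK // gt_eqF.
by rewrite (mulrA _ m) (divfK (lt0r_neq0 m0)) tE sinD /ay E E2; ring.
Qed.

(** The points of an arc are boundary points since they attain the support
    function; conversely the ray of a boundary point meets an arc, at the same
    point. *)
Lemma refbody_boundary (u v : R) : boundary [set p : plane R | refbody al A B ze p.1 p.2] (u, v) <->
  exists (j : int) (w : R), [/\ `|w| <= r, u = ax al A B ze j w & v = ay al A B ze j w].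
Proof.
have cC := refbody_compact; have [d d0 hd] := refbody_ball.
split=> [/(boundaryP _ _ cC)[/= Cuv nI]|[j [w [hw -> ->]]]].
  have uv0 : (u != 0) || (v != 0).
    rewrite -negb_and; apply/negP => /andP[/eqP u0 /eqP v0]; apply: nI; apply/interior_boxP.
    by exists d => // u' v'; rewrite u0 v0 !subr0; exact: hd.
  have [j [w [c [hw c0 E1 E2]]]] := arc_ray uv0; exists j, w; suff c1 : c = 1 by rewrite E1 E2 c1 !mul1r.
  have [f1 f2] := fi_range hw; have H0 : 0 < Hs A B ze (fi w).
    by apply: lt_le_trans (Hs_gt0 f1 f2); have [_ _ _ _ _ q00 _ _ _] := hp; rewrite mulr_gt0 // (cos_al_gt0 hp).
  have [c1|c1|//] := ltgtP c 1.
    have := Cuv j (fi w) f1 f2; have := arc_tight j hw; rewrite E1 E2.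
    set p := cos _; set q := sin _ => k1 k2; exfalso.
    have : c * (u * p + v * q) <= c * Hs A B ze (fi w) by rewrite ler_pM2l.
    have : c * Hs A B ze (fi w) < 1 * Hs A B ze (fi w) by rewrite ltr_pM2r.
    lra.
  exfalso; apply: nI; apply/interior_boxP.
  have k0 : 0 < 1 - c^-1 by rewrite subr_gt0 invf_lt1.
  exists (d * (1 - c^-1)); first exact: mulr_gt0.
  move=> u' v' hu hv /=.
  have t01 : 0 <= c^-1 <= 1 by rewrite invr_ge0 ltW //= invf_le1 // ltW.
  have e (x g : R) : x = (1 - c^-1) * ((x - g) / (1 - c^-1)) + c^-1 * (c * g).
    field.
    by rewrite (gt_eqF c0) /= subr_eq0 gt_eqF.
  rewrite [u'](e _ u) [v'](e _ v); apply: refbody_convex => //; last by rewrite -E1 -E2; exact: arc_in_refbody.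
  by apply: hd; rewrite normrM normfV (gtr0_norm k0) ltr_pdivrMr.
apply/boundaryP => //; split; first exact: arc_in_refbody.
move=> /interior_boxP[e e0 he].
have [f1 f2] := fi_range hw; have tg := arc_tight j hw.
set p := cos _ in tg; set q := sin _ in tg.
have e2 : `|e / 2 * p| < e.
  by rewrite normrM gtr0_norm ?divr_gt0 //; have : `|p| <= 1 by [rewrite ler_norml cos_geN1 cos_le1]; have := normr_ge0 p; nra.
have e3 : `|e / 2 * q| < e.
  by rewrite normrM gtr0_norm ?divr_gt0 //; have : `|q| <= 1 by [rewrite ler_norml sin_geN1 sin_le1]; have := normr_ge0 q; nra.
have := he (ax al A B ze j w + e / 2 * p) (ay al A B ze j w + e / 2 * q).
rewrite [_ + e / 2 * p]addrC [_ + e / 2 * q]addrC !addrK => /(_ e2 e3) /= K.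
have := K j (fi w) f1 f2; rewrite -/p -/q -tg.
have : p ^+ 2 + q ^+ 2 = 1 := cos2Dsin2 _.
nra.
Qed.

End Par.

End Reference.

(** * Uniqueness of the support points of the reference body *)

Section Tight.
Context {R : realType}.

Lemma sinh_le2 (e : R) : 0 <= e -> e <= 1 / 2 -> sinh e <= 2 * e.
Proof.
move=> e0 e1; have := sinh_ub e0; have s0 : 0 <= sinh e by rewrite sinh_ge0.
have e2 : e < 1 by lra.
move=> /(_ e2) h; nra.
Qed.

Lemma sinh_small (c d : R) : 0 < d -> (forall e : R, 0 < e -> e < d -> c <= sinh e) -> c <= 0.
Proof.
move=> d0 h; rewrite leNgt; apply/negP => c0; have hl : 0 < (1 / 2 : R) by rewrite divr_gt0.
have c4 : 0 < c / 4 by rewrite divr_gt0.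
have [m m0 [m1 m2 m3]] := min3_gt0 d0 hl c4.
have k1 : m / 2 < d by flra m0 m1. have k2 : 0 < m / 2 by rewrite divr_gt0.
have k3 : m / 2 <= 1 / 2 by flra m0 m2.
have := h _ k2 k1; have := sinh_le2 (ltW k2) k3; flra m3 c0.
Qed.

Variables (k : nat) (r al A B ze q0 : R).
Hypothesis hp : refpar k r al A B ze q0.

Lemma arc_end (j : int) : ax al A B ze j r = q0 * cos (2 * al * j%:~R + al) /\
  ay al A B ze j r = q0 * sin (2 * al * j%:~R + al).
Proof.
have [_ _ r0 _ _ _ hA _ _] := hp; have rr : `|r| = r by rewrite gtr0_norm.
by rewrite /ax /ay (aP_end hp rr) hA cosD sinD; split; ring.
Qed.

Lemma arc_start (j : int) : ax al A B ze j (- r) = q0 * cos (2 * al * j%:~R - al) /\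
  ay al A B ze j (- r) = q0 * sin (2 * al * j%:~R - al).
Proof.
have [_ _ r0 _ _ _ hA _ _] := hp; have rr : `|- r| = r by rewrite normrN gtr0_norm.
by rewrite /ax /ay (aP_end hp rr) sinhN mulrN hA cosB sinB; split; ring.
Qed.

Lemma next_sector (j : int) : 2 * al * (j + 1)%:~R - al = 2 * al * j%:~R + al.
Proof. by rewrite intrD; ring. Qed.

Lemma arc_joint (j : int) : ax al A B ze (j + 1) (- r) = ax al A B ze j r /\
   ay al A B ze (j + 1) (- r) = ay al A B ze j r.
Proof. by have [-> ->] := arc_start (j + 1); have [-> ->] := arc_end j; rewrite next_sector. Qed.

(** The points of the body are constrained by the normals next to phi as well;
    the support inequality in the direction of the parameter w bounds the
    tangential offset t to second order in the distance of the parameters. *)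
Lemma tight_offset (u v phi w : R) (j : int) : refbody al A B ze u v -> - al <= phi -> phi <= al -> `|w| <= r ->
  u * cos (2 * al * j%:~R + phi) + v * sin (2 * al * j%:~R + phi) = Hs A B ze phi ->
  let t := (v - ay al A B ze j (ww A B phi)) * cos (2 * al * j%:~R + phi) - (u - ax al A B ze j (ww A B phi)) * sin (2 * al * j%:~R + phi) in
  t * qq A B phi * sinh (w - ww A B phi) <= sinh (w - ww A B phi) ^+ 2 / 2.
Proof.
move=> huv h1 h2 hw tg; have [f1 f2] := fi_range hp hw; have [_ _ r0 A0 B0 _ _ _ _] := hp.
have hf : - al <= fi A B w <= al by rewrite f1.
have h : - al <= phi <= al by rewrite h1.
have wr : `|ww A B phi| <= r by rewrite ler_norml; exact: ww_range hp _ h.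
set be := 2 * al * j%:~R in tg *; set ps := be + phi in tg *.
have q1 := qq_gt0 hp h; have q2 := qq_gt0 hp hf.
have N0 : 0 < A * B by rewrite mulr_gt0.
have tx := arc_tight hp j wr; rewrite (fi_ww hp h1 h2) -/be -/ps in tx.
cbv zeta.
have s1 := huv j (fi A B w) f1 f2; rewrite -/be in s1.
have xd : ax al A B ze j (ww A B phi) * cos (be + fi A B w) + ay al A B ze j (ww A B phi) * sin (be + fi A B w) =
  ze * cos (fi A B w) - A * B * qq A B (fi A B w) * cosh (ww A B phi - w).
  by rewrite arc_dot -/be [be + _]addrC addrK (sector_dot hp) // (ww_fi hp hw).
set X := ax _ _ _ _ _ _ in tx xd *; set Y := ay _ _ _ _ _ _ in tx xd *.
set t := (Z in Z * qq A B phi * _ <= _).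
have sn : sin (fi A B w - phi) = A * B * (qq A B phi * qq A B (fi A B w)) * sinh (w - ww A B phi).
  by rewrite (sinh_ww hp h hf) (ww_fi hp hw).
have dec : (u - X) * cos (be + fi A B w) + (v - Y) * sin (be + fi A B w) = t * sin (fi A B w - phi).
  have -> : be + fi A B w = ps + (fi A B w - phi) by rewrite /ps; ring.
  have n0 : (u - X) * cos ps + (v - Y) * sin ps = 0 by move: tg tx; lra.
  rewrite (cosD ps) (sinD ps).
  have -> : (u - X) * (cos ps * cos (fi A B w - phi) - sin ps * sin (fi A B w - phi)) +
     (v - Y) * (sin ps * cos (fi A B w - phi) + cos ps * sin (fi A B w - phi)) =
     ((u - X) * cos ps + (v - Y) * sin ps) * cos (fi A B w - phi) + t * sin (fi A B w - phi) by rewrite /t; ring.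
  by rewrite n0 mul0r add0r.
set De := w - ww A B phi in sn *.
have ch : cosh (ww A B phi - w) = cosh De by rewrite -[RHS]coshN /De opprB.
have i1 : t * sin (fi A B w - phi) <= A * B * qq A B (fi A B w) * (cosh De - 1).
  by rewrite -dec -ch; move: s1 xd; rewrite /Hs; lra.
have i2 : cosh De - 1 <= sinh De ^+ 2 / 2.
  have c1 := cosh_ge1 De; have := cosh_sq De; nra.
have N2 : 0 < A * B * qq A B (fi A B w) by rewrite mulr_gt0.
rewrite -(ler_pM2l N2).
have -> : A * B * qq A B (fi A B w) * (t * qq A B phi * sinh De) = t * sin (fi A B w - phi) by rewrite sn; ring.
by apply: le_trans i1 _; rewrite ler_pM2l.
Qed.

(** Divide tight_offset by sinh and let w tend to the parameter of phi, from
    the right and from the left. *)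
Lemma tight_side (u v phi : R) (j : int) : refbody al A B ze u v -> - al <= phi -> phi <= al ->
  u * cos (2 * al * j%:~R + phi) + v * sin (2 * al * j%:~R + phi) = Hs A B ze phi ->
  let t := (v - ay al A B ze j (ww A B phi)) * cos (2 * al * j%:~R + phi) - (u - ax al A B ze j (ww A B phi)) * sin (2 * al * j%:~R + phi) in
  (phi < al -> t <= 0) /\ (- al < phi -> 0 <= t).
Proof.
move=> huv h1 h2 tg t; have off := tight_offset huv h1 h2 _ tg.
have h : - al <= phi <= al by rewrite h1.
have q1 := qq_gt0 hp h; have /andP[wr1 wr2] := ww_range hp h; have [w1 w2] := ww_al hp.
have ne psi' : - al <= psi' -> psi' <= al -> phi != psi' -> ww A B phi != ww A B psi'.
  by move=> k1 k2; apply: contra => /eqP/(congr1 (fi A B)); rewrite !(fi_ww hp) // => ->.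
have [a1 _ _] := al_bounds hp.
split=> hh.
  have wl : ww A B phi < r by rewrite lt_neqAle wr2 andbT -w1 ne // ?lt_eqF //; lra.
  have tq : t * qq A B phi * 2 <= 0.
    apply: (@sinh_small _ (r - ww A B phi)); first lra.
    move=> e e0 e1; have := off (ww A B phi + e); rewrite -/t.
    have -> : ww A B phi + e - ww A B phi = e by ring.
    move=> o.
    have sp : 0 < sinh e by rewrite sinh_gt0.
    have {}o : t * qq A B phi * sinh e <= sinh e ^+ 2 / 2 by apply: o; rewrite ler_norml; apply/andP; split; flra wr1 e0 e1.
    by rewrite -(ler_pM2r sp); flra o.
  by rewrite pmulr_lle0 // pmulr_lle0 in tq.
have wl : - r < ww A B phi by rewrite lt_neqAle wr1 andbT -w2 eq_sym ne // ?gt_eqF //; lra.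
have tq : - t * qq A B phi * 2 <= 0.
  apply: (@sinh_small _ (ww A B phi + r)); first lra.
  move=> e e0 e1; have := off (ww A B phi - e); rewrite -/t.
  have -> : ww A B phi - e - ww A B phi = - e by ring.
  move=> o.
  have sp : 0 < sinh e by rewrite sinh_gt0.
  have {}o : t * qq A B phi * sinh (- e) <= sinh (- e) ^+ 2 / 2 by apply: o; rewrite ler_norml; apply/andP; split; flra wr2 e0 e1.
  by rewrite -(ler_pM2r sp); rewrite sinhN in o; flra o.
by rewrite pmulr_lle0 // pmulr_lle0 // oppr_le0 in tq.
Qed.

(** Inside a sector both one-sided bounds apply. At the end of a sector one of
    them comes from the neighbouring arc, which starts there. *)
Lemma tight_unique (u v phi : R) (j : int) : refbody al A B ze u v -> - al <= phi -> phi <= al ->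
  u * cos (2 * al * j%:~R + phi) + v * sin (2 * al * j%:~R + phi) = Hs A B ze phi ->
  u = ax al A B ze j (ww A B phi) /\ v = ay al A B ze j (ww A B phi).
Proof.
move=> huv h1 h2 tg; have [a1 _ _] := al_bounds hp; have [w1 w2] := ww_al hp; have [Ha Hn] := Hs_al hp.
have h : - al <= phi <= al by rewrite h1.
have wr : `|ww A B phi| <= r by rewrite ler_norml; exact: ww_range hp _ h.
have tx := arc_tight hp j wr; rewrite (fi_ww hp h1 h2) in tx.
set t := (v - ay al A B ze j (ww A B phi)) * cos (2 * al * j%:~R + phi) - (u - ax al A B ze j (ww A B phi)) * sin (2 * al * j%:~R + phi).
suff t0 : t = 0.
  have cs := cos2Dsin2 (2 * al * j%:~R + phi); move: t0 tg tx cs; rewrite /t.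
  set c := cos _; set s := sin _; set X := ax _ _ _ _ _ _; set Y := ay _ _ _ _ _ _ => t0 tg tx cs.
  have n0 : (u - X) * c + (v - Y) * s = 0 by move: tg tx; lra.
  split; apply/eqP; rewrite -subr_eq0; apply/eqP.
    have -> : u - X = (u - X) * (c ^+ 2 + s ^+ 2) by rewrite cs mulr1.
    have -> : (u - X) * (c ^+ 2 + s ^+ 2) = ((u - X) * c + (v - Y) * s) * c - ((v - Y) * c - (u - X) * s) * s by ring.
    by rewrite n0 t0; ring.
  have -> : v - Y = (v - Y) * (c ^+ 2 + s ^+ 2) by rewrite cs mulr1.
  have -> : (v - Y) * (c ^+ 2 + s ^+ 2) = ((u - X) * c + (v - Y) * s) * s + ((v - Y) * c - (u - X) * s) * c by ring.
  by rewrite n0 t0; ring.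
have [T1 T2] := tight_side huv h1 h2 tg; rewrite -/t in T1 T2.
apply/eqP; rewrite eq_le; apply/andP; split.
  have [E|ne] := eqVneq phi al; last by apply: T1; rewrite lt_neqAle ne.
  have [|||S1 _] := @tight_side u v (- al) (j + 1) huv; try lra.
    by rewrite next_sector Hn; move: tg; rewrite E Ha.
  have nal : - al < al by lra.
  have := S1 nal; rewrite w2 next_sector; have [-> ->] := arc_joint j.
  by rewrite /t E w1.
have [E|ne] := eqVneq phi (- al); last by apply: T2; rewrite lt_neqAle eq_sym ne.
have jE : j = j - 1 + 1 by rewrite subrK.
have [|||_ S2] := @tight_side u v al (j - 1) huv; try lra.
  by move: tg; rewrite E Hn Ha -(next_sector (j - 1)) -jE.
have nal : - al < al by lra.
have := S2 nal; rewrite w1; have [<- <-] := arc_joint (j - 1).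
by rewrite /t E w2 -jE -next_sector -jE.
Qed.

Lemma refbody_mirror (u v : R) : refbody al A B ze u v -> refbody al A B ze u (- v).
Proof.
move=> huv j phi h1 h2.
have g1 : - al <= - phi by lra. have g2 : - phi <= al by lra.
have := huv (- j) (- phi) g1 g2.
have -> : 2 * al * (- j)%:~R + - phi = - (2 * al * j%:~R + phi) by rewrite mulrNz; ring.
have -> : Hs A B ze (- phi) = Hs A B ze phi.
  by rewrite /Hs cosN /qq mulrC; congr (_ - _ * Num.sqrt _); rewrite /Pp /Pm cosN sinN; ring.
by rewrite cosN sinN mulrN mulNr.
Qed.

End Tight.

(** * The curvature of the reference body *)

Section Smooth.
Context {R : realType}.

(** The function minus an antiderivative of its right derivative is constant. *)
Lemma rder_ftc (f g : R -> R) (l : R) : 0 < l -> continuous g ->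
  (forall s : R, 0 <= s -> s < l -> rder f s (g s)) ->
  (forall s : R, 0 < s -> s <= l -> lcont f s) ->
  (forall s : R, 0 < s -> s < l -> is_derive s 1 f (g s)) /\
  (\int[lebesgue_measure]_(s in `[0%R, l]) (g s)%:E = (f l - f 0)%:E)%E.
Proof.
move=> l0 cg df lf; have [F [dF IF]] := antiderivative l0 cg.
have c s : 0 <= s -> s <= l -> f s - F s = f 0 - F 0.
  move=> s0 sl; apply/esym; apply: (@rder0_cst _ (fun t => f t - F t) 0 l) => //.
    move=> t /andP[t0 tl]; rewrite -(subrr (g t)); apply: rderB; first exact: df.
    have tt : 0 <= t <= l by rewrite t0 ltW.
    move=> e e0; have [d d0 hd] := is_derive_eps (dF t tt) e0.
    by exists d => // h h0 hh; have := hd h; rewrite (gtr0_norm h0) => k; exact: k.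
  move=> t /andP[t0 tl] e e0.
  have cF : {for t, continuous F}.
    by have [k _] := dF t (introT andP (conj (ltW t0) tl)); apply: differentiable_continuous; apply/derivable1_diffP.
  have lc : lcont (fun t => f t + (-1) * F t) t by apply: lcontD; [exact: lf|apply: lcontZ; exact: lcont_continuous].
  have [d d0 hd] := lc e e0; exists d => // u u0 u1 u2.
  by have := hd u u0 u1 u2; rewrite !mulN1r.
split; last by rewrite IF; congr (_%:E); have := c l (ltW l0) (lexx l); lra.
move=> s s0 sl; apply: eps_is_derive => e e0.
have ss : 0 <= s <= l by rewrite !ltW.
have [d d0 hd] := is_derive_eps (dF s ss) e0.
have ls : 0 < l - s by rewrite subr_gt0.
have [m m0 [m1 m2 m3]] := min3_gt0 d0 s0 ls; exists m => // h hm.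
have := hd h (lt_le_trans hm m1).
move: hm; rewrite ltr_norml => /andP[k1 k2].
have e1 := c s (ltW s0) (ltW sl); have e2 : f (s + h) - F (s + h) = f 0 - F 0 by apply: c; flra m2 m3 k1 k2.
by have -> : F (s + h) - F s = f (s + h) - f s by lra.
Qed.

(** The sectors are half open, so the point to check is the common end of two
    of them. *)
Lemma sector_paste (al : R) (F : int -> R -> R) : 0 < al ->
  (forall (j : int) (phi : R), - al <= phi -> phi <= al -> {for phi, continuous (F j)}) ->
  (forall j : int, F j al = F (j + 1) (- al)) ->
  continuous (fun psi => F (sec al psi) (ph al psi)).
Proof.
move=> a0 cF EF.
have val (j : int) (psi : R) : - al <= psi - 2 * al * j%:~R -> psi - 2 * al * j%:~R <= al ->
    F (sec al psi) (ph al psi) = F j (psi - 2 * al * j%:~R).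
  move=> h1; rewrite le_eqVlt => /orP[/eqP h2|h2].
    have sE : sec al psi = j + 1.
      by apply/eqP; rewrite floor_eq ler_pdivlMr ?mulr_gt0 // ltr_pdivrMr ?mulr_gt0 // !intrD mulr1z; apply/andP; split; lra.
    rewrite /ph sE h2 EF; congr (F _ _); rewrite intrD mulr1z; lra.
  have sE : sec al psi = j.
    by apply/eqP; rewrite floor_eq ler_pdivlMr ?mulr_gt0 // ltr_pdivrMr ?mulr_gt0 // !intrD mulr1z; apply/andP; split; lra.
  by rewrite /ph sE.
move=> psi; apply/continuous_epsP => e e0.
pose j := sec al psi.
have /andP[h1 h2] : - al <= psi - 2 * al * j%:~R < al.
  have a2 : 0 < 2 * al by rewrite mulr_gt0.
  have /andP[f1 f2] := floor_itv ((psi + al) / (2 * al)).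
  by rewrite -/(sec al psi) -/j ler_pdivlMr // in f1; rewrite -/(sec al psi) -/j ltr_pdivrMr // intrD mulr1z in f2; apply/andP; split; lra.
have [d d0 hd] := (continuous_epsP _ _).1 (cF j _ h1 (ltW h2)) e e0.
have g0 : 0 < al - (psi - 2 * al * j%:~R) by rewrite subr_gt0.
have near_j t : - al <= t - 2 * al * j%:~R -> `|t - psi| < d -> t - psi < al - (psi - 2 * al * j%:~R) ->
    `|F (sec al t) (ph al t) - F (sec al psi) (ph al psi)| < e.
  move=> k1 k2 k3; rewrite (val j t) //; last by lra.
  rewrite (val j psi) //; last exact: ltW.
  by apply: hd; have -> : t - 2 * al * j%:~R - (psi - 2 * al * j%:~R) = t - psi by ring.
have [E|ne] := eqVneq (psi - 2 * al * j%:~R) (- al); last first.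
  have g1 : 0 < psi - 2 * al * j%:~R + al.
    have : - al < psi - 2 * al * j%:~R by rewrite lt_neqAle eq_sym ne.
    lra.
  have [m m0 [m1 m2 m3]] := min3_gt0 d0 g0 g1; exists m => // t tm.
  have := tm; rewrite ltr_norml => /andP[k1 k2].
  by apply: near_j; [flra m2 m3 k1 k2|exact: lt_le_trans m1|flra m2 m3 k1 k2].
have Ev : F (sec al psi) (ph al psi) = F (j - 1) (psi - 2 * al * (j - 1)%:~R).
  by apply: val; rewrite intrB mulr1z; lra.
have h3 : - al <= psi - 2 * al * (j - 1)%:~R by rewrite intrB mulr1z; lra.
have h4 : psi - 2 * al * (j - 1)%:~R <= al by rewrite intrB mulr1z; lra.
have [d' d'0 hd'] := (continuous_epsP _ _).1 (cF (j - 1) _ h3 h4) e e0.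
have [m m0 [m1 m2 m3]] := min3_gt0 d0 g0 d'0; have [m' m'0 [m'1 m'2 _]] := min3_gt0 m0 a0 a0.
exists m' => // t tm; have := tm; rewrite ltr_norml => /andP[k1 k2].
have [tp|tp] := leP psi t.
  by apply: near_j; [flra E m'2 k2 tp|apply: lt_le_trans tm _; exact: le_trans m1|flra E m'2 k2 tp].
rewrite Ev (val (j - 1) t); try (rewrite intrB mulr1z; lra).
apply: hd'; have -> : t - 2 * al * (j - 1)%:~R - (psi - 2 * al * (j - 1)%:~R) = t - psi by ring.
by apply: lt_le_trans tm _; exact: le_trans m3.
Qed.

Variables (k : nat) (r al A B ze q0 : R).
Hypothesis hp : refpar k r al A B ze q0.

Lemma ww_continuous phi : - al <= phi -> phi <= al -> {for phi, continuous (ww A B)}.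
Proof.
move=> h1 h2; have h : - al <= phi <= al by rewrite h1.
have [p1 p2] := Ppm_gt0 hp h.
apply: cvgM; last exact: cvg_cst.
apply: (@continuous_comp _ _ _ (fun t => Pp A B t / Pm A B t) (@ln R)); last by apply: continuous_ln; exact: divr_gt0.
apply: cvgM.
  by apply: cvgD; apply: cvgM; try exact: cvg_cst; [exact: continuous_cos|exact: continuous_sin].
apply: cvgV; first exact: lt0r_neq0.
by apply: cvgB; apply: cvgM; try exact: cvg_cst; [exact: continuous_cos|exact: continuous_sin].
Qed.

Lemma uu_continuous : continuous (uu r al A B).
Proof.
have [a1 _ _] := al_bounds hp; have [w1 w2] := ww_al hp.
apply: (@sector_paste al (fun j phi => 2 * r * j%:~R + ww A B phi)) => //.
  by move=> j phi h1 h2; apply: cvgD; [exact: cvg_cst|exact: ww_continuous].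
by move=> j; rewrite w1 w2 intrD mulr1z; ring.
Qed.

Lemma qq_sym phi : qq A B (- phi) = qq A B phi.
Proof. by rewrite /qq mulrC; congr Num.sqrt; rewrite /Pp /Pm cosN sinN; ring. Qed.

Lemma qq_ph_continuous : continuous (fun psi => qq A B (ph al psi)).
Proof.
have [a1 _ _] := al_bounds hp.
apply: (@sector_paste al (fun _ => qq A B)) => //.
  by move=> j phi h1 h2; exact: qq_continuous.
by move=> j; rewrite qq_sym.
Qed.

Variables (l : R) (x y psi : R -> R).
Hypothesis H : ccw (refbody al A B ze) l x y psi.

(** Every direction that supports the body at a boundary point determines this
    point by tight_unique. *)
Lemma sup_arc (s phi : R) (j : int) : 0 <= s -> s <= l -> - al <= phi -> phi <= al ->
  (forall u v : R, refbody al A B ze u v -> (u - x s) * cos (2 * al * j%:~R + phi) + (v - y s) * sin (2 * al * j%:~R + phi) <= 0) ->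
  [/\ x s * cos (2 * al * j%:~R + phi) + y s * sin (2 * al * j%:~R + phi) = Hs A B ze phi,
      x s = ax al A B ze j (ww A B phi) & y s = ay al A B ze j (ww A B phi)].
Proof.
move=> s0 sl h1 h2 sup; have h : - al <= phi <= al by rewrite h1.
have wr : `|ww A B phi| <= r by rewrite ler_norml; exact: ww_range hp _ h.
have tx := arc_tight hp j wr; rewrite (fi_ww hp h1 h2) in tx.
have k1 := sup _ _ (arc_in_refbody hp j wr).
have k2 := cc_D H s j phi h1 h2.
have E : x s * cos (2 * al * j%:~R + phi) + y s * sin (2 * al * j%:~R + phi) = Hs A B ze phi.
  by apply/eqP; rewrite eq_le k2 -tx /=; move: k1; lra.
by have [] := tight_unique hp (cc_D H s) h1 h2 E.
Qed.

Lemma psi_dec t : t = 2 * al * (sec al t)%:~R + ph al t.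
Proof. by rewrite /ph addrC subrK. Qed.

Lemma tight_at (s : R) : 0 <= s -> s <= l ->
  [/\ x s * cos (psi s) + y s * sin (psi s) = Hs A B ze (ph al (psi s)),
      x s = ax al A B ze (sec al (psi s)) (ww A B (ph al (psi s))) & y s = ay al A B ze (sec al (psi s)) (ww A B (ph al (psi s)))].
Proof.
move=> s0 sl; have /andP[h1 h2] := ph_range_le hp (psi s).
by have := @sup_arc s (ph al (psi s)) (sec al (psi s)) s0 sl h1 h2; rewrite -psi_dec; apply => u v huv; exact: (cc_sup H s0 sl huv).
Qed.

Lemma arc_inj (j : int) w w' : ax al A B ze j w = ax al A B ze j w' -> ay al A B ze j w = ay al A B ze j w' -> w = w'.
Proof.
move=> e1 e2; have [_ _ _ A0 _ _ _ _ _] := hp.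
have c v : ay al A B ze j v * cos (2 * al * j%:~R) - ax al A B ze j v * sin (2 * al * j%:~R) = A * sinh v.
  have -> : A * sinh v = A * sinh v * (cos (2 * al * j%:~R) ^+ 2 + sin (2 * al * j%:~R) ^+ 2) by rewrite cos2Dsin2 mulr1.
  rewrite /ax /ay; ring.
by have := c w; rewrite e1 e2 c => /(mulfI (lt0r_neq0 A0))/sinh_inj.
Qed.

(** A jump of the angle would make the boundary point support an interval of
    directions, whereas distinct directions in a sector have distinct support
    points. *)
Lemma psi_left s : 0 < s -> s <= l -> lcont psi s.
Proof.
move=> s0 sl e e0; apply: contrapT => no; have [a1 _ _] := al_bounds hp.
have low t : 0 <= t -> t < s -> psi t <= psi s - e.
  move=> t0 ts; rewrite leNgt; apply/negP => lt; apply: no; exists (s - t); first by rewrite subr_gt0.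
  move=> u u0 u1 u2; have m1 : psi t <= psi u by apply: (cc_mono H) => //; lra.
  have m2 : psi u <= psi s by apply: (cc_mono H) => //; lra.
  by rewrite ler_norml; apply/andP; split; lra.
have [j [phi [p1 p2 pE]]] : exists (j : int) (phi : R), [/\ - al < phi, phi <= al & psi s = 2 * al * j%:~R + phi].
  have /andP[h1 h2] := ph_range_le hp (psi s).
  have [E|ne] := eqVneq (ph al (psi s)) (- al).
    exists (sec al (psi s) - 1), al; split; try lra.
    by rewrite intrB mulr1z {1}(psi_dec (psi s)) E; ring.
  by exists (sec al (psi s)), (ph al (psi s)); split=> //; [rewrite lt_neqAle eq_sym ne|exact: psi_dec].
have pp : 0 < phi + al by lra.
have [m m0 [m1 m2 _]] := min3_gt0 e0 pp pp.
have [d d0 hd] := cc_jump H s0 sl.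
pose t0 := Num.max 0 (s - d / 2).
have [k1 k2 k3] : [/\ 0 <= t0, s - d < t0 & t0 < s].
  by rewrite /t0; have [h|h] := leP 0 (s - d / 2); split; flra s0 e0 m1 m2 d0 h.
have hl : - al <= phi - m / 2 by lra. have hr : phi - m / 2 <= al by lra.
have [_ X1 Y1] : [/\ x s * cos (2 * al * j%:~R + (phi - m / 2)) + y s * sin (2 * al * j%:~R + (phi - m / 2)) = Hs A B ze (phi - m / 2),
   x s = ax al A B ze j (ww A B (phi - m / 2)) & y s = ay al A B ze j (ww A B (phi - m / 2))].
  apply: (sup_arc (ltW s0) sl hl hr).
  apply: (left_support H s0 sl k1 k3 _ (hd t0 k1 k2 k3)); last by rewrite pE; lra.
  move=> t t1 t2; have := low t (le_trans k1 t1) t2; rewrite pE; lra.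
have [_ X2 Y2] : [/\ x s * cos (2 * al * j%:~R + phi) + y s * sin (2 * al * j%:~R + phi) = Hs A B ze phi,
   x s = ax al A B ze j (ww A B phi) & y s = ay al A B ze j (ww A B phi)].
  apply: (sup_arc (ltW s0) sl (ltW p1) p2) => u v huv; rewrite -pE.
  exact: (cc_sup H (ltW s0) sl huv).
have := arc_inj (etrans (esym X1) X2) (etrans (esym Y1) Y2).
move=> /(congr1 (fi A B)); rewrite !(fi_ww hp) //; try lra.
Qed.

Lemma psi_right s : 0 <= s -> s < l -> exists2 del : R, 0 < del & forall h : R, 0 < h -> h < del -> psi s <= psi (s + h).
Proof.
move=> s0 sl; exists (l - s); first by rewrite subr_gt0.
by move=> h h0 hh; apply: (cc_mono H) => //; lra.
Qed.

(** The coordinate A sinh w of the arc is a linear coordinate of the curve,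
    which has unit speed. *)
Lemma rder_uu s : 0 <= s -> s < l -> rder (fun t => uu r al A B (psi t)) s (qq A B (ph al (psi s))).
Proof.
move=> s0 sl; have [d d0 hd] := sec_right hp (cc_rcont H s0 sl) (psi_right s0 sl).
have [_ _ _ A0 B0 _ _ _ _] := hp; have [hx hy] := cc_der H s0 sl.
apply: rder_of_sinh.
  have [u u0 hu] := psi_right s0 sl; exists u => // h h0 hh; apply: (uu_mono hp); exact: hu.
set j := sec al (psi s) in hd; set w := ww A B (ph al (psi s)).
have [e1 e2] := qq_cosh hp (ph_range_le hp (psi s)); rewrite -/w in e1 e2.
pose c := cos (2 * al * j%:~R); pose sn := sin (2 * al * j%:~R).
have cs : c ^+ 2 + sn ^+ 2 = 1 := cos2Dsin2 _.
apply: (@rder_ext _ (fun t => cosh w / A * (c * y t - sn * x t) - sinh w / B * (ze - (c * x t + sn * y t)))).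
  have ls : 0 < l - s by rewrite subr_gt0.
  have [m m0 [m1 m2 _]] := min3_gt0 d0 ls ls; exists m => // h h0 hm.
  have E := hd h h0 (lt_le_trans hm m1).
  have [||_ X Y] := @tight_at (s + h); [by lra|by lra|].
  have -> : uu r al A B (psi (s + h)) - uu r al A B (psi s) = ww A B (ph al (psi (s + h))) - w by rewrite /uu E -/j -/w; ring.
  rewrite E -/j in X Y; rewrite X Y /ax /ay -/c -/sn /aP sinhB.
  set w' := ww A B (ph al (psi (s + h))).
  have k1 : c * ((ze - B * cosh w') * sn + A * sinh w' * c) - sn * ((ze - B * cosh w') * c - A * sinh w' * sn) = A * sinh w' * (c ^+ 2 + sn ^+ 2) by ring.
  have k2 : c * ((ze - B * cosh w') * c - A * sinh w' * sn) + sn * ((ze - B * cosh w') * sn + A * sinh w' * c) = (ze - B * cosh w') * (c ^+ 2 + sn ^+ 2) by ring.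
  rewrite k1 k2 cs !mulr1; field.
  by rewrite !gt_eqF.
have -> : qq A B (ph al (psi s)) = cosh w / A * (c * cos (psi s) - sn * - sin (psi s)) - sinh w / B * (0 - (c * - sin (psi s) + sn * cos (psi s))).
  have k1 : c * cos (psi s) - sn * - sin (psi s) = A * (qq A B (ph al (psi s)) * cosh w).
    by rewrite -e1 /ph cosB -/j -/c -/sn; ring.
  have k2 : 0 - (c * - sin (psi s) + sn * cos (psi s)) = B * (qq A B (ph al (psi s)) * sinh w).
    by rewrite -e2 /ph sinB -/j -/c -/sn; ring.
  rewrite k1 k2.
  have -> : cosh w / A * (A * (qq A B (ph al (psi s)) * cosh w)) - sinh w / B * (B * (qq A B (ph al (psi s)) * sinh w)) =
     qq A B (ph al (psi s)) * (cosh w ^+ 2 - sinh w ^+ 2).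
    field.
    by rewrite !gt_eqF.
  by rewrite cosh_sq mulr1.
apply: rderB; apply: rderZ; first by apply: rderB; apply: rderZ.
by apply: rderB; [exact: rder_cst|apply: rderD; apply: rderZ].
Qed.

(** Compare the angle with the hyperbolic parameter by sinh_ww. *)
Lemma rder_psi s : 0 <= s -> s < l -> rder psi s (A * B * qq A B (ph al (psi s)) ^+ 3).
Proof.
move=> s0 sl; have [d d0 hd] := sec_right hp (cc_rcont H s0 sl) (psi_right s0 sl).
set j := sec al (psi s) in hd.
have /andP[h1 h2] := ph_range_le hp (psi s).
have gE : uu r al A B (psi s) - 2 * r * j%:~R = ww A B (ph al (psi s)) by rewrite /uu -/j; ring.
apply: (@rder_ext _ (fun t => 2 * al * j%:~R + fi A B (uu r al A B (psi t) - 2 * r * j%:~R))).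
  exists d => // h h0 hh; have E := hd h h0 hh; have /andP[k1 k2] := ph_range_le hp (psi (s + h)).
  rewrite /uu E -/j; have -> : 2 * r * j%:~R + ww A B (ph al (psi (s + h))) - 2 * r * j%:~R = ww A B (ph al (psi (s + h))) by ring.
  by rewrite (fi_ww hp k1 k2) -E -psi_dec.
have -> : A * B * qq A B (ph al (psi s)) ^+ 3 = 0 + A * B * qq A B (ph al (psi s)) ^+ 2 * qq A B (ph al (psi s)) by ring.
apply: rderD; first exact: rder_cst.
pose g (t : R) : R := uu r al A B (psi t) - 2 * r * j%:~R.
have dfi : is_derive (g s) 1 (fi A B) (A * B * qq A B (ph al (psi s)) ^+ 2) by rewrite /g gE; exact: (is_derive_fi hp h1 h2).
have dg : rder g s (qq A B (ph al (psi s))).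
  have := rderB (rder_uu s0 sl) (rder_cst (2 * r * j%:~R) s).
  by rewrite subr0.
exact: (rder_comp_derive dfi dg).
Qed.

(** The angle, extended by constants in order to speak of continuity. *)
Definition psic (s : R) : R := psi (clamp l s).

Lemma psic_continuous : continuous psic.
Proof.
have l0 := cc_l H.
have cl u : 0 <= u -> u <= l -> forall e : R, 0 < e -> exists2 del : R, 0 < del &
    forall u' : R, 0 <= u' -> u' <= l -> `|u' - u| < del -> `|psi u' - psi u| < e.
  move=> u0 ul e e0; have e2 : 0 < e / 2 by rewrite divr_gt0.
  have [d1 d10 h1] : exists2 del : R, 0 < del & forall h : R, 0 < h -> h < del -> u + h <= l -> `|psi (u + h) - psi u| <= e / 2.
    have [ul'|ul'] := ltP u l; last by exists 1 => // h h0 _; lra.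
    by have [d d0 hd] := cc_rcont H u0 ul' e2; exists d => // h h0 hh _; exact: hd.
  have [d2 d20 h2] : exists2 del : R, 0 < del & forall t : R, 0 <= t -> u - del < t -> t < u -> `|psi t - psi u| <= e / 2.
    have [ul'|ul'] := ltP 0 u; last by exists 1 => // t t0 _; lra.
    exact: psi_left e2.
  have [m m0 [m1 m2 _]] := min3_gt0 d10 d20 d10; exists m => // u' u'0 u'l hu.
  apply: (@le_lt_trans _ _ (e / 2)); last lra.
  move: hu; rewrite ltr_norml => /andP[k1 k2].
  have [E|E|E] := ltgtP u u'; last by rewrite E subrr normr0 ltW.
    by have := h1 (u' - u); rewrite subrKC; apply; flra m1 m2 u'l k1 k2 E.
  by apply: h2; flra m1 m2 u'0 u'l k1 E.
have l0' : (0 : R) < l := l0.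
have := clamp_continuous l0' cl.
have -> // : (fun u => psi (0 + clamp (l - 0) (u - 0))) = psic.
by apply/funext => u; rewrite !subr0 add0r.
Qed.

Lemma psic_id s : 0 <= s -> s <= l -> psic s = psi s.
Proof. by move=> s0 sl; rewrite /psic clamp_id. Qed.

Lemma refbody_curvature : (forall s : R, 0 < s -> s < l -> is_derive s 1 psi (A * B * qq A B (ph al (psi s)) ^+ 3)).
Proof.
have cq : continuous (fun s => A * B * qq A B (ph al (psic s)) ^+ 3).
  move=> s; have c1 : {for s, continuous (fun t => qq A B (ph al (psic t)))}.
    by apply: (@continuous_comp _ _ _ psic (fun z => qq A B (ph al z))); [exact: psic_continuous|exact: qq_ph_continuous].
  by apply: cvgM; [exact: cvg_cst|exact: (cvg_comp _ _ c1 (@exprn_continuous _ 3 _))].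
have [||h _] := rder_ftc (cc_l H) cq (f := psi).
- by move=> s s0 sl; rewrite psic_id ?(ltW sl) //; exact: rder_psi.
- exact: psi_left.
by move=> s s0 sl; have := h s s0 sl; rewrite psic_id // ltW.
Qed.

(** The rate q is the derivative of u along the curve, and u increases by 2 r
    k in a full turn. *)
Lemma refbody_uu_integral : continuous (fun s => qq A B (ph al (psic s))) /\
  (\int[lebesgue_measure]_(s in `[0%R, l]) (qq A B (ph al (psic s)))%:E = (2 * r * k%:R)%:E)%E.
Proof.
have cq : continuous (fun s => qq A B (ph al (psic s))).
  by move=> s; apply: (@continuous_comp _ _ _ psic (fun z => qq A B (ph al z))); [exact: psic_continuous|exact: qq_ph_continuous].
split=> //; have [||_ ->] := rder_ftc (cc_l H) cq (f := fun t => uu r al A B (psi t)).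
- by move=> s s0 sl; rewrite psic_id ?(ltW sl) //; exact: rder_uu.
- move=> s s0 sl e e0; have cu : {for psi s, continuous (uu r al A B)} by exact: uu_continuous.
  have [d d0 hd] := (continuous_epsP _ _).1 cu e e0.
  have d2 : 0 < d / 2 by rewrite divr_gt0.
  have [d' d'0 hd'] := psi_left s0 sl d2; exists d' => // t t0 t1 t2.
  by apply/ltW/hd; apply: le_lt_trans (hd' t t0 t1 t2) _; lra.
by rewrite (cc_turn H) (uu_period hp) addrC addKr.
Qed.

End Smooth.

(** * Area and affine length of the reference body *)

Section PlaneDerivative.
Context {R : realType}.

Lemma derive1_plane (f : R -> plane R) (f1 f2 : R -> R) (s d1 d2 : R) :
  (exists2 del : R, 0 < del & forall t : R, `|t - s| < del -> f t = (f1 t, f2 t)) ->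
  is_derive s 1 f1 d1 -> is_derive s 1 f2 d2 -> derive1 f s = (d1, d2).
Proof.
move=> [d d0 hd] h1 h2.
suff cv : (fun h : R => h^-1 *: (f (h + s) - f s)) @ 0^' --> ((d1, d2) : plane R).
  exact: (cvg_lim (@norm_hausdorff _ _) cv).
apply/cvgrPdist_le => e e0.
have [u u0 hu] := is_derive_eps h1 e0; have [v v0 hv] := is_derive_eps h2 e0.
have [m m0 [m1 m2 m3]] := min3_gt0 u0 v0 d0.
apply/nbhs_ballP; exists m => //= h; rewrite /ball /= sub0r normrN => hm h0.
have {}hu := hu h (lt_le_trans hm m1); have {}hv := hv h (lt_le_trans hm m2).
have E1 : f (h + s) = (f1 (s + h), f2 (s + h)).
  rewrite addrC hd //; have -> : s + h - s = h by ring.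
  exact: lt_le_trans m3.
have E2 : f s = (f1 s, f2 s) by rewrite hd // subrr normr0.
have key (T x y : R) : `|x - y - T * h| <= e * `|h| -> `|T - h^-1 * (x - y)| <= e.
  have -> : T - h^-1 * (x - y) = - ((x - y - T * h) / h) by field.
  by rewrite normrN normrM normfV ler_pdivrMr // normr_gt0.
by rewrite E1 E2 prod_normE /= ge_max /GRing.scale /= !key.
Qed.

(** By convention the derivative of a function that is not differentiable is
    0. *)
Lemma derive1_plane_rder (f : R -> plane R) (s : R) :
  derive1 f s = (0, 0) \/ rder (fun t => (f t).1) s (derive1 f s).1 /\ rder (fun t => (f t).2) s (derive1 f s).2.
Proof.
have [cv|ncv] := pselect (cvg ((fun h : R => h^-1 *: (f (h + s) - f s)) @ 0^')); last first.
  by left; rewrite /derive1 (dvgP ncv).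
right; have /cvgrPdist_le hc : (fun h : R => h^-1 *: (f (h + s) - f s)) @ 0^' --> derive1 f s by [].
have main e : 0 < e -> exists2 del : R, 0 < del & forall h : R, 0 < h -> h < del ->
   `|(f (s + h)).1 - (f s).1 - (derive1 f s).1 * h| <= e * h /\ `|(f (s + h)).2 - (f s).2 - (derive1 f s).2 * h| <= e * h.
  move=> e0; have := hc e e0; move=> /nbhs_ballP[d /= d0 hd]; exists d => // h h0 hh.
  have := hd h; rewrite /ball /= sub0r normrN gtr0_norm // => /(_ hh (lt0r_neq0 h0)).
  rewrite prod_normE /= ge_max /GRing.scale /= [h + s]addrC => /andP[k1 k2].
  have key (T x y : R) : `|T - h^-1 * (x - y)| <= e -> `|x - y - T * h| <= e * h.
    have -> : x - y - T * h = - ((T - h^-1 * (x - y)) * h) by field; rewrite gt_eqF.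
    by rewrite normrN normrM (gtr0_norm h0) ler_pM2r.
  by split; apply: key.
by split=> e e0; have [d d0 hd] := main e e0; exists d => // h h0 hh; have [] := hd h h0 hh.
Qed.

(** Where the tangent is not differentiable the curvature of the definition is
    0. *)
Lemma curvature_cases (gamma : R -> plane R) (psi : R -> R) (e l s : R) : (e == 1) || (e == -1) ->
  (forall s : R, 0 <= s -> s < l -> tangent gamma s = (- sin (psi s), e * cos (psi s))) ->
  0 <= s -> s < l -> curvature gamma s = 0 \/ exists d1 d2 : R,
     [/\ rder (fun t => cos (psi t)) s d1, rder (fun t => sin (psi t)) s d2 & curvature gamma s = Num.sqrt (d1 ^+ 2 + d2 ^+ 2)].
Proof.
move=> he ht s0 sl; rewrite /curvature; have [->|[h1 h2]] := derive1_plane_rder (tangent gamma) s.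
  by left; rewrite /enorm /= expr0n addr0 sqrtr0.
have ee : e * e = 1 by case/orP: he => /eqP ->; rewrite ?mulr1 // mulrNN mulr1.
have ls : 0 < l - s by rewrite subr_gt0.
right; exists (e * (derive1 (tangent gamma) s).2), (- (derive1 (tangent gamma) s).1); split.
- apply: (rder_ext _ (rderZ e h2)); exists (l - s) => // h hh0 hh.
  by rewrite ht ?addr_ge0 //= ?mulrA ?ee ?mul1r //; lra.
- apply: (rder_ext _ (rderN h1)); exists (l - s) => // h hh0 hh.
  by rewrite ht ?addr_ge0 //= ?opprK //; lra.
- by rewrite /enorm exprMn sqrrN [e ^+ 2]expr2 ee mul1r addrC.
Qed.

End PlaneDerivative.

Section ReferenceMeasures.
Context {R : realType}.
Variables (k : nat) (r al A B ze q0 : R).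
Hypothesis hp : refpar k r al A B ze q0.

Definition refset : set (plane R) := [set p : plane R | refbody al A B ze p.1 p.2].

Lemma refset_mirror (e : R) : (e == 1) || (e == -1) -> (fun u v : R => refset (u, e * v)) = refbody al A B ze.
Proof.
move=> he; apply/funext => u; apply/funext => v; apply/propext; rewrite /refset /=.
case/orP: he => /eqP ->; rewrite ?mul1r ?mulN1r //.
by split=> h; first rewrite -[v]opprK; exact: refbody_mirror.
Qed.

Lemma refset_compact : compact refset. Proof. exact: (refbody_compact hp). Qed.

Lemma refset_convex : @convex_set R (plane R) refset.
Proof. by apply/convex_setP; exact: refbody_convex. Qed.

Lemma refset_interior : interior refset (0, 0).
Proof.
apply/interior_boxP; have [d d0 hd] := refbody_ball hp; exists d => // u v.
by rewrite !subr0; exact: hd.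
Qed.

(** The curvature is N q^3, so its cube root is N^(1/3) q, and q integrates to
    2 r k. *)
Lemma refset_length (M3 l : R) (gamma : R -> plane R) : 0 < M3 -> M3 ^+ 3 = A * B -> arc_length_param refset l gamma ->
  ((2 * r * k%:R * M3)%:E <= \int[lebesgue_measure]_(s in `[0%R, l]) ((curvature gamma s) `^ (3%:R^-1))%:E)%E.
Proof.
move=> M0 ME g; have [e [psi [he H ht]]] := ccw_of_param refset_compact refset_convex refset_interior g.
rewrite (refset_mirror he) in H.
have dpsi := refbody_curvature hp H; have [cq Iq] := refbody_uu_integral hp H.
set q := fun s => qq A B (ph al (psic l psi s)) in cq Iq.
have q_gt0 s : 0 < q s by exact: (qq_gt0 hp (ph_range_le hp _)).
have kE s : 0 < s -> s < l -> curvature gamma s = A * B * q s ^+ 3.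
  move=> s0 sl; have [_ _ _ A0 B0 _ _ _ _] := hp.
  have dp := dpsi s s0 sl; set K := A * B * _ in dp.
  have K0 : 0 < K.
    have qs : 0 < qq A B (ph al (psi s)) by exact: (qq_gt0 hp (ph_range_le hp _)).
    by rewrite /K mulr_gt0 ?exprn_gt0 // mulr_gt0.
  have KE : A * B * q s ^+ 3 = K by rewrite /K /q psic_id // ltW.
  rewrite KE /curvature.
  have i1 : is_derive s 1 (fun t => - sin (psi t)) (- (cos (psi s) * K)).
    have ds : is_derive (psi s) 1 (@sin R) (cos (psi s)) by exact: is_derive_sin.
    by apply: is_deriveN; exact: is_derive1_comp.
  have i2 : is_derive s 1 (fun t => e * cos (psi t)) (e * (- sin (psi s) * K)).
    have dc : is_derive (psi s) 1 (@cos R) (- sin (psi s)) by exact: is_derive_cos.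
    by apply: is_deriveZ; exact: is_derive1_comp.
  have near : exists2 del : R, 0 < del & forall t : R, `|t - s| < del -> tangent gamma t = (- sin (psi t), e * cos (psi t)).
    have ls : 0 < l - s by rewrite subr_gt0.
    have [m m0 [m1 m2 _]] := min3_gt0 s0 ls ls; exists m => // t; rewrite ltr_norml => /andP[k1 k2].
    by apply: ht; flra m1 m2 k1 k2.
  rewrite (derive1_plane near i1 i2) /enorm /=.
  have -> : (- (cos (psi s) * K)) ^+ 2 + (e * (- sin (psi s) * K)) ^+ 2 = K ^+ 2 * (cos (psi s) ^+ 2 + (e * e) * sin (psi s) ^+ 2) by ring.
  have -> : e * e = 1 by case/orP: he => /eqP ->; rewrite ?mulr1 // mulrNN mulr1.
  by rewrite mul1r cos2Dsin2 mulr1 sqrtr_sqr ger0_norm // ltW.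
have mq : measurable_fun [set: R] (fun s => (M3 * q s)%:E).
  apply/measurable_EFinP; apply: continuous_measurable_fun => s.
  by apply: cvgM; [exact: cvg_cst|exact: cq].
have -> : ((2 * r * k%:R * M3)%:E = \int[lebesgue_measure]_(s in `]0%R, l[) (M3 * q s)%:E)%E.
  rewrite integral_itv_obnd_cbnd; last exact: measurable_funTS.
  rewrite integral_itv_bndo_bndc; last exact: measurable_funTS.
  transitivity (M3%:E * \int[lebesgue_measure]_(s in `[0%R, l]) (q s)%:E)%E; last first.
    rewrite -ge0_integralZl //.
    - apply: measurable_funTS; apply/measurable_EFinP; exact: continuous_measurable_fun.
    - by move=> s _; rewrite lee_fin ltW.
    - by rewrite lee_fin ltW.
  by rewrite Iq -EFinM mulrC.
rewrite integral_mkcond [leRHS]integral_mkcond; apply: le_integral_nonneg.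
  move=> s _; rewrite patchE; case: ifP => // _; by rewrite lee_fin mulr_ge0 // ltW.
move=> s _; rewrite !patchE; case: ifPn => [|_]; last first.
  by case: ifP => // _; rewrite lee_fin powR_ge0.
rewrite inE /= in_itv /= => /andP[s0 sl].
rewrite mem_set /= ?in_itv /= ?(ltW s0) ?(ltW sl) //.
have k0 : 0 <= A * B * q s ^+ 3.
  by have [_ _ _ A0 B0 _ _ _ _] := hp; rewrite !mulr_ge0 // ?ltW // exprn_gt0.
rewrite kE // lee_fin; have [c0 cE] := powR_third k0.
have mq0 : 0 <= M3 * q s by rewrite mulr_ge0 // ltW.
by rewrite -(@ler_pXn2r _ 3) ?nnegrE // cE exprMn ME.
Qed.

(** The transport of the body to itself is the identity. Hence S is the
    potential of the support function, for which H = ze cos phi - N q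
    integrates to the total increment of V minus that of N u. *)
Lemma refbody_area (l a b : R) (x y psi bot top Fb Ft : R -> R) :
  ccw (refbody al A B ze) l x y psi -> body (refbody al A B ze) a b bot top Fb Ft ->
  2 * (Ft b - Fb b) = 2 * ze * sin al * q0 * k%:R - 2 * r * k%:R * (A * B).
Proof.
move=> H HD; have [_ _ r0 A0 B0 q00 hA _ _] := hp; have [w1 w2] := ww_al hp; have [a1 _ _] := al_bounds hp.
pose S := Spot x y psi a b a b Fb Ft Fb Ft.
pose V t := Vj ze q0 al (sec al (psi t)) (x t) (y t).
pose u t := uu r al A B (psi t).
have vE t : 0 <= t -> t <= l -> V t = ze * A * sinh (ww A B (ph al (psi t))) + 2 * ze * sin al * q0 * (sec al (psi t))%:~R.
  move=> t0 tl; have [_ X Y] := tight_at hp H t0 tl; rewrite /V /Vj X Y /ax /ay.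
  set c := cos _; set s := sin (2 * al * _); set w := ww _ _ _.
  have cs : c ^+ 2 + s ^+ 2 = 1 := cos2Dsin2 _.
  have -> : ze * (c * (aP B ze w * s + A * sinh w * c) - s * (aP B ze w * c - A * sinh w * s)) = ze * A * sinh w * (c ^+ 2 + s ^+ 2) by ring.
  by rewrite cs mulr1.
have cV : continuous (fun z => ze * A * sinh (ww A B (ph al z)) + 2 * ze * sin al * q0 * (sec al z)%:~R).
  apply: (@sector_paste _ al (fun j phi => ze * A * sinh (ww A B phi) + 2 * ze * sin al * q0 * j%:~R)) => //.
    move=> j phi h1 h2; apply: cvgD; last exact: cvg_cst.
    apply: cvgM; first exact: cvg_cst.
    apply: (@continuous_comp _ _ _ (ww A B) (@sinh R)); first exact: (ww_continuous hp).
    have i1 := is_derive_sinh (ww A B phi).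
    by apply: differentiable_continuous; apply/derivable1_diffP; case: i1.
  by move=> j; rewrite w1 w2 sinhN intrD mulr1z mulrN -!mulrA hA; ring.
have lpsi (F : R -> R) s : continuous F -> 0 < s -> s <= l -> lcont (fun t => F (psi t)) s.
  move=> cF s0 sl e e0; have cu : {for psi s, continuous F} by exact: cF.
  have [d d0 hd] := (continuous_epsP _ _).1 cu e e0.
  have d2 : 0 < d / 2 by rewrite divr_gt0.
  have [d' d'0 hd'] := psi_left hp H s0 sl d2; exists d' => // t t0 t1 t2.
  by apply/ltW/hd; apply: le_lt_trans (hd' t t0 t1 t2) _; lra.
(* a potential with zero derivative *)
pose T t := V t + ((-1) * S t + (- (A * B)) * u t).
have l0 := cc_l H.
have E : T 0 = T l.
  apply: (@rder0_cst _ T 0 l) => //; last by rewrite ltW.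
    move=> s /andP[s0 sl]; rewrite /T.
    have [tg _ _] := tight_at hp H s0 (ltW sl).
    have gs := graph_sin H HD s0 (ltW sl).
    have dS := rder_Spot H HD HD s0 sl; rewrite (cx_self x HD) /cy (cx_self x HD) gs tg in dS.
    have -> : 0 = ze * cos (ph al (psi s)) + (-1 * Hs A B ze (ph al (psi s)) + - (A * B) * qq A B (ph al (psi s))) by rewrite /Hs; ring.
    apply: rderD; first exact: (Vj_rder hp H s0 sl).
    by apply: rderD; apply: rderZ; [exact: dS|exact: (rder_uu hp H s0 sl)].
  move=> s /andP[s0 sl]; apply: lcontD; last first.
    apply: lcontD; apply: lcontZ; first exact: (left_Spot H HD HD s0 sl).
    by apply: lpsi => //; exact: (uu_continuous hp).
  move=> e e0; have [d d0 hd] := lpsi _ s cV s0 sl e e0; exists d => // t t0 t1 t2.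
  by rewrite !vE ?(ltW s0) //; [exact: hd|lra].
have tV := Vj_turn hp H; rewrite -/(V l) -/(V 0) in tV.
have := turn_Spot a b a b Fb Ft Fb Ft H; rewrite -/S (ratio_self HD) mul1r invr1 mul1r => tS.
have tu : u l - u 0 = 2 * r * k%:R by rewrite /u (cc_turn H) (uu_period hp) addrC addKr.
move: E tV tS tu; rewrite /T => E tV tS tu.
rewrite -tu -tV; have -> : 2 * (Ft b - Fb b) = S l - S 0 by rewrite tS; ring.
lra.
Qed.

End ReferenceMeasures.

(** * Curves of unit speed and the arc length of the reference arcs *)

Section UnitSpeed.
Context {R : realType}.

Lemma derive_nondecreasing (F f : R -> R) (a b : R) :
  (forall t : R, a <= t <= b -> is_derive t 1 F (f t)) -> (forall t : R, a <= t <= b -> 0 <= f t) ->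
  forall s t : R, a <= s -> s <= t -> t <= b -> F s <= F t.
Proof.
move=> dF f0; apply: (@dini_nondecreasing _ F a b).
  move=> s /andP[s1 s2] e e0; have hs : a <= s <= b by rewrite s1 ltW.
  have [d d0 hd] := is_derive_eps (dF s hs) e0; exists d => // h h0 hh.
  have := hd h; rewrite gtr0_norm // => /(_ hh); rewrite ler_norml => /andP[k1 _].
  have : 0 <= f s * h by rewrite mulr_ge0 ?f0 // ltW.
  by flra k1.
move=> s /andP[s1 s2] e e0; have hs : a <= s <= b by rewrite s2 ltW.
have cF : {for s, continuous F}.
  by have [k _] := dF s hs; apply: differentiable_continuous; apply/derivable1_diffP.
have [d d0 hd] := (continuous_epsP _ _).1 cF e e0; exists d => // t t0 t1 t2.
have : `|t - s| < d by rewrite ltr0_norm; lra.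
by move=> /hd; rewrite ltr_norml; lra.
Qed.

Lemma rder_nondecreasing (f g : R -> R) (a b : R) : 0 <= a ->
  (forall s : R, a <= s -> s < b -> rder f s (g s)) -> (forall s : R, a < s -> s <= b -> lcont f s) ->
  (forall s : R, a <= s -> s < b -> 0 <= g s) -> a <= b -> f a <= f b.
Proof.
move=> a0 df lf g0 ab; apply: (@dini_nondecreasing _ f a b) => //.
  move=> s /andP[s1 s2] e e0; have [d d0 hd] := df s s1 s2 e e0; exists d => // h h0 hh.
  have := hd h h0 hh; rewrite ler_norml => /andP[k1 _].
  have : 0 <= g s * h by rewrite mulr_ge0 ?g0 // ltW.
  by flra k1.
move=> s /andP[s1 s2] e e0; have [d d0 hd] := lf s s1 s2 e e0; exists d => // t t0 t1 t2.
by have := hd t (le_trans a0 t0) t1 t2; rewrite ler_norml; lra.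
Qed.

Fixpoint steps (a d : R) (n : nat) : seq R := if n is n'.+1 then (a + d) :: steps (a + d) d n' else [::].

Lemma steps_partition a d n : 0 < d -> itv_partition a (a + d * n%:R) (steps a d n).
Proof.
move=> d0; elim: n a => [|n ih] a /=; first by split=> //=; rewrite mulr0 addr0.
have [p l] := ih (a + d); split=> /=; first by rewrite ltrDl d0.
by rewrite -natr1 (eqP l); apply/eqP; ring.
Qed.

Lemma chain_steps (gamma : R -> plane R) (c a d : R) n : 0 < d -> 0 <= a ->
  (forall s : R, a <= s -> s < a + d * n%:R -> c * d <= enorm (gamma (s + d) - gamma s)) ->
  c * d * n%:R <= chain_length gamma a (steps a d n).
Proof.
move=> d0; elim: n a => [|n ih] a a0 h /=; first by rewrite mulr0.
have n0 : 0 <= n%:R :> R by [].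
have dn : 0 <= d * n%:R by rewrite mulr_ge0 // ltW.
rewrite -natr1 mulrDr mulr1 addrC; apply: lerD.
  by apply: h => //; rewrite -natr1; flra d0 dn.
apply: ih; first by rewrite addr_ge0 // ltW.
by move=> s s1 s2; apply: h; [flra s1 d0|rewrite -natr1; flra s2].
Qed.

(** Chords are never longer than the parameter interval; and on a subdivision
    into n steps each chord is longer than cos (K t / n) times its step. *)
Lemma unit_speed (gx gy psi : R -> R) (K : R) : 0 < K ->
  (forall s : R, 0 <= s -> rder gx s (- sin (psi s)) /\ rder gy s (cos (psi s))) ->
  continuous gx -> continuous gy ->
  (forall s t : R, 0 <= s -> s <= t -> psi s <= psi t /\ psi t - psi s <= K * (t - s)) ->
  forall t : R, 0 <= t -> curve_length (fun s => (gx s, gy s) : plane R) 0 t = t%:E.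
Proof.
move=> K0 dg cx cy hpsi t t0; pose gamma (s : R) : plane R := (gx s, gy s).
have dv (a b s : R) : 0 <= s -> rder (fun u => a * gx u + b * gy u) s (a * - sin (psi s) + b * cos (psi s)).
  by move=> s0; have [h1 h2] := dg s s0; apply: rderD; apply: rderZ.
have cv (a b s : R) : lcont (fun u => a * gx u + b * gy u) s.
  by apply: lcontD; apply: lcontZ; apply: lcont_continuous; [exact: cx|exact: cy].
have upper u v : 0 <= u -> u <= v -> enorm (gamma v - gamma u) <= v - u.
  move=> u0 uv; set n := enorm _.
  have [n0|n0] := ltP 0 n; last by apply: le_trans n0 _; rewrite subr_ge0.
  pose a : R := (gx v - gx u) / n; pose b : R := (gy v - gy u) / n.
  have nE : n ^+ 2 = (gx v - gx u) ^+ 2 + (gy v - gy u) ^+ 2 by exact: enorm_sq.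
  have ab1 : a ^+ 2 + b ^+ 2 = 1 by rewrite !expr_div_n -mulrDl -nE divff // gt_eqF // exprn_gt0.
  have := @rder_nondecreasing (fun w => w + ((- a) * gx w + (- b) * gy w)) (fun w => 1 + ((- a) * - sin (psi w) + (- b) * cos (psi w))) u v u0.
  have -> : (u + (- a * gx u + - b * gy u) <= v + (- a * gx v + - b * gy v)) = (n <= v - u).
    have -> : n = a * (gx v - gx u) + b * (gy v - gy u).
      have -> : a * (gx v - gx u) + b * (gy v - gy u) = n ^+ 2 / n by rewrite nE /a /b; ring.
      by rewrite expr2 mulfK // gt_eqF.
    by apply/idP/idP; flra ab1.
  apply=> //.
  - move=> s us sv; apply: rderD; last by apply: dv; exact: le_trans us.
    move=> e e0; exists 1 => // h h0 _; have -> : s + h - s - 1 * h = 0 by ring.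
    by rewrite normr0 mulr_ge0 // ltW.
  - move=> s us sv; apply: lcontD; last exact: cv.
    by apply: lcont_continuous; exact: cvg_id.
  - move=> s us sv; have cs := cos2Dsin2 (psi s).
    move: (cos _) (sin _) cs => c d cs.
    have : 0 <= (a - d) ^+ 2 + (b + c) ^+ 2 by rewrite addr_ge0 ?sqr_ge0.
    have : 0 <= (a + d) ^+ 2 + (b - c) ^+ 2 by rewrite addr_ge0 ?sqr_ge0.
    by flra cs ab1.
have lower u v e : 0 <= u -> u <= v -> 0 <= e -> e <= pi -> psi v - psi u <= e -> cos e * (v - u) <= enorm (gamma v - gamma u).
  move=> u0 uv e0 epi he; pose a := - sin (psi u); pose b := cos (psi u).
  have h1 : cos e * (v - u) <= a * (gx v - gx u) + b * (gy v - gy u).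
    have := @rder_nondecreasing (fun w => (a * gx w + b * gy w) + (- cos e) * w) (fun w => (a * - sin (psi w) + b * cos (psi w)) + (- cos e) * 1) u v u0.
    have -> : (a * gx u + b * gy u + - cos e * u <= a * gx v + b * gy v + - cos e * v) = (cos e * (v - u) <= a * (gx v - gx u) + b * (gy v - gy u)).
      by apply/idP/idP; flra he.
    apply=> //.
    - move=> s us sv; apply: rderD; first by apply: dv; exact: le_trans us.
      apply: rderZ; move=> f f0; exists 1 => // h h0 _; have -> : s + h - s - 1 * h = 0 by ring.
      by rewrite normr0 mulr_ge0 // ltW.
    - move=> s us sv; apply: lcontD; first exact: cv.
      by apply: lcontZ; apply: lcont_continuous; exact: cvg_id.
    - move=> s us sv; have [m1 _] := hpsi u s u0 us; have [m2 _] := hpsi s v (le_trans u0 us) (ltW sv).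
      have -> : a * - sin (psi s) + b * cos (psi s) + - cos e * 1 = cos (psi s - psi u) - cos e by rewrite /a /b cosB; ring.
      rewrite subr_ge0 leNgt ltr_cos ?in_itv /= -?leNgt ?e0 ?epi //; first by flra he m2.
      by apply/andP; split; [flra m1|flra he m2 epi].
  apply: le_trans h1 _; set p := gx v - gx u; set q := gy v - gy u.
  apply: le_trans (ler_norm _) _; rewrite -(@ler_pXn2r _ 2) ?nnegrE ?enorm_ge0 // -normrX ger0_norm ?sqr_ge0 //.
  rewrite enorm_sq /= -/p -/q.
  have cs : a ^+ 2 + b ^+ 2 = 1 by rewrite /a /b sqrrN addrC cos2Dsin2.
  have -> : p ^+ 2 + q ^+ 2 = (a ^+ 2 + b ^+ 2) * (p ^+ 2 + q ^+ 2) by rewrite cs mul1r.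
  rewrite -subr_ge0.
  have -> : (a ^+ 2 + b ^+ 2) * (p ^+ 2 + q ^+ 2) - (a * p + b * q) ^+ 2 = (a * q - b * p) ^+ 2 by ring.
  exact: sqr_ge0.
apply/eqP; rewrite eq_le; apply/andP; split.
  apply: curve_length_le => p [pp /eqP pl].
  have := @chain_length_le _ gamma id 0 t p _ pp; rewrite pl subr0; apply => //.
  by move=> u v u0 uv _; apply: upper => //; exact: ltW.
have [t00|tn0] := eqVneq t 0.
  rewrite t00; have := @curve_length_ge _ gamma 0 0 [::]; apply; split=> //=.
have {tn0} t0 : 0 < t by rewrite lt_neqAle eq_sym tn0.
apply/lee_addgt0Pr => d d0.
have dt : 0 < d / t by rewrite divr_gt0.
have c0 : {for (0 : R), continuous (@cos R)} by exact: continuous_cos.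
have [m m0 hm] := (continuous_epsP _ _).1 c0 _ dt.
have [e e0 [e1 e2 _]] := min3_gt0 m0 (pi_gt0 R) m0.
have eh : 0 < e / 2 by rewrite divr_gt0.
have cose : 1 - d / t <= cos (e / 2).
  have := hm (e / 2); rewrite subr0 gtr0_norm // cos0 => /(_ _); rewrite ltr_norml => k.
  have : e / 2 < m by flra e0 e1.
  by move=> /k/andP[k1 _]; flra k1.
have [n hn] : exists n : nat, K * t / (e / 2) < n.+1%:R.
  have := archi_boundP (x := K * t / (e / 2)); set n := Num.bound _ => h.
  exists n; apply: lt_trans (h _) _; last by rewrite ltr_nat.
  by rewrite divr_ge0 ?mulr_ge0 // ltW.
(* n is so large that the angle varies by at most e / 2 along a step *)
pose de := t / n.+1%:R; have de0 : 0 < de by rewrite divr_gt0.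
have dn : de * n.+1%:R = t by rewrite /de divfK // pnatr_eq0.
have Kde : K * de <= e / 2.
  move: (ltW hn); rewrite ler_pdivrMr // => hn'; rewrite /de mulrA ler_pdivrMr //.
  by rewrite (mulrC (e / 2)).
have ch := @chain_steps gamma (cos (e / 2)) 0 de n.+1 de0 (lexx 0).
have step : forall s : R, 0 <= s -> s < 0 + de * n.+1%:R -> cos (e / 2) * de <= enorm (gamma (s + de) - gamma s).
  move=> s s0 _; have s1 : s <= s + de by rewrite lerDl ltW.
  have [_ k2] := hpsi s (s + de) s0 s1.
  have E : s + de - s = de by rewrite addrC addKr.
  rewrite E in k2.
  have := @lower s (s + de) (e / 2) s0 s1 (ltW eh) _ (le_trans k2 Kde).
  by rewrite E; apply; flra e0 e2.
have {ch} ch := ch step; rewrite -mulrA dn in ch.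
have hp := @steps_partition 0 de n.+1 de0; rewrite add0r dn in hp.
have := leeD2r d%:E (curve_length_ge gamma hp); rewrite -EFinD.
apply: le_trans; rewrite lee_fin.
have : (1 - d / t) * t <= cos (e / 2) * t by rewrite ler_pM2r.
have -> : (1 - d / t) * t = t - d by field; rewrite gt_eqF.
by flra ch.
Qed.

End UnitSpeed.

Section ReferenceParam.
Context {R : realType}.
Variables (k : nat) (r al A B ze q0 : R).
Hypothesis hp : refpar k r al A B ze q0.

(** If two normals at a point both support then so do all normals between
    them, and they would share their support point, contrary to tight_unique
    and the injectivity of the arcs. *)
Lemma one_normal (u v be be' : R) : refbody al A B ze u v ->
  u * cos be + v * sin be = Hs A B ze (ph al be) -> u * cos be' + v * sin be' = Hs A B ze (ph al be') ->
  be < be' -> be' < be + pi -> False.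
Proof.
move=> huv t1 t2 b1 b2; have [a1 _ _] := al_bounds hp; have pi0 := pi_gt0 R.
have mid b : be <= b -> b <= be' -> forall p q, refbody al A B ze p q -> (p - u) * cos b + (q - v) * sin b <= 0.
  move=> h1 h2 p q hpq.
  have k1 := refbody_dir hp be hpq; have k2 := refbody_dir hp be' hpq.
  have s0 : 0 < sin (be' - be) by apply: sin_gt0_pi; apply/andP; split; lra.
  have s1 : 0 <= sin (be' - b) by apply: sin_ge0_pi; apply/andP; split; flra b2 h1 h2 k2.
  have s2 : 0 <= sin (b - be) by apply: sin_ge0_pi; apply/andP; split; lra.
  rewrite -(pmulr_rle0 _ s0).
  have -> : sin (be' - be) * ((p - u) * cos b + (q - v) * sin b) =
     sin (be' - b) * ((p - u) * cos be + (q - v) * sin be) + sin (b - be) * ((p - u) * cos be' + (q - v) * sin be').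
    have id1 : sin (be' - be) * cos b = sin (be' - b) * cos be + sin (b - be) * cos be' .
      by rewrite !sinB; have c2 := cos2Dsin2 b; set c := cos b in c2 *; set s := sin b in c2 *; ring.
    have id2 : sin (be' - be) * sin b = sin (be' - b) * sin be + sin (b - be) * sin be'.
      by rewrite !sinB; ring.
    have -> : sin (be' - be) * ((p - u) * cos b + (q - v) * sin b) = (p - u) * (sin (be' - be) * cos b) + (q - v) * (sin (be' - be) * sin b) by ring.
    by rewrite id1 id2; ring.
  have h3 : sin (be' - b) * ((p - u) * cos be + (q - v) * sin be) <= 0 by rewrite mulr_ge0_le0 //; lra.
  have h4 : sin (b - be) * ((p - u) * cos be' + (q - v) * sin be') <= 0 by rewrite mulr_ge0_le0 //; lra.
  lra.
have arc b : be <= b -> b <= be' -> - al <= b - 2 * al * (sec al be)%:~R -> b - 2 * al * (sec al be)%:~R <= al ->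
    u = ax al A B ze (sec al be) (ww A B (b - 2 * al * (sec al be)%:~R)) /\
    v = ay al A B ze (sec al be) (ww A B (b - 2 * al * (sec al be)%:~R)).
  move=> h1 h2 h3 h4; set phi := b - _ in h3 h4 *.
  have h : - al <= phi <= al by rewrite h3.
  have wr : `|ww A B phi| <= r by rewrite ler_norml; exact: ww_range hp _ h.
  have bE : 2 * al * (sec al be)%:~R + phi = b by rewrite /phi addrC subrK.
  apply: (tight_unique hp huv h3 h4).
  have := mid b h1 h2 _ _ (arc_in_refbody hp (sec al be) wr).
  have := arc_tight hp (sec al be) wr; rewrite (fi_ww hp h3 h4) bE => tx.
  have := huv (sec al be) phi h3 h4; rewrite bE => h5 h6.
  by apply/eqP; rewrite eq_le h5 /=; flra tx h6.
have /andP[p1 p2] := ph_range hp be; rewrite /ph in p1 p2.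
have d1 : 0 < be' - be by lra. have d2 : 0 < al - (be - 2 * al * (sec al be)%:~R) by lra.
have [m m0 [m1 m2 _]] := min3_gt0 d1 d2 d1.
have [X1 Y1] := arc be (lexx _) (ltW b1) p1 (ltW p2).
have g1 : be <= be + m by flra d1 d2 m0. have g2 : be + m <= be' by flra d2 m0 m1.
have g3 : - al <= be + m - 2 * al * (sec al be)%:~R by flra p1 Y1 g1.
have g4 : be + m - 2 * al * (sec al be)%:~R <= al by flra m1 m2 g3.
have [X2 Y2] := arc (be + m) g1 g2 g3 g4.
have := arc_inj hp (etrans (esym X1) X2) (etrans (esym Y1) Y2).
move=> /(congr1 (fi A B)); rewrite !(fi_ww hp) //; flra m0 m1 m2.
Qed.

(** The speed of the arc with respect to its hyperbolic parameter. *)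
Definition speed (w : R) : R := Num.sqrt (A ^+ 2 * cosh w ^+ 2 + B ^+ 2 * sinh w ^+ 2).

Lemma speed_qq w : `|w| <= r -> speed w * qq A B (fi A B w) = 1.
Proof.
move=> hw; have [f1 f2] := fi_range hp hw; have h : - al <= fi A B w <= al by rewrite f1.
have [e1 e2] := qq_cosh hp h; rewrite (ww_fi hp hw) in e1 e2; have q1 := qq_gt0 hp h.
set q := qq A B (fi A B w) in e1 e2 q1 *.
have s0 : 0 <= speed w := sqrtr_ge0 _.
have : (speed w * q) ^+ 2 = 1.
  rewrite exprMn sqr_sqrtr; last by rewrite addr_ge0 // -exprMn sqr_ge0.
  by rewrite -(cos2Dsin2 (fi A B w)) e1 e2; ring.
move=> /eqP; rewrite sqrf_eq1 => /orP[/eqP //|/eqP E].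
have : 0 <= speed w * q by rewrite mulr_ge0 // ltW.
by rewrite E; lra.
Qed.

Lemma speed_ge w : A <= speed w.
Proof.
have [_ _ _ A0 _ _ _ _ _] := hp.
rewrite -(@ler_pXn2r _ 2) ?nnegrE ?sqrtr_ge0 ?(ltW A0) // sqr_sqrtr; last by rewrite addr_ge0 // -exprMn sqr_ge0.
have h1 := cosh_sq w; have h2 := sqr_ge0 (A * sinh w); have h3 := sqr_ge0 (B * sinh w).
move: (cosh w) (sinh w) h1 h2 h3 => c s h1 h2 h3.
have -> : A ^+ 2 * c ^+ 2 = A ^+ 2 + (A * s) ^+ 2.
  have -> : c ^+ 2 = 1 + s ^+ 2 by lra.
  by ring.
rewrite exprMn in h3; lra.
Qed.

Lemma speed_continuous : continuous speed.
Proof.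
move=> w; have i1 := is_derive_sinh w; have i2 := is_derive_cosh w.
have c1 : {for w, continuous (@sinh R)} by apply: differentiable_continuous; apply/derivable1_diffP; case: i1.
have c2 : {for w, continuous (@cosh R)} by apply: differentiable_continuous; apply/derivable1_diffP; case: i2.
apply: (@continuous_comp _ _ _ (fun w => A ^+ 2 * cosh w ^+ 2 + B ^+ 2 * sinh w ^+ 2) (@Num.sqrt R)); last exact: sqrt_continuous.
have cc : {for w, continuous (fun t => cosh t ^+ 2)} by exact: (cvg_comp _ _ c2 (@exprn_continuous _ 2 _)).
have cs : {for w, continuous (fun t => sinh t ^+ 2)} by exact: (cvg_comp _ _ c1 (@exprn_continuous _ 2 _)).
by apply: cvgD; apply: cvgM; try exact: cvg_cst; [exact: cc|exact: cs].
Qed.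

(** The arc length as a function of w is an antiderivative of the speed, which
    is at least A; invert it by the intermediate value theorem. *)
Lemma arc_length_inverse : exists (h : R) (sg : R -> R), [/\ 0 < h, continuous sg, sg (- h) = - r /\ sg h = r,
  forall s : R, `|sg s| <= r &
  [/\ forall s t : R, - h <= s -> s < t -> t <= h -> sg s < sg t,
   forall w : R, `|w| <= r -> exists2 s : R, - h <= s <= h & sg s = w &
   forall s : R, - h <= s -> s < h -> rder sg s (qq A B (fi A B (sg s)))]].
Proof.
have [_ _ r0 A0 _ _ _ _ _] := hp; have nr : - r < r by lra.
have [G0 [dG _]] := antiderivative nr speed_continuous.
(* center the antiderivative, so that the midpoint of the arc has arc length 0 *)
pose c : R := (G0 r + G0 (- r)) / 2; pose G w := G0 w - c; pose h : R := (G0 r - G0 (- r)) / 2.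
have dG' w : - r <= w <= r -> is_derive w 1 G (speed w).
  by move=> hw; have d1 := dG w hw; have := is_deriveB d1 (is_derive_cst c w 1); rewrite subr0.
have GL v w : - r <= v -> v <= w -> w <= r -> A * (w - v) <= G w - G v.
  move=> h1 h2 h3; have := @derive_nondecreasing _ (fun t => G t - A * t) (fun t => speed t - A * 1) (- r) r _ _ v w h1 h2 h3.
  have -> : (G v - A * v <= G w - A * w) = (A * (w - v) <= G w - G v) by apply/idP/idP; lra.
  apply.
    move=> t ht; have d1 := dG' t ht; have d2 : is_derive t 1 (fun u : R => A * u) (A * 1) by apply: is_deriveZ; exact: is_derive_id.
    exact: is_deriveB.
  by move=> t _; rewrite mulr1 subr_ge0; exact: speed_ge.
have Gr : G r = h /\ G (- r) = - h by rewrite /G /c /h; split; field.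
have h0 : 0 < h.
  have := GL (- r) r (lexx _) (ltW nr) (lexx _); have [-> ->] := Gr.
  have : 0 < A * (r - - r) by rewrite mulr_gt0 //; lra.
  lra.
have cG : {within `[- r, r], continuous G}.
  apply: (@continuous_in_subspaceT _ _ `[- r, r] G) => w; rewrite inE /= in_itv /= => hw.
  by have [k1 _] := dG' w hw; apply: differentiable_continuous; apply/derivable1_diffP.
have ex s : exists w, - h <= s -> s <= h -> - r <= w <= r /\ G w = s.
  have [/andP[s1 s2]|ns] := boolP (- h <= s <= h); last by exists 0 => s1 s2; move: ns; rewrite s1 s2.
  have [] := IVT (ltW nr) cG (v := s).
    by have [-> ->] := Gr; rewrite ge_min le_max s1 s2 orbT.
  by move=> w; rewrite in_itv /= => hw E; exists w.
have [sg0 hsg] := choice ex.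
have lip s t : - h <= s -> s <= t -> t <= h -> A * `|sg0 t - sg0 s| <= t - s /\ sg0 s <= sg0 t.
  move=> s1 st t1; have [|/andP[a1 a2] E1] := hsg s s1; first lra.
  have [||/andP[b1 b2] E2] := hsg t; [lra|by []|].
  have [le|lt] := leP (sg0 s) (sg0 t).
    by rewrite ger0_norm ?subr_ge0 //; split=> //; have := GL _ _ a1 le b2; rewrite E1 E2.
  have := GL _ _ b1 (ltW lt) a2; rewrite E1 E2 => k1.
  have : 0 < A * (sg0 s - sg0 t) by rewrite mulr_gt0 // subr_gt0.
  flra st lt k1.
pose sg s := sg0 (- h + clamp (h - - h) (s - - h)).
have hh : - h < h by lra.
have idc s : - h <= s -> s <= h -> - h + clamp (h - - h) (s - - h) = s.
  by move=> s1 s2; rewrite clamp_id; flra hh s1 s2.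
have sgE s : - h <= s -> s <= h -> sg s = sg0 s by move=> s1 s2; rewrite /sg idc.
have csg : continuous sg.
  apply: (@clamp_continuous _ (- h) h sg0 hh) => u u1 u2 e e0; exists (A * e); first exact: mulr_gt0.
  move=> u' v1 v2 hu; rewrite -(ltr_pM2l A0); apply: le_lt_trans hu.
  have [le|/ltW le] := leP u u'.
    by have [k1 _] := lip u u' u1 le v2; apply: le_trans k1 _; exact: ler_norm.
  by have [k1 _] := lip u' u v1 le u2; rewrite distrC; apply: le_trans k1 _; rewrite distrC; exact: ler_norm.
have Gsg s : - h <= s -> s <= h -> - r <= sg s <= r /\ G (sg s) = s.
  by move=> s1 s2; rewrite sgE //; exact: hsg.
have Ginj v w : - r <= v <= r -> - r <= w <= r -> G v = G w -> v = w.
  move=> /andP[v1 v2] /andP[w1 w2] E; have [lt|lt|//] := ltgtP v w.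
    have := GL _ _ v1 (ltW lt) w2; rewrite E subrr; have : 0 < A * (w - v) by rewrite mulr_gt0 // subr_gt0.
    lra.
  have := GL _ _ w1 (ltW lt) v2; rewrite E subrr; have : 0 < A * (v - w) by rewrite mulr_gt0 // subr_gt0.
  flra E.
have rr1 : - r <= r <= r by rewrite lexx andbT ltW.
have rr2 : - r <= - r <= r by rewrite lexx ltW.
exists h, sg; split=> //.
- have [k1 k2] := Gsg (- h) (lexx _) (ltW hh); have [k3 k4] := Gsg h (ltW hh) (lexx _).
  by split; apply: Ginj => //; [rewrite k2 Gr.2|rewrite k4 Gr.1].
- move=> s; rewrite /sg; set s' := _ + _.
  have p0 : 0 < h - - h by flra h0 hh rr1 rr2.
  have /andP[c1 c2] := clamp_itv (s - - h) p0.
  have [||k1 _] := hsg s'; [by rewrite /s'; flra p0 c1 c2|by rewrite /s'; flra p0 c1 c2|].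
  by rewrite ler_norml.
split.
- move=> s t s1 st t1; have [|k1 k2] := Gsg s s1; first lra. have [||k3 k4] := Gsg t; [flra s1 st|by []|].
  have [_ le] := lip s t s1 (ltW st) t1.
  have s2 : s <= h by flra st t1.
  have t0 : - h <= t by flra s1 st.
  rewrite lt_neqAle (sgE s s1 s2) (sgE t t0 t1) le andbT; apply/eqP => E.
  by move: k2 k4; rewrite (sgE s s1 s2) (sgE t t0 t1) E => -> k4; move: st; rewrite k4 ltxx.
- move=> w; rewrite ler_norml => hw; have /andP[w1 w2] := hw.
  have g1 := GL _ _ (lexx _) w1 w2; have g2 := GL _ _ w1 w2 (lexx _).
  have k1 : 0 <= A * (w - - r) by rewrite mulr_ge0 ?(ltW A0) // subr_ge0.
  have k2 : 0 <= A * (r - w) by rewrite mulr_ge0 ?(ltW A0) // subr_ge0.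
  have [G1 G2] := Gr; have a1 : - h <= G w by flra Gr g1 k1. have a2 : G w <= h by flra g2 k2 G1.
  exists (G w); first by rewrite a1.
  by have [k3 k4] := Gsg _ a1 a2; apply: Ginj.
- move=> s s1 s2; have [|hw Es] := Gsg s s1; first lra.
  have wr : `|sg s| <= r by rewrite ler_norml.
  have sq := speed_qq wr; set q := qq _ _ _ in sq *.
  have q0' : 0 < q by have [f1 f2] := fi_range hp wr; apply: (qq_gt0 hp); rewrite f1.
  move=> e e0; have e1 : 0 < e * A / q by rewrite divr_gt0 // mulr_gt0.
  have [d d0 hd] := is_derive_eps (dG' _ hw) e1.
  have hs : 0 < h - s by rewrite subr_gt0.
  have dA : 0 < A * d by rewrite mulr_gt0.
  have [m m0 [m1 m2 _]] := min3_gt0 hs dA dA; exists m => // u u0 um.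
  have t1 : s + u <= h by flra m1 um. have t0 : - h <= s + u by flra s1 u0.
  have [hw' Et] := Gsg _ t0 t1.
  have st : s <= s + u by flra m2 u0.
  have [k1 _] := lip s (s + u) s1 st t1.
  have E : s + u - s = u by rewrite addrC addKr.
  rewrite E -(sgE s s1 (ltW s2)) -(sgE _ t0 t1) in k1.
  set de := sg (s + u) - sg s in k1 *.
  have dd : `|de| < d by rewrite -(ltr_pM2l A0); apply: le_lt_trans k1 _; lra.
  have := hd de dd; have -> : sg s + de = sg (s + u) by rewrite /de addrC subrK.
  rewrite Es Et => k2.
  have -> : de - q * u = - (q * (s + u - s - speed (sg s) * de)).
    have -> : q * (s + u - s - speed (sg s) * de) = q * u - (speed (sg s) * q) * de by ring.
    by rewrite sq; ring.
  rewrite normrN normrM (gtr0_norm q0').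
  have k3 : q * `|s + u - s - speed (sg s) * de| <= q * (e * A / q * `|de|) by rewrite ler_pM2l.
  apply: le_trans k3 _; have -> : q * (e * A / q * `|de|) = e * (A * `|de|) by field; rewrite gt_eqF.
  by rewrite ler_pM2l.
Qed.

End ReferenceParam.

(** * An arc-length parametrization of the reference body *)

Section Sectors.
Context {R : realType}.
Variable h : R.
Hypothesis h0 : 0 < h.

Lemma rder_id (s : R) : rder (fun t => t) s 1.
Proof.
move=> e e0; exists 1 => // t t0 _; have -> : s + t - s - 1 * t = 0 by ring.
by rewrite normr0 mulr_ge0 // ltW.
Qed.

Lemma sec_shift (s : R) (n : int) : sec h (s + 2 * h * n%:~R) = sec h s + n.
Proof.
have h2 : 0 < 2 * h by rewrite mulr_gt0.
rewrite /sec; have -> : (s + 2 * h * n%:~R + h) / (2 * h) = (s + h) / (2 * h) + n%:~R.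
  field; by rewrite gt_eqF.
by rewrite floorDrz ?intr_int // intrKfloor.
Qed.

Lemma ph_shift (s : R) (n : int) : ph h (s + 2 * h * n%:~R) = ph h s.
Proof. by rewrite /ph sec_shift intrD; ring. Qed.

Lemma sector_itv (s : R) : - h <= ph h s < h.
Proof.
have h2 : 0 < 2 * h by rewrite mulr_gt0.
have /andP[f1 f2] := floor_itv ((s + h) / (2 * h)).
rewrite ler_pdivlMr // in f1; rewrite ltr_pdivrMr // intrD mulr1z in f2.
by rewrite /ph /sec; apply/andP; split; lra.
Qed.

Lemma sector_val (j : int) (t : R) : - h <= t -> t < h -> sec h (2 * h * j%:~R + t) = j /\ ph h (2 * h * j%:~R + t) = t.
Proof.
have h2 : 0 < 2 * h by rewrite mulr_gt0.
move=> t1 t2; have E : sec h (2 * h * j%:~R + t) = j.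
  apply/eqP; rewrite /sec floor_eq ler_pdivlMr // ltr_pdivrMr // intrD mulr1z.
  by apply/andP; split; lra.
by split=> //; rewrite /ph E addrC addKr.
Qed.

Lemma sector_split (s : R) : s = 2 * h * (sec h s)%:~R + ph h s.
Proof. by rewrite /ph addrC subrK. Qed.

Lemma sector_rder (F : int -> R -> R) (s g : R) : rder (F (sec h s)) (ph h s) g ->
  rder (fun s => F (sec h s) (ph h s)) s g.
Proof.
move=> dF e e0; have [d d0 hd] := dF e e0; have /andP[p1 p2] := sector_itv s.
have p3 : 0 < h - ph h s by rewrite subr_gt0.
have [m m0 [m1 m2 _]] := min3_gt0 d0 p3 p3; exists m => // t t0 tm.
have t1 : - h <= ph h s + t by lra. have t2 : ph h s + t < h by lra.
have [E1 E2] := sector_val (sec h s) t1 t2.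
have E : 2 * h * (sec h s)%:~R + (ph h s + t) = s + t by rewrite addrA -sector_split.
rewrite E in E1 E2; rewrite E1 E2; apply: hd => //; exact: lt_le_trans m1.
Qed.

End Sectors.

Section ReferenceParam.
Context {R : realType}.
Variables (k : nat) (r al A B ze q0 : R).
Hypothesis hp : refpar k r al A B ze q0.

Lemma int_lt_real (m : int) (n : nat) : (m < n%:Z)%R -> m%:~R + 1 <= n%:R :> R.
Proof. by rewrite -lezD1 -(ler_int R) intrD. Qed.

Lemma is_derive_ax (j : int) (w : R) :
  is_derive w 1 (ax al A B ze j) (- B * sinh w * cos (2 * al * j%:~R) - A * cosh w * sin (2 * al * j%:~R)) /\
  is_derive w 1 (ay al A B ze j) (- B * sinh w * sin (2 * al * j%:~R) + A * cosh w * cos (2 * al * j%:~R)).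
Proof.
have i1 := is_derive_sinh w; have i2 := is_derive_cosh w.
have dl (a b c : R) : is_derive w 1 (fun t => a + (b * cosh t + c * sinh t)) (b * sinh w + c * cosh w).
  have j2 : is_derive w 1 (fun t => b * cosh t) (b * sinh w) by exact: is_deriveZ.
  have j1 : is_derive w 1 (fun t => c * sinh t) (c * cosh w) by exact: is_deriveZ.
  have j3 : is_derive w 1 (fun t => b * cosh t + c * sinh t) (b * sinh w + c * cosh w) by exact: is_deriveD.
  by have := is_deriveD (is_derive_cst a w 1) j3; rewrite add0r.
set c := cos _; set s := sin _; split.
  have := dl (ze * c) (- B * c) (- A * s).
  have -> : (fun t => ze * c + (- B * c * cosh t + - A * s * sinh t)) = ax al A B ze j.
    by apply/funext => t; rewrite /ax /aP -/c -/s; ring.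
  have -> // : - B * c * sinh w + - A * s * cosh w = - B * sinh w * c - A * cosh w * s by ring.
have := dl (ze * s) (- B * s) (A * c).
have -> : (fun t => ze * s + (- B * s * cosh t + A * c * sinh t)) = ay al A B ze j.
  by apply/funext => t; rewrite /ay /aP -/c -/s; ring.
have -> // : - B * s * sinh w + A * c * cosh w = - B * sinh w * s + A * cosh w * c by ring.
Qed.

Lemma arc_shift (j n : int) (w : R) : ax al A B ze (j + k%:Z * n) w = ax al A B ze j w /\ ay al A B ze (j + k%:Z * n) w = ay al A B ze j w.
Proof.
have E : 2 * al * (j + k%:Z * n)%:~R = 2 * al * j%:~R + 2 * pi * n%:~R.
  by rewrite -(kal hp) !(intrD, intrM) -pmulrn; ring.
by rewrite /ax /ay E; have [-> ->] := sin_cos_2pi_int (2 * al * j%:~R : R) n.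
Qed.

(** The arcs are joined at the midpoints with a continuous normal angle, whose
    rate N q^3 is bounded, so that unit_speed applies. For injectivity, the
    normal angle is strictly increasing, and two normals at one point
    contradict one_normal, after a full turn of the smaller one if they differ
    by more than pi; they cannot be opposite since the origin is an interior
    point. *)
Lemma refset_param : exists (l : R) (gamma : R -> plane R), arc_length_param (refset al A B ze) l gamma.
Proof.
have [k3 alE r0 A0 B0 q00 hA hB hz] := hp; have [a1 a2 a3] := al_bounds hp; have pi0 := pi_gt0 R.
have [h [sg [h0 csg [sgl sgr] sgb [sgm sgs dsg]]]] := arc_length_inverse hp.
have kp := k_gt0 hp; have nh : - h < h by lra.
have rr : `|r| <= r by rewrite gtr0_norm. have rn : `|- r| <= r by rewrite normrN gtr0_norm.
have nal : - al <= al by lra.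
have fr : fi A B r = al by have [e1 _] := ww_al hp; rewrite -e1 (fi_ww hp nal).
have fnr : fi A B (- r) = - al by have [_ e1] := ww_al hp; rewrite -e1 (fi_ww hp (lexx _) nal).
pose X (j : int) (t : R) := ax al A B ze j (sg t); pose Y (j : int) (t : R) := ay al A B ze j (sg t).
pose P (j : int) (t : R) := 2 * al * j%:~R + fi A B (sg t).
pose gx s := X (sec h s) (ph h s); pose gy s := Y (sec h s) (ph h s); pose psi s := P (sec h s) (ph h s).
have dfi (w : R) : `|w| <= r -> is_derive w 1 (fi A B) (A * B * qq A B (fi A B w) ^+ 2).
  move=> hw; have [f1 f2] := fi_range hp hw.
  by have := is_derive_fi hp f1 f2; rewrite (ww_fi hp hw).
have cont (f : R -> R) (w d : R) : is_derive w 1 f d -> {for w, continuous f}.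
  by case=> D _; apply: differentiable_continuous; apply/derivable1_diffP.
have cX : continuous gx.
  apply: (@sector_paste _ h X h0).
    by move=> j t _ _; apply: (@continuous_comp _ _ _ sg (ax al A B ze j)); [exact: csg|exact: cont (is_derive_ax j (sg t)).1].
  by move=> j; rewrite /X sgl sgr; have [-> _] := arc_joint hp j.
have cY : continuous gy.
  apply: (@sector_paste _ h Y h0).
    by move=> j t _ _; apply: (@continuous_comp _ _ _ sg (ay al A B ze j)); [exact: csg|exact: cont (is_derive_ax j (sg t)).2].
  by move=> j; rewrite /Y sgl sgr; have [_ ->] := arc_joint hp j.
have cpsi : continuous psi.
  apply: (@sector_paste _ h P h0).
    move=> j t _ _; have cf : {for t, continuous (fun t => fi A B (sg t))}.
      by apply: (@continuous_comp _ _ _ sg (fi A B)); [exact: csg|exact: cont (dfi _ (sgb t))].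
    by apply: cvgD; [exact: cvg_cst|exact: cf].
  by move=> j; rewrite /P sgl sgr fr fnr intrD mulr1z; flra fr fnr.
pose q s := qq A B (fi A B (sg (ph h s))).
have q_gt0 s : 0 < q s.
  by have [f1 f2] := fi_range hp (sgb (ph h s)); apply: (qq_gt0 hp); rewrite f1.
have dsg' s : rder sg (ph h s) (q s) by have /andP[p1 p2] := sector_itv h0 s; exact: dsg.
have dX s : rder gx s (- sin (psi s)) /\ rder gy s (cos (psi s)).
  have [f1 f2] := fi_range hp (sgb (ph h s)); have hf : - al <= fi A B (sg (ph h s)) <= al by rewrite f1.
  have [e1 e2] := qq_cosh hp hf; rewrite (ww_fi hp (sgb _)) -/(q s) in e1 e2.
  have [d1 d2] := is_derive_ax (sec h s) (sg (ph h s)).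
  split; apply: sector_rder => //.
    have := rder_comp_derive d1 (dsg' s); congr rder; rewrite /psi /P sinD e1 e2; ring.
  have := rder_comp_derive d2 (dsg' s); congr rder; rewrite /psi /P cosD e1 e2; ring.
have dP s : rder psi s (A * B * q s ^+ 3).
  apply: sector_rder => //; rewrite /P.
  have := rderD (@rder_cst _ (2 * al * (sec h s)%:~R) (ph h s)) (rder_comp_derive (dfi _ (sgb (ph h s))) (dsg' s)).
  by congr rder; rewrite -/(q s); ring.
have qA s : A * q s <= 1.
  rewrite -(speed_qq hp (sgb (ph h s))) ler_pM2r; first exact: speed_ge hp _.
  exact: q_gt0.
(* N q^3 <= K because q <= 1 / A *)
pose K := B / A ^+ 2; have K0 : 0 < K by rewrite divr_gt0 // exprn_gt0.
have KE s : 0 < A * B * q s ^+ 3 <= K.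
  have q1 := q_gt0 s; rewrite !mulr_gt0 ?exprn_gt0 //= /K ler_pdivlMr ?exprn_gt0 //.
  have -> : A * B * q s ^+ 3 * A ^+ 2 = B * (A * q s) ^+ 3 by ring.
  by rewrite ler_piMr ?(ltW B0) // exprn_ile1 ?mulr_ge0 // ltW.
have psim (s t : R) : 0 <= s -> s <= t -> psi s <= psi t /\ psi t - psi s <= K * (t - s).
  move=> s0 st; split.
    apply: (rder_nondecreasing s0 (g := fun s => A * B * q s ^+ 3)) => // u us ut.
      by apply: lcont_continuous; exact: cpsi.
    by have /andP[/ltW] := KE u.
  have : - 1 * psi s + K * s <= - 1 * psi t + K * t.
    apply: (@rder_nondecreasing _ (fun u => - 1 * psi u + K * u) (fun u => - 1 * (A * B * q u ^+ 3) + K * 1) s t s0) => //.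
    - move=> u us ut; apply: rderD; first exact: rderZ.
      apply: rderZ; exact: rder_id.
    - move=> u us ut; apply: lcontD; apply: lcontZ; apply: lcont_continuous; first exact: cpsi.
      exact: cvg_id.
    - by move=> u us ut; have /andP[_] := KE u; flra st.
  flra st.
have psis (s t : R) : 0 <= s -> s < t -> psi s < psi t.
  move=> s0 st; have /andP[g0 _] := KE s; have g2 : 0 < A * B * q s ^+ 3 / 2 by rewrite divr_gt0.
  have [d d0 hd] := dP s _ g2; have ts : 0 < t - s by rewrite subr_gt0.
  have [m m0 [m1 m2 _]] := min3_gt0 d0 ts ts.
  have mh : 0 < m / 2 by rewrite divr_gt0. have md : m / 2 < d by flra m1 m2 mh.
  have := hd _ mh md; rewrite ler_norml => /andP[k1 _].
  have su : 0 <= s + m / 2 by flra K0 s0 m0. have ut : s + m / 2 <= t by flra m2 mh k1.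
  have [k2 _] := psim _ _ su ut.
  have k4 : 0 < A * B * q s ^+ 3 / 2 * (m / 2) by rewrite mulr_gt0.
  move: (A * B * q s ^+ 3) k1 k4 => gg k1 k4; flra k1 k2 k4.
pose l := 2 * h * k%:R; have l0 : 0 < l by rewrite !mulr_gt0.
have lE : l = 2 * h * (k%:Z)%:~R by rewrite -pmulrn.
have perX s : gx (s + l) = gx s /\ gy (s + l) = gy s.
  rewrite /gx /gy lE ph_shift // sec_shift //; have := arc_shift (sec h s) 1 (sg (ph h s)).
  by rewrite mulr1.
have perP s : psi (s + l) = psi s + 2 * pi.
  by rewrite /psi /P lE ph_shift // sec_shift // -(kal hp) intrD -pmulrn; ring.
have gval (j : int) (t : R) : - h <= t -> t <= h -> gx (2 * h * j%:~R + t) = ax al A B ze j (sg t) /\ gy (2 * h * j%:~R + t) = ay al A B ze j (sg t).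
  move=> t1; rewrite le_eqVlt => /orP[/eqP ->|t2].
    have -> : 2 * h * j%:~R + h = 2 * h * (j + 1)%:~R + - h by rewrite intrD mulr1z; ring.
    have [E1 E2] := sector_val h0 (j + 1) (lexx (- h)) nh.
    by rewrite /gx /gy E1 E2 /X /Y sgl sgr; have := arc_joint hp j.
  by have [E1 E2] := sector_val h0 j t1 t2; rewrite /gx /gy E1 E2.
have tight s : gx s * cos (psi s) + gy s * sin (psi s) = Hs A B ze (ph al (psi s)).
  rewrite /gx /gy /psi /X /Y /P (arc_tight hp _ (sgb _)).
  have [f1 f2] := fi_range hp (sgb (ph h s)); have [E|ne] := eqVneq (fi A B (sg (ph h s))) al.
    rewrite E; have -> : 2 * al * (sec h s)%:~R + al = 2 * al * (sec h s + 1)%:~R + - al by rewrite intrD mulr1z; ring.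
    have nal' : - al < al by flra hz a1.
    have [_ ->] := sector_val a1 (sec h s + 1) (lexx (- al)) nal'.
    by have [-> ->] := Hs_al hp.
  have f3 : fi A B (sg (ph h s)) < al by rewrite lt_neqAle ne.
  by have [_ ->] := sector_val a1 (sec h s) f1 f3.
have inC s : refbody al A B ze (gx s) (gy s) by exact: (arc_in_refbody hp _ (sgb _)).
have Hs0 t : 0 < Hs A B ze (ph al t).
  have /andP[p1 p2] := ph_range_le hp t; have := Hs_gt0 hp p1 p2; have := cos_al_gt0 hp => c0.
  by apply: lt_le_trans; rewrite mulr_gt0.
have inj (s t : R) : 0 <= s -> s < t -> t < l -> gx s = gx t -> gy s = gy t -> False.
  move=> s0 st tl Ex Ey; have p1 := psis s t s0 st.
  have p2 : psi t < psi s + 2 * pi by rewrite -perP; apply: psis; flra s0 st tl.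
  have ts := tight s; have tt := tight t; rewrite -Ex -Ey in tt.
  have [b|b|E] := ltgtP (psi t) (psi s + pi).
  - exact: (one_normal hp (inC s) ts tt p1 b).
  - have ts' : gx s * cos (psi s + 2 * pi) + gy s * sin (psi s + 2 * pi) = Hs A B ze (ph al (psi s + 2 * pi)).
      rewrite (ph_period hp); have := sin_cos_2pi_int (psi s) 1; rewrite mulr1z mulr1.
      by case=> -> ->.
    by apply: (one_normal hp (inC s) tt ts' p2); flra b.
  - have := Hs0 (psi s); have := Hs0 (psi t); rewrite -ts -tt E cosDpi sinDpi; flra E.
exists l, (fun s => (gx s, gy s)); split=> //.
- have cG : continuous (fun s : R => (gx s, gy s) : plane R) by move=> s; exact: (cvg_pair (cX s) (cY s)).
  exact: (continuous_subspaceT cG).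
- split; last by have [] := perX 0; rewrite add0r => -> ->.
  move=> s t; rewrite !in_itv /= => /andP[s0 sl] /andP[t0 tl] [Ex Ey].
  have [lt|lt|//] := ltgtP s t; first by case: (inj s t).
  by case: (inj t s).
- apply/seteqP; split=> [_ [s _ <-]|[u v]].
    by apply/(refbody_boundary hp); exists (sec h s), (sg (ph h s)).
  move=> /(refbody_boundary hp)[j [w [hw -> ->]]].
  have kn : k%:Z != 0 by rewrite eqz_nat -lt0n (leq_trans _ k3).
  have Ej := divz_eq j k%:Z; set n := (j %/ k)%Z in Ej; set m := (j %% k)%Z in Ej.
  have m0 : (0 <= m)%R by exact: modz_ge0.
  have mk : (m < k%:Z)%R by apply: ltz_pmod; rewrite ltz_nat (leq_trans _ k3).
  have -> : j = m + k%:Z * n by rewrite {1}Ej addrC mulrC.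
  have [-> ->] := arc_shift m n w.
  have [t /andP[t1 t2] <-] := sgs w hw; have [<- <-] := gval m t t1 t2.
  have mR0 : 0 <= m%:~R :> R by rewrite ler0z.
  have mRk : m%:~R + 1 <= k%:R :> R. by exact: int_lt_real.
  have b1 : 0 <= 2 * h * m%:~R by rewrite !mulr_ge0 // ltW.
  have b2 : 2 * h * (m%:~R + 1) <= l by rewrite ler_pM2l // mulr_gt0.
  have [s0|s0] := leP 0 (2 * h * m%:~R + t).
    exists (2 * h * m%:~R + t) => //=; rewrite in_itv /= s0; flra t1 t2 b2.
  exists (2 * h * m%:~R + t + l); last by have [-> ->] := perX (2 * h * m%:~R + t).
  by rewrite /= in_itv /=; apply/andP; split; flra t1 b1 b2 s0.
- move=> t; rewrite in_itv /= => /andP[t0 _].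
  by apply: (unit_speed K0 _ cX cY psim t0) => s _; exact: dX.
Qed.

End ReferenceParam.

(** * The upper bound for convex subsets of the polygon *)

Section Area.
Context {R : realType}.

(** The fibers over the abscissae near an interior point have lengths bounded
    below. *)
Lemma area_pos (C : set (plane R)) (o1 o2 : R) : compact C -> interior C (o1, o2) -> (0 < area C)%E.
Proof.
move=> cC /interior_boxP[d d0 hd]; rewrite area_fiber.
have mF (x : R) : measurable [set y : R | C (x, y)].
  apply: closed_measurable; have clC := compact_closed (@norm_hausdorff _ _) cC.
  have cc : continuous (fun y : R => (x, y) : plane R) by move=> y; exact: (cvg_pair (cvg_cst x) (cvg_id)).
  exact: (closed_comp (fun y _ => cc y) clC).
have w0 : 0 < d * 2 * (d * 2) by rewrite !mulr_gt0.
have wid (c : R) : lebesgue_measure (`]c - d, c + d[%classic : set R) = (d * 2)%:E.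
  rewrite lebesgue_measure_itv /= lte_fin.
  have -> : c - d < c + d by lra.
  by rewrite -EFinB; congr EFin; ring.
apply: (@lt_le_trans _ _ (\int[lebesgue_measure]_(x in `](o1 - d)%R, (o1 + d)%R[) (cst (d * 2)%:E x))%E).
  rewrite integral_cst //.
  have /= -> := wid o1; by rewrite -EFinM lte_fin.
rewrite [leLHS]integral_mkcond; apply: le_integral_nonneg => x _.
  by apply: erestrict_ge0 => y _; rewrite lee_fin mulr_ge0 // ltW.
rewrite patchE; case: ifPn => //; last by move=> _; exact: measure_ge0.
rewrite inE /= in_itv /= => /andP[x1 x2].
rewrite -(wid o2); apply: le_measure; rewrite ?inE; [exact: measurable_itv|exact: mF|].
move=> y /=; rewrite in_itv /= => /andP[y1 y2]; apply: hd; rewrite ltr_norml; lra.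
Qed.

End Area.

Section UpperBound.
Context {R : realType}.

(** A reflection exchanges the two graphs. *)
Lemma mirrored_body (C : set (plane R)) (e a : R) : (e == 1) || (e == -1) -> compact C -> convexP (fun u v => C (u, v)) ->
  area C = a%:E -> 0 < a -> exists (a1 b1 : R) (bot top Fb Ft : R -> R),
  body (fun u v => C (u, e * v)) a1 b1 bot top Fb Ft /\ Ft b1 - Fb b1 = a.
Proof.
move=> he cC vC Ca a0; have [E|ne] := eqVneq e 1.
  have [|a1 [b1 [bot [top [Fb [Ft [H E2 _ _]]]]]]] := body_exists cC vC; first by rewrite Ca lte_fin.
  exists a1, b1, bot, top, Fb, Ft; split; last by move: E2; rewrite Ca => -[].
  by have -> : (fun u v => C (u, e * v)) = (fun u v => C (u, v)) by apply/funext => u; apply/funext => v; rewrite E mul1r.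
have {he ne} -> : e = -1 by move: he; rewrite (negbTE ne) => /eqP.
have [|a1 [b1 [bot [top [Fb [Ft [H E2 _ _]]]]]]] := body_exists cC vC; first by rewrite Ca lte_fin.
exists a1, b1, (fun u => - top u), (fun u => - bot u), (fun u => - Ft u), (fun u => - Fb u); split.
  have [h1 h2 h3 h4 h5 h6 h7 [h8 h9]] := H; split=> //.
  - move=> u v; rewrite mulN1r h2; split=> -[k1 k2 k3 k4]; split=> //; lra.
  - by move=> u; apply: cvgN; exact: h4.
  - by move=> u; apply: cvgN; exact: h3.
  - by move=> u u1 u2; rewrite lerN2; exact: h5.
  - by move=> u u1 u2; apply: is_deriveN; exact: h7.
  - by move=> u u1 u2; apply: is_deriveN; exact: h6.
  - by rewrite h8 h9 oppr0.
by move: E2; rewrite Ca => -[->]; ring.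
Qed.

Lemma halfplanes_mirror (al q0 : R) (C : set (plane R)) (e : R) : (e == 1) || (e == -1) ->
  (forall u v : R, C (u, v) -> forall j : int, u * cos (2 * al * j%:~R + al) + v * sin (2 * al * j%:~R + al) <= q0) ->
  (forall u v : R, C (u, e * v) -> forall j : int, u * cos (2 * al * j%:~R + al) + v * sin (2 * al * j%:~R + al) <= q0).
Proof.
move=> he h u v; case/orP: he => /eqP ->; first by rewrite mul1r; exact: h.
rewrite mulN1r => /h k j; have := k (- j - 1).
have -> : 2 * al * (- j - 1)%:~R + al = - (2 * al * j%:~R + al) by rewrite intrD !mulrNz mulr1z; ring.
by rewrite cosN sinN mulrNN.
Qed.

Variables (k : nat) (r al A B ze q0 M3 : R).
Hypotheses (hp : refpar k r al A B ze q0) (M0 : 0 < M3) (ME : M3 ^+ 3 = A * B).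

(** The competitor is reflected, if necessary, to be run counterclockwise; the
    half planes of the polygon are preserved. The data of the transport are
    returned for the discussion of equality. *)
Lemma length_bound (C : set (plane R)) (l areaC : R) (gamma : R -> plane R)
  (a' b' : R) (bot' top' Fb' Ft' : R -> R) :
  compact C -> @convex_set R (plane R) C -> area C = areaC%:E -> 0 < areaC ->
  (forall u v : R, C (u, v) -> forall j : int, u * cos (2 * al * j%:~R + al) + v * sin (2 * al * j%:~R + al) <= q0) ->
  arc_length_param C l gamma -> body (refbody al A B ze) a' b' bot' top' Fb' Ft' ->
  exists (e a b : R) (x y psi bot top Fb Ft : R -> R),
   [/\ (e == 1) || (e == -1), ccw (fun u v => C (u, e * v)) l x y psi,
    body (fun u v => C (u, e * v)) a b bot top Fb Ft, Ft b - Fb b = areaC &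
  forall g : R -> R,
  (forall s : R, 0 <= s -> s < l -> forall ep : R, 0 < ep -> exists2 del : R, 0 < del & forall h : R, 0 < h -> h < del ->
     g (s + h) - g s <= (2 / (3 * M3 ^+ 2) * (Hs A B ze (ph al (psi s)) -
         (cx x a b a' b' s * cos (psi s) + cy x psi a b a' b' bot' top' s * sin (psi s))) + ep) * h) ->
  (forall s : R, 0 < s -> s <= l -> lcont g s) ->
  (\int[lebesgue_measure]_(s in `[0%R, l]) ((curvature gamma s) `^ (3%:R^-1))%:E <=
    ((3 * M3 ^+ 2)^-1 * (2 * (2 * ze * sin al * q0 * k%:R -
     (ratio a b a' b' * areaC + (ratio a b a' b')^-1 * (Ft' b' - Fb' b'))) + A * B * (2 * r * k%:R)) - (g l - g 0))%:E)%E].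
Proof.
move=> cC vC Ca a0 hC gC HC; have vC' : convexP (fun u v => C (u, v)) by apply/convex_setP.
have [ox [oy iC]] : exists ox oy : R, interior C (ox, oy).
  by have [|a1 [b1 [bot [top [Fb [Ft [H E2 _ //]]]]]]] := body_exists cC vC'; first by rewrite Ca lte_fin.
have [e [psi [he H ht]]] := ccw_of_param cC vC iC gC.
have [a [b [bot [top [Fb [Ft [HD aE]]]]]]] := mirrored_body he cC vC' Ca a0.
pose x : R -> R := fun s => (gamma (clamp l s)).1; pose y : R -> R := fun s => e * (gamma (clamp l s)).2.
have {}H : ccw (fun u v => C (u, e * v)) l x y psi := H.
exists e, a, b, x, y, psi, bot, top, Fb, Ft; split=> // g hg lg; clearbody x y.
rewrite -aE -(turn_Spot a b a' b' Fb Ft Fb' Ft' H).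
apply: (affine_length_bound hp H M0 ME (halfplanes_mirror he hC) _ _ _ _ hg lg).
- by move=> s s0 sl; exact: (rder_Spot H HD HC s0 sl).
- by move=> s s0 sl; exact: (left_Spot H HD HC s0 sl).
- by move=> s s0 sl; exact: (refbody_dir hp (psi s) (c_in s H HD HC)).
- by move=> s s0 sl; exact: curvature_cases he ht s0 sl.
Qed.

End UpperBound.

(** * The case of equality: translates *)

Section Translates.
Context {R : realType}.

(** On a short interval the difference T - U varies by at most the variation
    of m times the length of the interval. Cut into n pieces and use the
    monotonicity of m. *)
Lemma common_slope_cst (T U m : R -> R) (a b : R) :
  (forall u w : R, a < u -> u < b -> a < w -> w < b -> T w <= T u + m u * (w - u) /\ U w <= U u + m u * (w - u)) ->
  forall u w : R, a < u -> u < w -> w < b -> T w - U w = T u - U u.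
Proof.
move=> h; have step u w : a < u -> u < w -> w < b -> 0 <= m u - m w /\ `|(T w - U w) - (T u - U u)| <= (m u - m w) * (w - u).
  move=> u1 uw w1; have ub : u < b by exact: lt_trans uw w1. have wa : a < w by exact: lt_trans u1 uw.
  have [t1 t2] := h u w u1 ub wa w1; have [t3 t4] := h w u wa w1 u1 ub; split.
    rewrite -(@pmulr_lge0 _ (w - u)) ?subr_gt0 //; lra.
  rewrite ler_norml; apply/andP; split; lra.
have many n : forall u w : R, a < u -> u < w -> w < b -> `|(T w - U w) - (T u - U u)| * n.+1%:R <= (m u - m w) * (w - u).
  elim: n => [|n ih] u w u1 uw w1; first by rewrite mulr1; have [] := step u w u1 uw w1.
  pose d := (w - u) / n.+2%:R; have nn : 0 < n.+2%:R :> R by [].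
  have d0 : 0 < d by rewrite divr_gt0 // subr_gt0.
  have dE : w - u = d * n.+2%:R by rewrite /d divfK // gt_eqF.
  pose v := u + d.
  have n1 : 0 < n.+1%:R :> R by [].
  have uv : u < v by rewrite ltrDl.
  have vE : w - v = d * n.+1%:R by rewrite /v opprD addrA dE -[in LHS]natr1 mulrDr mulr1 addrK.
  have vw : v < w by rewrite -subr_gt0 vE mulr_gt0.
  have [s1 s2] := step u v u1 uv (lt_trans vw w1).
  have s3 := ih v w (lt_trans u1 uv) vw w1; have [s4 _] := step v w (lt_trans u1 uv) vw w1.
  have uvE : v - u = d by rewrite /v addrC addKr.
  rewrite uvE in s2; rewrite vE mulrA ler_pM2r // in s3.
  have s5 : `|T w - U w - (T u - U u)| <= (m u - m w) * d.
    have -> : T w - U w - (T u - U u) = (T w - U w - (T v - U v)) + (T v - U v - (T u - U u)) by ring.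
    apply: le_trans (ler_normD _ _) _; lra.
  by rewrite dE mulrA ler_pM2r.
move=> u w u1 uw w1; apply/eqP; rewrite -subr_eq0 -normr_eq0; set z := `|_|.
have z0 : 0 <= z by rewrite /z.
rewrite eq_le z0 andbT leNgt; apply/negP => zp.
have := archi_boundP (x := (m u - m w) * (w - u) / z).
have [s1 _] := step u w u1 uw w1.
have wu : 0 <= w - u by rewrite subr_ge0 ltW.
rewrite divr_ge0 ?mulr_ge0 // => /(_ isT); rewrite ltr_pdivrMr //; set n := Num.bound _ => hn.
have := many n u w u1 uw w1; rewrite -/z => hm.
have : z * n%:R <= z * n.+1%:R by rewrite ler_pM2l // ler_nat.
rewrite [z * n%:R]mulrC => hk; move: (le_trans hk hm); rewrite leNgt hn //.
Qed.

Lemma derive_cst_slope (F : R -> R) (c a b : R) : a <= b -> (forall u : R, a <= u -> u <= b -> is_derive u 1 F c) ->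
  F b - F a = c * (b - a).
Proof.
move=> ab dF.
have d1 (e : R) u : a <= u <= b -> is_derive u 1 (fun t => e * (F t - c * t)) 0.
  move=> /andP[u1 u2]; have i1 := dF u u1 u2.
  have i2 : is_derive u 1 (fun t : R => c * t) (c * 1) by apply: is_deriveZ; exact: is_derive_id.
  have i3 : is_derive u 1 (fun t => F t - c * t) (c - c * 1) by exact: is_deriveB.
  have i4 : is_derive u 1 (fun t => e * (F t - c * t)) (e * (c - c * 1)) by exact: is_deriveZ.
  by move: i4; rewrite mulr1 subrr mulr0.
have l1 := derive_nondecreasing (d1 1) (fun _ _ => lexx 0) (lexx a) ab (lexx b).
have l2 := derive_nondecreasing (d1 (-1)) (fun _ _ => lexx 0) (lexx a) ab (lexx b).
lra.
Qed.

Lemma frac_itv (x p : R) : 0 < p -> 0 <= x -> x < p -> 0 <= x / p <= 1 /\ x / p < 1.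
Proof.
move=> p0 x0 xp; have h : x / p < 1 by rewrite ltr_pdivrMr // mul1r.
by rewrite h (ltW h) divr_ge0 // ltW.
Qed.

(** The length of the fibers is a concave function; a zero inside would make
    it vanish everywhere. *)
Lemma body_fat (D : R -> R -> Prop) (a b : R) (bot top Fb Ft : R -> R) : convexP D -> body D a b bot top Fb Ft ->
  0 < Ft b - Fb b -> forall u : R, a < u -> u < b -> bot u < top u.
Proof.
move=> cD HD A0 u au ub; have le0 := bd_le HD; rewrite lt_neqAle le0 ?ltW // andbT; apply/eqP => E.
have flat (w z : R) : a <= w -> w <= b -> a <= z -> z <= b -> (w < u /\ u < z) \/ (z < u /\ u < w) -> bot w = top w.
  move=> w1 w2 z1 z2 hz; have [z0 t01 uE] : exists2 t : R, 0 <= t <= 1 /\ t < 1 & (1 - t) * w + t * z = u.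
    have zw : z - w != 0 by case: hz => -[h1 h2]; rewrite subr_eq0; [rewrite gt_eqF // (lt_trans h1)|rewrite lt_eqF // (lt_trans h1)].
    exists ((u - w) / (z - w)); last by field.
    case: hz => -[h1 h2].
      have p : 0 < z - w by rewrite subr_gt0 (lt_trans h1).
      by apply: frac_itv => //; lra.
    have p : 0 < w - z by rewrite subr_gt0 (lt_trans h1).
    have -> : (u - w) / (z - w) = (w - u) / (w - z) by rewrite -[u - w]opprB -[z - w]opprB invrN mulrNN.
    by apply: frac_itv => //; lra.
  have [/andP[t0 t1] t2] := t01.
  have bw := le0 w w1 w2; have bz := le0 z z1 z2.
  have P v : bot w <= v -> v <= top w -> bot u <= (1 - z0) * v + z0 * top z /\ (1 - z0) * v + z0 * top z <= top u.
    move=> v1 v2; have D1 : D w v by apply/(bd_P HD). have D2 : D z (top z) by apply/(bd_P HD).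
    have := cD _ _ _ _ z0 D1 D2; rewrite t0 t1 => /(_ isT); rewrite uE => /(bd_P HD)[_ _]. by [].
  have [_ p1] := P _ bw (lexx _); have [p2 _] := P _ (lexx _) bw.
  have : (1 - z0) * (top w - bot w) <= 0 by rewrite E in p2; lra.
  rewrite pmulr_rle0 ?subr_gt0 // => k; apply/eqP; rewrite eq_le bw /=; lra.
have all (w : R) : a <= w -> w <= b -> bot w = top w.
  move=> w1 w2; have [lt|lt|->//] := ltgtP w u.
    by apply: (flat w b) => //; [exact: le_trans w2|left].
  by apply: (flat w a) => //; [exact: le_trans w2|right].
have ab := ltW (bd_ab HD).
have := @derive_cst_slope (fun t => Ft t - Fb t) 0 a b ab _.
have [-> ->] := bd_0 HD; rewrite subrr subr0 mul0r => K.
move: A0; rewrite (K _) ?ltxx // => t t1 t2.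
by have := is_deriveB (bd_Ft HD t1 t2) (bd_Fb HD t1 t2); rewrite all // subrr.
Qed.

(** Every boundary point is on the curve, and the normal is not horizontal
    there since the abscissa is not extremal; the fiber being nondegenerate,
    the normal points upwards on the upper graph and downwards on the lower
    one. *)
Lemma body_bound_top (D : R -> R -> Prop) (l : R) (x y psi : R -> R) (a b : R) (bot top Fb Ft : R -> R) (u : R) :
  convexP D -> ccw D l x y psi -> body D a b bot top Fb Ft -> 0 < Ft b - Fb b -> a < u -> u < b ->
  (exists s : R, [/\ 0 <= s, s < l, x s = u, y s = top u & 0 < sin (psi s)]) /\
  (exists s : R, [/\ 0 <= s, s < l, x s = u, y s = bot u & sin (psi s) < 0]).
Proof.
move=> cD H HD A0 au ub; have fat := body_fat cD HD A0 au ub; have bP := bd_P HD.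
have Db : D u (bot u) by apply/bP; split=> //; rewrite ltW. have Dt : D u (top u) by apply/bP; split=> //; rewrite ltW.
have ab := bd_ab HD.
have Da : D a (bot a) by apply/bP; split=> //; [exact: ltW|exact: (bd_le HD (lexx a) (ltW ab))].
have DB : D b (bot b) by apply/bP; split=> //; [exact: ltW|exact: (bd_le HD (ltW ab) (lexx b))].
have sn (s : R) : 0 <= s -> s < l -> x s = u -> sin (psi s) != 0.
  move=> s0 sl E; apply/eqP => sE; have := cos2Dsin2 (psi s); rewrite sE expr0n addr0 => c1.
  have k1 := cc_sup H s0 (ltW sl) Da; have k2 := cc_sup H s0 (ltW sl) DB.
  rewrite sE !mulr0 !addr0 E in k1 k2.
  have k3 : 0 <= cos (psi s) by rewrite -(@nmulr_rle0 _ (a - u)) ?subr_lt0.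
  have k4 : cos (psi s) <= 0 by rewrite -(@pmulr_rle0 _ (b - u)) ?subr_gt0.
  have c0 : cos (psi s) = 0 by apply/eqP; rewrite eq_le k3 k4.
  by move: c1; rewrite c0 expr0n => /eqP; rewrite eq_sym oner_eq0.
split.
  have [|s [s0 sl sx sy]] := cc_surj H Dt.
    move=> d d0; exists u, (top u + d / 2); rewrite subrr normr0 addrC addKr gtr0_norm ?divr_gt0 //; split=> //; first lra.
    by move=> /bP[_ _ _]; lra.
  exists s; split=> //; rewrite lt_neqAle eq_sym sn //=.
  have := cc_sup H s0 (ltW sl) Db; rewrite sx sy subrr mul0r add0r nmulr_rle0 //; lra.
have [|s [s0 sl sx sy]] := cc_surj H Db.
  move=> d d0; exists u, (bot u - d / 2); rewrite subrr normr0 addrC addKr normrN gtr0_norm ?divr_gt0 //; split=> //; first lra.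
  by move=> /bP[_ _]; lra.
exists s; split=> //; rewrite lt_neqAle sn //=.
have := cc_sup H s0 (ltW sl) Dt; rewrite sx sy subrr mul0r add0r pmulr_rle0 //; lra.
Qed.

Lemma graph_side (bot top : R -> R) (t : R) : (0 < sin t -> graph bot top (phase t) = top) /\ (sin t < 0 -> graph bot top (phase t) = bot).
Proof.
have [j [E|E]] := int_parity (phase t); rewrite E.
  have [h _] := phase_even_sin E; rewrite graph_even; split=> // h1.
  by move: (lt_le_trans h1 h); rewrite ltxx.
have [h _] := phase_odd_sin E; rewrite graph_odd; split=> // h1.
by move: (lt_le_trans h1 h); rewrite ltxx.
Qed.

(** With equal widths, the upper graphs of D and of C have common slopes over
    matched abscissae, so they differ by a constant, and so do the lower
    graphs; the equality of the areas makes the two constants equal. *)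
Lemma translate_of_normals (D C : R -> R -> Prop) (l : R) (x y psi : R -> R) (a b a' b' : R)
  (bot top Fb Ft bot' top' Fb' Ft' : R -> R) :
  convexP D -> ccw D l x y psi -> body D a b bot top Fb Ft -> body C a' b' bot' top' Fb' Ft' ->
  0 < Ft b - Fb b -> ratio a b a' b' = 1 -> Ft b - Fb b = Ft' b' - Fb' b' ->
  (forall s u v : R, 0 <= s -> s < l -> C u v ->
     (u - cx x a b a' b' s) * cos (psi s) + (v - cy x psi a b a' b' bot' top' s) * sin (psi s) <= 0) ->
  exists p q : R, forall u v : R, D u v <-> C (u + p) (v + q).
Proof.
move=> cD H HD HC A0 r1 AE sup; have ab := bd_ab HD; have ab' := bd_ab HC.
have ba : b' - a' = b - a.
  by move: r1; rewrite /ratio => /(congr1 (fun z => z * (b - a))); rewrite divfK ?mul1r // subr_eq0 gt_eqF.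
pose p := a' - a; have bE : b' = b + p by rewrite /p; lra. have aE : a' = a + p by rewrite /p; lra.
have cxE s : cx x a b a' b' s = x s + p by rewrite /cx /shift r1 !mul1r.
have inC w : a <= w -> w <= b -> C (w + p) (top' (w + p)) /\ C (w + p) (bot' (w + p)).
  move=> w1 w2; have w3 : a' <= w + p by rewrite aE lerD2r. have w4 : w + p <= b' by rewrite bE lerD2r.
  by have := bd_le HC w3 w4; split; apply/(bd_P HC).
have inD w : a <= w -> w <= b -> D w (top w) /\ D w (bot w).
  by move=> w1 w2; have := bd_le HD w1 w2; split; apply/(bd_P HD).
have slope (e1 : R) (f f' : R -> R) :
    (forall u : R, a < u -> u < b -> exists s : R, [/\ 0 <= s, s < l, x s = u, y s = f u & 0 < e1 * sin (psi s) /\ cy x psi a b a' b' bot' top' s = f' (u + p)]) ->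
    e1 * e1 = 1 -> (forall w : R, a <= w -> w <= b -> D w (f w) /\ C (w + p) (f' (w + p))) ->
    continuous f -> continuous f' -> exists K : R, forall u : R, a <= u -> u <= b -> f' (u + p) = f u + K.
  move=> hs ee hDC cf cf'; have ch u : exists s : R, a < u -> u < b -> [/\ 0 <= s, s < l, x s = u, y s = f u & 0 < e1 * sin (psi s) /\ cy x psi a b a' b' bot' top' s = f' (u + p)].
    have [/andP[u1 u2]|nu] := boolP (a < u < b); first by have [s h] := hs u u1 u2; exists s.
    by exists 0 => u1 u2; move: nu; rewrite u1 u2.
  have [sg hsg] := choice ch.
  pose m u := - cos (psi (sg u)) / (e1 * sin (psi (sg u))).
  pose c := (a + b) / 2; have ca : a < c by rewrite /c; lra. have cb : c < b by rewrite /c; lra.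
  have cst : forall u w : R, a < u -> u < w -> w < b -> e1 * f' (w + p) - e1 * f w = e1 * f' (u + p) - e1 * f u.
    apply: (@common_slope_cst (fun u => e1 * f' (u + p)) (fun u => e1 * f u) m a b) => u w u1 u2 w1 w2.
    have [s0 sl sx sy [ss sc]] := hsg u u1 u2; have [d1 d2] := hDC w (ltW w1) (ltW w2).
    have k1 := cc_sup H s0 (ltW sl) d1; have k2 := sup _ _ _ s0 sl d2.
    rewrite cxE sc sx in k2; rewrite sx sy in k1; rewrite /m.
    pose S := e1 * sin (psi (sg u)); have sE : sin (psi (sg u)) = e1 * S by rewrite /S mulrA ee mul1r.
    rewrite sE in k1 k2; rewrite -/S; have S0 : 0 < S := ss; clearbody S.
    move: (cos _) k1 k2 => cc k1 k2.
    have Sn : S != 0 by rewrite gt_eqF.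
    by split; rewrite -subr_ge0 -(pmulr_lge0 _ S0);
       [have -> : (e1 * f' (u + p) + - cc / S * (w - u) - e1 * f' (w + p)) * S = - ((w + p - (u + p)) * cc + (f' (w + p) - f' (u + p)) * (e1 * S)) by field
       |have -> : (e1 * f u + - cc / S * (w - u) - e1 * f w) * S = - ((w - u) * cc + (f w - f u) * (e1 * S)) by field]; rewrite oppr_ge0.
  exists (f' (c + p) - f c).
  have int u : a < u -> u < b -> f' (u + p) = f u + (f' (c + p) - f c).
    move=> u1 u2; have key : e1 * f' (u + p) - e1 * f u = e1 * f' (c + p) - e1 * f c.
      by have [lt|lt|->//] := ltgtP u c; [rewrite (cst u c)|rewrite (cst c u)].
    have : e1 * (e1 * f' (u + p) - e1 * f u) = e1 * (e1 * f' (c + p) - e1 * f c) by rewrite key.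
    rewrite !mulrBr !mulrA ee !mul1r; lra.
  have cg : continuous (fun u => f' (u + p) - f u).
    move=> u; apply: cvgB; last exact: cf.
    apply: (@continuous_comp _ _ _ (fun t : R => t + p) f'); last exact: cf'.
    by apply: cvgD; [exact: cvg_id|exact: cvg_cst].
  have lim (u : R) : (forall d : R, 0 < d -> exists2 w : R, `|w - u| < d & a < w /\ w < b) -> f' (u + p) = f u + (f' (c + p) - f c).
    move=> hu; apply/eqP; rewrite -subr_eq0 -normr_eq0; set z := `|_|; have z0 : 0 <= z by rewrite /z.
    rewrite eq_le z0 andbT leNgt; apply/negP => zp.
    have cu : {for u, continuous (fun u => f' (u + p) - f u)} by exact: cg.
    have [d d0 hd] := (continuous_epsP _ _).1 cu z zp; have [w wu [w1 w2]] := hu d d0.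
    have := hd w wu; rewrite (int w w1 w2) distrC /z.
    have -> : f' (u + p) - f u - (f w + (f' (c + p) - f c) - f w) = f' (u + p) - (f u + (f' (c + p) - f c)) by ring.
    by rewrite ltxx.
  move=> u u1 u2; apply: lim => d d0; have d2 : 0 < d / 2 by rewrite divr_gt0.
  have ba2 : 0 < (b - a) / 2 by rewrite divr_gt0 // subr_gt0.
  have [m1 m10 [m11 m12 _]] := min3_gt0 d2 ba2 ba2.
  have [uc|cu] := leP u c.
    by exists (u + m1 / 2); [rewrite addrC addKr gtr0_norm ?divr_gt0 //; flra u1 m10 m11 m12 uc|rewrite /c in uc; split; flra u1 m10 m11 m12 uc].
  by exists (u - m1 / 2); [rewrite addrC addKr normrN gtr0_norm ?divr_gt0 //; flra u2 m10 m11 m12 cu|rewrite /c in cu; split; flra u2 m10 m11 m12 cu].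
have [Kt hKt] : exists K : R, forall u : R, a <= u -> u <= b -> top' (u + p) = top u + K.
  apply: (slope 1) => //; [|exact: mulr1| |exact: bd_ct HD|exact: bd_ct HC].
    move=> u u1 u2; have [[s [s0 sl sx sy ss]] _] := body_bound_top cD H HD A0 u1 u2.
    by exists s; split=> //; split; rewrite ?mul1r // /cy (graph_side _ _ _).1 // cxE sx.
  by move=> w w1 w2; split; [exact: (inD w w1 w2).1|exact: (inC w w1 w2).1].
have [Kb hKb] : exists K : R, forall u : R, a <= u -> u <= b -> bot' (u + p) = bot u + K.
  apply: (slope (-1)) => //; [|by rewrite mulrNN mulr1| |exact: bd_cb HD|exact: bd_cb HC].
    move=> u u1 u2; have [_ [s [s0 sl sx sy ss]]] := body_bound_top cD H HD A0 u1 u2.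
    by exists s; split=> //; split; rewrite ?mulN1r ?oppr_gt0 // /cy (graph_side _ _ _).2 // cxE sx.
  by move=> w w1 w2; split; [exact: (inD w w1 w2).2|exact: (inC w w1 w2).2].
have KK : Kt = Kb.
  have dsh (F : R -> R) (d u : R) : is_derive (u + p) 1 F d -> is_derive u 1 (fun t => F (t + p)) d.
    move=> dF; apply: eps_is_derive => e e0; have [m m0 hm] := is_derive_eps dF e0; exists m => // h hh.
    by rewrite (addrAC u); exact: hm.
  have := @derive_cst_slope (fun u => (Ft' (u + p) - Fb' (u + p)) - (Ft u - Fb u)) (Kt - Kb) a b (ltW ab) _.
  have [k1 k2] := bd_0 HD; have [k3 k4] := bd_0 HC.
  rewrite -aE -bE k1 k2 k3 k4 !subrr subr0 AE subrr => K.
  have : 0 = (Kt - Kb) * (b - a).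
    apply: K => u u1 u2; have u3 : a' <= u + p by rewrite aE lerD2r. have u4 : u + p <= b' by rewrite bE lerD2r.
    have j1 := dsh _ _ _ (bd_Ft HC u3 u4); have j2 := dsh _ _ _ (bd_Fb HC u3 u4).
    have j3 : is_derive u 1 (fun t => Ft' (t + p) - Fb' (t + p)) (top' (u + p) - bot' (u + p)) by exact: is_deriveB.
    have j4 : is_derive u 1 (fun t => Ft t - Fb t) (top u - bot u) by apply: is_deriveB; [exact: (bd_Ft HD)|exact: (bd_Fb HD)].
    have := is_deriveB j3 j4; rewrite hKt // hKb //.
    by have -> : top u + Kt - (bot u + Kb) - (top u - bot u) = Kt - Kb by ring.
  move=> /esym/eqP; rewrite mulf_eq0 => /orP[|/eqP k]; first by rewrite subr_eq0 => /eqP.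
  by move: ab; rewrite -subr_gt0 k ltxx.
exists p, Kt => u v; split.
  move=> /(bd_P HD)[u1 u2 v1 v2]; apply/(bd_P HC).
  by rewrite aE bE !lerD2r hKt // hKb // -KK !lerD2r.
move=> /(bd_P HC); rewrite aE bE !lerD2r => -[u1 u2].
by rewrite hKt // hKb // -KK !lerD2r => v1 v2; apply/(bd_P HD).
Qed.

End Translates.

Section RefTranslate.
Context {R : realType}.
Variables (k : nat) (r al A B ze q0 : R).
Hypothesis hp : refpar k r al A B ze q0.

(** The body touches every side of the polygon, so a translation must have a
    nonnegative scalar product with all their normals, whereas the one of the
    sector opposite to the translation is negative. *)
Lemma refbody_fixed (D : R -> R -> Prop) (p q : R) :
  (forall u v : R, D u v -> forall j : int, u * cos (2 * al * j%:~R + al) + v * sin (2 * al * j%:~R + al) <= q0) ->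
  (forall u v : R, D u v <-> refbody al A B ze (u + p) (v + q)) -> p = 0 /\ q = 0.
Proof.
move=> hD DE; have [_ _ r0 A0 _ q00 _ _ _] := hp; have c0 := cos_al_gt0 hp; have s0 := sin_al_gt0 hp.
have rr : `|r| <= r by rewrite gtr0_norm.
have side (j : int) : 0 <= p * cos (2 * al * j%:~R + al) + q * sin (2 * al * j%:~R + al).
  have := arc_in_refbody hp j rr; have [-> ->] := arc_end hp j; set t := 2 * al * j%:~R + al => hin.
  have := hD (q0 * cos t - p) (q0 * sin t - q); rewrite DE !subrK => /(_ hin j); rewrite -/t.
  have cs : q0 * cos t * cos t + q0 * sin t * sin t = q0 by rewrite -!mulrA -mulrDr -!expr2 cos2Dsin2 mulr1.
  lra.
have [/andP[/eqP -> /eqP ->] //|ne] := boolP ((p == 0) && (q == 0)).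
have ne' : (- p != 0) || (- q != 0) by rewrite !oppr_eq0 -negb_and.
have [j [w [c [wr cp Ex Ey]]]] := arc_ray hp ne'.
have P0 : 0 < aP B ze w by apply: lt_le_trans (aP_ge hp wr); rewrite mulr_gt0.
have P1 : 0 < aP B ze w * cos al by rewrite mulr_gt0.
have d1 := arc_dot al A B ze j w (2 * al * j%:~R + al).
have d2 := arc_dot al A B ze j w (2 * al * (j - 1)%:~R + al).
have e1 : 2 * al * j%:~R + al - 2 * al * j%:~R = al by ring.
have e2 : 2 * al * (j - 1)%:~R + al - 2 * al * j%:~R = - al by rewrite intrD mulrNz mulr1z; ring.
rewrite e1 Ex Ey in d1; rewrite e2 Ex Ey cosN sinN in d2.
have f1 : 0 <= c * (p * cos (2 * al * j%:~R + al) + q * sin (2 * al * j%:~R + al)) by apply: mulr_ge0; [exact: ltW|exact: side].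
have f2 : 0 <= c * (p * cos (2 * al * (j - 1)%:~R + al) + q * sin (2 * al * (j - 1)%:~R + al)) by apply: mulr_ge0; [exact: ltW|exact: side].
exfalso; flra P1 d1 d2 f1 f2.
Qed.

End RefTranslate.

(** * The reference body is the only maximizer *)

Section Numerics.
Context {R : realType}.

Lemma ln_le_pred (u : R) : 0 < u -> ln u <= u - 1 /\ (ln u = u - 1 -> u = 1).
Proof.
move=> u0; have h := expR_ge1Dx (ln u); rewrite lnK ?posrE // in h; split; first by lra.
move=> E; apply/eqP; apply: contrapT => /negP ne.
have : ln u != 0 by rewrite E subr_eq0.
by move=> /expR_gt1Dx; rewrite lnK ?posrE // E addrC subrK ltxx.
Qed.

(** Take logarithms and apply ln z <= z - 1 to z = rho * t and z = 1 / rho,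
    whose product is t. *)
Lemma gain_bound (lam w rho t : R) : 0 < lam -> 0 < rho -> 0 < t -> 0 <= w ->
  w <= 1 + lam / 3 * (2 - rho * t - rho^-1) ->
  w ^+ 3 * t `^ lam <= 1 /\ (1 <= w ^+ 3 * t `^ lam -> rho = 1 /\ t = 1).
Proof.
move=> l0 r0 t0 w0; set x := lam / 3 * _ => wx.
have ri : 0 < rho^-1 by rewrite invr_gt0.
have rt : 0 < rho * t by rewrite mulr_gt0.
have [a1 a2] := ln_le_pred rt; have [b1 b2] := ln_le_pred ri.
have lnE : ln t = ln (rho * t) + ln (rho^-1).
  by rewrite lnM ?posrE // lnV ?posrE //; ring.
have tE : t `^ lam = expR (lam * ln t) by rewrite /powR gt_eqF.
have le1 : w ^+ 3 * t `^ lam <= expR (lam * (2 - rho * t - rho^-1 + ln t)).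
  have -> : lam * (2 - rho * t - rho^-1 + ln t) = x + (x + x) + lam * ln t.
    by rewrite /x; move: (2 - rho * t - rho^-1) (ln t) => z n; field.
  rewrite !expRD -tE ler_pM2r ?powR_gt0 //.
  have we : w <= expR x by apply: le_trans wx _; exact: expR_ge1Dx.
  have -> : expR x * (expR x * expR x) = expR x ^+ 3 by ring.
  by rewrite lerXn2r ?nnegrE // ltW // expR_gt0.
have s0 : 2 - rho * t - rho^-1 + ln t <= 0 by rewrite lnE; lra.
split.
  by apply: le_trans le1 _; rewrite -[leRHS]expR0 ler_expR pmulr_rle0.
move=> ge1; have : 1 <= expR (lam * (2 - rho * t - rho^-1 + ln t)) by exact: le_trans le1.
rewrite -[leLHS]expR0 ler_expR pmulr_rge0 // lnE => h.
have e2 : rho^-1 = 1 by apply: b2; lra.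
have e1 : rho * t = 1 by apply: a2; lra.
have rE : rho = 1 by rewrite -[rho]invrK e2 invr1.
by split=> //; move: e1; rewrite rE mul1r.
Qed.

Lemma cube_le (x y : R) : 0 <= x -> x <= y -> x ^+ 3 <= y ^+ 3.
Proof. by move=> x0 xy; rewrite lerXn2r ?nnegrE // (le_trans x0). Qed.

Lemma rcontD (f g : R -> R) (s : R) : rcont f s -> rcont g s -> rcont (fun t => f t + g t) s.
Proof.
move=> hf hg e e0; have e20 : 0 < e / 2 by rewrite divr_gt0.
have [u u0 hu] := hf _ e20; have [v v0 hv] := hg _ e20.
have [m m0 [mu mv _]] := min3_gt0 u0 v0 v0; exists m => // h h0 hm.
have := hu h h0 (lt_le_trans hm mu); have := hv h h0 (lt_le_trans hm mv); rewrite !ler_norml => /andP[a1 a2] /andP[b1 b2].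
by apply/andP; split; flra a1 a2 b1 b2.
Qed.

Lemma rcontM (f g : R -> R) (s : R) : rcont f s -> rcont g s -> rcont (fun t => f t * g t) s.
Proof.
move=> hf hg e e0; have f1 : 0 < `|f s| + 1 by have := normr_ge0 (f s); lra.
have g1 : 0 < `|g s| + 1 by have := normr_ge0 (g s); lra.
have e1 : 0 < e / (2 * (`|f s| + 1)) by rewrite divr_gt0 // mulr_gt0.
have e2 : 0 < e / (2 * (`|g s| + 1)) by rewrite divr_gt0 // mulr_gt0.
have [u u0 hu] := hf _ e2; have [v v0 hv] := hg _ e1; have [w w0 hw] := hf _ ltr01.
have [m m0 [mu mv mw]] := min3_gt0 u0 v0 w0; exists m => // h h0 hm.
have {}hu := hu h h0 (lt_le_trans hm mu); have {}hv := hv h h0 (lt_le_trans hm mv).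
have {}hw := hw h h0 (lt_le_trans hm mw).
have -> : f (s + h) * g (s + h) - f s * g s = f (s + h) * (g (s + h) - g s) + g s * (f (s + h) - f s) by ring.
apply: le_trans (ler_normD _ _) _; rewrite !normrM.
have fb : `|f (s + h)| <= `|f s| + 1.
  rewrite -[f (s + h)](subrK (f s)); apply: le_trans (ler_normD _ _) _; flra hw.
have p1 : `|f (s + h)| * `|g (s + h) - g s| <= (`|f s| + 1) * (e / (2 * (`|f s| + 1))) by apply: ler_pM.
have p2 : `|g s| * `|f (s + h) - f s| <= (`|g s| + 1) * (e / (2 * (`|g s| + 1))) by apply: ler_pM => //; rewrite lerDl.
have q1 : (`|f s| + 1) * (e / (2 * (`|f s| + 1))) = e / 2 by field; rewrite gt_eqF.
have q2 : (`|g s| + 1) * (e / (2 * (`|g s| + 1))) = e / 2 by field; rewrite gt_eqF.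
rewrite q1 in p1; rewrite q2 in p2; flra p1 p2.
Qed.

Lemma rcontN (f : R -> R) (s : R) : rcont f s -> rcont (fun t => - f t) s.
Proof. by move=> hf e e0; have [d d0 hd] := hf e e0; exists d => // h h0 hh; rewrite -opprD normrN; exact: hd. Qed.

(** A positive slack at a point persists on an interval to its right, and a
    function g that grows there at a fixed positive rate would improve the
    bound. *)
Lemma no_slack (c l L : R) (slack : R -> R) : 0 < c -> (forall s : R, 0 <= slack s) ->
  (forall s : R, 0 <= s -> s < l -> rcont slack s) ->
  (forall g : R -> R, (forall s : R, 0 <= s -> s < l -> forall ep : R, 0 < ep -> exists2 del : R, 0 < del &
     forall h : R, 0 < h -> h < del -> g (s + h) - g s <= (c * slack s + ep) * h) ->
    (forall s : R, 0 < s -> s <= l -> lcont g s) -> L <= L - (g l - g 0)) ->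
  forall s : R, 0 <= s -> s < l -> slack s = 0.
Proof.
move=> cpos sl0 rc bound s s0 sl; apply/eqP; rewrite eq_le sl0 andbT leNgt; apply/negP => sp.
have s2 : 0 < slack s / 2 by rewrite divr_gt0.
have [d d0 hd] := rc s s0 sl _ s2; have ls : 0 < l - s by rewrite subr_gt0.
have [m m0 [m1 m2 _]] := min3_gt0 d0 ls ls.
pose c1 := c * (slack s / 2); have c0 : 0 < c1 by rewrite mulr_gt0.
(* the loss is collected on [s, s + m], at half the rate of the slack at s *)
pose g t := c1 * clamp m (t - s).
have zl (w : R) : w <= s -> g w = 0.
  by move=> ws; rewrite /g /clamp (max_idPl _) ?mulr0 // ge_min; apply/orP; left; rewrite subr_le0.
have zr (w : R) : s + m <= w -> g w = c1 * m.
  by move=> ws; rewrite /g /clamp (min_idPr _) ?(max_idPr (ltW m0)) //; lra.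
have glip t h : 0 < h -> g (t + h) - g t <= c1 * h.
  move=> h0; rewrite /g -mulrBr ler_pM2l //; apply: le_trans (ler_norm _) _.
  apply: le_trans (clamp_lip _ _ m0) _; have -> : t + h - s - (t - s) = h by ring.
  by rewrite gtr0_norm.
have cm : 0 < c1 * m by rewrite mulr_gt0.
have : L <= L - (g l - g 0).
  apply: bound => [t t0 tl ep ep0|t t0 tl].
    have nn (h : R) : 0 < h -> 0 <= (c * slack t + ep) * h.
      by move=> h0; rewrite mulr_ge0 ?(ltW h0) // addr_ge0 ?(ltW ep0) // mulr_ge0 ?(ltW cpos).
    have [ts|st] := ltP t s.
      exists (s - t); first by rewrite subr_gt0.
      move=> h h0 hh; rewrite (zl t (ltW ts)) zl ?subrr ?nn //; lra.
    have [tm|mt] := ltP t (s + m).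
      exists 1 => // h h0 _; apply: le_trans (glip t h h0) _; rewrite ler_pM2r // /c1.
      have : slack s / 2 <= slack t.
        have [->|ne] := eqVneq t s; first by lra.
        have ts0 : 0 < t - s by rewrite subr_gt0 lt_neqAle eq_sym ne.
        have td : t - s < d by lra.
        have tE : s + (t - s) = t by ring.
        have := hd _ ts0 td; rewrite tE ler_norml => /andP[k2 _]; lra.
      move=> k2; have k3 : c * (slack s / 2) <= c * slack t by rewrite ler_pM2l.
      lra.
    exists 1 => // h h0 _.
    rewrite (zr t mt) zr ?subrr ?nn //; lra.
  move=> ep ep0; have e1 : 0 < ep / c1 by rewrite divr_gt0.
  exists (ep / c1) => // w w0 w1 w2; rewrite /g -mulrBr normrM (gtr0_norm c0) -ler_pdivlMl //.
  apply: le_trans (clamp_lip _ _ m0) _; have -> : w - s - (t - s) = w - t by ring.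
  rewrite mulrC ltr0_norm; flra w1 w2.
rewrite (zl 0 s0) zr; lra.
Qed.

End Numerics.

Section AffinePerimeter.
Context {R : realType}.

Lemma affine_perimeter_param (C : set (plane R)) : (exists (l : R) (gamma : R -> plane R), arc_length_param C l gamma) ->
  exists (l : R) (gamma : R -> plane R), arc_length_param C l gamma /\
   affine_perimeter C = (\int[lebesgue_measure]_(s in `[0%R, l]) ((curvature gamma s) `^ (3%:R^-1))%:E)%E.
Proof.
move=> [l [gamma h]]; rewrite /affine_perimeter.
have := @xgetPex _ (0, cst 0) [set p : R * (R -> plane R) | arc_length_param C p.1 p.2] (ex_intro _ (l, gamma) h).
by set p := xget _ _ => hp; exists p.1, p.2.
Qed.

(** The default parametrization has length 0. *)
Lemma affine_perimeter_degenerate (C : set (plane R)) : ~ (exists (l : R) (gamma : R -> plane R), arc_length_param C l gamma) ->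
  affine_perimeter C = 0%E.
Proof.
move=> h; rewrite /affine_perimeter xgetPN /=; last by move=> [l gamma] hp; apply: h; exists l, gamma.
by rewrite set_itv1 integral_set1 // lebesgue_measure_set1 mule0.
Qed.

Lemma affine_perimeter_ge0 (C : set (plane R)) : (0 <= affine_perimeter C)%E.
Proof. by apply: integral_ge0 => s _; rewrite lee_fin powR_ge0. Qed.

End AffinePerimeter.

Section Optimal.
Context {R : realType}.
Variables (k : nat) (r al A B ze q0 M3 lam : R).
Hypotheses (hp : refpar k r al A B ze q0) (M0 : 0 < M3) (ME : M3 ^+ 3 = A * B).

(** The half planes whose boundary lines carry the sides of the polygon. *)
Definition inpoly (D : set (plane R)) := forall u v : R, D (u, v) -> forall j : int,
  u * cos (2 * al * j%:~R + al) + v * sin (2 * al * j%:~R + al) <= q0.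

Lemma refset_inpoly : inpoly (refset al A B ze).
Proof.
have [a1 _ _] := al_bounds hp; move=> u v h j; have := h j al; have [-> _] := Hs_al hp.
apply; lra.
Qed.

Lemma refset_area : exists (a' b' As : R) (bot' top' Fb' Ft' : R -> R),
  [/\ body (refbody al A B ze) a' b' bot' top' Fb' Ft', Ft' b' - Fb' b' = As, area (refset al A B ze) = As%:E, 0 < As &
   2 * As = 2 * ze * sin al * q0 * k%:R - 2 * r * k%:R * (A * B)].
Proof.
have cC := refset_compact hp; have vC := @refset_convex R al A B ze; have iC := refset_interior hp.
have vC' : convexP (fun u v => refset al A B ze (u, v)) by apply/convex_setP.
have [a' [b' [bot' [top' [Fb' [Ft' [H aE A0 _]]]]]]] := body_exists cC vC' (area_pos cC iC).
exists a', b', (Ft' b' - Fb' b'), bot', top', Fb', Ft'; split=> //.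
have [l [gamma g]] := refset_param hp; have [e [psi [he H' ht]]] := ccw_of_param cC vC iC g.
have mE : (fun u v => refset al A B ze (u, e * v)) = refbody al A B ze by exact: refset_mirror he.
rewrite mE in H'; have {}H : body (refbody al A B ze) a' b' bot' top' Fb' Ft' := H.
by have := refbody_area hp H' H.
Qed.

Lemma Hs_ph_continuous : continuous (fun psi => Hs A B ze (ph al psi)).
Proof.
have [a1 _ _] := al_bounds hp; apply: (@sector_paste _ al (fun _ => Hs A B ze)) => //.
  move=> j phi _ _; apply: cvgB; apply: cvgM; try exact: cvg_cst; [exact: continuous_cos|exact: qq_continuous].
by move=> j; have [-> ->] := Hs_al hp.
Qed.

Variable As : R.
Hypotheses (areaE : area (refset al A B ze) = As%:E) (As0 : 0 < As)
  (asE : 2 * As = 2 * ze * sin al * q0 * k%:R - 2 * r * k%:R * (A * B))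
  (lamE : lam = As / (k%:R * r * (A * B))) (lam0 : 0 < lam).

Definition Ls := 2 * r * k%:R * M3.

Lemma Ls_gt0 : 0 < Ls.
Proof. have [_ _ r0 _ _ _ _ _ _] := hp; have k0 := k_gt0 hp; by rewrite !mulr_gt0. Qed.

Lemma gain_factor_gt0 : 0 < 2 / (3 * M3 ^+ 2).
Proof. by rewrite divr_gt0 // mulr_gt0 // exprn_gt0. Qed.

Lemma gain_term_ge0 (z ep h : R) : 0 <= z -> 0 < ep -> 0 < h -> 0 <= (2 / (3 * M3 ^+ 2) * z + ep) * h.
Proof.
move=> z0 e0 h0; have c0 := gain_factor_gt0; apply: mulr_ge0; last exact: ltW.
by apply: addr_ge0; [apply: mulr_ge0; [exact: ltW|]|exact: ltW].
Qed.

(** This is where the equation for r enters: lambda is the ratio of the area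
    to k r N. *)
Lemma bound_form (rho a d : R) : 0 < rho ->
  (3 * M3 ^+ 2)^-1 * (2 * (2 * ze * sin al * q0 * k%:R - (rho * a + rho^-1 * As)) + A * B * (2 * r * k%:R)) - d =
  Ls * (1 + lam / 3 * (2 - rho * (a / As) - rho^-1)) - d.
Proof.
move=> rho0; have -> : 2 * ze * sin al * q0 * k%:R = 2 * As + 2 * r * k%:R * (A * B) by rewrite asE; ring.
have [_ _ r0 _ _ _ _ _ _] := hp; have k0 := k_gt0 hp.
have n1 : M3 != 0 by rewrite gt_eqF. have n2 : As != 0 by rewrite gt_eqF. have n3 : rho != 0 by rewrite gt_eqF.
have n4 : k%:R != 0 :> R by rewrite gt_eqF. have n5 : r != 0 by rewrite gt_eqF.
rewrite lamE /Ls -ME; field; by rewrite n1 n2 n3 n4 n5.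
Qed.

Lemma slack_ge0 (D : R -> R -> Prop) (l a b a' b' s : R) (x y psi bot top Fb Ft bot' top' Fb' Ft' : R -> R) :
  ccw D l x y psi -> body D a b bot top Fb Ft -> body (refbody al A B ze) a' b' bot' top' Fb' Ft' ->
  0 <= Hs A B ze (ph al (psi s)) - (cx x a b a' b' s * cos (psi s) + cy x psi a b a' b' bot' top' s * sin (psi s)).
Proof. by move=> H HD HC; rewrite subr_ge0; exact: (refbody_dir hp (psi s) (c_in s H HD HC)). Qed.

(** The translation statement is kept in the reflected body because the
    transport is. *)
Lemma competitor_cases (D : set (plane R)) : compact D -> @convex_set R (plane R) D -> inpoly D ->
  Phi lam D = 0%E \/ exists (a L : R), [/\ area D = a%:E, 0 < a, affine_perimeter D = L%:E, 0 <= L &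
    exists (e rho : R), [/\ (e == 1) || (e == -1), 0 < rho, L <= Ls * (1 + lam / 3 * (2 - rho * (a / As) - rho^-1)) &
     rho = 1 -> a = As -> Ls <= L -> exists p q : R, forall u v : R, D (u, e * v) <-> refbody al A B ze (u + p) (v + q)]].
Proof.
move=> cD vD hD; have [P|/affine_perimeter_degenerate nP] := pselect (exists (l : R) (gamma : R -> plane R), arc_length_param D l gamma); last first.
  by left; rewrite /Phi nP /expe /= !mul0e.
have [l [gamma [g pE]]] := affine_perimeter_param P.
have vD' : convexP (fun u v => D (u, v)) by apply/convex_setP.
have [a0|a0] := boolP (0 < area D)%E; last first.
  have -> : Phi lam D = 0%E; last by left.
  have : (0 <= area D)%E by exact: measure_ge0.
  rewrite le_eqVlt (negbTE a0) orbF => /eqP E.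
  have E0 : (0 `^ lam = 0 :> \bar R)%E by apply: poweR0r; rewrite gt_eqF.
  by rewrite /Phi -E E0 mule0.
have [a1' [b1' [bt' [tp' [Fb0 [Ft0 [_ aE a00 _]]]]]]] := body_exists cD vD' a0.
set a : R := _ - _ in aE a00; clearbody a; clear a1' b1' bt' tp' Fb0 Ft0.
right; have [a' [b' [As' [bot' [top' [Fb' [Ft' [HC AE aE' _ _]]]]]]]] := refset_area.
have EA : As' = As by move: aE'; rewrite areaE => -[].
rewrite EA in AE; clear EA aE' As'.
have [e [a1 [b1 [x [y [psi [bot [top [Fb [Ft [he H HD dE bound]]]]]]]]]]] :=
  length_bound hp M0 ME cD vD aE a00 hD g HC.
set rho := ratio a1 b1 a' b'; have rho0 : 0 < rho by exact: ratio_gt0 HD HC.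
rewrite AE -/rho in bound.
set slack := fun s => Hs A B ze (ph al (psi s)) - (cx x a1 b1 a' b' s * cos (psi s) + cy x psi a1 b1 a' b' bot' top' s * sin (psi s)).
have sl0 s : 0 <= slack s by exact: slack_ge0 H HD HC.
have cpos := gain_factor_gt0.
have b0 : (affine_perimeter D <= (Ls * (1 + lam / 3 * (2 - rho * (a / As) - rho^-1)))%:E)%E.
  have := bound (cst 0); rewrite -pE (bound_form _ _ rho0) /= subrr subr0; apply.
    move=> s _ _ ep ep0; exists 1; first exact: ltr01.
    by move=> h h0 _; exact: gain_term_ge0 (sl0 s) ep0 h0.
  by move=> s _ _; apply: lcont_continuous; exact: cvg_cst.
have [L LE] : exists L : R, affine_perimeter D = L%:E.
  have := affine_perimeter_ge0 D; move: b0; case: (affine_perimeter D) => [L|//|//] _ _; by exists L.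
have L1 : 0 <= L by have h := affine_perimeter_ge0 D; rewrite LE lee_fin in h; exact: h.
have L2 : L <= Ls * (1 + lam / 3 * (2 - rho * (a / As) - rho^-1)) by rewrite LE lee_fin in b0; exact: b0.
exists a, L; apply: (And5 aE a00 LE L1); exists e, rho; apply: (And4 he rho0 L2).
move=> r1 aA LL; have aa : a / As = 1 by rewrite aA; apply: divff; exact: lt0r_neq0 As0.
have sz (s : R) : 0 <= s -> s < l -> slack s = 0.
  apply: (@no_slack R (2 / (3 * M3 ^+ 2)) l L slack cpos sl0).
    move=> t t0 tl; have rp := cc_rcont H t0 tl.
    have c1 : rcont (fun s => Hs A B ze (ph al (psi s))) t.
      by apply: (rcont_comp (F := fun z => Hs A B ze (ph al z))) rp; exact: Hs_ph_continuous.
    have c2 : rcont (fun s => cos (psi s)) t by apply: rcont_comp rp; exact: continuous_cos.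
    have c3 : rcont (fun s => sin (psi s)) t by apply: rcont_comp rp; exact: continuous_sin.
    have c4 := rder_rcont (rder_cx a1 b1 a' b' H t0 tl); have c5 := rcont_cy a1 b1 H HC t0 tl.
    exact: (rcontD c1 (rcontN (rcontD (rcontM c4 c2) (rcontM c5 c3)))).
  move=> g1 hg lg; have := bound g1 hg lg; rewrite -pE LE (bound_form _ _ rho0) r1 aa lee_fin.
  rewrite invr1 mulr1; have -> : 2 - 1 - 1 = 0 :> R by ring.
  rewrite mulr0 addr0 mulr1 => k1; apply: le_trans k1 _; rewrite lerD2r; exact: LL.
have vDe : convexP (fun u v => D (u, e * v)).
  move=> u v u' v' t h1 h2 t01; have := vD' _ _ _ _ t h1 h2 t01.
  by have -> : (1 - t) * (e * v) + t * (e * v') = e * ((1 - t) * v + t * v') by ring.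
apply: (translate_of_normals vDe H HD HC _ r1); first by rewrite dE.
  by rewrite dE AE.
move=> s u v s0 sl huv; have := refbody_dir hp (psi s) huv; have := sz s s0 sl; rewrite /slack; flra vDe.
Qed.

(** The numerical inequality gain_bound applied to the two ratios; in case of
    equality the two bodies are translates by competitor_cases, and the
    translation is trivial by refbody_fixed. *)
Lemma Phi_bound (D : set (plane R)) : compact D -> @convex_set R (plane R) D -> inpoly D ->
  (Phi lam D <= (Ls ^+ 3 * As `^ lam)%:E)%E /\ ((Ls ^+ 3 * As `^ lam)%:E <= Phi lam D -> D = refset al A B ze)%E.
Proof.
move=> cD vD hD; have L0 := Ls_gt0; have P0 : 0 < Ls ^+ 3 * As `^ lam by rewrite mulr_gt0 ?exprn_gt0 ?powR_gt0.
have [->|[a [L [aE a0 LE L1 [e [rho [he rho0 bd tr]]]]]]] := competitor_cases cD vD hD.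
  by rewrite !lee_fin; split; [exact: ltW|move=> h; exfalso; lra].
have PE : Phi lam D = (L ^+ 3 * a `^ lam)%:E by rewrite /Phi LE aE poweR_EFin -EFin_expe -EFinM.
pose w := L / Ls; pose t := a / As; have t0 : 0 < t by rewrite divr_gt0.
have wL : L = w * Ls by rewrite /w divfK // gt_eqF.
have tA : a = t * As by rewrite /t divfK // gt_eqF.
have w0 : 0 <= w by rewrite divr_ge0 // ltW.
have wb : w <= 1 + lam / 3 * (2 - rho * t - rho^-1) by rewrite /w ler_pdivrMr // mulrC.
have [g1 g2] := gain_bound lam0 rho0 t0 w0 wb.
have prod : L ^+ 3 * a `^ lam = (w ^+ 3 * t `^ lam) * (Ls ^+ 3 * As `^ lam).
  rewrite wL tA powRM ?(ltW t0) ?(ltW As0) // exprMn; ring.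
rewrite PE !lee_fin prod; split; first by rewrite ler_piMl // ltW.
rewrite ler_pMl // => gg; have [r1 t1] := g2 gg.
have aA : a = As by rewrite tA t1 mul1r.
have w1 : 1 <= w.
  by move: gg; rewrite t1 powR1 mulr1 -{1}(expr1n _ 3) ler_pXn2r ?nnegrE.
have LL : Ls <= L by rewrite wL ler_pMl.
have [p [q pq]] := tr r1 aA LL.
have hDe := halfplanes_mirror he hD.
have [p0 q0'] := refbody_fixed hp hDe pq; rewrite p0 q0' in pq.
have ee : e * e = 1 by case/orP: he => /eqP ->; rewrite ?mulr1 // mulrNN mulr1.
have mir (u v : R) : refbody al A B ze u (e * v) <-> refset al A B ze (u, v).
  have mE : (fun u v => refset al A B ze (u, e * v)) = refbody al A B ze by exact: refset_mirror he.
  have E : refbody al A B ze u (e * v) = refbody al A B ze u v := congr1 (fun f : R -> R -> Prop => f u v) mE.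
  by rewrite E.
have key (u v : R) : D (u, v) <-> refset al A B ze (u, v).
  by rewrite -mir -[v in D (u, v)]mul1r -ee -mulrA pq !addr0.
by apply/seteqP; split=> -[u v] /key.
Qed.

(** The affine length of the reference body is at least Ls by its curvature,
    and at most Ls by the general bound. *)
Lemma Phi_refset : Phi lam (refset al A B ze) = (Ls ^+ 3 * As `^ lam)%:E.
Proof.
have cC := refset_compact hp; have vC := @refset_convex R al A B ze; have L0 := Ls_gt0.
apply/eqP; rewrite eq_le (Phi_bound cC vC refset_inpoly).1 /=.
have [l [gamma [g pE]]] := affine_perimeter_param (refset_param hp).
have := refset_length hp M0 ME g; rewrite -pE /Phi areaE poweR_EFin => h.
have ap : 0 < As `^ lam by rewrite powR_gt0.
move: h; case: (affine_perimeter _) => [L|_|//].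
  rewrite lee_fin -/Ls => LL; have L1 : 0 <= L by exact: le_trans (ltW L0) LL.
  have h3 : Ls ^+ 3 <= L ^+ 3 by exact: cube_le (ltW L0) LL.
  have h4 : Ls ^+ 3 * As `^ lam <= L ^+ 3 * As `^ lam by rewrite ler_pM2r.
  by rewrite -EFin_expe -EFinM lee_fin.
by rewrite /expe /= !mulyy gt0_mulye ?lte_fin ?leey.
Qed.

Lemma refset_maximizer (K : set (plane R)) : refset al A B ze `<=` K -> (forall D, D `<=` K -> inpoly D) ->
  unique (maximizer lam K) (refset al A B ze).
Proof.
move=> sub hK; have cC := refset_compact hp; have vC := @refset_convex R al A B ze.
split.
  split=> [|D [cD vD sD]]; first by split.
  by rewrite Phi_refset; exact: (Phi_bound cD vD (hK D sD)).1.
move=> D [[cD vD sD] mD]; apply/esym/(Phi_bound cD vD (hK D sD)).2.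
by rewrite -Phi_refset; apply: mD.
Qed.

End Optimal.

(** * The equation for v *)

Section LambdaEquation.
Context {R : realType}.

Lemma sinh_ge_id (x : R) : 0 <= x -> x <= sinh x.
Proof.
move=> x0; have d (t : R) : 0 <= t <= x -> is_derive t 1 (fun u => sinh u - u) (cosh t - 1).
  by move=> _; have i1 := is_derive_sinh t; apply: is_deriveB.
have := derive_nondecreasing d _ (lexx 0) x0 (lexx x).
rewrite sinh0 subr0 subr_ge0; apply => t _; rewrite subr_ge0; exact: cosh_ge1.
Qed.

(** Both sides vanish at 0; compare the derivatives x sinh x and x^2. *)
Lemma cosh_gap (x : R) : 0 <= x -> x ^+ 3 / 3 <= x * cosh x - sinh x.
Proof.
move=> x0; have d (t : R) : 0 <= t <= x -> is_derive t 1 (fun u => u * cosh u - sinh u - 3^-1 * (u * (u * u))) (t * sinh t - t ^+ 2).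
  move=> _; have i1 := is_derive_sinh t; have i2 := is_derive_cosh t; have i0 := is_derive_id t (1 : R).
  have i3 : is_derive t 1 (fun u => u * cosh u) (t *: sinh t + cosh t *: (1 : R)) by exact: is_deriveM.
  have i4 : is_derive t 1 (fun u : R => u * u) (t *: (1 : R) + t *: (1 : R)) by exact: is_deriveM.
  have i5 : is_derive t 1 (fun u : R => u * (u * u)) (t *: (t *: (1 : R) + t *: (1 : R)) + (t * t) *: (1 : R)) by exact: is_deriveM.
  have i6 : is_derive t 1 (fun u : R => 3^-1 * (u * (u * u))) (3^-1 *: (t *: (t *: (1 : R) + t *: (1 : R)) + (t * t) *: (1 : R))) by exact: is_deriveZ.
  have := is_deriveB (is_deriveB i3 i1) i6; rewrite /GRing.scale /=.
  have -> // : t * sinh t + cosh t * 1 - cosh t - 3^-1 * (t * (t * 1 + t * 1) + t * t * 1) = t * sinh t - t ^+ 2.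
  by field.
have := derive_nondecreasing d _ (lexx 0) x0 (lexx x).
have -> : 0 * cosh 0 - sinh 0 - 3^-1 * (0 * (0 * 0)) = 0 :> R by rewrite sinh0; ring.
have -> : x * cosh x - sinh x - 3^-1 * (x * (x * x)) = x * cosh x - sinh x - x ^+ 3 / 3 by ring.
rewrite subr_ge0; apply => t /andP[t0 _]; rewrite expr2 -mulrBr mulr_ge0 // subr_ge0; exact: sinh_ge_id.
Qed.

(** The derivative of sinh x / x is (x cosh x - sinh x) / x^2, at least x / 3
    by cosh_gap. The explicit rate gives both the strict monotonicity of Psi
    and its limit at infinity. *)
Lemma sinhc_growth (s t : R) : 0 < s -> s <= t -> s / 3 * (t - s) <= sinh t / t - sinh s / s.
Proof.
move=> s0 st; have d (x : R) : s <= x <= t -> is_derive x 1 (fun u => u^-1 * sinh u - s / 3 * u) ((x * cosh x - sinh x) / x ^+ 2 - s / 3).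
  move=> /andP[sx _]; have x0 : x != 0 by rewrite gt_eqF // (lt_le_trans s0).
  have i1 := is_derive_sinh x; have i0 := is_derive_id x (1 : R).
  have i2 : is_derive x 1 (fun u : R => u^-1) (- x ^- 2 *: (1 : R)) by exact: is_deriveV.
  have i3 : is_derive x 1 (fun u => u^-1 * sinh u) (x^-1 *: cosh x + sinh x *: (- x ^- 2 *: (1 : R))) by exact: is_deriveM.
  have i4 : is_derive x 1 (fun u : R => s / 3 * u) (s / 3 *: (1 : R)) by exact: is_deriveZ.
  have := is_deriveB i3 i4; rewrite /GRing.scale /=.
  have -> // : x^-1 * cosh x + sinh x * (- x ^- 2 * 1) - s / 3 * 1 = (x * cosh x - sinh x) / x ^+ 2 - s / 3.
  by field.
have := derive_nondecreasing d _ (lexx s) st (lexx t).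
have -> : (s^-1 * sinh s - s / 3 * s <= t^-1 * sinh t - s / 3 * t) = (s / 3 * (t - s) <= sinh t / t - sinh s / s).
  by rewrite ![_^-1 * _]mulrC; apply/idP/idP; lra.
apply=> x /andP[sx _]; have x0 : 0 < x by exact: lt_le_trans sx.
have := cosh_gap (ltW x0); have x2 : 0 < x ^+ 2 by rewrite exprn_gt0.
rewrite subr_ge0 => g; rewrite ler_pdivlMr //; apply: le_trans g.
have -> : x ^+ 3 / 3 = x / 3 * x ^+ 2 by ring.
by rewrite ler_pM2r // ler_pM2r // invr_gt0.
Qed.

Lemma Psi_pos (r : R) : 0 < r -> Psi r = sinh (2 * r) / (2 * r) - 1.
Proof. by move=> r0; rewrite /Psi gt_eqF. Qed.

Lemma Psi_lt (s t : R) : 0 < s -> s < t -> Psi s < Psi t.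
Proof.
move=> s0 st; have t0 := lt_trans s0 st; rewrite !Psi_pos // ltrD2r -subr_gt0.
have s2 : 0 < 2 * s by rewrite mulr_gt0. have st2 : 2 * s <= 2 * t by rewrite ler_pM2l // ltW.
apply: lt_le_trans (sinhc_growth s2 st2).
by rewrite -mulrBr !mulr_gt0 // ?divr_gt0 // subr_gt0.
Qed.

Lemma Psi_gt0 (r : R) : 0 < r -> 0 < Psi r.
Proof.
move=> r0; have h0 : 0 < r / 2 by rewrite divr_gt0.
have hr : r / 2 < r by lra.
apply: le_lt_trans (Psi_lt h0 hr); rewrite Psi_pos // subr_ge0 ler_pdivlMr ?mulr_gt0 // mul1r.
by apply: sinh_ge_id; rewrite mulr_ge0 // ltW.
Qed.

Lemma Psi_rhs (r : R) : 0 < r -> r * Psi r = sinh r * cosh r - r.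
Proof.
move=> r0; rewrite Psi_pos //; have -> : sinh (2 * r) = 2 * (sinh r * cosh r).
  have -> : 2 * r = r + r by ring.
  by rewrite sinhD; ring.
move: (sinh r) (cosh r) => s c; field.
by rewrite gt_eqF.
Qed.

Lemma Psi_invK (r : R) : 0 < r -> Psi_inv (Psi r) = r.
Proof.
move=> r0; have P0 := Psi_gt0 r0; rewrite /Psi_inv.
have := @xgetPex _ 0 [set x : R | 0 <= x /\ Psi x = Psi r] (ex_intro _ r (conj (ltW r0) erefl)).
move: (xget _ _) => x [x0 xE].
have xp : 0 < x.
  rewrite lt_neqAle x0 andbT; apply/eqP => E; move: P0; rewrite -xE -E /Psi eqxx ltxx //.
have [lt|lt|//] := ltgtP x r; first by have := Psi_lt xp lt; rewrite xE ltxx.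
by have := Psi_lt r0 lt; rewrite xE ltxx.
Qed.

Variables (a b : R) (k : nat).
Hypotheses (a0 : 0 < a) (b0 : 0 < b) (k0 : (0 < k)%N).

(** The right-hand side of the equation for v, as a function of r. *)
Definition lam_of (r : R) : R := (a + k%:R * r * fhyp r * Psi r * b) / (k%:R * r * fhyp r * b).

(** In this form every factor is visibly increasing. *)
Lemma lam_ofE (r : R) : 0 < r -> lam_of r = a / (k%:R * b) * (sinh r / r * (sinh r * (sinh r / cosh r))) + Psi r.
Proof.
move=> r0; have s0 : 0 < sinh r by rewrite sinh_gt0. have c0 := cosh_gt0 r.
have kp : 0 < k%:R :> R by rewrite ltr0n.
rewrite /lam_of /fhyp; move: (Psi r) => P; field.
by rewrite !gt_eqF.
Qed.

Lemma lam_of_lt (s t : R) : 0 < s -> s < t -> lam_of s < lam_of t.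
Proof.
move=> s0 st; have t0 := lt_trans s0 st; have ss : 0 < sinh s by rewrite sinh_gt0. have cs := cosh_gt0 s.
have ct := cosh_gt0 t; have kp : 0 < k%:R :> R by rewrite ltr0n.
have sl : sinh s <= sinh t by rewrite ltW // ltr_sinh.
rewrite !lam_ofE // ler_ltD ?Psi_lt // ler_pM2l ?divr_gt0 ?mulr_gt0 //.
have f1 : 0 <= sinh s / s by rewrite divr_ge0 // ltW.
have f2 : 0 <= sinh s / cosh s by rewrite divr_ge0 // ltW.
have f3 : 0 <= sinh s * (sinh s / cosh s) by rewrite mulr_ge0 // ltW.
have f4 : sinh s / s <= sinh t / t.
  have g := sinhc_growth s0 (ltW st); have : 0 <= s / 3 * (t - s) by rewrite mulr_ge0 ?divr_ge0 ?subr_ge0 ?(ltW s0) ?(ltW st).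
  lra.
apply: ler_pM => //; apply: ler_pM => //; first exact: ltW.
rewrite ler_pdivrMr // mulrAC ler_pdivlMr // -subr_ge0.
have -> : sinh t * cosh s - sinh s * cosh t = sinh (t - s) by rewrite sinhB; ring.
by rewrite sinh_ge0 subr_ge0 ltW.
Qed.

Lemma lam_of_continuous (r : R) : 0 < r -> {for r, continuous (fun r => a / (k%:R * b) * (sinh r / r * (sinh r * (sinh r / cosh r))) + (sinh (2 * r) / (2 * r) - 1))}.
Proof.
move=> r0; have cont (f : R -> R) (w d : R) : is_derive w 1 f d -> {for w, continuous f}.
  by case=> D _; apply: differentiable_continuous; apply/derivable1_diffP.
have cs (w : R) : {for w, continuous (@sinh R)} := cont _ _ _ (is_derive_sinh w).
have cc : {for r, continuous (@cosh R)} := cont _ _ _ (is_derive_cosh r).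
have c2 : {for r, continuous (fun t : R => 2 * t)} by apply: cvgM; [exact: cvg_cst|exact: cvg_id].
have c2s : {for r, continuous (fun t : R => sinh (2 * t))} by apply: (@continuous_comp _ _ _ (fun t : R => 2 * t) (@sinh R)); [exact: c2|exact: cs].
have ci : {for r, continuous (fun t : R => t^-1)} by apply: cvgV; [exact: lt0r_neq0|exact: cvg_id].
have c2i : {for r, continuous (fun t : R => (2 * t)^-1)} by apply: cvgV; [rewrite mulf_neq0 // gt_eqF|exact: c2].
have cci : {for r, continuous (fun t : R => (cosh t)^-1)} by apply: cvgV; [exact: lt0r_neq0 (cosh_gt0 r)|exact: cc].
apply: cvgD; last by apply: cvgB; [apply: cvgM; [exact: c2s|exact: c2i]|exact: cvg_cst].
apply: cvgM; first exact: cvg_cst.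
apply: cvgM; first by apply: cvgM; [exact: cs|exact: ci].
by apply: cvgM; [exact: cs|apply: cvgM; [exact: cs|exact: cci]].
Qed.

(** The right-hand side is of order r at 0 and at least (2 r - 4) / 3 for
    large r. *)
Lemma lam_of_surj (lam : R) : 0 < lam -> exists2 r : R, 0 < r & lam_of r = lam.
Proof.
move=> l0; have kp : 0 < k%:R :> R by rewrite ltr0n.
pose c := a / (k%:R * b); have c0 : 0 < c by rewrite divr_gt0 // mulr_gt0.
pose F r := c * (sinh r / r * (sinh r * (sinh r / cosh r))) + (sinh (2 * r) / (2 * r) - 1).
have FE r : 0 < r -> lam_of r = F r by move=> r0; rewrite lam_ofE // Psi_pos.
have c8 : 0 < 8 * c + 4 by lra.
have q0 : 0 < (1 / 4 : R) by rewrite divr_gt0.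
have [d d0 [d1 d2 _]] := min3_gt0 q0 (divr_gt0 l0 c8) q0.
(* the bound of sinhc_growth between 1 and 2 M gives Psi M >= lam *)
pose M := (3 * lam + 4) / 2; have dM : d <= M by rewrite /M; lra.
have F1 : F d <= lam.
  have s0 : 0 < sinh d by rewrite sinh_gt0. have ch0 := cosh_gt0 d; have ch1 := cosh_ge1 d.
  have s2 : sinh d <= 2 * d by apply: sinh_le2; lra.
  have t1 : sinh d / d <= 2 by rewrite ler_pdivrMr // mulrC.
  have t2 : sinh d / cosh d <= sinh d by rewrite ler_pdivrMr // ler_peMr // ltW.
  have t3 : sinh d * (sinh d / cosh d) <= 2 * d * (2 * d).
    by apply: ler_pM => //; [exact: ltW|apply: divr_ge0; exact: ltW|exact: le_trans t2 s2].
  have t4 : sinh d / d * (sinh d * (sinh d / cosh d)) <= 2 * (2 * d * (2 * d)).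
    have g1 : 0 <= sinh d / cosh d by apply: divr_ge0; exact: ltW.
    by apply: ler_pM => //; [apply: divr_ge0; exact: ltW|apply: mulr_ge0 => //; exact: ltW].
  have t5 : sinh (2 * d) / (2 * d) - 1 <= 4 * d.
    have p : 0 < 2 * d by rewrite mulr_gt0. have p0 := ltW p.
    have p1 : 2 * d < 1 by lra.
    have ub := sinh_ub p0 p1; rewrite lerBlDr ler_pdivrMr //.
    have := sinh_ge0 (2 * d); nra.
  have t6 : d * (8 * c + 4) <= lam by rewrite -ler_pdivlMr.
  have t7 : c * (sinh d / d * (sinh d * (sinh d / cosh d))) <= c * (2 * (2 * d * (2 * d))) by rewrite ler_pM2l.
  have t8 : c * (2 * (2 * d * (2 * d))) <= c * (8 * d).
    by rewrite ler_pM2l //; nra.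
  rewrite /F; flra t5 t6 t7 t8.
have M0 : 0 < M by rewrite /M; lra.
have F2 : lam <= F M.
  have h1 : 1 <= 2 * M by rewrite /M; lra.
  have := sinhc_growth (ltr01 : (0 : R) < 1) h1; rewrite divr1.
  have s1 : 0 < sinh (1 : R) by rewrite sinh_gt0.
  have sM : 0 < sinh M by rewrite sinh_gt0. have cM := cosh_gt0 M.
  have : 0 <= c * (sinh M / M * (sinh M * (sinh M / cosh M))).
    by apply/ltW; apply: mulr_gt0 => //; apply: mulr_gt0; [exact: divr_gt0|apply: mulr_gt0 => //; exact: divr_gt0].
  rewrite /F; move: (c * _) (sinh (2 * M) / (2 * M)) (sinh 1) s1 => X Y Z Z0 X0 YZ; rewrite /M in YZ; lra.
have cF : {within `[d, M], continuous F}.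
  apply: (@continuous_in_subspaceT _ _ `[d, M] F) => w; rewrite inE /= in_itv /= => /andP[w1 _].
  by apply: lam_of_continuous; exact: lt_le_trans w1.
have [|r] := IVT dM cF (v := lam); first by rewrite ge_min F1 /= le_max F2 orbT.
rewrite in_itv /= => /andP[r1 _] E; have r0 := lt_le_trans d0 r1.
by exists r => //; rewrite FE.
Qed.

(** Outside of the range of Psi the function Psi_inv is 0, and the right-hand
    side is then a quotient by 0, which is not the positive lambda. *)
Lemma lambda_equation (lam : R) : 0 < lam -> exists r : R, [/\ 0 < r, lam = lam_of r, Psi_inv (Psi r) = r &
  unique (fun v : R => 0 < v /\ lam = lam_of (Psi_inv v)) (Psi r)].
Proof.
move=> l0; have [r r0 E] := lam_of_surj l0; exists r; split=> //; first exact: Psi_invK.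
split; first by rewrite Psi_invK // E Psi_gt0.
move=> v [v0 vE]; have [[x [x0 xv]]|no] := pselect (exists x : R, 0 <= x /\ Psi x = v); last first.
  have I0 : Psi_inv v = 0 by rewrite /Psi_inv xgetPN // => x hx; apply: no; exists x.
  by move: l0; rewrite vE I0 /lam_of mulr0 !mul0r invr0 mulr0 ltxx.
have xp : 0 < x.
  rewrite lt_neqAle x0 andbT; apply/eqP => X; move: v0; rewrite -xv -X /Psi eqxx ltxx //.
have iv : Psi_inv v = x by rewrite -xv Psi_invK.
rewrite -xv; congr Psi; rewrite iv in vE.
have [lt|lt|//] := ltgtP r x; first by have := lam_of_lt r0 lt; rewrite E vE ltxx.
by have := lam_of_lt xp lt; rewrite E vE ltxx.
Qed.

End LambdaEquation.

(** * The polygon, its corner triangles and the hyperbola arcs *)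

Section Polygon.
Context {R : realType}.

Lemma hullP (G : set (plane R)) (p : plane R) :
  (forall M : set (plane R), convexP (fun u v => M (u, v)) -> G `<=` M -> M p) -> convex_hull G p.
Proof. by move=> h M [cM GM]; apply: h => //; apply/convex_setP. Qed.

Lemma convex_three (M : set (plane R)) (u v u' v' u'' v'' al be ga : R) : convexP (fun u v => M (u, v)) ->
  M (u, v) -> M (u', v') -> M (u'', v'') -> 0 <= al -> 0 <= be -> 0 <= ga -> al + be + ga = 1 ->
  M (al * u + be * u' + ga * u'', al * v + be * v' + ga * v'').
Proof.
move=> cM m1 m2 m3 a0 b0 c0 E; have [ab|ab] := eqVneq (al + be) 0.
  have a1 : al = 0 by lra. have b1 : be = 0 by lra. have c1 : ga = 1 by lra.
  by rewrite a1 b1 c1 !mul0r !mul1r !add0r.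
have ab0 : 0 < al + be by rewrite lt_neqAle eq_sym ab addr_ge0.
have t1 : 0 <= be / (al + be) <= 1 by rewrite divr_ge0 ?(ltW ab0) //= ler_pdivrMr // mul1r lerDr.
have t2 : 0 <= ga <= 1 by rewrite c0; lra.
have := cM _ _ _ _ _ (cM _ _ _ _ _ m1 m2 t1) m3 t2.
have key (x y z : R) : (1 - ga) * ((1 - be / (al + be)) * x + be / (al + be) * y) + ga * z = al * x + be * y + ga * z.
  have -> : 1 - ga = al + be by lra.
  by field.
by rewrite !key.
Qed.

Lemma affine_frame (c1 c2 a b c d : R) : affine_map (fun p : plane R => (c1 + a * p.1 + b * p.2, c2 + c * p.1 + d * p.2) : plane R).
Proof.
move=> t [u v] [u' v'] /=; apply: injective_projections; rewrite /= /GRing.scale /=.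
  ring.
ring.
Qed.

Variables (k : nat) (r al A B ze q0 : R).
Hypotheses (hp : refpar k r al A B ze q0) (qE : k%:R * q0 ^+ 2 * sin al = cos al).

Lemma vertexE (j : nat) : vertex R k j = (q0 / cos al * cos (2 * al * j%:R), q0 / cos al * sin (2 * al * j%:R)).
Proof.
have [_ alE _ _ _ q00 _ _ _] := hp; have kp := k_gt0 hp; have c0 := cos_al_gt0 hp; have s0 := sin_al_gt0 hp.
have kn : k%:R != 0 :> R by rewrite gt_eqF.
have rho : Num.sqrt (2 / (k%:R * sin (2 * pi / k%:R))) = q0 / cos al.
  have r0 : 0 <= q0 / cos al by rewrite divr_ge0 // ltW.
  rewrite -[RHS](ger0_norm r0) -sqrtr_sqr; congr Num.sqrt.
  have -> : 2 * pi / k%:R = al + al :> R by rewrite alE; field.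
  rewrite sinD; have -> : sin al * cos al + cos al * sin al = 2 * (sin al * cos al) by ring.
  apply: (mulIf (lt0r_neq0 c0)); rewrite -{2}qE.
  have cn : cos al != 0 by exact: lt0r_neq0. have sn : sin al != 0 by exact: lt0r_neq0.
  by field; rewrite kn cn sn.
have ang : 2 * pi * j%:R / k%:R = 2 * al * j%:R :> R by rewrite alE; field.
by rewrite /vertex /= rho ang.
Qed.

Lemma midpointE (i : nat) : midpoint R k i = (q0 * cos (2 * al * i%:R + al), q0 * sin (2 * al * i%:R + al)).
Proof.
have c0 := cos_al_gt0 hp; have cn : cos al != 0 by rewrite gt_eqF.
rewrite /midpoint !vertexE; have e1 : 2 * al * i%:R = (2 * al * i%:R + al) - al by ring.
have e2 : 2 * al * i.+1%:R = (2 * al * i%:R + al) + al by rewrite -natr1; ring.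
rewrite e2 {1 2}e1; move: (_ + al) => t; congr pair; rewrite /GRing.scale /=.
  by rewrite cosB cosD; field.
by rewrite sinB sinD; field.
Qed.

(** The half planes are convex and contain the vertices. *)
Lemma Reg_inpoly : inpoly al q0 (Reg R k).
Proof.
have [_ _ _ _ _ q00 _ _ _] := hp; have c0 := cos_al_gt0 hp; have [a1 a2 a3] := al_bounds hp.
pose H : set (plane R) := [set p : plane R | forall j : int, p.1 * cos (2 * al * j%:~R + al) + p.2 * sin (2 * al * j%:~R + al) <= q0].
suff sub : Reg R k `<=` H by move=> u v /sub.
move=> p hpp; apply: hpp; split.
  apply/convex_setP => u v u' v' t h1 h2 /andP[t0 t1] j; rewrite /=.
  have k1 := h1 j; have k2 := h2 j; rewrite /= in k1 k2.
  have k3 : (1 - t) * (u * cos (2 * al * j%:~R + al) + v * sin (2 * al * j%:~R + al)) <= (1 - t) * q0 by rewrite ler_wpM2l // subr_ge0.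
  have k4 : t * (u' * cos (2 * al * j%:~R + al) + v' * sin (2 * al * j%:~R + al)) <= t * q0 by rewrite ler_wpM2l.
  lra.
move=> _ [i _ <-] j; rewrite vertexE /=.
have -> : q0 / cos al * cos (2 * al * i%:R) * cos (2 * al * j%:~R + al) + q0 / cos al * sin (2 * al * i%:R) * sin (2 * al * j%:~R + al)
  = q0 / cos al * cos (2 * al * i%:R - (2 * al * j%:~R + al)) by rewrite cosB; ring.
have -> : 2 * al * i%:R - (2 * al * j%:~R + al) = 0 + (2 * (i%:Z - j) - 1)%:~R * al.
  by rewrite !(intrD, intrM, mulrNz) mulr1z -pmulrn; ring.
have na : - al <= 0 by lra. have pa : 0 <= al by lra.
have := cos_midpoint hp (i%:Z - j) na pa; rewrite normr0 subr0 => cm.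
have : q0 / cos al * cos (0 + (2 * (i%:Z - j) - 1)%:~R * al) <= q0 / cos al * cos al by rewrite ler_pM2l ?divr_gt0.
by rewrite divfK // gt_eqF.
Qed.

Lemma vertex_in_Reg (M : set (plane R)) (j : nat) : [set vertex R k j | j in [set j | (j < k)%N]] `<=` M -> M (vertex R k j).
Proof.
have [k3 alE _ _ _ _ _ _ _] := hp; move=> sub.
have -> : vertex R k j = vertex R k (j %% k)%N.
  rewrite !vertexE {1 2}(divn_eq j k) natrD natrM.
  have -> : 2 * al * ((j %/ k)%N%:R * k%:R + (j %% k)%N%:R) = 2 * al * (j %% k)%N%:R + 2 * pi * (Posz (j %/ k))%:~R.
    by rewrite -(kal hp) -pmulrn; ring.
  by have [-> ->] := sin_cos_2pi_int (2 * al * (j %% k)%N%:R : R) (Posz (j %/ k)).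
by apply: sub; exists (j %% k)%N => //=; rewrite ltn_mod (leq_trans _ k3).
Qed.

(** The affine map from the unit triangle onto the triangle of the corner i +
    1, in terms of the radial and tangential directions of this corner. *)
Definition corner_map (i : nat) (p : plane R) : plane R :=
  let t : R := 2 * al * i.+1%:R in
  ((q0 * cos al * cos t + q0 * sin al * sin t) + (- (q0 * sin al * sin t)) * p.1 + (q0 * sin al ^+ 2 / cos al * cos t) * p.2,
   (q0 * cos al * sin t - q0 * sin al * cos t) + (q0 * sin al * cos t) * p.1 + (q0 * sin al ^+ 2 / cos al * sin t) * p.2).

Lemma corner_map_vertices (i : nat) : [/\ affine_map (corner_map i), corner_map i (0, 0) = midpoint R k i,
  corner_map i (2, 0) = midpoint R k i.+1 & corner_map i (1, 1) = vertex R k i.+1].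
Proof.
have c0 := cos_al_gt0 hp; have cn : cos al != 0 by rewrite gt_eqF.
split; first exact: affine_frame.
- rewrite midpointE /corner_map /=; set t := 2 * al * i.+1%:R.
  have -> : 2 * al * i%:R + al = t - al by rewrite /t -natr1; ring.
  by rewrite cosB sinB; congr pair; ring.
- rewrite midpointE /corner_map /=; set t := 2 * al * i.+1%:R.
  by rewrite cosD sinD; congr pair; ring.
- rewrite vertexE /corner_map /=; set t := 2 * al * i.+1%:R.
  have cs := cos2Dsin2 al; have sE : sin al ^+ 2 = 1 - cos al ^+ 2 by lra.
  by rewrite sE; congr pair; field.
Qed.

Lemma Bcos : B * sinh r ^+ 2 * cos al = q0 * sin al ^+ 2 * cosh r.
Proof.
have [_ _ _ _ _ _ hA hB _] := hp.
have -> : B * sinh r ^+ 2 * cos al = (B * sinh r * cos al) * sinh r by ring.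
have -> : q0 * sin al ^+ 2 * cosh r = (q0 * sin al) * sin al * cosh r by ring.
by rewrite hB -hA; ring.
Qed.

(** With w = r (1 - 2 t), the product 2 sinh (r (1 - t)) sinh (r t) equals
    cosh r - cosh w. *)
Lemma corner_map_curve (i : nat) (t : R) : Psi_inv (Psi r) = r ->
  corner_map i (Hcurve (Psi r) t) = (ax al A B ze i.+1 (r * (1 - 2 * t)), ay al A B ze i.+1 (r * (1 - 2 * t))).
Proof.
have [_ _ r0 _ _ _ hA hB hz] := hp; move=> iv; have c0 := cos_al_gt0 hp.
have s0 : 0 < sinh r by rewrite sinh_gt0. have sn : sinh r != 0 by rewrite gt_eqF.
have cn : cos al != 0 by rewrite gt_eqF.
set w := r * (1 - 2 * t).
have pr : 2 * (sinh (r * (1 - t)) * sinh (r * t)) = cosh r - cosh w.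
  have -> : w = r * (1 - t) - r * t by rewrite /w; ring.
  have -> : cosh r = cosh (r * (1 - t) + r * t) by congr cosh; ring.
  by rewrite coshB coshD; ring.
have AE : A = q0 * sin al / sinh r by rewrite -hA mulfK.
have BE : B = q0 * sin al ^+ 2 * cosh r / (sinh r ^+ 2 * cos al).
  by rewrite -Bcos; field; rewrite cn sn.
rewrite /corner_map /Hcurve iv /= -/w; set th := 2 * al * i.+1%:R.
have -> : 2 * cosh r / sinh r ^+ 2 * sinh (r * (1 - t)) * sinh (r * t) = cosh r / sinh r ^+ 2 * (cosh r - cosh w) by rewrite -pr; ring.
rewrite /ax /ay /aP hz AE BE -pmulrn -/th.
by congr pair; field; rewrite cn sn.
Qed.

Lemma corner_curve_range (i : nat) : Psi_inv (Psi r) = r ->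
  corner_map i @` Hset (Psi r) = [set p : plane R | exists w : R, `|w| <= r /\ p = (ax al A B ze i.+1 w, ay al A B ze i.+1 w)].
Proof.
move=> iv; have [_ _ r0 _ _ _ _ _ _] := hp; apply/seteqP; split=> [_ [_ [t /= ht <-] <-]|p [w [wr ->]]].
  exists (r * (1 - 2 * t)); split; last exact: corner_map_curve.
  move: ht; rewrite in_itv /= => /andP[t0 t1]; rewrite normrM (gtr0_norm r0) ler_piMr ?(ltW r0) // ler_norml.
  by apply/andP; split; lra.
have rn : r != 0 by rewrite gt_eqF.
pose t := (1 - w / r) / 2; have wE : r * (1 - 2 * t) = w by rewrite /t; field.
exists (Hcurve (Psi r) t); last by rewrite corner_map_curve // wE.
exists t => //=; rewrite in_itv /= /t; move: wr; rewrite ler_norml => /andP[w1 w2].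
have : w / r <= 1 by rewrite ler_pdivrMr // mul1r.
have : -1 <= w / r by rewrite ler_pdivlMr // mulN1r.
by move=> *; apply/andP; split; lra.
Qed.

(** In barycentric coordinates the inequalities to check reduce to cosh (r -
    w) >= 1 and cosh (r + w) >= 1. *)
Lemma arc_in_triangle (i : nat) (w : R) (M : set (plane R)) : `|w| <= r -> convexP (fun u v => M (u, v)) ->
  M (midpoint R k i) -> M (midpoint R k i.+1) -> M (vertex R k i.+1) -> M (ax al A B ze i.+1 w, ay al A B ze i.+1 w).
Proof.
have [_ _ r0 _ _ _ hA hB hz] := hp; move=> wr cM m1 m2 m3; have c0 := cos_al_gt0 hp.
have s0 : 0 < sinh r by rewrite sinh_gt0. have sn : sinh r != 0 by rewrite gt_eqF.
have cn : cos al != 0 by rewrite gt_eqF.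
pose X := sinh w / sinh r; pose y := cosh r * (cosh r - cosh w) / sinh r ^+ 2.
have y0 : 0 <= y.
  rewrite divr_ge0 ?sqr_ge0 // mulr_ge0 ?(ltW (cosh_gt0 r)) // subr_ge0.
  by apply: cosh_le; rewrite (gtr0_norm r0).
have tri (v : R) : v <= r -> 1 <= cosh (r - v) by move=> _; exact: cosh_ge1.
have S2 : sinh r ^+ 2 = cosh r ^+ 2 - 1 by have := cosh_sq r; lra.
have bound (e : R) : e * e = 1 -> y <= 1 - e * X.
  move=> ee; have := cosh_ge1 (r - e * w).
  have [ce se] : cosh (e * w) = cosh w /\ sinh (e * w) = e * sinh w.
    have /orP[/eqP ->|/eqP ->] : (e == 1) || (e == -1) by rewrite -sqrf_eq1 expr2 ee.
      by rewrite !mul1r.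
    by rewrite !mulN1r coshN sinhN.
  rewrite coshB ce se => h; rewrite -subr_ge0.
  have -> : 1 - e * X - y = (cosh r * cosh w - sinh r * (e * sinh w) - 1) / sinh r ^+ 2.
    rewrite /X /y; apply: (mulIf (lt0r_neq0 s0)); apply: (mulIf (lt0r_neq0 s0)).
    have -> : (1 - e * (sinh w / sinh r) - cosh r * (cosh r - cosh w) / sinh r ^+ 2) * sinh r * sinh r = sinh r ^+ 2 - e * sinh w * sinh r - cosh r * (cosh r - cosh w) by field.
    have -> : (cosh r * cosh w - sinh r * (e * sinh w) - 1) / sinh r ^+ 2 * sinh r * sinh r = cosh r * cosh w - sinh r * (e * sinh w) - 1 by field.
    rewrite S2; ring.
  by rewrite divr_ge0 ?sqr_ge0 // subr_ge0.
have b1 := bound 1 (mulr1 1). have b2 : y <= 1 - -1 * X by apply: bound; rewrite mulrNN mulr1.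
move: m1 m2 m3; have [_ <- <- <-] := corner_map_vertices i => m1 m2 m3.
have := @convex_three M _ _ _ _ _ _ ((1 - X - y) / 2) ((1 + X - y) / 2) y cM m1 m2 m3 _ _ y0 _.
have AE : A = q0 * sin al / sinh r by rewrite -hA mulfK.
have BE : B = q0 * sin al ^+ 2 * cosh r / (sinh r ^+ 2 * cos al).
  by rewrite -Bcos; field; rewrite cn sn.
rewrite /= /ax /ay /aP hz -pmulrn; set t := 2 * al * i.+1%:R.
have e1 : A * sinh w = q0 * sin al * X by rewrite AE /X; ring.
have e2 : q0 * cos al + B * cosh r - B * cosh w = q0 * cos al + q0 * sin al ^+ 2 / cos al * y.
  by rewrite BE /y; field; rewrite cn sn.
rewrite e1 e2; clearbody X y.
set p1 := (X in M X); set p2 := (X in _ -> M X).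
have -> : p1 = p2 by rewrite /p1 /p2; congr pair; field.
apply; flra b1 b2 AE.
Qed.

Lemma arc_in_Reg (j : int) (w : R) (M : set (plane R)) : `|w| <= r -> convexP (fun u v => M (u, v)) ->
  [set vertex R k j | j in [set j | (j < k)%N]] `<=` M -> M (ax al A B ze j w, ay al A B ze j w).
Proof.
have [k3 _ _ _ _ _ _ _ _] := hp; move=> wr cM sub.
have kn : k%:Z != 0 by rewrite eqz_nat -lt0n (leq_trans _ k3).
have Ej := divz_eq (j - 1) k%:Z; set n := ((j - 1) %/ k)%Z in Ej; set m := ((j - 1) %% k)%Z in Ej.
have m0 : (0 <= m)%R by exact: modz_ge0.
have -> : j = (m + 1) + k%:Z * n by rewrite -[LHS](subrK 1) Ej; ring.
have [-> ->] := arc_shift hp (m + 1) n w.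
have mE : m + 1 = (absz m).+1 by rewrite -addn1 PoszD gez0_abs.
have mid (i : nat) : M (midpoint R k i).
  have v1 := vertex_in_Reg i sub; have v2 := vertex_in_Reg i.+1 sub.
  have t01 : 0 <= (2^-1 : R) <= 1 by rewrite invr_ge0 ler0n invf_le1 ?ler1n ?ltr0n.
  rewrite /midpoint; move: v1 v2; case: (vertex R k i) => a b; case: (vertex R k i.+1) => c d v1 v2.
  have := cM _ _ _ _ _ v1 v2 t01.
  have mE' (x y : R) : (1 - 2^-1) * x + 2^-1 * y = 2^-1 * (x + y) by field.
  by rewrite !mE'.
by rewrite mE; apply: arc_in_triangle => //; exact: vertex_in_Reg.
Qed.

(** The arcs lie in the corner triangles, and every point of the body lies on
    a segment from the origin to a point of an arc. *)
Lemma refset_in_Reg : refset al A B ze `<=` Reg R k.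
Proof.
move=> [u v] huv; have [a1 _ _] := al_bounds hp; apply: hullP => M cM sub.
have arc j w (wr : `|w| <= r) := arc_in_Reg j wr cM sub.
have M00 : M (0, 0).
  have n1 : ((1 : R) != 0) || ((0 : R) != 0) by rewrite oner_eq0.
  have n2 : ((-1 : R) != 0) || ((0 : R) != 0) by rewrite oppr_eq0 oner_eq0.
  have [j1 [w1 [c1 [h1 c10 x1 y1]]]] := arc_ray hp n1; have [j2 [w2 [c2 [h2 c20 x2 y2]]]] := arc_ray hp n2.
  have := arc j1 w1 h1; have := arc j2 w2 h2; rewrite x1 y1 x2 y2 !mulr0 mulr1 mulrN1 => p2 p1.
  have cc : 0 < c1 + c2 by rewrite addr_gt0.
  have t01 : 0 <= c1 / (c1 + c2) <= 1 by rewrite divr_ge0 ?(ltW c10) ?(ltW cc) //= ler_pdivrMr // mul1r lerDl ltW.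
  have := cM _ _ _ _ _ p1 p2 t01; rewrite !mulr0 addr0.
  have -> // : (1 - c1 / (c1 + c2)) * c1 + c1 / (c1 + c2) * - c2 = 0.
  by field; rewrite gt_eqF.
have [/andP[/eqP -> /eqP -> //]|ne] := boolP ((u == 0) && (v == 0)).
rewrite negb_and in ne; have [j [w [c [wr c0 Ex Ey]]]] := arc_ray hp ne.
have c1 : 1 <= c.
  have := arc_tight hp j wr; rewrite Ex Ey; set th := _ + fi A B w; have [f1 f2] := fi_range hp wr => T.
  have h := huv j _ f1 f2; rewrite /= -/th -T in h.
  have H0 : 0 < u * cos th + v * sin th.
    rewrite -(pmulr_rgt0 _ c0) mulrDr !mulrA T; apply: lt_le_trans (Hs_gt0 hp f1 f2).
    by have [_ _ _ _ _ q00 _ _ _] := hp; rewrite mulr_gt0 // (cos_al_gt0 hp).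
  have : 1 * (u * cos th + v * sin th) <= c * (u * cos th + v * sin th) by rewrite mul1r mulrDr !mulrA.
  by rewrite ler_pM2r.
have := arc j w wr; rewrite Ex Ey => p1.
have t01 : 0 <= c^-1 <= 1 by rewrite invr_ge0 (ltW c0) invf_le1.
have cn : c != 0 by rewrite gt_eqF.
have := cM _ _ _ _ _ M00 p1 t01; rewrite !mulr0 !add0r !mulrA mulVf // !mul1r //.
Qed.

Lemma refset_boundary_corners : Psi_inv (Psi r) = r ->
  boundary (refset al A B ze) = \bigcup_(i in [set: 'I_k]) (corner_map i @` Hset (Psi r)).
Proof.
move=> iv; have [k3 _ _ _ _ _ _ _ _] := hp; apply/seteqP; split=> [[u v]|[u v] [i _]].
  move=> /(refbody_boundary hp)[j [w [wr -> ->]]].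
  have kn : k%:Z != 0 by rewrite eqz_nat -lt0n (leq_trans _ k3).
  have Ej := divz_eq (j - 1) k%:Z; set n := ((j - 1) %/ k)%Z in Ej; set m := ((j - 1) %% k)%Z in Ej.
  have m0 : (0 <= m)%R by exact: modz_ge0.
  have mk : (m < k%:Z)%R by apply: ltz_pmod; rewrite ltz_nat (leq_trans _ k3).
  have mi : (absz m < k)%N by rewrite -ltz_nat gez0_abs.
  exists (Ordinal mi) => //; rewrite corner_curve_range //=; exists w; split=> //.
  have -> : j = (m + 1) + k%:Z * n by rewrite -[LHS](subrK 1) Ej; ring.
  have [-> ->] := arc_shift hp (m + 1) n w.
  by have -> : m + 1 = (absz m).+1 by rewrite -addn1 PoszD gez0_abs.
rewrite corner_curve_range //= => -[w [wr [-> ->]]].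
by apply/(refbody_boundary hp); exists i.+1, w.
Qed.

(** The arc is the image of the points (cosh w, sinh w) under the affine map
    with axes B and A. *)
Lemma corner_hyperbola (i : nat) : Psi_inv (Psi r) = r -> hyperbola_arc (corner_map i @` Hset (Psi r)).
Proof.
move=> iv; have [_ _ r0 A0 B0 _ _ _ _] := hp; rewrite corner_curve_range //.
have An : A != 0 by rewrite gt_eqF. have Bn : B != 0 by rewrite gt_eqF.
set th : R := 2 * al * (i.+1)%:~R; have cs := cos2Dsin2 th.
have axE w : ax al A B ze i.+1 w = aP B ze w * cos th - A * sinh w * sin th by [].
have ayE w : ay al A B ze i.+1 w = aP B ze w * sin th + A * sinh w * cos th by [].
have inv (p q : R) : (p * cos th - q * sin th) * cos th + (p * sin th + q * cos th) * sin th = p /\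
    (p * sin th + q * cos th) * cos th - (p * cos th - q * sin th) * sin th = q.
  by split; [rewrite -[RHS]mulr1 -cs|rewrite -[RHS]mulr1 -cs]; ring.
split.
  pose g (t : R) : plane R := (ax al A B ze i.+1 (r * (1 - 2 * t)), ay al A B ze i.+1 (r * (1 - 2 * t))).
  exists g; split.
  - have cg : continuous g.
      move=> t; have cont (f : R -> R) (w d : R) : is_derive w 1 f d -> {for w, continuous f}.
        by case=> D _; apply: differentiable_continuous; apply/derivable1_diffP.
      have cw : {for t, continuous (fun t : R => r * (1 - 2 * t))}.
        apply: cvgM; first exact: cvg_cst.
        apply: cvgB; first exact: cvg_cst.
        by apply: cvgM; [exact: cvg_cst|exact: cvg_id].
      have c1 : {for t, continuous (fun t : R => ax al A B ze i.+1 (r * (1 - 2 * t)))}.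
        by apply: (@continuous_comp _ _ _ (fun t : R => r * (1 - 2 * t)) (ax al A B ze i.+1)); [exact: cw|exact: cont (is_derive_ax _ _ _ _ _ _).1].
      have c2 : {for t, continuous (fun t : R => ay al A B ze i.+1 (r * (1 - 2 * t)))}.
        by apply: (@continuous_comp _ _ _ (fun t : R => r * (1 - 2 * t)) (ay al A B ze i.+1)); [exact: cw|exact: cont (is_derive_ax _ _ _ _ _ _).2].
      exact: (cvg_pair c1 c2).
    exact: continuous_subspaceT cg.
  - move=> s t _ _ [E1 E2]; have := arc_inj hp E1 E2 => /(mulfI (lt0r_neq0 r0)) E; lra.
  - apply/seteqP; split=> [p [w [wr ->]]|_ [t /= ht <-]].
      have rn : r != 0 by rewrite gt_eqF.
      pose t := (1 - w / r) / 2; have wE : r * (1 - 2 * t) = w by rewrite /t; field.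
      exists t; last by rewrite /g wE.
      rewrite /= in_itv /= /t; move: wr; rewrite ler_norml => /andP[w1 w2].
      have : w / r <= 1 by rewrite ler_pdivrMr // mul1r.
      have : -1 <= w / r by rewrite ler_pdivlMr // mulN1r.
      by move=> *; apply/andP; split; lra.
    exists (r * (1 - 2 * t)); split=> //; move: ht; rewrite in_itv /= => /andP[t0 t1].
    rewrite normrM (gtr0_norm r0) ler_piMr ?(ltW r0) // ler_norml; apply/andP; split; lra.
pose f (p : plane R) : plane R := (ze * cos th + - (B * cos th) * p.1 + - (A * sin th) * p.2, ze * sin th + - (B * sin th) * p.1 + (A * cos th) * p.2).
exists (f @` [set p | p.1 ^+ 2 - p.2 ^+ 2 = 1]).
  exists f; split=> //; first exact: affine_frame.
  exists (fun p : plane R => ((ze - (p.1 * cos th + p.2 * sin th)) / B, (p.2 * cos th - p.1 * sin th) / A)) => -[x y]; rewrite /f /=.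
    have [i1 i2] := inv (ze - B * x) (A * y).
    congr pair.
      have e1 : (ze * cos th + - (B * cos th) * x + - (A * sin th) * y) * cos th + (ze * sin th + - (B * sin th) * x + A * cos th * y) * sin th = ze - B * x.
        by rewrite -[RHS]i1; ring.
      by rewrite e1; field.
    have e2 : (ze * sin th + - (B * sin th) * x + A * cos th * y) * cos th - (ze * cos th + - (B * cos th) * x + - (A * sin th) * y) * sin th = A * y.
      by rewrite -[RHS]i2; ring.
    by rewrite e2; field.
  set p := x * cos th + y * sin th; set q := y * cos th - x * sin th.
  have xE : x = p * cos th - q * sin th by rewrite /p /q -[LHS]mulr1 -cs; ring.
  have yE : y = p * sin th + q * cos th by rewrite /p /q -[LHS]mulr1 -cs; ring.
  by congr pair; [rewrite [RHS]xE|rewrite [RHS]yE]; field; rewrite An Bn.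
move=> p [w [wr ->]]; exists (cosh w, sinh w); first exact: cosh_sq.
by rewrite /f axE ayE /aP /=; congr pair; ring.
Qed.

End Polygon.

(** * The parameters, and the theorem *)

Section ArcData.
Context {R : realType}.

(** The equation for q0 says that the polygon has area 1; then N = f(r) b. *)
Lemma parameters (k : nat) (r : R) : (3 <= k)%N -> 0 < r -> exists (al A B ze q0 : R),
  [/\ refpar k r al A B ze q0, k%:R * q0 ^+ 2 * sin al = cos al, A * B = fhyp r * area_corner R k,
    area_inner R k = cos al ^+ 2 & 0 < area_inner R k /\ 0 < area_corner R k].
Proof.
move=> k3 r0; pose al : R := pi / k%:R; have kp : 0 < k%:R :> R by rewrite ltr0n (leq_trans _ k3).
have pi0 := pi_gt0 R; have al0 : 0 < al by rewrite divr_gt0.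
have k3r : 3 <= k%:R :> R by rewrite (ler_nat _ 3).
have kal : k%:R * al = pi by rewrite mulrC divfK // gt_eqF.
have al3 : al <= pi / 3 by rewrite ler_pdivlMr // mulrC -kal ler_pM2r.
have c0 : 0 < cos al by apply: cos_gt0_pihalf; apply/andP; split; lra.
have s0 : 0 < sin al by apply: sin_gt0_pi; apply/andP; split; lra.
have S0 : 0 < sinh r by rewrite sinh_gt0. have C0 := cosh_gt0 r.
have kn : k%:R != 0 :> R by rewrite gt_eqF. have cn : cos al != 0 by rewrite gt_eqF.
have sn : sin al != 0 by rewrite gt_eqF. have Sn : sinh r != 0 by rewrite gt_eqF.
pose q0 := Num.sqrt (cos al / (k%:R * sin al)).
have q00 : 0 < q0 by rewrite sqrtr_gt0 divr_gt0 // mulr_gt0.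
have q2 : q0 ^+ 2 = cos al / (k%:R * sin al) by rewrite sqr_sqrtr // divr_ge0 ?mulr_ge0 // ltW.
pose A := q0 * sin al / sinh r; pose B := A * cosh r * sin al / (sinh r * cos al).
have A0 : 0 < A by rewrite divr_gt0 // mulr_gt0.
have B0 : 0 < B by apply: divr_gt0; [apply: mulr_gt0; [exact: mulr_gt0|]|exact: mulr_gt0].
have cs := cos2Dsin2 al; have sE : sin al ^+ 2 = 1 - cos al ^+ 2 by lra.
exists al, A, B, (q0 * cos al + B * cosh r), q0.
have bE : area_corner R k = sin al ^+ 2 / k%:R by rewrite /area_corner /area_inner -/al sE.
split=> //.
- split=> //; first by rewrite /A divfK.
  by rewrite /B; field; rewrite cn Sn.
- by rewrite q2; field; rewrite sn kn.
- rewrite bE /fhyp /B /A; move: q2 => /(congr1 (fun z => z * (k%:R * sin al))); rewrite divfK ?mulf_neq0 // => q2.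
  have -> : q0 * sin al / sinh r * (q0 * sin al / sinh r * cosh r * sin al / (sinh r * cos al)) =
    (q0 ^+ 2 * (k%:R * sin al)) * sin al ^+ 2 * cosh r / (sinh r ^+ 3 * (k%:R * cos al)).
    by field; rewrite cn kn Sn.
  by rewrite q2; field; rewrite cn kn Sn.
- by rewrite bE /area_inner -/al; split; rewrite ?exprn_gt0 // divr_gt0 // exprn_gt0.
Qed.

(** The area of the reference body is a + k N (sinh r cosh r - r), that is, a
    + k N r Psi(r). *)
Lemma area_lambda (k : nat) (r al A B ze q0 As : R) : refpar k r al A B ze q0 -> k%:R * q0 ^+ 2 * sin al = cos al ->
  A * B = fhyp r * area_corner R k -> area_inner R k = cos al ^+ 2 ->
  2 * As = 2 * ze * sin al * q0 * k%:R - 2 * r * k%:R * (A * B) ->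
  lam_of (area_inner R k) (area_corner R k) k r = As / (k%:R * r * (A * B)).
Proof.
move=> hp qE NE aE asE; have [_ _ r0 A0 B0 q00 hA hB hz] := hp.
have AsE : As = area_inner R k + k%:R * (A * B) * (r * Psi r).
  have e1 : ze * sin al * q0 * k%:R = (k%:R * q0 ^+ 2 * sin al) * cos al + k%:R * (q0 * sin al) * (B * cosh r) by rewrite hz; ring.
  rewrite qE -hA in e1; rewrite Psi_rhs // aE.
  have : 2 * As = 2 * (ze * sin al * q0 * k%:R) - 2 * r * k%:R * (A * B) by rewrite asE; ring.
  rewrite e1 => e2; apply: (mulfI (_ : 2 != 0 :> R)); first by rewrite pnatr_eq0.
  by rewrite e2; ring.
rewrite /lam_of AsE NE; congr (_ / _); ring.
Qed.

End ArcData.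

Theorem proposition1p18 (R : realType) (k : nat) (lambda : R)
    (k_ge3 : (3 <= k)%N) (lambda_gt0 : 0 < lambda) :
  exists v : R,
    unique (fun v : R => 0 < v /\
      lambda = (area_inner R k + k%:R * Psi_inv v * fhyp (Psi_inv v)
                                 * Psi (Psi_inv v) * area_corner R k)
               / (k%:R * Psi_inv v * fhyp (Psi_inv v) * area_corner R k)) v /\
    exists C : set (plane R),
      unique (maximizer lambda (Reg R k)) C /\
      exists phi : 'I_k -> plane R -> plane R,
        (forall i : 'I_k,
           [/\ affine_map (phi i),
               phi i (0, 0) = midpoint R k i,
               phi i (2, 0) = midpoint R k i.+1 &
               phi i (1, 1) = vertex R k i.+1]) /\
        boundary C = \bigcup_(i in [set: 'I_k]) (phi i @` Hset v) /\
        (forall i : 'I_k,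
           hyperbola_arc (phi i @` Hset v) /\
           phi i @` Hset v `<=`
             convex_hull [set midpoint R k i; midpoint R k i.+1;
                              vertex R k i.+1]).
Proof.
have k0 : (0 < k)%N by exact: leq_trans k_ge3.
have [_ [_ [_ [_ [_ [_ _ _ _ [a0 b0]]]]]]] := @parameters R k 1 k_ge3 ltr01.
have [r [r0 lE iv uv]] := lambda_equation a0 b0 k0 lambda_gt0.
have [al [A [B [ze [q0 [hp qE NE aE _]]]]]] := parameters k_ge3 r0.
exists (Psi r); split; first exact: uv.
have [a' [b' [As [bot' [top' [Fb' [Ft' [_ _ areaE As0 asE]]]]]]]] := refset_area hp.
have N0 : 0 < A * B by have [_ _ _ A0 B0 _ _ _ _] := hp; rewrite mulr_gt0.
have [_ ME] := powR_third (ltW N0); have M0 : 0 < (A * B) `^ (3%:R^-1) by rewrite powR_gt0.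
have lamE : lambda = As / (k%:R * r * (A * B)) by rewrite lE; exact: area_lambda hp qE NE aE asE.
exists (refset al A B ze); split.
  apply: (refset_maximizer hp M0 ME areaE As0 asE lamE lambda_gt0); first exact: refset_in_Reg hp qE.
  by move=> D sub u v /sub; exact: Reg_inpoly hp qE u v.
exists (fun i : 'I_k => corner_map al q0 i); split; first by move=> i; exact: corner_map_vertices hp qE i.
split; first exact: refset_boundary_corners hp iv.
move=> i; split; first exact: corner_hyperbola hp i iv.
rewrite (corner_curve_range hp i iv) => _ [w [wr ->]]; apply: hullP => M cM sub.
by apply: (arc_in_triangle hp qE wr cM); apply: sub; [left; left|left; right|right].
Qed.
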